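(* Let $L_1,L_2,L_3,L_4$ be affine Lagrangian sections of $T^*\mathbb{R}$, $L_i=\operatorname{graph}(df_i)$, and for $\epsilon>0$ let $L_i^\epsilon=\operatorname{graph}(\epsilon\,df_i)$. Assume that $L_i^\epsilon\cap L_j^\epsilon$ is a one-point set whenever $i\neq j$, and that there exists a convex quadrilateral which has vertices $x_1^\epsilon,x_2^\epsilon,x_3^\epsilon,x_4^\epsilon$ in counterclockwise order, where $x_i^\epsilon$ is the point of $L_i^\epsilon\cap L_{i+1}^\epsilon$ (indices mod $4$). Let $p_i$ be the unique critical point of $f_{i+1}-f_i$, and let $I$ be the unique element of the moduli space $\mathcal{M}_g(\mathbb{R};\vec f,\vec p)$ of gradient trees. Put $z_1=1$, $z_2=\infty$, $z_3=0$, let $w_\epsilon$ be the Schwarz--Christoffel map from the upper half plane to the convex quadrilateral $x_1^\epsilon x_2^\epsilon x_3^\epsilon x_4^\epsilon$ with $w_\epsilon(z_i)=x_i^\epsilon$ for $i=1,2,3$, and let $z_{4,\epsilon}=w_\epsilon^{-1}(x_4^\epsilon)\in(0,1)$. Let $\delta>0$ be a real number such that $D_i(\delta)\cap D_j(\delta)=\emptyset$ for $i\neq j$, $i,j\in\{0,1,\infty\}$. Let $p_0$ be the one of $p_1,p_2$ whose Morse index is zero, and $p_0'$ the one of $p_3,p_4$ whose Morse index is zero (the index of $p_i$ being taken for $f_{i+1}-f_i$). Let $I_i$ be the restriction of $I$ to the external edge $e_i$, and $I_{int}$ the restriction of $I$ to the internal edge. If $(p_3-p_1)(p_4-p_2)>0$,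 then $$\lim_{\epsilon\to+0}\ \sup_{z\in D(\delta)}|w_\epsilon(z)-p_0|=0,$$ $$\lim_{\epsilon\to+0}\ \sup_{z\in D(\delta)}|w_\epsilon\circ\psi_\epsilon^{-1}(z)-p_0'|=0,$$ $$\lim_{\epsilon\to+0}\ \sup_{(\tau,\sigma)\in\Theta_{ext}}|w_\epsilon\circ\phi^\epsilon_{z_i,\delta}(\tau,\sigma)-I_i(\epsilon\tau)|=0\qquad(i=1,2,3,4),$$ $$\lim_{\epsilon\to+0}\ \sup_{(\tau,\sigma)\in\Theta^\epsilon_{int}(\delta)}|w_\epsilon\circ\phi_{int}(\tau,\sigma)-I_{int}(\epsilon\tau)|=0.$$
   Context: Identify $T^*\mathbb{R}$ with $\mathbb{R}^2=\mathbb{C}$, $(x,y)\leftrightarrow x+iy$ ($x$ base coordinate, $y$ fibre coordinate); $\mathbb{R}$ is identified with the zero section. $\operatorname{graph}(df)=\{(x,f'(x))\}$. An affine Lagrangian section is a line $\{y=ax+b\}$, so $f_i(x)=\frac12a_ix^2+b_ix+c_i$. Put $f_5=f_1$, $L_5=L_1$. The Morse index of a nondegenerate critical point is the number of negative eigenvalues of the Hessian. Gradient trees for $k=4$ (Euclidean metric on $\mathbb{R}$): in all cases there are four curves $I_i:(-\infty,0]\to\mathbb{R}$ (restrictions to the external edges $e_i\simeq(-\infty,0]$) with $\frac{dI_i}{dt}=-\operatorname{grad}(f_{i+1}-f_i)(I_i)$ and $\lim_{t\to-\infty}I_i(t)=p_i$, $i=1,2,3,4$; and one of the following holds. (a) (one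 internal vertex, no internal edge) $I_1(0)=I_2(0)=I_3(0)=I_4(0)$. (b) (two internal vertices, one adjacent to $e_1,e_2$, the other to $e_3,e_4$, joined by an internal edge of length $l>0$) there is $I_{int}:[0,l]\to\mathbb{R}$ with $\frac{dI_{int}}{dt}=-\operatorname{grad}(f_3-f_1)(I_{int})$, $I_{int}(0)=I_1(0)=I_2(0)$, $I_{int}(l)=I_3(0)=I_4(0)$. (c) (two internal vertices, one adjacent to $e_2,e_3$, the other to $e_4,e_1$, joined by an internal edge of length $l>0$) there is $I_{int}:[0,l]\to\mathbb{R}$ with $\frac{dI_{int}}{dt}=-\operatorname{grad}(f_4-f_2)(I_{int})$, $I_{int}(0)=I_2(0)=I_3(0)$, $I_{int}(l)=I_4(0)=I_1(0)$. Under the stated assumptions exactly one gradient tree exists, and when $(p_3-p_1)(p_4-p_2)>0$ it is of type (b). For $t$ outside $[0,l]$, $I_{int}(t)$ denotes the value of the solution of the same differential equation extended to all $t\in\mathbb{R}$. The Schwarz--Christoffel map is the conformal map of the open upper half plane $\mathbb{H}$ onto the interior of the quadrilateral, extended continuously to $\overline{\mathbb{H}}\cup\{\infty\}$, with prescribed values at $z_1,z_2,z_3$. $\overline{\mathbb{H}}=\{\operatorname{Im}z\ge0\}$. $D_p(\delta)=\{z:|z-p|<\delta,\operatorname{Im}z\geq0\}$ for $p\in\mathbb{R}$, $D_\infty(\delta)=\{z:|z|^{-1}<\delta,\operatorname{Im}z\ge0\}$, and $D(\delta)=\overline{\mathbb{H}}\setminus(D_0(\delta)\cup D_1(\delta)\cup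 D_\infty(\delta))$. $\psi_\epsilon(z)=z/z_{4,\epsilon}$. $\Theta_{ext}=(-\infty,0)\times[0,1]$, and $\phi^\epsilon_{z_1,\delta}(\tau,\sigma)=1+\delta e^{\pi(\tau+i\sigma)}$, $\phi^\epsilon_{z_2,\delta}(\tau,\sigma)=-\delta^{-1}e^{-\pi(\tau+i\sigma)}$, $\phi^\epsilon_{z_3,\delta}(\tau,\sigma)=z_{4,\epsilon}\,\delta e^{\pi(\tau+i\sigma)}$, $\phi^\epsilon_{z_4,\delta}(\tau,\sigma)=z_{4,\epsilon}\,(1+\delta e^{\pi(\tau+i\sigma)})$ (where $z_4$ stands for $z_{4,\epsilon}$). $\phi_{int}(\tau,\sigma)=\exp[-\pi\tau+i\pi(1-\sigma)]$, and $\Theta^\epsilon_{int}(\delta)=\{(\tau,\sigma):\tau\in(-\frac1\pi\log\delta,\,-\frac1\pi\log z_{4,\epsilon}+\frac1\pi\log\delta),\ \sigma\in[0,1]\}$, which is nonempty for all sufficiently small $\epsilon>0$ when $(p_3-p_1)(p_4-p_2)>0$, since then $z_{4,\epsilon}\to0$. *)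

(* Defs.v *)
From Stdlib Require Export Reals.
From Coquelicot Require Export Coquelicot.
Open Scope R_scope.

Inductive index : Set := i1 | i2 | i3 | i4.

Definition next (i : index) : index :=
  match i with i1 => i2 | i2 => i3 | i3 => i4 | i4 => i1 end.

(** * Lagrangian sections, in T^*R = C with base coordinate Re, fibre coordinate Im *)

Definition graph (u : R -> R) : C -> Prop := fun z => Im z = u (Re z).

Definition affine_potential (f : R -> R) : Prop :=
  exists a b c : R, forall x, f x = / 2 * a * x ^ 2 + b * x + c.

(** L_i^eps = graph (eps df_i). *)
Definition lagrangian (f : index -> R -> R) (eps : R) (i : index) : C -> Prop :=
  graph (fun x => eps * Derive (f i) x).

(** The function whose critical points are the intersections of L_i and L_(i+1). *)
Definition fdiff (f : index -> R -> R) (i j : index) : R -> R :=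
  fun x => f j x - f i x.

Definition critical_point (g : R -> R) (p : R) : Prop := Derive g p = 0.

(** On R the Hessian is a 1x1 matrix, with eigenvalue the second derivative. *)
Definition morse_index (g : R -> R) (p : R) : nat :=
  if Rlt_dec (Derive_n g 2 p) 0 then 1%nat else 0%nat.

(** * Convex quadrilaterals *)

(** Positive iff p, q, r is a counterclockwise triangle. *)
Definition orient (p q r : C) : R :=
  (Re q - Re p) * (Im r - Im p) - (Im q - Im p) * (Re r - Re p).

(** Every vertex not on the edge from x_i to x_(i+1) is strictly to its left. *)
Definition convex_ccw_quadrilateral (x : index -> C) : Prop :=
  forall i j, j <> i -> j <> next i -> 0 < orient (x i) (x (next i)) (x j).

Definition quadrilateral (x : index -> C) : C -> Prop := fun z =>
  exists t : index -> R,
    (forall i, 0 <= t i) /\ t i1 + t i2 + t i3 + t i4 = 1 /\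
    z = (t i1 * x i1 + t i2 * x i2 + t i3 * x i3 + t i4 * x i4)%C.

Definition interior_of (S : C -> Prop) : C -> Prop := fun z => locally z S.

(** * Schwarz-Christoffel map *)

Definition upper (z : C) : Prop := 0 < Im z.
Definition closed_upper (z : C) : Prop := 0 <= Im z.

(** Neighbourhood filter of the point at infinity of the Riemann sphere. *)
Definition C_infty : (C -> Prop) -> Prop := fun P =>
  exists M : R, forall z : C, M < Cmod z -> P z.

Definition conformal_onto (w : C -> C) (U V : C -> Prop) : Prop :=
  (forall z, U z -> ex_derive (K := C_AbsRing) (V := C_NormedModule) w z) /\
  (forall z, U z -> V (w z)) /\
  (forall z z', U z -> U z' -> w z = w z' -> z = z') /\
  (forall v, V v -> exists z, U z /\ w z = v).

(** Normalised by z_1 = 1, z_2 = infinity, z_3 = 0.  The value of the extension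
    at infinity is the limit there; values of w off the closed half plane are
    irrelevant. *)
Definition schwarz_christoffel (x : index -> C) (w : C -> C) : Prop :=
  conformal_onto w upper (interior_of (quadrilateral x)) /\
  (forall z, closed_upper z ->
     filterlim w (within closed_upper (locally z)) (locally (w z))) /\
  w (RtoC 1) = x i1 /\
  filterlim w (within closed_upper C_infty) (locally (x i2)) /\
  w (RtoC 0) = x i3.

(** * Gradient trees *)

(** One-sided at the endpoints of an interval D. *)
Definition is_derive_within (D : R -> Prop) (u : R -> R) (t l : R) : Prop :=
  filterdiff u (within D (locally t)) (fun h => scal h l).

Definition neg_gradient_flow (g : R -> R) (D : R -> Prop) (u : R -> R) : Prop :=
  forall t, D t -> is_derive_within D u t (- Derive g (u t)).

(** The constructor names list the external edges at the two ends of the internal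
    edge, at parameters 0 and l respectively; l is its length. *)
Inductive internal_edge : Type :=
| no_edge
| edge_12_34 (l : R) (u : R -> R)
| edge_23_41 (l : R) (u : R -> R).

Record tree : Type := Tree {
  ext : index -> R -> R;
  int : internal_edge
}.

Definition gradient_tree (f : index -> R -> R) (p : index -> R) (T : tree) : Prop :=
  (forall i,
     neg_gradient_flow (fdiff f i (next i)) (fun t => t <= 0) (ext T i) /\
     is_lim (ext T i) m_infty (p i)) /\
  match int T with
  | no_edge =>
      ext T i1 0 = ext T i2 0 /\ ext T i2 0 = ext T i3 0 /\ ext T i3 0 = ext T i4 0
  | edge_12_34 l u =>
      0 < l /\ neg_gradient_flow (fdiff f i1 i3) (fun t => 0 <= t <= l) u /\
      (u 0 = ext T i1 0 /\ u 0 = ext T i2 0) /\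
      (u l = ext T i3 0 /\ u l = ext T i4 0)
  | edge_23_41 l u =>
      0 < l /\ neg_gradient_flow (fdiff f i2 i4) (fun t => 0 <= t <= l) u /\
      (u 0 = ext T i2 0 /\ u 0 = ext T i3 0) /\
      (u l = ext T i4 0 /\ u l = ext T i1 0)
  end.

(** v solves on all of R the equation solved by u on [0,l], and extends u. *)
Definition extends_flow (g : R -> R) (l : R) (u v : R -> R) : Prop :=
  neg_gradient_flow g (fun _ => True) v /\ forall t, 0 <= t <= l -> v t = u t.

(** * Regions and coordinates in the closed upper half plane *)

Definition D_at (p delta : R) : C -> Prop := fun z =>
  Cmod (z - RtoC p) < delta /\ closed_upper z.

(** The condition z <> 0 is needed because / 0 = 0, whereas here |0|^(-1) is infinite. *)
Definition D_infty (delta : R) : C -> Prop := fun z =>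
  z <> RtoC 0 /\ / Cmod z < delta /\ closed_upper z.

Definition D_out (delta : R) : C -> Prop := fun z =>
  closed_upper z /\ ~ (D_at 0 delta z \/ D_at 1 delta z \/ D_infty delta z).

Definition disjoint (A B : C -> Prop) : Prop := forall z, ~ (A z /\ B z).

Definition Cexp (z : C) : C := (exp (Re z) * cos (Im z), exp (Re z) * sin (Im z)).

Definition psi (z4 : R) (z : C) : C := (z / RtoC z4)%C.
Definition psi_inv (z4 : R) (z : C) : C := (RtoC z4 * z)%C.

Lemma psi_invK (z4 : R) (z : C) :
  z4 <> 0 -> psi z4 (psi_inv z4 z) = z /\ psi_inv z4 (psi z4 z) = z.
Proof.
  intros h; assert (RtoC z4 <> RtoC 0) by (intros e; apply h; now injection e).
  unfold psi, psi_inv; split; field; assumption.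
Qed.

Definition strip_coord (s : R * R) : C := (RtoC (fst s) + Ci * RtoC (snd s))%C.

Definition Theta_ext : R * R -> Prop := fun s => fst s < 0 /\ 0 <= snd s <= 1.

Definition phi_ext (z4 delta : R) (i : index) (s : R * R) : C :=
  (let e := Cexp (RtoC PI * strip_coord s) in
   match i with
   | i1 => RtoC 1 + RtoC delta * e
   | i2 => - (/ RtoC delta * Cexp (- (RtoC PI * strip_coord s)))
   | i3 => RtoC z4 * (RtoC delta * e)
   | i4 => RtoC z4 * (RtoC 1 + RtoC delta * e)
   end)%C.

Definition Theta_int (z4 delta : R) : R * R -> Prop := fun s =>
  - / PI * ln delta < fst s < - / PI * ln z4 + / PI * ln delta /\
  0 <= snd s <= 1.

Definition phi_int (s : R * R) : C :=
  Cexp (- (RtoC PI * RtoC (fst s)) + Ci * RtoC PI * (RtoC 1 - RtoC (snd s)))%C.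

(** * Suprema and their limits *)

Definition sup_on {T : Type} (S : T -> Prop) (g : T -> R) : Rbar :=
  Lub_Rbar (fun r => exists s, S s /\ r = g s).

(** Convergence in the extended reals as eps -> +0; [filtermap Finite (locally 0)]
    is the neighbourhood filter of [Finite 0] in [Rbar]. *)
Definition tends_to_0 (h : R -> Rbar) : Prop :=
  filterlim h (at_right 0) (filtermap Finite (locally 0)).

(* Main.v *)
(** Since [Im w_eps = O(eps)], in a strip coordinate at a marked point (or between two of
    them) Cauchy's theorem makes the average of [Re w_eps] over cross-sections solve
    [U' = - eps grad (f_j - f_i)(U)] up to an error of total size [O(eps^2)], hence [U]
    follows a gradient flow line with error [O(eps)] over arbitrarily long strips.  The
    boundary values of [Re w_eps] are monotone along each edge, because convexity of the
    quadrilateral yields the boundary correspondence, so they differ from the averages by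
    [O(eps)]; the maximum principle with rational barriers extends the estimates to the
    interior.  The sign condition separates the pairs of vertices 1, 2 and 3, 4, and a thick
    half annulus joining opposite edges would bring these together; thus [z4 = O(eps)], which
    splits the half plane into two hubs, near [p0] and [p0'], a neck and four ends. *)

Require Import Defs.
From Stdlib Require Import Reals Lra Lia Psatz ClassicalEpsilon.
From Coquelicot Require Import Coquelicot.
Open Scope R_scope.

(** * Complex derivatives *)

(** Tracking errors on an infinitely long strip stay bounded only in the direction in which the
    linear flow contracts. At an end of Morse index zero this is the direction from the vertex to
    the hub: the mean is pinned to the vertex all along the end, and this is what fixes the hub
    value. At an end of index one it is the direction from the hub to the vertex, so the hub value
    must be known beforehand. The signs of the slopes, together with the separation of the vertices,
    leave exactly one vertex of index zero at each hub. On the neck the flow may expand; its growth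
    factor is bounded a posteriori, because the means at both hubs are already known and the near
    hub value is not a rest point.

    Interior values at radius [r] are read off from boundary values at radii between [r / K] and
    [r * K], at a cost of order [1 / K]. So [K] is fixed by the tolerance before [eps] is taken
    small; the flow varies by only [O(eps * lg K)] across such an annulus. All geometric facts about
    the quadrilateral that do not involve [eps] are proved for [eps = 1]. *)

Lemma im_le_Cmod (z : C) : Rabs (Im z) <= Cmod z.
Proof. eapply Rle_trans; [|apply Rmax_Cmod]; apply Rmax_r. Qed.

Lemma Cmod_le_abs (z : C) : Cmod z <= Rabs (Re z) + Rabs (Im z).
Proof.
  destruct z as [a b]; simpl.
  replace (a, b) with (RtoC a + Ci * RtoC b)%C by (apply injective_projections; simpl; ring).
  eapply Rle_trans; [apply Cmod_triangle|].
  rewrite Cmod_mult, Cmod_Ci, !Cmod_R; lra.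
Qed.

Lemma Cmod_minus_sym (x y : C) : Cmod (x - y) = Cmod (y - x).
Proof. rewrite <- Cmod_opp; f_equal; ring. Qed.

Lemma Cmod_minus_le (x y : C) : Cmod x - Cmod y <= Cmod (x - y).
Proof.
  pose proof (Cmod_triangle (x - y) y) as H.
  replace (x - y + y)%C with x in H by ring; lra.
Qed.

(** Balls of the product uniform structure on [C] are squares; [sqrt 2] is the factor that compares
    them with discs. *)
Lemma locally_C_Cmod (P : C -> Prop) (z : C) :
  locally z P <-> exists d, 0 < d /\ forall z', Cmod (z' - z) < d -> P z'.
Proof.
  split.
  - intros [d Hd]; exists d; split; [apply cond_pos|].
    intros z' Hz'; apply Hd.
    apply C_NormedModule_mixin_compat1; exact Hz'.
  - intros [d [Hd H]].
    assert (Hs : 0 < sqrt 2) by (apply sqrt_lt_R0; lra).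
    assert (He : 0 < d / sqrt 2) by (apply Rdiv_lt_0_compat; lra).
    exists (mkposreal _ He); intros z' Hz'; apply H.
    apply C_NormedModule_mixin_compat2 in Hz'; simpl in Hz'.
    replace (sqrt 2 * (d / sqrt 2)) with d in Hz' by (field; lra).
    exact Hz'.
Qed.

Lemma continuous_C_eps (f : C -> C) (z : C) :
  continuous f z <->
  forall e, 0 < e -> exists d, 0 < d /\
    forall z', Cmod (z' - z) < d -> Cmod (f z' - f z) < e.
Proof.
  split.
  - intros H e He.
    apply locally_C_Cmod.
    apply (H (fun y => Cmod (y - f z) < e)).
    apply locally_C_Cmod; exists e; auto.
  - intros H P HP.
    apply locally_C_Cmod in HP; destruct HP as [e [He HP]].
    destruct (H e He) as [d [Hd H']].
    apply locally_C_Cmod; exists d; auto.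
Qed.

Lemma continuous_CR_eps (f : C -> R) (z : C) :
  continuous f z <->
  forall e, 0 < e -> exists d, 0 < d /\
    forall z', Cmod (z' - z) < d -> Rabs (f z' - f z) < e.
Proof.
  split.
  - intros H e He.
    apply locally_C_Cmod.
    apply (H (fun y => Rabs (y - f z) < e)).
    exists (mkposreal e He); intros y Hy; exact Hy.
  - intros H P [e HP].
    destruct (H e (cond_pos e)) as [d [Hd H']].
    apply locally_C_Cmod; exists d; split; auto.
    intros z' Hz'; apply HP; apply H'; exact Hz'.
Qed.

Lemma continuous_Re (z : C) : continuous Re z.
Proof. destruct z; apply continuous_fst. Qed.

Lemma continuous_Im (z : C) : continuous Im z.
Proof. destruct z; apply continuous_snd. Qed.

Lemma continuous_pair {U : UniformSpace} (f g : U -> R) (x : U) :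
  continuous f x -> continuous g x ->
  continuous (U := C_UniformSpace) (fun t => (f t, g t)) x.
Proof.
  intros Hf Hg.
  apply (filterlim_comp_2 (G := locally (f x)) (H := locally (g x)) f g (fun a b => (a, b))).
  - exact Hf.
  - exact Hg.
  - intros P [d Hd]. exists (ball (f x) d) (ball (g x) d).
    + exists d; auto.
    + exists d; auto.
    + intros a b Ha Hb; apply Hd; split; assumption.
Qed.

Section ContinuityAlgebra.
Context {U : UniformSpace}.
Implicit Types (f g : U -> C) (x : U).

Lemma continuous_Re_comp f x : continuous (U := C_UniformSpace) f x -> continuous (fun t => Re (f t)) x.
Proof. intros H; apply (continuous_comp f Re); [exact H|apply continuous_Re]. Qed.

Lemma continuous_Im_comp f x : continuous (U := C_UniformSpace) f x -> continuous (fun t => Im (f t)) x.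
Proof. intros H; apply (continuous_comp f Im); [exact H|apply continuous_Im]. Qed.

Lemma continuous_from_Re_Im f x :
  continuous (fun t => Re (f t)) x -> continuous (fun t => Im (f t)) x ->
  continuous (U := C_UniformSpace) f x.
Proof.
  intros H1 H2.
  apply (continuous_ext (U := C_UniformSpace) (fun t => (Re (f t), Im (f t)))).
  - intros t; destruct (f t); reflexivity.
  - apply continuous_pair; assumption.
Qed.

Lemma continuous_Cplus f g x :
  continuous (U := C_UniformSpace) f x -> continuous (U := C_UniformSpace) g x ->
  continuous (U := C_UniformSpace) (fun t => (f t + g t)%C) x.
Proof.
  intros Hf Hg; apply continuous_from_Re_Im; simpl.
  - apply (continuous_plus (fun t => Re (f t)) (fun t => Re (g t)));
      apply continuous_Re_comp; assumption.
  - apply (continuous_plus (fun t => Im (f t)) (fun t => Im (g t)));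
      apply continuous_Im_comp; assumption.
Qed.

Lemma continuous_Rmult (f g : U -> R) x :
  continuous f x -> continuous g x -> continuous (fun t => f t * g t) x.
Proof. apply (continuous_mult (K := R_AbsRing)). Qed.

Lemma continuous_Rplus (f g : U -> R) x :
  continuous f x -> continuous g x -> continuous (fun t => f t + g t) x.
Proof. apply (continuous_plus (K := R_AbsRing) (V := R_NormedModule)). Qed.

Lemma continuous_Rminus (f g : U -> R) x :
  continuous f x -> continuous g x -> continuous (fun t => f t - g t) x.
Proof. apply (continuous_minus (K := R_AbsRing) (V := R_NormedModule)). Qed.

Lemma continuous_Cmult f g x :
  continuous (U := C_UniformSpace) f x -> continuous (U := C_UniformSpace) g x ->
  continuous (U := C_UniformSpace) (fun t => (f t * g t)%C) x.
Proof.
  intros Hf Hg.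
  pose proof (continuous_Re_comp _ _ Hf); pose proof (continuous_Re_comp _ _ Hg).
  pose proof (continuous_Im_comp _ _ Hf); pose proof (continuous_Im_comp _ _ Hg).
  apply continuous_from_Re_Im.
  - apply (continuous_Rminus (fun t => Re (f t) * Re (g t)) (fun t => Im (f t) * Im (g t)));
      apply continuous_Rmult; assumption.
  - apply (continuous_Rplus (fun t => Re (f t) * Im (g t)) (fun t => Im (f t) * Re (g t)));
      apply continuous_Rmult; assumption.
Qed.

Lemma continuous_Cmod_comp f x :
  continuous (U := C_UniformSpace) f x -> continuous (fun t => Cmod (f t)) x.
Proof.
  intros H; apply (continuous_comp f Cmod); [exact H|].
  apply continuous_CR_eps; intros e He; exists e; split; [exact He|].
  intros z' Hz'; eapply Rle_lt_trans; [|exact Hz'].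
  apply Rabs_le; pose proof (Cmod_minus_le z' (f x)); pose proof (Cmod_minus_le (f x) z').
  rewrite Cmod_minus_sym in H1; lra.
Qed.

End ContinuityAlgebra.

Lemma continuous_Cinv (z : C) : z <> RtoC 0 -> continuous (U := C_UniformSpace) Cinv z.
Proof.
  intros Hz; apply continuous_C_eps; intros e He.
  assert (Hm : 0 < Cmod z) by (apply Cmod_gt_0; exact Hz).
  exists (Rmin (Cmod z / 2) (e * (Cmod z * Cmod z / 2))); split.
  { apply Rmin_pos; [lra|]. apply Rmult_lt_0_compat; nra. }
  intros z' Hz'.
  assert (H1 : Cmod (z' - z) < Cmod z / 2) by (eapply Rlt_le_trans; [exact Hz'|apply Rmin_l]).
  assert (H2 : Cmod (z' - z) < e * (Cmod z * Cmod z / 2)) by (eapply Rlt_le_trans; [exact Hz'|apply Rmin_r]).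
  assert (H3 : Cmod z / 2 < Cmod z').
  { pose proof (Cmod_minus_le z z'); rewrite Cmod_minus_sym in H; lra. }
  assert (Hz0 : z' <> RtoC 0) by (apply Cmod_gt_0; lra).
  replace (/ z' - / z)%C with ((z - z') * / (z' * z))%C by (field; auto).
  rewrite Cmod_mult, Cmod_inv by (apply Cmult_neq_0; auto).
  rewrite Cmod_mult, Cmod_minus_sym.
  apply (Rmult_lt_reg_r (Cmod z' * Cmod z)); [apply Rmult_lt_0_compat; lra|].
  rewrite Rmult_assoc, Rinv_l, Rmult_1_r by (apply Rgt_not_eq, Rmult_lt_0_compat; lra).
  eapply Rlt_le_trans; [exact H2|].
  apply Rmult_le_compat_l; [lra|].
  replace (Cmod z * Cmod z / 2) with (Cmod z / 2 * Cmod z) by field.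
  apply Rmult_le_compat_r; lra.
Qed.

(** The explicit remainder estimate is the form used in the subdivision argument for Cauchy's
    theorem, and it makes the rules for products, compositions and inverses plain inequalities
    between moduli. *)
Definition is_cderive (f : C -> C) (z A : C) : Prop :=
  forall e, 0 < e -> exists d, 0 < d /\
    forall z', Cmod (z' - z) < d -> Cmod (f z' - f z - A * (z' - z)) <= e * Cmod (z' - z).

Definition cderivable (f : C -> C) (z : C) : Prop := exists A, is_cderive f z A.

Lemma ex_derive_cderivable (f : C -> C) (z : C) :
  ex_derive (K := C_AbsRing) (V := C_NormedModule) f z -> cderivable f z.
Proof.
  intros [A [_ H]]; exists A; intros e He.
  specialize (H z (fun P HP => HP) (mkposreal e He)); simpl in H.
  change (locally z (fun y => Cmod (f y - f z - (y - z) * A) <= e * Cmod (y - z))) in H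
    || apply locally_C in H.
  apply locally_C_Cmod in H; destruct H as [d [Hd H]].
  exists d; split; [exact Hd|]; intros z' Hz'; specialize (H z' Hz').
  rewrite (Cmult_comm A); exact H.
Qed.

Lemma cderivable_continuous (f : C -> C) (z : C) : cderivable f z -> continuous (U := C_UniformSpace) f z.
Proof.
  intros [A HA]; apply continuous_C_eps; intros e He.
  destruct (HA 1 Rlt_0_1) as [d [Hd H]].
  assert (Hp : 0 < Cmod A + 1) by (pose proof (Cmod_ge_0 A); lra).
  exists (Rmin d (e / (Cmod A + 1))); split.
  { apply Rmin_pos; [exact Hd|apply Rdiv_lt_0_compat; assumption]. }
  intros z' Hz'.
  specialize (H z' (Rlt_le_trans _ _ _ Hz' (Rmin_l _ _))).
  assert (H2 : Cmod (z' - z) < e / (Cmod A + 1)) by (eapply Rlt_le_trans; [exact Hz'|apply Rmin_r]).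
  replace (f z' - f z)%C with ((f z' - f z - A * (z' - z)) + A * (z' - z))%C by ring.
  eapply Rle_lt_trans; [apply Cmod_triangle|].
  rewrite Cmod_mult.
  apply (Rmult_lt_compat_r (Cmod A + 1)) in H2; [|exact Hp].
  unfold Rdiv in H2; rewrite Rmult_assoc, Rinv_l, Rmult_1_r in H2 by lra. lra.
Qed.

Lemma cderivable_ext_loc (f g : C -> C) (z : C) (r : R) :
  0 < r -> (forall z', Cmod (z' - z) < r -> f z' = g z') -> cderivable f z -> cderivable g z.
Proof.
  intros Hr E [A HA]; exists A; intros e He.
  destruct (HA e He) as [d [Hd H]].
  exists (Rmin r d); split; [apply Rmin_pos; assumption|].
  intros z' Hz'.
  rewrite <- (E z') by (eapply Rlt_le_trans; [exact Hz'|apply Rmin_l]).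
  rewrite <- (E z) by (replace (z - z)%C with (RtoC 0) by ring; rewrite Cmod_0; exact Hr).
  apply H; eapply Rlt_le_trans; [exact Hz'|apply Rmin_r].
Qed.

Lemma cderivable_const (a z : C) : cderivable (fun _ => a) z.
Proof.
  exists (RtoC 0); intros e He; exists 1; split; [lra|]; intros z' _.
  replace (a - a - 0 * (z' - z))%C with (RtoC 0) by ring.
  rewrite Cmod_0; apply Rmult_le_pos; [lra|apply Cmod_ge_0].
Qed.

Lemma cderivable_id (z : C) : cderivable (fun z => z) z.
Proof.
  exists (RtoC 1); intros e He; exists 1; split; [lra|]; intros z' _.
  replace (z' - z - 1 * (z' - z))%C with (RtoC 0) by ring.
  rewrite Cmod_0; apply Rmult_le_pos; [lra|apply Cmod_ge_0].
Qed.

Lemma cderivable_plus (f g : C -> C) (z : C) :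
  cderivable f z -> cderivable g z -> cderivable (fun z => f z + g z)%C z.
Proof.
  intros [A HA] [B HB]; exists (A + B)%C; intros e He.
  destruct (HA (e / 2)) as [d [Hd H]]; [lra|].
  destruct (HB (e / 2)) as [d' [Hd' H']]; [lra|].
  exists (Rmin d d'); split; [apply Rmin_pos; assumption|].
  intros z' Hz'.
  specialize (H z' (Rlt_le_trans _ _ _ Hz' (Rmin_l _ _))).
  specialize (H' z' (Rlt_le_trans _ _ _ Hz' (Rmin_r _ _))).
  replace (f z' + g z' - (f z + g z) - (A + B) * (z' - z))%C
    with ((f z' - f z - A * (z' - z)) + (g z' - g z - B * (z' - z)))%C by ring.
  eapply Rle_trans; [apply Cmod_triangle|]; lra.
Qed.

Lemma cderivable_mult (f g : C -> C) (z : C) :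
  cderivable f z -> cderivable g z -> cderivable (fun z => f z * g z)%C z.
Proof.
  intros Hf Hg.
  pose proof (cderivable_continuous _ _ Hf) as Cf.
  destruct Hf as [A HA]; destruct Hg as [B HB].
  exists (A * g z + f z * B)%C; intros e He.
  (* [K] dominates every fixed factor in the three error terms, so each of them is at most a third
     of [e]; the cap 1 on the tolerance below keeps [Cmod (f z')] under [Cmod (f z) + 1]. *)
  set (K := Cmod (f z) + Cmod (g z) + Cmod B + 2).
  assert (HK : 2 <= K) by (unfold K; pose proof (Cmod_ge_0 (f z)); pose proof (Cmod_ge_0 (g z)); pose proof (Cmod_ge_0 B); lra).
  assert (He' : 0 < Rmin 1 (e / (3 * K))) by (apply Rmin_pos; [lra|apply Rdiv_lt_0_compat; lra]).
  set (e' := Rmin 1 (e / (3 * K))) in *.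
  assert (Hek : 3 * K * e' <= e).
  { assert (e' <= e / (3 * K)) by apply Rmin_r.
    apply (Rmult_le_compat_l (3 * K)) in H; [|lra].
    replace (3 * K * (e / (3 * K))) with e in H by (field; lra); exact H. }
  assert (He1 : e' <= 1) by apply Rmin_l.
  destruct (HA e' He') as [d1 [Hd1 H1]].
  destruct (HB e' He') as [d2 [Hd2 H2]].
  destruct (proj1 (continuous_C_eps f z) Cf e' He') as [d3 [Hd3 H3]].
  exists (Rmin d1 (Rmin d2 d3)); split; [repeat apply Rmin_pos; assumption|].
  intros z' Hz'.
  specialize (H1 z' (Rlt_le_trans _ _ _ Hz' (Rmin_l _ _))).
  specialize (H2 z' (Rlt_le_trans _ _ _ Hz' (Rle_trans _ _ _ (Rmin_r _ _) (Rmin_l _ _)))).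
  specialize (H3 z' (Rlt_le_trans _ _ _ Hz' (Rle_trans _ _ _ (Rmin_r _ _) (Rmin_r _ _)))).
  replace (f z' * g z' - f z * g z - (A * g z + f z * B) * (z' - z))%C
    with ((f z' - f z - A * (z' - z)) * g z + f z' * (g z' - g z - B * (z' - z)) + (f z' - f z) * (B * (z' - z)))%C by ring.
  eapply Rle_trans; [apply Cmod_triangle|].
  eapply Rle_trans; [apply Rplus_le_compat_r, Cmod_triangle|].
  rewrite !Cmod_mult.
  assert (H4 : Cmod (f z') <= Cmod (f z) + 1).
  { pose proof (Cmod_minus_le (f z') (f z)); lra. }
  pose proof (Cmod_ge_0 (f z)); pose proof (Cmod_ge_0 (g z)); pose proof (Cmod_ge_0 B).
  pose proof (Cmod_ge_0 (z' - z)).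
  set (h := Cmod (z' - z)) in *.
  assert (T1 : Cmod (f z' - f z - A * (z' - z)) * Cmod (g z) <= e' * h * K).
  { apply Rmult_le_compat; try apply Cmod_ge_0; [exact H1|unfold K; lra]. }
  assert (T2 : Cmod (f z') * Cmod (g z' - g z - B * (z' - z)) <= K * (e' * h)).
  { apply Rmult_le_compat; try apply Cmod_ge_0; [unfold K; lra|exact H2]. }
  assert (T3 : Cmod (f z' - f z) * (Cmod B * h) <= e' * (K * h)).
  { apply Rmult_le_compat; try apply Cmod_ge_0; [apply Rmult_le_pos; assumption|lra|].
    apply Rmult_le_compat_r; [assumption|unfold K; lra]. }
  apply (Rle_trans _ (3 * K * e' * h)); [lra|].
  apply Rmult_le_compat_r; assumption.
Qed.

Lemma cderivable_comp (f g : C -> C) (z : C) :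
  cderivable g z -> cderivable f (g z) -> cderivable (fun z => f (g z)) z.
Proof.
  intros Hg [A HA].
  pose proof (cderivable_continuous _ _ Hg) as Cg.
  destruct Hg as [B HB].
  exists (A * B)%C; intros e He.
  set (K := Cmod A + Cmod B + 2).
  assert (HK : 2 <= K) by (unfold K; pose proof (Cmod_ge_0 A); pose proof (Cmod_ge_0 B); lra).
  assert (He' : 0 < Rmin 1 (e / (2 * K))) by (apply Rmin_pos; [lra|apply Rdiv_lt_0_compat; lra]).
  set (e' := Rmin 1 (e / (2 * K))) in *.
  assert (Hek : 2 * K * e' <= e).
  { assert (e' <= e / (2 * K)) by apply Rmin_r.
    apply (Rmult_le_compat_l (2 * K)) in H; [|lra].
    replace (2 * K * (e / (2 * K))) with e in H by (field; lra); exact H. }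
  assert (He1 : e' <= 1) by apply Rmin_l.
  destruct (HA e' He') as [d1 [Hd1 H1]].
  destruct (HB e' He') as [d2 [Hd2 H2]].
  destruct (proj1 (continuous_C_eps g z) Cg d1 Hd1) as [d3 [Hd3 H3]].
  exists (Rmin d2 d3); split; [repeat apply Rmin_pos; assumption|].
  intros z' Hz'.
  specialize (H2 z' (Rlt_le_trans _ _ _ Hz' (Rmin_l _ _))).
  specialize (H3 z' (Rlt_le_trans _ _ _ Hz' (Rmin_r _ _))).
  specialize (H1 _ H3).
  replace (f (g z') - f (g z) - A * B * (z' - z))%C
    with ((f (g z') - f (g z) - A * (g z' - g z)) + A * (g z' - g z - B * (z' - z)))%C by ring.
  eapply Rle_trans; [apply Cmod_triangle|].
  rewrite !Cmod_mult.
  set (h := Cmod (z' - z)) in *.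
  assert (Hh : 0 <= h) by apply Cmod_ge_0.
  pose proof (Cmod_ge_0 A); pose proof (Cmod_ge_0 B).
  assert (H4 : Cmod (g z' - g z) <= K * h).
  { replace (g z' - g z)%C with ((g z' - g z - B * (z' - z)) + B * (z' - z))%C by ring.
    eapply Rle_trans; [apply Cmod_triangle|]; rewrite Cmod_mult; fold h.
    unfold K; nra. }
  assert (T1 : e' * Cmod (g z' - g z) <= e' * (K * h)) by (apply Rmult_le_compat_l; lra).
  assert (T2 : Cmod A * Cmod (g z' - g z - B * (z' - z)) <= K * (e' * h)).
  { apply Rmult_le_compat; try apply Cmod_ge_0; [unfold K; lra|exact H2]. }
  apply (Rle_trans _ (2 * K * e' * h)); [lra|].
  apply Rmult_le_compat_r; assumption.
Qed.

Lemma cderivable_inv (z : C) : z <> RtoC 0 -> cderivable Cinv z.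
Proof.
  intros Hz.
  assert (Hm : 0 < Cmod z) by (apply Cmod_gt_0; exact Hz).
  exists (- (/ (z * z)))%C; intros e He.
  destruct (proj1 (continuous_C_eps Cinv z) (continuous_Cinv z Hz) (e * Cmod z)) as [d [Hd H]].
  { apply Rmult_lt_0_compat; assumption. }
  exists (Rmin (Cmod z) d); split; [apply Rmin_pos; assumption|].
  intros z' Hz'.
  specialize (H z' (Rlt_le_trans _ _ _ Hz' (Rmin_r _ _))).
  assert (Hz0 : z' <> RtoC 0).
  { intros ->. assert (Cmod (0 - z) < Cmod z) by (eapply Rlt_le_trans; [exact Hz'|apply Rmin_l]).
    replace (0 - z)%C with (- z)%C in H0 by ring; rewrite Cmod_opp in H0; lra. }
  replace (/ z' - / z - - / (z * z) * (z' - z))%C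
    with ((/ z' - / z) * (- (/ z * (z' - z))))%C by (field; auto).
  rewrite Cmod_mult, Cmod_opp, Cmod_mult, Cmod_inv by assumption.
  rewrite <- Rmult_assoc; apply Rmult_le_compat_r; [apply Cmod_ge_0|].
  apply (Rmult_le_reg_r (Cmod z)); [assumption|].
  rewrite Rmult_assoc, Rinv_l by lra; lra.
Qed.

Lemma cderivable_scal (a : C) (f : C -> C) (z : C) :
  cderivable f z -> cderivable (fun z => a * f z)%C z.
Proof. intros H; apply cderivable_mult; [apply cderivable_const|exact H]. Qed.

(** * Cauchy's theorem on rectangles *)

Definition ccontinuous (f : C -> C) : Prop := forall z, continuous (U := C_UniformSpace) f z.

Lemma ex_RInt_cont (f : R -> R) (a b : R) : (forall x, continuous f x) -> ex_RInt f a b.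
Proof. intros H; apply (ex_RInt_continuous (V := R_CompleteNormedModule)); intros; apply H. Qed.

Lemma RInt_diff_le (f g : R -> R) (a b M : R) :
  a <= b -> (forall x, continuous f x) -> (forall x, continuous g x) ->
  (forall x, a <= x <= b -> Rabs (f x - g x) <= M) ->
  Rabs (RInt f a b - RInt g a b) <= (b - a) * M.
Proof.
  intros Hab Hf Hg H.
  replace (RInt f a b - RInt g a b) with (RInt (fun x => f x - g x) a b).
  - apply abs_RInt_le_const; auto.
    apply ex_RInt_cont; intros x; apply (continuous_Rminus f g); auto.
  - apply (RInt_minus (V := R_CompleteNormedModule)); apply ex_RInt_cont; auto.
Qed.

Lemma RInt_Rchasles (f : R -> R) (a b c : R) :
  (forall x, continuous f x) -> RInt f a b + RInt f b c = RInt f a c.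
Proof. intros H; apply (RInt_Chasles (V := R_CompleteNormedModule)); apply ex_RInt_cont; auto. Qed.

Lemma RInt_affine (p q a b : R) :
  RInt (fun x => p * x + q) a b = (p * b ^ 2 / 2 + q * b) - (p * a ^ 2 / 2 + q * a).
Proof.
  apply is_RInt_unique.
  apply (is_RInt_derive (fun x => p * x ^ 2 / 2 + q * x)).
  - intros x _; auto_derive; [auto|field].
  - intros x _; apply (ex_derive_continuous (fun x => p * x + q)); auto_derive; auto.
Qed.

Lemma RInt_Rscal (f : R -> R) (a b k : R) :
  (forall x, continuous f x) -> RInt (fun x => k * f x) a b = k * RInt f a b.
Proof. intros H; apply (RInt_scal (V := R_CompleteNormedModule)); apply ex_RInt_cont; auto. Qed.

Lemma RInt_Rplus (f g : R -> R) (a b : R) :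
  (forall x, continuous f x) -> (forall x, continuous g x) ->
  RInt (fun x => f x + g x) a b = RInt f a b + RInt g a b.
Proof. intros; apply (RInt_plus (V := R_CompleteNormedModule)); apply ex_RInt_cont; auto. Qed.

Lemma RInt_Rminus (f g : R -> R) (a b : R) :
  (forall x, continuous f x) -> (forall x, continuous g x) ->
  RInt (fun x => f x - g x) a b = RInt f a b - RInt g a b.
Proof. intros; apply (RInt_minus (V := R_CompleteNormedModule)); apply ex_RInt_cont; auto. Qed.

Lemma continuous_line_h (f : C -> C) (y x : R) :
  ccontinuous f -> continuous (U := C_UniformSpace) (fun t => f (t, y)) x.
Proof.
  intros H; apply (continuous_comp (U := R_UniformSpace) (V := C_UniformSpace) (W := C_UniformSpace) (fun t => (t, y)) f); [|apply H].
  apply continuous_pair; [apply continuous_id|apply continuous_const].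
Qed.

Lemma continuous_line_v (f : C -> C) (y x : R) :
  ccontinuous f -> continuous (U := C_UniformSpace) (fun t => f (x, t)) y.
Proof.
  intros H; apply (continuous_comp (U := R_UniformSpace) (V := C_UniformSpace) (W := C_UniformSpace) (fun t => (x, t)) f); [|apply H].
  apply continuous_pair; [apply continuous_const|apply continuous_id].
Qed.

(** The real part of the integral of [f dz] along the boundary of [a,b] x [c,d]. *)
Definition flux (f : C -> C) (a b c d : R) : R :=
  RInt (fun x => Re (f (x, c))) a b - RInt (fun x => Re (f (x, d))) a b
  - RInt (fun y => Im (f (b, y))) c d + RInt (fun y => Im (f (a, y))) c d.

Section Flux.
Variables (f : C -> C).
Hypothesis Hf : ccontinuous f.

Lemma cont_Re_h (y x : R) : continuous (fun t => Re (f (t, y))) x.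
Proof. apply continuous_Re_comp, continuous_line_h, Hf. Qed.
Lemma cont_Im_h (y x : R) : continuous (fun t => Im (f (t, y))) x.
Proof. apply continuous_Im_comp, continuous_line_h, Hf. Qed.
Lemma cont_Re_v (y x : R) : continuous (fun t => Re (f (x, t))) y.
Proof. apply continuous_Re_comp, continuous_line_v, Hf. Qed.
Lemma cont_Im_v (y x : R) : continuous (fun t => Im (f (x, t))) y.
Proof. apply continuous_Im_comp, continuous_line_v, Hf. Qed.

Lemma flux_split_h (a m b c d : R) : flux f a b c d = flux f a m c d + flux f m b c d.
Proof.
  unfold flux.
  rewrite <- (RInt_Rchasles (fun x => Re (f (x, c))) a m b) by (intros; apply cont_Re_h).
  rewrite <- (RInt_Rchasles (fun x => Re (f (x, d))) a m b) by (intros; apply cont_Re_h).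
  ring.
Qed.

Lemma flux_split_v (a b c m d : R) : flux f a b c d = flux f a b c m + flux f a b m d.
Proof.
  unfold flux.
  rewrite <- (RInt_Rchasles (fun y => Im (f (a, y))) c m d) by (intros; apply cont_Im_v).
  rewrite <- (RInt_Rchasles (fun y => Im (f (b, y))) c m d) by (intros; apply cont_Im_v).
  ring.
Qed.

(** The affine approximation of [f] at the point has flux zero on every rectangle. What remains is
    the approximation error, at most [e / 2] times half the perimeter, integrated along the whole
    perimeter. *)
Lemma flux_local (x y e : R) :
  0 < e -> cderivable f (x, y) ->
  exists r, 0 < r /\ forall a b c d,
    a <= x <= b -> c <= y <= d -> b - a < r -> d - c < r ->
    Rabs (flux f a b c d) <= e * (b - a + (d - c)) ^ 2.
Proof.
  intros He [[p q] HA].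
  destruct (HA (e / 2)) as [r [Hr H]]; [lra|].
  exists (r / 2); split; [lra|]; intros a b c d Hx Hy Hab Hcd.
  set (S := b - a + (d - c)).
  set (f0 := f (x, y)) in *.
  assert (Hz : forall s t, a <= s <= b -> c <= t <= d ->
    Rabs (Re (f (s, t)) - (p * (s - x) - q * (t - y) + Re f0)) <= e / 2 * S /\
    Rabs (Im (f (s, t)) - (q * (s - x) + p * (t - y) + Im f0)) <= e / 2 * S).
  { intros s t Hs Ht.
    assert (Hm : Cmod ((s, t) - (x, y)) <= S).
    { eapply Rle_trans; [apply Cmod_le_abs|]; simpl.
      unfold S; apply Rplus_le_compat; apply Rabs_le; lra. }
    assert (Hm' : Cmod ((s, t) - (x, y)) < r) by (unfold S in Hm; lra).
    specialize (H _ Hm').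
    assert (H' : Cmod (f (s, t) - f0 - (p, q) * ((s, t) - (x, y))) <= e / 2 * S).
    { eapply Rle_trans; [exact H|]; apply Rmult_le_compat_l; lra. }
    split; eapply Rle_trans; try exact H'.
    - eapply Rle_trans; [|apply re_le_Cmod]; right; f_equal; unfold Re, Im, f0; simpl; unfold Re, Im; ring.
    - eapply Rle_trans; [|apply im_le_Cmod]; right; f_equal; unfold Re, Im, f0; simpl; unfold Re, Im; ring. }
  assert (Cl : forall u v z, continuous (fun t => u * t + v) z).
  { intros u v z; apply (ex_derive_continuous (fun t => u * t + v)); auto_derive; auto. }
  assert (E1 := RInt_diff_le (fun s => Re (f (s, c))) (fun s => p * s + (- p * x - q * (c - y) + Re f0)) a b (e / 2 * S)).
  assert (E2 := RInt_diff_le (fun s => Re (f (s, d))) (fun s => p * s + (- p * x - q * (d - y) + Re f0)) a b (e / 2 * S)).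
  assert (E3 := RInt_diff_le (fun t => Im (f (b, t))) (fun t => p * t + (- p * y + q * (b - x) + Im f0)) c d (e / 2 * S)).
  assert (E4 := RInt_diff_le (fun t => Im (f (a, t))) (fun t => p * t + (- p * y + q * (a - x) + Im f0)) c d (e / 2 * S)).
  rewrite RInt_affine in E1, E2, E3, E4.
  lapply E1; [clear E1; intros E1|lra].
  lapply E2; [clear E2; intros E2|lra].
  lapply E3; [clear E3; intros E3|lra].
  lapply E4; [clear E4; intros E4|lra].
  specialize (E1 (fun s => cont_Re_h c s) (Cl _ _)).
  specialize (E2 (fun s => cont_Re_h d s) (Cl _ _)).
  specialize (E3 (fun s => cont_Im_v s b) (Cl _ _)).
  specialize (E4 (fun s => cont_Im_v s a) (Cl _ _)).
  lapply E1; [clear E1; intros E1|intros s Hs; destruct (Hz s c) as [Z _]; try lra; eapply Rle_trans; [|exact Z]; right; f_equal; ring].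
  lapply E2; [clear E2; intros E2|intros s Hs; destruct (Hz s d) as [Z _]; try lra; eapply Rle_trans; [|exact Z]; right; f_equal; ring].
  lapply E3; [clear E3; intros E3|intros s Hs; destruct (Hz b s) as [_ Z]; try lra; eapply Rle_trans; [|exact Z]; right; f_equal; ring].
  lapply E4; [clear E4; intros E4|intros s Hs; destruct (Hz a s) as [_ Z]; try lra; eapply Rle_trans; [|exact Z]; right; f_equal; ring].
  apply Rabs_le_between in E1. apply Rabs_le_between in E2. apply Rabs_le_between in E3. apply Rabs_le_between in E4.
  unfold flux; apply Rabs_le.
  assert (Q : e * S ^ 2 = 2 * ((b - a) * (e / 2 * S)) + 2 * ((d - c) * (e / 2 * S))) by (unfold S; field).
  rewrite Q; clear Q. revert E1 E2 E3 E4.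
  generalize ((b - a) * (e / 2 * S)) ((d - c) * (e / 2 * S)); intros A B.
  intros E1 E2 E3 E4; split; nra.
Qed.
End Flux.

(** Goursat's nested quarters for an arbitrary property: if [Q] failed, it would fail on quarters of
    quarters shrinking to a single point, against the local hypothesis there. Decidability serves to
    select the failing quarter. *)
Lemma bisection_rectangle (Q : R -> R -> R -> R -> Prop) (a0 b0 c0 d0 : R) :
  (forall a b c d, {Q a b c d} + {~ Q a b c d}) ->
  (forall a b c d, let m := (a + b) / 2 in let n := (c + d) / 2 in
     Q a m c n -> Q m b c n -> Q a m n d -> Q m b n d -> Q a b c d) ->
  a0 <= b0 -> c0 <= d0 ->
  (forall x y, a0 <= x <= b0 -> c0 <= y <= d0 ->
     exists r, 0 < r /\ forall a b c d,
       a <= x <= b -> c <= y <= d -> b - a < r -> d - c < r -> Q a b c d) ->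
  Q a0 b0 c0 d0.
Proof.
  intros Qdec Qjoin Hab0 Hcd0 Qloc.
  destruct (Qdec a0 b0 c0 d0) as [|NQ]; [assumption|exfalso].
  (* The fourth quarter is taken without a test: if the other three satisfy [Q], then [Qjoin] forces
     it to fail. *)
  pose (step := fun r : (R * R) * (R * R) =>
    let '((a, b), (c, d)) := r in
    let m := (a + b) / 2 in let n := (c + d) / 2 in
    if Qdec a m c n then
      if Qdec m b c n then
        if Qdec a m n d then ((m, b), (n, d)) else ((a, m), (n, d))
      else ((m, b), (c, n))
    else ((a, m), (c, n))).
  pose (s := fix s k := match k with O => ((a0, b0), (c0, d0)) | S k => step (s k) end).
  set (an := fun k => fst (fst (s k))). set (bn := fun k => snd (fst (s k))).
  set (cn := fun k => fst (snd (s k))). set (dn := fun k => snd (snd (s k))).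
  assert (NQn : forall k, ~ Q (an k) (bn k) (cn k) (dn k)).
  { intros k; induction k; [exact NQ|].
    revert IHk; unfold an, bn, cn, dn; simpl.
    destruct (s k) as [[a b] [c d]]; simpl.
    destruct (Qdec a ((a + b) / 2) c ((c + d) / 2)); [|auto].
    destruct (Qdec ((a + b) / 2) b c ((c + d) / 2)); [|auto].
    destruct (Qdec a ((a + b) / 2) ((c + d) / 2) d); [|auto].
    intros H H'; apply H; apply Qjoin; auto. }
  assert (St : forall k, an k <= bn k -> cn k <= dn k ->
    an k <= an (S k) <= bn (S k) /\ bn (S k) <= bn k /\
    cn k <= cn (S k) <= dn (S k) /\ dn (S k) <= dn k /\
    bn (S k) - an (S k) = (bn k - an k) / 2 /\ dn (S k) - cn (S k) = (dn k - cn k) / 2).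
  { intros k; unfold an, bn, cn, dn; simpl.
    destruct (s k) as [[a b] [c d]]; simpl; intros Hab Hcd.
    destruct (Qdec a ((a + b) / 2) c ((c + d) / 2)); [|simpl; repeat split; lra].
    destruct (Qdec ((a + b) / 2) b c ((c + d) / 2)); [|simpl; repeat split; lra].
    destruct (Qdec a ((a + b) / 2) ((c + d) / 2) d); simpl; repeat split; lra. }
  assert (Ord : forall k, an k <= bn k /\ cn k <= dn k).
  { intros k; induction k; [split; assumption|]. destruct IHk as [I1 I2]; destruct (St k I1 I2); lra. }
  assert (Len : forall k, bn k - an k = (b0 - a0) / 2 ^ k /\ dn k - cn k = (d0 - c0) / 2 ^ k).
  { intros k; induction k; [unfold an, bn, cn, dn; simpl; split; field|].
    destruct (Ord k) as [I1 I2]; destruct (St k I1 I2) as (_ & _ & _ & _ & L1 & L2).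
    destruct IHk as [J1 J2]; rewrite L1, L2, J1, J2; simpl; split; field; apply pow_nonzero; lra. }
  assert (lim : forall u v : nat -> R, (forall k, u k <= u (S k)) -> (forall k, v (S k) <= v k) ->
     (forall k, u k <= v k) -> exists x, forall k, u k <= x <= v k).
  { intros u v Hu Hv Huv.
    assert (Hu' : forall i j, u i <= u (i + j)%nat).
    { intros i j; induction j; [rewrite Nat.add_0_r; lra|]. rewrite Nat.add_succ_r; eapply Rle_trans; [exact IHj|apply Hu]. }
    assert (Hv' : forall i j, v (i + j)%nat <= v i).
    { intros i j; induction j; [rewrite Nat.add_0_r; lra|]. rewrite Nat.add_succ_r; eapply Rle_trans; [apply Hv|exact IHj]. }
    destruct (completeness (fun t => exists k, t = u k)) as [x [X1 X2]].
    - exists (v 0%nat); intros t [k ->]; eapply Rle_trans; [apply Huv|]; apply (Hv' 0%nat k).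
    - exists (u 0%nat), 0%nat; reflexivity.
    - exists x; intros k; split; [apply X1; exists k; reflexivity|].
      apply X2; intros t [j ->].
      eapply Rle_trans; [apply (Hu' j k)|]; eapply Rle_trans; [apply Huv|].
      rewrite Nat.add_comm; apply Hv'. }
  destruct (lim an bn) as [x Hx].
  { intros k; destruct (Ord k) as [I1 I2]; destruct (St k I1 I2); lra. }
  { intros k; destruct (Ord k) as [I1 I2]; destruct (St k I1 I2) as (? & ? & ?); lra. }
  { intros k; apply Ord. }
  destruct (lim cn dn) as [y Hy].
  { intros k; destruct (Ord k) as [I1 I2]; destruct (St k I1 I2) as (? & ? & ? & ?); lra. }
  { intros k; destruct (Ord k) as [I1 I2]; destruct (St k I1 I2) as (? & ? & ? & ? & ?); lra. }
  { intros k; apply Ord. }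
  destruct (Qloc x y (Hx 0%nat) (Hy 0%nat)) as [r [Hr HQ]].
  destruct (pow_lt_1_zero (/ 2)) with (y := r / (b0 - a0 + (d0 - c0) + 1)) as [N HN].
  { rewrite Rabs_pos_eq; lra. }
  { apply Rdiv_lt_0_compat; lra. }
  specialize (HN N (Nat.le_refl N)).
  rewrite Rabs_pos_eq in HN by (apply pow_le; lra).
  rewrite pow_inv in HN.
  assert (H2 : 0 < / 2 ^ N) by (apply Rinv_0_lt_compat, pow_lt; lra).
  apply (Rmult_lt_compat_r (b0 - a0 + (d0 - c0) + 1)) in HN; [|lra].
  unfold Rdiv in HN; rewrite Rmult_assoc, Rinv_l, Rmult_1_r in HN by lra.
  destruct (Len N) as [L1 L2].
  apply (NQn N); apply HQ; [apply Hx|apply Hy| |].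
  - rewrite L1; unfold Rdiv; nra.
  - rewrite L2; unfold Rdiv; nra.
Qed.

(** A bound of the form [e] times the squared half perimeter is additive under quartering, since
    each quarter has half the perimeter. So it passes from small rectangles to the given one, for
    every [e]. *)
Lemma goursat_closed (f : C -> C) (a b c d : R) :
  ccontinuous f -> a <= b -> c <= d ->
  (forall x y, a <= x <= b -> c <= y <= d -> cderivable f (x, y)) ->
  flux f a b c d = 0.
Proof.
  intros Hf Hab Hcd Hd.
  destruct (Req_dec (flux f a b c d) 0) as [|N]; [assumption|exfalso].
  assert (Hp : 0 < Rabs (flux f a b c d)) by (apply Rabs_pos_lt; exact N).
  set (S := b - a + (d - c)).
  assert (HS : 0 < S ^ 2 + 1) by nra.
  (* With this choice [e * S ^ 2] stays below the supposed flux; the summand 1 covers a rectangle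
     reduced to a point. *)
  set (e := Rabs (flux f a b c d) / 2 / (S ^ 2 + 1)).
  assert (He : 0 < e) by (apply Rdiv_lt_0_compat; lra).
  assert (B : Rabs (flux f a b c d) <= e * S ^ 2).
  { apply (bisection_rectangle (fun a b c d => Rabs (flux f a b c d) <= e * (b - a + (d - c)) ^ 2)); auto.
    - intros; apply Rle_dec.
    - intros a' b' c' d' m n Q1 Q2 Q3 Q4.
      rewrite (flux_split_h f Hf a' m b'), (flux_split_v f Hf a' m c' n d'), (flux_split_v f Hf m b' c' n d').
      apply Rabs_le_between in Q1. apply Rabs_le_between in Q2. apply Rabs_le_between in Q3. apply Rabs_le_between in Q4.
      apply Rabs_le. unfold m, n in *.
      replace (e * (b' - a' + (d' - c')) ^ 2) with
        (e * ((a' + b') / 2 - a' + ((c' + d') / 2 - c')) ^ 2 + e * (b' - (a' + b') / 2 + ((c' + d') / 2 - c')) ^ 2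
         + e * ((a' + b') / 2 - a' + (d' - (c' + d') / 2)) ^ 2 + e * (b' - (a' + b') / 2 + (d' - (c' + d') / 2)) ^ 2) by field.
      lra.
    - intros x y Hx Hy; apply flux_local; auto. }
  assert (e * (S ^ 2 + 1) = Rabs (flux f a b c d) / 2) by (unfold e; field; lra).
  nra.
Qed.

Lemma unif_cont_rect (f : C -> C) (a b c d e : R) :
  ccontinuous f -> 0 < e -> exists r, 0 < r /\ forall x y u v,
    a <= x <= b -> c <= y <= d -> a <= u <= b -> c <= v <= d ->
    Rabs (u - x) < r -> Rabs (v - y) < r ->
    Rabs (Re (f (u, v)) - Re (f (x, y))) < e /\ Rabs (Im (f (u, v)) - Im (f (x, y))) < e.
Proof.
  intros Hf He.
  assert (H1 : exists r : posreal, forall x y u v, a <= x <= b -> c <= y <= d -> a <= u <= b -> c <= v <= d ->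
    Rabs (u - x) < r -> Rabs (v - y) < r -> Rabs (Re (f (u, v)) - Re (f (x, y))) < mkposreal e He).
  { apply (uniform_continuity_2d (fun x y => Re (f (x, y)))).
    intros x y _ _; apply continuity_2d_pt_filterlim.
    apply (filterlim_ext (fun z : C => Re (f z))); [intros [? ?]; reflexivity|].
    exact (continuous_Re_comp (U := C_UniformSpace) f (x, y) (Hf (x, y))). }
  assert (H2 : exists r : posreal, forall x y u v, a <= x <= b -> c <= y <= d -> a <= u <= b -> c <= v <= d ->
    Rabs (u - x) < r -> Rabs (v - y) < r -> Rabs (Im (f (u, v)) - Im (f (x, y))) < mkposreal e He).
  { apply (uniform_continuity_2d (fun x y => Im (f (x, y)))).
    intros x y _ _; apply continuity_2d_pt_filterlim.
    apply (filterlim_ext (fun z : C => Im (f z))); [intros [? ?]; reflexivity|].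
    exact (continuous_Im_comp (U := C_UniformSpace) f (x, y) (Hf (x, y))). }
  destruct H1 as [r1 H1]; destruct H2 as [r2 H2].
  exists (Rmin r1 r2); split; [apply Rmin_pos; apply cond_pos|].
  intros x y u v Hx Hy Hu Hv Hr Hr'.
  pose proof (Rmin_l r1 r2); pose proof (Rmin_r r1 r2).
  split; [apply H1|apply H2]; auto; lra.
Qed.

Lemma ccontinuous_comp (f g : C -> C) : ccontinuous g -> ccontinuous f -> ccontinuous (fun z => f (g z)).
Proof. intros Hg Hf z; apply (continuous_comp g f); [apply Hg|apply Hf]. Qed.

(** Holomorphy is only needed in the open rectangle: compare [f] with its
    dilations about the centre, which are holomorphic on the closed one. *)
Lemma goursat (f : C -> C) (a b c d : R) :
  ccontinuous f -> a < b -> c < d ->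
  (forall x y, a < x < b -> c < y < d -> cderivable f (x, y)) ->
  flux f a b c d = 0.
Proof.
  intros Hf Hab Hcd Hd.
  destruct (Req_dec (flux f a b c d) 0) as [|N]; [assumption|exfalso].
  assert (Hp : 0 < Rabs (flux f a b c d)) by (apply Rabs_pos_lt; exact N).
  set (S := b - a + (d - c)).
  assert (HS : 0 < S) by (unfold S; lra).
  set (e := Rabs (flux f a b c d) / 4 / S).
  assert (He : 0 < e) by (repeat apply Rdiv_lt_0_compat; lra).
  destruct (unif_cont_rect f a b c d e Hf He) as [r [Hr Hu]].
  (* The dilation by [1 - k] moves the closed rectangle into the open one and displaces its points
     by less than [r], the distance given by uniform continuity for the error [e]. *)
  set (k := Rmin (1 / 2) (r / (2 * S))).
  assert (Hk : 0 < k) by (apply Rmin_pos; [lra|apply Rdiv_lt_0_compat; lra]).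
  assert (Hk1 : k <= 1 / 2) by apply Rmin_l.
  assert (Hk2 : k * S <= r / 2).
  { apply Rle_trans with (r / (2 * S) * S); [apply Rmult_le_compat_r; [lra|apply Rmin_r]|].
    right; field; lra. }
  set (x0 := (a + b) / 2). set (y0 := (c + d) / 2).
  set (g := fun z : C => f (RtoC (1 - k) * z + RtoC k * (x0, y0))%C).
  assert (Hg : ccontinuous g).
  { apply (ccontinuous_comp f (fun z => (RtoC (1 - k) * z + RtoC k * (x0, y0))%C)); [|exact Hf].
    intros z; apply continuous_Cplus; [|apply continuous_const].
    apply (continuous_Cmult (fun _ => RtoC (1 - k)) (fun z => z)); [apply continuous_const|apply continuous_id]. }
  assert (E : forall x y, (RtoC (1 - k) * (x, y) + RtoC k * (x0, y0))%C = ((1 - k) * x + k * x0, (1 - k) * y + k * y0)).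
  { intros x y; apply injective_projections; simpl; ring. }
  assert (Z : flux g a b c d = 0).
  { apply goursat_closed; [exact Hg|lra|lra|].
    intros x y Hx Hy; unfold g.
    apply (cderivable_comp f (fun z => (RtoC (1 - k) * z + RtoC k * (x0, y0))%C)).
    - apply cderivable_plus; [|apply cderivable_const].
      apply cderivable_scal, cderivable_id.
    - rewrite E; apply Hd; unfold x0, y0; split; nra. }
  assert (D : forall x y, a <= x <= b -> c <= y <= d ->
     Rabs (Re (f (x, y)) - Re (g (x, y))) <= e /\ Rabs (Im (f (x, y)) - Im (g (x, y))) <= e).
  { intros x y Hx Hy; unfold g; rewrite E.
    destruct (Hu ((1 - k) * x + k * x0) ((1 - k) * y + k * y0) x y); try lra.
    - unfold x0; split; nra.
    - unfold y0; split; nra.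
    - replace (x - ((1 - k) * x + k * x0)) with (k * (x - x0)) by ring.
      rewrite Rabs_mult, Rabs_pos_eq by lra.
      assert (Rabs (x - x0) <= S) by (apply Rabs_le; unfold S, x0; lra). nra.
    - replace (y - ((1 - k) * y + k * y0)) with (k * (y - y0)) by ring.
      rewrite Rabs_mult, Rabs_pos_eq by lra.
      assert (Rabs (y - y0) <= S) by (apply Rabs_le; unfold S, y0; lra). nra. }
  assert (E1 := RInt_diff_le (fun x => Re (f (x, c))) (fun x => Re (g (x, c))) a b e).
  assert (E2 := RInt_diff_le (fun x => Re (f (x, d))) (fun x => Re (g (x, d))) a b e).
  assert (E3 := RInt_diff_le (fun y => Im (f (b, y))) (fun y => Im (g (b, y))) c d e).
  assert (E4 := RInt_diff_le (fun y => Im (f (a, y))) (fun y => Im (g (a, y))) c d e).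
  lapply E1; [clear E1; intros E1|lra].
  lapply E2; [clear E2; intros E2|lra].
  lapply E3; [clear E3; intros E3|lra].
  lapply E4; [clear E4; intros E4|lra].
  specialize (E1 (cont_Re_h f Hf c) (cont_Re_h g Hg c)).
  specialize (E2 (cont_Re_h f Hf d) (cont_Re_h g Hg d)).
  specialize (E3 (fun y => cont_Im_v f Hf y b) (fun y => cont_Im_v g Hg y b)).
  specialize (E4 (fun y => cont_Im_v f Hf y a) (fun y => cont_Im_v g Hg y a)).
  lapply E1; [clear E1; intros E1|intros; apply D; lra].
  lapply E2; [clear E2; intros E2|intros; apply D; lra].
  lapply E3; [clear E3; intros E3|intros; apply D; lra].
  lapply E4; [clear E4; intros E4|intros; apply D; lra].
  assert (B : Rabs (flux f a b c d) <= 2 * (S * e)).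
  { rewrite <- (Rminus_0_r (flux f a b c d)), <- Z.
    apply Rabs_le_between in E1. apply Rabs_le_between in E2.
    apply Rabs_le_between in E3. apply Rabs_le_between in E4.
    replace (2 * (S * e)) with (2 * ((b - a) * e) + 2 * ((d - c) * e)) by (unfold S; ring).
    unfold flux; apply Rabs_le; lra. }
  assert (S * e = Rabs (flux f a b c d) / 4) by (unfold e; field; lra).
  lra.
Qed.

(** The imaginary part of the integral of [f dz] is the flux of [- Ci * f]. *)
Lemma goursat_Im (f : C -> C) (a b c d : R) :
  ccontinuous f -> a < b -> c < d ->
  (forall x y, a < x < b -> c < y < d -> cderivable f (x, y)) ->
  RInt (fun x => Im (f (x, c))) a b - RInt (fun x => Im (f (x, d))) a b
  + RInt (fun y => Re (f (b, y))) c d - RInt (fun y => Re (f (a, y))) c d = 0.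
Proof.
  intros Hf Hab Hcd Hd.
  pose (g := fun z => (- Ci * f z)%C).
  assert (Z : flux g a b c d = 0).
  { apply goursat; auto.
    - intros z; apply (continuous_Cmult (fun _ => (- Ci)%C) f); [apply continuous_const|apply Hf].
    - intros x y Hx Hy; apply cderivable_scal; auto. }
  assert (Er : forall z, Re (g z) = Im (f z)) by (intros z; unfold g, Re, Im; simpl; unfold Re, Im; ring).
  assert (Ei : forall z, Im (g z) = -1 * Re (f z)) by (intros z; unfold g, Re, Im; simpl; unfold Re, Im; ring).
  unfold flux in Z.
  rewrite (RInt_ext (fun x => Re (g (x, c))) (fun x => Im (f (x, c)))) in Z by (intros; apply Er).
  rewrite (RInt_ext (fun x => Re (g (x, d))) (fun x => Im (f (x, d)))) in Z by (intros; apply Er).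
  rewrite (RInt_ext (fun y => Im (g (b, y))) (fun y => -1 * Re (f (b, y)))) in Z by (intros; apply Ei).
  rewrite (RInt_ext (fun y => Im (g (a, y))) (fun y => -1 * Re (f (a, y)))) in Z by (intros; apply Ei).
  rewrite !RInt_Rscal in Z by (intros; apply cont_Re_v; exact Hf).
  lra.
Qed.

(** * The mean value property and the maximum principle *)

Lemma Cexp_plus (a b : C) : Cexp (a + b) = (Cexp a * Cexp b)%C.
Proof.
  unfold Cexp, Re, Im; apply injective_projections; simpl; rewrite exp_plus.
  - rewrite cos_plus; ring.
  - rewrite sin_plus; ring.
Qed.

Lemma Cmod_Cexp (z : C) : Cmod (Cexp z) = exp (Re z).
Proof.
  unfold Cmod, Cexp; simpl fst; simpl snd.
  replace ((exp (Re z) * cos (Im z)) ^ 2 + (exp (Re z) * sin (Im z)) ^ 2) with (Rsqr (exp (Re z))).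
  - apply sqrt_Rsqr; left; apply exp_pos.
  - pose proof (sin2_cos2 (Im z)); unfold Rsqr in *. nra.
Qed.

Lemma derive_little_o (g : R -> R) (l : R) :
  is_derive g 0 l -> forall e, 0 < e -> exists d, 0 < d /\
  forall x, Rabs x < d -> Rabs (g x - g 0 - l * x) <= e * Rabs x.
Proof.
  intros [_ H] e He.
  destruct (H 0 (fun P HP => HP) (mkposreal e He)) as [d Hd]; simpl in Hd.
  exists d; split; [apply cond_pos|]; intros x Hx.
  specialize (Hd x).
  assert (B : ball 0 d x) by (unfold ball; simpl; unfold AbsRing_ball, abs, minus, plus, opp; simpl; rewrite Ropp_0, Rplus_0_r; exact Hx).
  specialize (Hd B). unfold norm, minus, plus, opp, scal in Hd; simpl in Hd.
  unfold mult, abs in Hd; simpl in Hd.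
  rewrite Ropp_0, Rplus_0_r in Hd.
  replace (g x - g 0 - l * x) with (g x + - g 0 + - (x * l)) by ring; exact Hd.
Qed.

Lemma is_cderive_Cexp (z : C) : is_cderive Cexp z (Cexp z).
Proof.
  assert (K : forall e, 0 < e -> exists d, 0 < d /\ forall h : C, Cmod h < d -> Cmod (Cexp h - 1 - h) <= e * Cmod h).
  { intros e He.
    assert (D1 : is_derive exp 0 1) by (auto_derive; [auto|rewrite exp_0; ring]).
    assert (D2 : is_derive cos 0 0) by (auto_derive; [auto|rewrite sin_0; ring]).
    assert (D3 : is_derive sin 0 1) by (auto_derive; [auto|rewrite cos_0; ring]).
    destruct (derive_little_o _ _ D1 (e / 8)) as [d1 [Hd1 H1]]; [lra|].
    destruct (derive_little_o _ _ D1 1) as [d4 [Hd4 H4]]; [lra|].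
    destruct (derive_little_o _ _ D2 (e / 12)) as [d2 [Hd2 H2]]; [lra|].
    destruct (derive_little_o _ _ D3 (e / 12)) as [d3 [Hd3 H3]]; [lra|].
    set (m := Rmin (Rmin d1 d4) (Rmin (Rmin d2 d3) (Rmin 1 (e / 8)))).
    exists m; split.
    { unfold m; repeat apply Rmin_pos; lra. }
    intros [x y] Hh.
    assert (Hx : Rabs x <= Cmod (x, y)) by apply (re_le_Cmod (x, y)).
    assert (Hy : Rabs y <= Cmod (x, y)) by apply (im_le_Cmod (x, y)).
    set (c := Cmod (x, y)) in *.
    assert (M : m <= d1 /\ m <= d2 /\ m <= d3 /\ m <= d4 /\ m <= 1 /\ m <= e / 8).
    { unfold m, Rmin; repeat destruct Rle_dec; lra. }
    destruct M as (M1 & M2 & M3 & M4 & M5 & M6).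
    specialize (H1 x ltac:(lra)); specialize (H4 x ltac:(lra)).
    specialize (H2 y ltac:(lra)); specialize (H3 y ltac:(lra)).
    rewrite exp_0 in H1, H4; rewrite cos_0 in H2; rewrite sin_0 in H3.
    assert (Ex : 0 < exp x <= 3).
    { split; [apply exp_pos|]. apply Rle_trans with (exp 1); [|apply exp_le_3].
      assert (x <= 1) by (apply Rabs_le_between in Hx; lra).
      destruct H as [H| ->]; [left; apply exp_increasing, H|lra]. }
    assert (Ex1 : Rabs (exp x - 1) <= 2 * c).
    { replace (exp x - 1) with ((exp x - 1 - 1 * x) + x) by ring.
      eapply Rle_trans; [apply Rabs_triang|]; lra. }
    eapply Rle_trans; [apply Cmod_le_abs|].
    assert (R1 : Rabs (Re (Cexp (x, y) - 1 - (x, y))) <= e / 12 * c * 3 + e / 8 * c).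
    { replace (Re (Cexp (x, y) - 1 - (x, y))) with ((cos y - 1 - 0 * y) * exp x + (exp x - 1 - 1 * x))
        by (unfold Cexp, Re, Im; simpl; ring).
      eapply Rle_trans; [apply Rabs_triang|]; rewrite Rabs_mult, (Rabs_pos_eq (exp x)) by lra.
      apply Rplus_le_compat; [apply Rmult_le_compat; try apply Rabs_pos; try lra; nra|nra]. }
    assert (I1 : Rabs (Im (Cexp (x, y) - 1 - (x, y))) <= e / 12 * c * 3 + 2 * c * (e / 8)).
    { replace (Im (Cexp (x, y) - 1 - (x, y))) with ((sin y - 0 - 1 * y) * exp x + (exp x - 1) * y)
        by (unfold Cexp, Re, Im; simpl; ring).
      eapply Rle_trans; [apply Rabs_triang|]; rewrite !Rabs_mult, (Rabs_pos_eq (exp x)) by lra.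
      apply Rplus_le_compat; [apply Rmult_le_compat; try apply Rabs_pos; try lra; nra|].
      apply Rmult_le_compat; try apply Rabs_pos; lra. }
    assert (0 <= c) by apply Cmod_ge_0. nra. }
  intros e He.
  assert (Hp : 0 < Cmod (Cexp z)) by (rewrite Cmod_Cexp; apply exp_pos).
  destruct (K (e / Cmod (Cexp z))) as [d [Hd H]]; [apply Rdiv_lt_0_compat; assumption|].
  exists d; split; [exact Hd|]; intros z' Hz'.
  replace (Cexp z' - Cexp z - Cexp z * (z' - z))%C with (Cexp z * (Cexp (z' - z) - 1 - (z' - z)))%C.
  - rewrite Cmod_mult.
    specialize (H _ Hz'); apply (Rmult_le_compat_l (Cmod (Cexp z))) in H; [|left; exact Hp].
    eapply Rle_trans; [exact H|]; right; field; lra.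
  - replace (Cexp z') with (Cexp z * Cexp (z' - z))%C; [ring|].
    rewrite <- Cexp_plus; f_equal; ring.
Qed.

Lemma cderivable_Cexp (z : C) : cderivable Cexp z.
Proof. eexists; apply is_cderive_Cexp. Qed.

Lemma ccontinuous_Cexp : ccontinuous Cexp.
Proof. intros z; apply cderivable_continuous, cderivable_Cexp. Qed.

Lemma Cexp_2PI (x : R) : Cexp (x, 2 * PI) = Cexp (x, 0).
Proof. unfold Cexp; simpl; rewrite cos_2PI, sin_2PI, cos_0, sin_0; reflexivity. Qed.

Lemma continuous_Rmin_l (a : R) (x : R) : continuous (fun t => Rmin t a) x.
Proof.
  apply (continuous_ext (fun t => (t + a - Rabs (t - a)) / 2)).
  - intros t; unfold Rmin; destruct Rle_dec; [rewrite Rabs_left1|rewrite Rabs_pos_eq]; lra.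
  - apply (continuous_Rmult (fun t => t + a - Rabs (t - a)) (fun _ => / 2)); [|apply continuous_const].
    apply (continuous_Rminus (fun t => t + a) (fun t => Rabs (t - a))).
    + apply (continuous_Rplus (fun t => t) (fun t => a)); [apply continuous_id|apply continuous_const].
    + apply (continuous_comp (fun t => t - a) Rabs).
      * apply (continuous_Rminus (fun t => t) (fun t => a)); [apply continuous_id|apply continuous_const].
      * apply continuous_Rabs.
Qed.

Lemma Cmod_circle (c : C) (s t : R) : Cmod (c + Cexp (s, t) - c) = exp s.
Proof. replace (c + Cexp (s, t) - c)%C with (Cexp (s, t)) by ring; apply Cmod_Cexp. Qed.

(** Cauchy's theorem for [f (c + exp z)] on [s0, ln r] x [0, 2 PI], with [s0 -> -oo]. *)
Lemma mean_value (f : C -> C) (c : C) (r : R) :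
  0 < r ->
  (forall z, Cmod (z - c) <= r -> continuous (U := C_UniformSpace) f z) ->
  (forall z, Cmod (z - c) < r -> cderivable f z) ->
  RInt (fun t => Re (f (c + Cexp (ln r, t))%C)) 0 (2 * PI) = 2 * PI * Re (f c).
Proof.
  intros Hr Cf Df.
  pose proof PI_RGT_0 as HPI.
  (* [goursat_Im] asks for continuity on the whole plane. Clamping the abscissa at [ln r] keeps
     [c + exp z] in the closed disc and changes nothing on the rectangle. *)
  pose (cl := fun z : C => (Rmin (Re z) (ln r), Im z)).
  pose (g := fun z => f (c + Cexp (cl z))%C).
  assert (Ccl : ccontinuous cl).
  { intros z; apply (continuous_pair (fun z : C => Rmin (Re z) (ln r)) (fun z : C => Im z)).
    - apply (continuous_comp Re (fun t => Rmin t (ln r))); [apply continuous_Re|apply continuous_Rmin_l].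
    - apply continuous_Im. }
  assert (Cg : ccontinuous g).
  { intros z; apply (continuous_comp (U := C_UniformSpace) (V := C_UniformSpace) (W := C_UniformSpace) (fun z => (c + Cexp (cl z))%C) f).
    - apply continuous_Cplus; [apply continuous_const|].
      apply (ccontinuous_comp Cexp cl); [exact Ccl|exact ccontinuous_Cexp].
    - apply Cf; unfold cl; rewrite Cmod_circle.
      rewrite <- (exp_ln r Hr) at 2.
      destruct (Rmin_r (Re z) (ln r)) as [H|H]; [left; apply exp_increasing, H|rewrite H; lra]. }
  assert (G : forall s0, s0 < ln r -> RInt (fun t => Re (g (ln r, t))) 0 (2 * PI) = RInt (fun t => Re (g (s0, t))) 0 (2 * PI)).
  { intros s0 Hs0.
    assert (Z : RInt (fun x => Im (g (x, 0))) s0 (ln r) - RInt (fun x => Im (g (x, 2 * PI))) s0 (ln r)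
      + RInt (fun y => Re (g (ln r, y))) 0 (2 * PI) - RInt (fun y => Re (g (s0, y))) 0 (2 * PI) = 0).
    { apply goursat_Im; [exact Cg|exact Hs0|lra|].
      intros x y Hx Hy.
      apply (cderivable_ext_loc (fun z => f (c + Cexp z)%C) g (x, y) (ln r - x)); [lra| |].
      - intros z' Hz'; unfold g, cl; f_equal; f_equal; f_equal.
        rewrite Rmin_left; [destruct z'; reflexivity|].
        assert (Rabs (Re (z' - (x, y))) < ln r - x) by (eapply Rle_lt_trans; [apply re_le_Cmod|exact Hz']).
        unfold Re in *; simpl in *; apply Rabs_lt_between in H; lra.
      - apply (cderivable_comp f (fun z => (c + Cexp z)%C)).
        + apply cderivable_plus; [apply cderivable_const|apply cderivable_Cexp].
        + apply Df; rewrite Cmod_circle; rewrite <- (exp_ln r Hr); apply exp_increasing; lra. }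
    (* The two horizontal sides cancel by periodicity of the exponential. *)
    rewrite (RInt_ext (fun x => Im (g (x, 2 * PI))) (fun x => Im (g (x, 0)))) in Z; [lra|].
    intros x _; unfold g, cl; simpl; rewrite Cexp_2PI; reflexivity. }
  rewrite (RInt_ext _ (fun t => Re (g (ln r, t)))).
  2:{ intros t _; unfold g, cl; simpl; rewrite Rmin_left by lra; reflexivity. }
  apply cond_eq; intros e He.
  destruct (proj1 (continuous_C_eps f c) (Cf c ltac:(replace (c - c)%C with (RtoC 0) by ring; rewrite Cmod_0; lra)) (e / (4 * PI))) as [d [Hd H]].
  { apply Rdiv_lt_0_compat; lra. }
  set (s0 := Rmin (ln r - 1) (ln d - 1)).
  assert (S1 : s0 <= ln r - 1) by apply Rmin_l.
  assert (S2 : s0 <= ln d - 1) by apply Rmin_r.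
  rewrite (G s0) by lra.
  assert (E := RInt_diff_le (fun t => Re (g (s0, t))) (fun t => Re (f c)) 0 (2 * PI) (e / (4 * PI))).
  rewrite (RInt_const (V := R_CompleteNormedModule)) in E.
  change (scal (2 * PI - 0) (Re (f c))) with ((2 * PI - 0) * Re (f c)) in E.
  rewrite Rminus_0_r in E.
  eapply Rle_lt_trans; [apply E|].
  - lra.
  - intros t; apply cont_Re_v, Cg.
  - intros t; apply continuous_const.
  - intros t _; unfold g, cl; simpl; rewrite Rmin_left by lra.
    rewrite <- (Ropp_involutive (Re (f c))).
    replace (Re (f (c + Cexp (s0, t))%C) - - - Re (f c)) with (Re (f (c + Cexp (s0, t))%C - f c)%C)
      by (unfold Re; simpl; unfold Re; ring).
    eapply Rle_trans; [apply re_le_Cmod|]; left; apply H.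
    rewrite Cmod_circle, <- (exp_ln d Hd); apply exp_increasing; lra.
  - replace (2 * PI * (e / (4 * PI))) with (e / 2) by (field; lra); lra.
Qed.

(** Compactness turns collars whose width depends on the point into one of uniform width. It will be
    applied to the unit circle, with [t] the angle and [s] the distance to the circle. *)
Lemma uniform_on_segment (P : R -> R -> Prop) (a b : R) :
  (forall t, a <= t <= b -> exists d, 0 < d /\ forall t' s, Rabs (t' - t) < d -> 0 < s < d -> P t' s) ->
  exists d, 0 < d /\ forall t s, a <= t <= b -> 0 < s < d -> P t s.
Proof.
  intros H.
  assert (H' : forall t, exists d : posreal, a <= t <= b -> forall t' s, Rabs (t' - t) < d -> 0 < s < d -> P t' s).
  { intros t; destruct (Rle_dec a t); [destruct (Rle_dec t b)|].
    - destruct (H t) as [d [Hd Hd']]; [lra|]; exists (mkposreal d Hd); auto.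
    - exists (mkposreal 1 Rlt_0_1); intros; lra.
    - exists (mkposreal 1 Rlt_0_1); intros; lra. }
  pose (D := fun t => proj1_sig (constructive_indefinite_description _ (H' t))).
  assert (HD : forall t, a <= t <= b -> forall t' s, Rabs (t' - t) < D t -> 0 < s < D t -> P t' s).
  { intros t; exact (proj2_sig (constructive_indefinite_description _ (H' t))). }
  destruct (compactness_value_1d a b D) as [d Hd].
  exists d; split; [apply cond_pos|]; intros t s Ht Hs.
  apply NNPP; intros N; apply (Hd t Ht); intros [t0 [Ht0 [Hc Hle]]].
  apply N; apply (HD t0 Ht0); [exact Hc|lra].
Qed.

(** The Moebius map of the unit disc onto the upper half plane that takes 0 to [z0] and 1 to
    infinity. *)
Definition cayley (z0 z : C) : C := (RtoC (Re z0) + RtoC (Im z0) * (Ci * (1 + z) * / (1 - z)))%C.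

Lemma cayley_0 (z0 : C) : cayley z0 0 = z0.
Proof.
  unfold cayley. replace (1 - 0)%C with (RtoC 1) by ring.
  replace (Ci * (1 + 0) * / 1)%C with Ci by (field; apply RtoC_neq; lra).
  destruct z0; apply injective_projections; simpl; ring.
Qed.

Lemma Im_cayley (z0 z : C) : z <> RtoC 1 ->
  Im (cayley z0 z) = Im z0 * (1 - Cmod z ^ 2) / Cmod (1 - z) ^ 2.
Proof.
  intros Hz.
  rewrite !Cmod2_alt.
  destruct z as [x y], z0 as [a b].
  assert (N : (1 - x) ^ 2 + y ^ 2 <> 0).
  { intros E; apply Hz.
    assert (y = 0) by (apply NNPP; intros F; pose proof (pow2_gt_0 y F); pose proof (pow2_ge_0 (1 - x)); lra).
    assert (1 - x = 0) by (apply NNPP; intros F; pose proof (pow2_gt_0 (1 - x) F); pose proof (pow2_ge_0 y); lra). apply injective_projections; simpl; lra. }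
  unfold cayley, Re, Im; simpl. field. simpl in N. intros E; apply N; rewrite <- E; ring.
Qed.

Lemma cderivable_cayley (z0 z : C) : z <> RtoC 1 -> cderivable (cayley z0) z.
Proof.
  intros Hz. unfold cayley.
  apply cderivable_plus; [apply cderivable_const|].
  apply cderivable_scal, cderivable_mult.
  - apply cderivable_scal, cderivable_plus; [apply cderivable_const|apply cderivable_id].
  - apply (cderivable_comp Cinv (fun z => (1 - z)%C)).
    + apply (cderivable_ext_loc (fun z => (1 + (- (1)) * z)%C) _ z 1); [lra|intros; ring|].
      apply cderivable_plus; [apply cderivable_const|apply cderivable_scal, cderivable_id].
    + apply cderivable_inv; intros E; apply Hz.
      replace z with (1 - (1 - z))%C by ring; rewrite E; ring.
Qed.

Lemma cayley_large (z0 z : C) : z <> RtoC 1 -> 0 < Im z0 ->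
  Im z0 * (2 - Cmod (z - 1)) / Cmod (z - 1) - Rabs (Re z0) <= Cmod (cayley z0 z).
Proof.
  intros Hz Hy.
  assert (N : (1 - z)%C <> RtoC 0).
  { intros E; apply Hz. replace z with (1 - (1 - z))%C by ring; rewrite E; ring. }
  assert (P : 0 < Cmod (z - 1)) by (rewrite Cmod_minus_sym; apply Cmod_gt_0; exact N).
  unfold cayley. set (B := (RtoC (Im z0) * (Ci * (1 + z) * / (1 - z)))%C).
  assert (HB : Im z0 * (2 - Cmod (z - 1)) / Cmod (z - 1) <= Cmod B).
  { unfold B; rewrite !Cmod_mult, Cmod_inv, Cmod_Ci, Cmod_R, Rabs_pos_eq, (Cmod_minus_sym 1 z) by (auto; lra).
    unfold Rdiv; rewrite Rmult_1_l, <- Rmult_assoc.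
    apply Rmult_le_compat_r; [left; apply Rinv_0_lt_compat; exact P|].
    apply Rmult_le_compat_l; [lra|].
    replace (1 + z)%C with (2 - (- (z - 1)))%C by ring.
    pose proof (Cmod_minus_le 2 (- (z - 1))) as H; rewrite Cmod_opp, Cmod_R, Rabs_pos_eq in H by lra; exact H. }
  pose proof (Cmod_minus_le B (- RtoC (Re z0))) as H.
  rewrite Cmod_opp, Cmod_R in H.
  replace (B - - RtoC (Re z0))%C with (RtoC (Re z0) + B)%C in H by ring. lra.
Qed.

Lemma Re_Cexp_continuous (t : R) (d : R) : 0 < d -> exists r, 0 < r /\
  forall t' s, Rabs (t' - t) < r -> 0 < s < r -> Cmod (Cexp (ln (1 - s), t') - Cexp (0, t)) < d.
Proof.
  intros Hd.
  destruct (proj1 (continuous_C_eps Cexp (0, t)) (ccontinuous_Cexp (0, t)) d Hd) as [r [Hr H]].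
  assert (L : continuous (fun s => ln (1 - s)) 0).
  { apply (ex_derive_continuous (fun s => ln (1 - s))); auto_derive; lra. }
  destruct (L (fun y => Rabs (y - 0) < r / 2)) as [q Hq].
  { assert (Hr2 : 0 < r / 2) by lra. exists (mkposreal _ Hr2); intros y Hy.
    rewrite Rminus_0_r, ln_1 in Hy; exact Hy. }
  exists (Rmin q (r / 2)); split; [apply Rmin_pos; [apply cond_pos|lra]|].
  intros t' s Ht Hs.
  pose proof (Rmin_l q (r / 2)); pose proof (Rmin_r q (r / 2)).
  apply H; eapply Rle_lt_trans; [apply Cmod_le_abs|]; unfold Re, Im; simpl.
  assert (Rabs (ln (1 - s) - 0) < r / 2).
  { apply Hq; unfold ball; simpl; unfold AbsRing_ball, abs, minus, plus, opp; simpl.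
    rewrite Ropp_0, Rplus_0_r, Rabs_pos_eq; lra. }
  unfold Rminus in *; lra.
Qed.

(** Pull back by [cayley z0], so that [z0] becomes the centre of the disc. If [Re (f z0)] were
    [e > 0], the real part would be below [e / 2] near every point of the circle, hence on a full
    circle of radius [1 - s] by compactness, against the mean value property. *)
Lemma max_principle (f : C -> C) :
  (forall z, upper z -> cderivable f z) ->
  (forall x e, 0 < e -> exists d, 0 < d /\ forall z, upper z -> Cmod (z - RtoC x) < d -> Re (f z) < e) ->
  (forall e, 0 < e -> exists M, forall z, upper z -> M < Cmod z -> Re (f z) < e) ->
  forall z, upper z -> Re (f z) <= 0.
Proof.
  intros Df Hb Hi z0 Hz0.
  pose proof PI_RGT_0 as HPI.
  apply Rnot_lt_le; intros Hpos.
  set (e := Re (f z0)) in *.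
  assert (Hup : forall z, Cmod z < 1 -> z <> RtoC 1 /\ upper (cayley z0 z)).
  { intros z Hz.
    assert (N : z <> RtoC 1) by (intros ->; rewrite Cmod_1 in Hz; lra).
    split; [exact N|]; unfold upper; rewrite Im_cayley by exact N.
    assert (0 < Cmod (1 - z)).
    { apply Cmod_gt_0; intros E; apply N; replace z with (1 - (1 - z))%C by ring; rewrite E; ring. }
    pose proof (Cmod_ge_0 z).
    apply Rdiv_lt_0_compat; [apply Rmult_lt_0_compat; [exact Hz0|nra]|nra]. }
  destruct (uniform_on_segment (fun t s => s < 1 -> Re (f (cayley z0 (Cexp (ln (1 - s), t)))) < e / 2) 0 (2 * PI)) as [d [Hd H]].
  { intros t Ht.
    assert (Hex : exists q, 0 < q /\ forall z, Cmod z < 1 -> Cmod (z - Cexp (0, t)) < q -> Re (f (cayley z0 z)) < e / 2).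
    (* The point 1 of the circle corresponds to infinity and is governed by [Hi]; all other points
       correspond to real numbers and are governed by [Hb]. *)
    { destruct (classic (Cexp (0, t) = RtoC 1)) as [E|N].
      - destruct (Hi (e / 2)) as [M HM]; [lra|].
        set (M' := Rabs M + Rabs (Re z0) + 1).
        assert (HM' : 0 < M') by (unfold M'; pose proof (Rabs_pos M); pose proof (Rabs_pos (Re z0)); lra).
        exists (Rmin 1 (Im z0 / M')); split.
        { apply Rmin_pos; [lra|apply Rdiv_lt_0_compat; assumption]. }
        intros z Hz Hq; rewrite E in Hq.
        destruct (Hup z Hz) as [N U]; apply HM; [exact U|].
        pose proof (cayley_large z0 z N Hz0) as L.
        assert (P : 0 < Cmod (z - 1)).
        { apply Cmod_gt_0; intros E'; apply N; replace z with (1 + (z - 1))%C by ring; rewrite E'; ring. }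
        assert (Q1 : Cmod (z - 1) < 1) by (eapply Rlt_le_trans; [exact Hq|apply Rmin_l]).
        assert (Q2 : Cmod (z - 1) < Im z0 / M') by (eapply Rlt_le_trans; [exact Hq|apply Rmin_r]).
        assert (M' < Im z0 * (2 - Cmod (z - 1)) / Cmod (z - 1)).
        { apply (Rmult_lt_compat_r M') in Q2; [|exact HM'].
          unfold Rdiv in Q2; rewrite Rmult_assoc, Rinv_l, Rmult_1_r in Q2 by lra.
          apply (Rmult_lt_reg_r (Cmod (z - 1))); [exact P|].
          unfold Rdiv; rewrite Rmult_assoc, Rinv_l, Rmult_1_r by lra.
          unfold upper in Hz0. nra. }
        pose proof (Rle_abs M). unfold M' in *; lra.
      - set (b := cayley z0 (Cexp (0, t))).
        assert (Hbr : b = RtoC (Re b)).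
        { apply injective_projections; simpl; [reflexivity|].
          change (Im b = 0); unfold b; rewrite Im_cayley by exact N.
          rewrite Cmod_Cexp; simpl; rewrite exp_0; unfold Rdiv; ring. }
        destruct (Hb (Re b) (e / 2)) as [q [Hq Hq']]; [lra|].
        destruct (proj1 (continuous_C_eps (cayley z0) (Cexp (0, t))) (cderivable_continuous _ _ (cderivable_cayley z0 _ N)) q Hq) as [p [Hp Hp']].
        exists p; split; [exact Hp|]; intros z Hz Hzp.
        apply Hq'; [apply Hup; exact Hz|rewrite <- Hbr; apply Hp'; exact Hzp]. }
    destruct Hex as [q [Hq Hq']].
    destruct (Re_Cexp_continuous t q Hq) as [r [Hr Hr']].
    exists r; split; [exact Hr|]; intros t' s Ht' Hs Hs1.
    apply Hq'; [|apply Hr'; assumption].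
    rewrite Cmod_Cexp; simpl; rewrite exp_ln; lra. }
  set (s := Rmin (1 / 2) (d / 2)).
  assert (Hs : 0 < s) by (apply Rmin_pos; lra).
  assert (Hs1 : s <= 1 / 2) by apply Rmin_l.
  assert (Hs2 : s <= d / 2) by apply Rmin_r.
  assert (Cd : forall z, Cmod z < 1 -> cderivable (fun z => f (cayley z0 z)) z).
  { intros z Hz; destruct (Hup z Hz) as [N U].
    apply cderivable_comp; [apply cderivable_cayley; exact N|apply Df; exact U]. }
  assert (MV := mean_value (fun z => f (cayley z0 z)) 0 (1 - s)).
  lapply MV; [clear MV; intros MV|lra].
  lapply MV; [clear MV; intros MV|].
  2:{ intros z Hz; apply cderivable_continuous, Cd; replace (z - 0)%C with z in Hz by ring; lra. }
  lapply MV; [clear MV; intros MV|].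
  2:{ intros z Hz; apply Cd; replace (z - 0)%C with z in Hz by ring; lra. }
  simpl in MV; rewrite cayley_0 in MV; fold e in MV.
  assert (Le : RInt (fun t => Re (f (cayley z0 (0 + Cexp (ln (1 - s), t))%C))) 0 (2 * PI) <= RInt (fun _ => e / 2) 0 (2 * PI)).
  { apply RInt_le; [lra| |apply (ex_RInt_const (V := R_NormedModule))|].
    - apply ex_RInt_cont; intros t.
      apply (continuous_comp (U := R_UniformSpace) (V := C_UniformSpace) (W := R_UniformSpace)
        (fun t => (0 + Cexp (ln (1 - s), t))%C) (fun z => Re (f (cayley z0 z)))).
      + apply continuous_Cplus; [apply continuous_const|].
        apply (continuous_line_v Cexp); exact ccontinuous_Cexp.
      + apply continuous_Re_comp, cderivable_continuous, Cd.
        replace (0 + Cexp (ln (1 - s), t))%C with (Cexp (ln (1 - s), t)) by ring.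
        rewrite Cmod_Cexp; simpl; rewrite exp_ln; lra.
    - intros t Ht; replace (0 + Cexp (ln (1 - s), t))%C with (Cexp (ln (1 - s), t)) by ring.
      left; apply H; lra. }
  rewrite MV, (RInt_const (V := R_CompleteNormedModule)) in Le.
  change (scal (2 * PI - 0) (e / 2)) with ((2 * PI - 0) * (e / 2)) in Le.
  nra.
Qed.

(** * Barriers *)

(** [Re (near_barrier c d)] is positive on the half plane, and at least 1 exactly
    on the disc of radius [d] about [c]; [far_barrier] plays the same role for the
    complement of a disc. *)
Definition near_barrier (c d : R) (z : C) : C := (RtoC (2 * d) * Ci * / (z - RtoC c + RtoC d * Ci))%C.
Definition far_barrier (c d : R) (z : C) : C := (RtoC 2 * Ci * (z - RtoC c) * / (Ci * (z - RtoC c) - RtoC d))%C.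

Lemma near_den (c d : R) (z : C) : 0 < d -> 0 <= Im z -> (z - RtoC c + RtoC d * Ci)%C <> RtoC 0.
Proof.
  intros Hd Hz E; apply (f_equal Im) in E; destruct z as [x y]; unfold Im in *; simpl in *.
  ring_simplify in E; lra.
Qed.

Lemma far_den (c d : R) (z : C) : 0 < d -> 0 <= Im z -> (Ci * (z - RtoC c) - RtoC d)%C <> RtoC 0.
Proof.
  intros Hd Hz E; apply (f_equal Re) in E; destruct z as [x y]; unfold Im, Re in *; simpl in *.
  ring_simplify in E; lra.
Qed.

Lemma Re_near_barrier (c d : R) (z : C) : 0 < d -> 0 <= Im z ->
  Re (near_barrier c d z) = 2 * d * (Im z + d) / ((Re z - c) ^ 2 + (Im z + d) ^ 2).
Proof.
  intros Hd Hz; destruct z as [x y]; unfold near_barrier, Re, Im in *; simpl in *.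
  field. intros E. assert (0 < (y + d) ^ 2) by (apply pow_lt; lra). pose proof (pow2_ge_0 (x - c)). simpl in *. nra.
Qed.

Lemma Re_far_barrier (c d : R) (z : C) : 0 < d -> 0 <= Im z ->
  Re (far_barrier c d z) = 2 * (Im z * (d + Im z) + (Re z - c) ^ 2) / ((Re z - c) ^ 2 + (Im z + d) ^ 2).
Proof.
  intros Hd Hz; destruct z as [x y]; unfold far_barrier, Re, Im in *; simpl in *.
  field; intros E; assert (0 < (y + d) ^ 2) by (apply pow_lt; lra); pose proof (pow2_ge_0 (x - c)); simpl in *; nra.
Qed.

Lemma near_barrier_pos (c d : R) (z : C) : 0 < d -> 0 <= Im z -> 0 <= Re (near_barrier c d z).
Proof.
  intros Hd Hz; rewrite Re_near_barrier by auto.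
  assert (0 < (Im z + d) ^ 2) by (apply pow_lt; lra).
  pose proof (pow2_ge_0 (Re z - c)).
  apply Rmult_le_pos; [nra|left; apply Rinv_0_lt_compat; lra].
Qed.

Lemma far_barrier_pos (c d : R) (z : C) : 0 < d -> 0 <= Im z -> 0 <= Re (far_barrier c d z).
Proof.
  intros Hd Hz; rewrite Re_far_barrier by auto.
  assert (0 < (Im z + d) ^ 2) by (apply pow_lt; lra).
  pose proof (pow2_ge_0 (Re z - c)).
  apply Rmult_le_pos; [nra|left; apply Rinv_0_lt_compat; lra].
Qed.

Lemma near_barrier_ge_1 (c d : R) (z : C) : 0 < d -> 0 <= Im z ->
  Cmod (z - RtoC c) <= d -> 1 <= Re (near_barrier c d z).
Proof.
  intros Hd Hz H; rewrite Re_near_barrier by auto.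
  assert (0 < (Im z + d) ^ 2) by (apply pow_lt; lra).
  pose proof (pow2_ge_0 (Re z - c)).
  pose proof (Cmod_ge_0 (z - RtoC c)).
  assert (K : Cmod (z - RtoC c) ^ 2 = (Re z - c) ^ 2 + Im z ^ 2).
  { rewrite Cmod2_alt; destruct z; unfold Re, Im; simpl; ring. }
  apply (Rmult_le_reg_r ((Re z - c) ^ 2 + (Im z + d) ^ 2)); [lra|].
  unfold Rdiv; rewrite Rmult_assoc, Rinv_l by lra. nra.
Qed.

Lemma far_barrier_ge_1 (c d : R) (z : C) : 0 < d -> 0 <= Im z ->
  d <= Cmod (z - RtoC c) -> 1 <= Re (far_barrier c d z).
Proof.
  intros Hd Hz H; rewrite Re_far_barrier by auto.
  assert (0 < (Im z + d) ^ 2) by (apply pow_lt; lra).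
  pose proof (pow2_ge_0 (Re z - c)).
  assert (K : Cmod (z - RtoC c) ^ 2 = (Re z - c) ^ 2 + Im z ^ 2).
  { rewrite Cmod2_alt; destruct z; unfold Re, Im; simpl; ring. }
  apply (Rmult_le_reg_r ((Re z - c) ^ 2 + (Im z + d) ^ 2)); [lra|].
  unfold Rdiv; rewrite Rmult_assoc, Rinv_l by lra. nra.
Qed.

Lemma Cmod_le_sq (z w : C) : Re z ^ 2 + Im z ^ 2 <= Re w ^ 2 + Im w ^ 2 -> Cmod z <= Cmod w.
Proof. intros H; unfold Cmod; apply sqrt_le_1_alt; exact H. Qed.

Lemma near_barrier_le (c d : R) (z : C) : 0 < d -> 0 <= Im z -> z <> RtoC c ->
  Re (near_barrier c d z) <= 2 * (d / Cmod (z - RtoC c)).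
Proof.
  intros Hd Hz Hc.
  assert (P : 0 < Cmod (z - RtoC c)).
  { apply Cmod_gt_0; intros E; apply Hc; replace z with (z - RtoC c + RtoC c)%C by ring; rewrite E; ring. }
  eapply Rle_trans; [apply Rle_abs|]; eapply Rle_trans; [apply re_le_Cmod|].
  unfold near_barrier; rewrite !Cmod_mult, Cmod_Ci, Cmod_R, Rabs_pos_eq, Cmod_inv by (try apply near_den; lra).
  rewrite Rmult_1_r; unfold Rdiv; rewrite <- Rmult_assoc; apply Rmult_le_compat_l; [lra|].
  apply Rinv_le_contravar; [exact P|].
  apply Cmod_le_sq; destruct z as [x y]; unfold Re, Im in *; simpl in *.
  pose proof (Rmult_le_pos _ _ Hz (Rlt_le _ _ Hd)); pose proof (Rle_0_sqr (x - c)); pose proof (Rle_0_sqr y); pose proof (Rle_0_sqr d); unfold Rsqr in *; lra.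
Qed.

Lemma far_barrier_le (c d : R) (z : C) : 0 < d -> 0 <= Im z ->
  Re (far_barrier c d z) <= 2 * (Cmod (z - RtoC c) / d).
Proof.
  intros Hd Hz.
  eapply Rle_trans; [apply Rle_abs|]; eapply Rle_trans; [apply re_le_Cmod|].
  unfold far_barrier; rewrite !Cmod_mult, Cmod_Ci, Cmod_R, Rabs_pos_eq, Cmod_inv by (try apply far_den; lra).
  rewrite Rmult_1_r; unfold Rdiv; rewrite Rmult_assoc.
  apply Rmult_le_compat_l; [lra|]; apply Rmult_le_compat_l; [apply Cmod_ge_0|].
  apply Rinv_le_contravar; [exact Hd|].
  apply Rle_trans with (Cmod (RtoC d)); [rewrite Cmod_R, Rabs_pos_eq; lra|].
  apply Cmod_le_sq; destruct z as [x y]; unfold Re, Im in *; simpl in *.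
  pose proof (Rmult_le_pos _ _ Hz (Rlt_le _ _ Hd)); pose proof (Rle_0_sqr (x - c)); pose proof (Rle_0_sqr y); pose proof (Rle_0_sqr d); unfold Rsqr in *; lra.
Qed.

Lemma cderivable_minus_const (f : C -> C) (a z : C) : cderivable f z -> cderivable (fun z => f z - a)%C z.
Proof. intros H; apply (cderivable_plus f (fun _ => (- a)%C)); [exact H|apply cderivable_const]. Qed.

Lemma cderivable_near_barrier (c d : R) (z : C) : 0 < d -> 0 <= Im z -> cderivable (near_barrier c d) z.
Proof.
  intros Hd Hz; unfold near_barrier; apply cderivable_scal.
  apply (cderivable_comp Cinv (fun z => (z - RtoC c + RtoC d * Ci)%C)).
  - apply cderivable_plus; [apply (cderivable_minus_const (fun z => z)), cderivable_id|apply cderivable_const].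
  - apply cderivable_inv, near_den; auto.
Qed.

Lemma cderivable_far_barrier (c d : R) (z : C) : 0 < d -> 0 <= Im z -> cderivable (far_barrier c d) z.
Proof.
  intros Hd Hz; unfold far_barrier; apply cderivable_mult.
  - apply cderivable_scal, (cderivable_minus_const (fun z => z)), cderivable_id.
  - apply (cderivable_comp Cinv (fun z => (Ci * (z - RtoC c) - RtoC d)%C)).
    + apply (cderivable_minus_const (fun z => (Ci * (z - RtoC c))%C)).
      apply cderivable_scal, (cderivable_minus_const (fun z => z)), cderivable_id.
    + apply cderivable_inv, far_den; auto.
Qed.

(** A two-constants estimate. Near [c1], near [c2] and far from [c3] only the bound [M] is available
    on the boundary; each of these sets costs [M] times its barrier, and the barriers decay like the
    ratios of distances in the conclusion. *)
Lemma harmonic_majorant (f : C -> C) (c1 c2 c3 d1 d2 d3 k eta M : R) :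
  0 < d1 -> 0 < d2 -> 0 < d3 -> 0 <= M -> 0 <= eta ->
  ccontinuous f -> (forall z, upper z -> cderivable f z) ->
  (forall z, upper z -> Re (f z) - k <= M) ->
  (forall x : R, Re (f (RtoC x)) - k <= eta \/ Rabs (x - c1) < d1 \/ Rabs (x - c2) < d2 \/ d3 < Rabs (x - c3)) ->
  forall z, upper z -> z <> RtoC c1 -> z <> RtoC c2 ->
  Re (f z) - k <= eta + 2 * M * (d1 / Cmod (z - RtoC c1) + d2 / Cmod (z - RtoC c2) + Cmod (z - RtoC c3) / d3).
Proof.
  intros Hd1 Hd2 Hd3 HM Heta Cf Df HbM Hb z Hz Hz1 Hz2.
  pose (g := fun z => (f z + (RtoC (- k - eta) +
     RtoC (- M) * (near_barrier c1 d1 z + near_barrier c2 d2 z + far_barrier c3 d3 z)))%C).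
  assert (Rg : forall z, Re (g z) = Re (f z) - k - eta - M * (Re (near_barrier c1 d1 z) + Re (near_barrier c2 d2 z) + Re (far_barrier c3 d3 z))).
  { intros; unfold g, Re; simpl; ring. }
  assert (G : Re (g z) <= 0).
  { apply max_principle; auto.
    - intros w Hw; assert (0 <= Im w) by (unfold upper in Hw; lra).
      unfold g; apply cderivable_plus; [auto|].
      apply cderivable_plus; [apply cderivable_const|]. apply cderivable_scal.
      apply cderivable_plus; [apply cderivable_plus|];
        [apply cderivable_near_barrier|apply cderivable_near_barrier|apply cderivable_far_barrier]; auto.
    - intros x e He.
      assert (Pos : forall w, upper w -> 0 <= Re (near_barrier c1 d1 w) /\ 0 <= Re (near_barrier c2 d2 w) /\ 0 <= Re (far_barrier c3 d3 w)).
      { intros w Hw; unfold upper in Hw; repeat split; [apply near_barrier_pos|apply near_barrier_pos|apply far_barrier_pos]; lra. }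
      (* Where some barrier reaches 1, its multiple by [M] absorbs the a priori bound [HbM],
         whatever the boundary values are. *)
      assert (Ex : forall w, upper w -> (1 <= Re (near_barrier c1 d1 w) \/ 1 <= Re (near_barrier c2 d2 w) \/ 1 <= Re (far_barrier c3 d3 w)) -> Re (g w) < e).
      { intros w Hw H1; rewrite Rg; destruct (Pos w Hw) as (? & ? & ?).
        specialize (HbM w Hw).
        assert (M <= M * (Re (near_barrier c1 d1 w) + Re (near_barrier c2 d2 w) + Re (far_barrier c3 d3 w))); [|lra].
        rewrite <- (Rmult_1_r M) at 1; apply Rmult_le_compat_l; lra. }
      assert (Tr : forall (w : C) (c : R), Rabs (Cmod (w - RtoC c) - Rabs (x - c)) <= Cmod (w - RtoC x)).
      { intros w c; rewrite <- (Cmod_R (x - c)).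
        pose proof (Cmod_minus_le (w - RtoC c) (RtoC (x - c))) as A.
        pose proof (Cmod_minus_le (RtoC (x - c)) (w - RtoC c)) as B.
        rewrite (Cmod_minus_sym (RtoC (x - c)) (w - RtoC c)) in B.
        replace (w - RtoC c - RtoC (x - c))%C with (w - RtoC x)%C in A, B by (rewrite RtoC_minus; ring).
        apply Rabs_le; lra. }
      destruct (Hb x) as [Hx|[Hx|[Hx|Hx]]].
      + destruct (proj1 (continuous_C_eps f (RtoC x)) (Cf (RtoC x)) e He) as [d [Hd H]].
        exists d; split; [exact Hd|]; intros w Hw Hwd; rewrite Rg; destruct (Pos w Hw) as (? & ? & ?).
        specialize (H w Hwd).
        assert (Re (f w) - Re (f (RtoC x)) < e).
        { eapply Rle_lt_trans; [|exact H]. eapply Rle_trans; [|apply re_le_Cmod].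
          eapply Rle_trans; [|apply Rle_abs]; right; unfold Re; simpl; ring. }
        assert (0 <= M * (Re (near_barrier c1 d1 w) + Re (near_barrier c2 d2 w) + Re (far_barrier c3 d3 w))) by (apply Rmult_le_pos; lra).
        lra.
      + exists (d1 - Rabs (x - c1)); split; [lra|]; intros w Hw Hwd; apply Ex; [exact Hw|left].
        apply near_barrier_ge_1; [exact Hd1|unfold upper in Hw; lra|].
        specialize (Tr w c1); apply Rabs_le_between in Tr; lra.
      + exists (d2 - Rabs (x - c2)); split; [lra|]; intros w Hw Hwd; apply Ex; [exact Hw|right; left].
        apply near_barrier_ge_1; [exact Hd2|unfold upper in Hw; lra|].
        specialize (Tr w c2); apply Rabs_le_between in Tr; lra.
      + exists (Rabs (x - c3) - d3); split; [lra|]; intros w Hw Hwd; apply Ex; [exact Hw|right; right].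
        apply far_barrier_ge_1; [exact Hd3|unfold upper in Hw; lra|].
        specialize (Tr w c3); apply Rabs_le_between in Tr; lra.
    - intros e He; exists (d3 + Rabs c3); intros w Hw Hwd; rewrite Rg.
      assert (0 <= Im w) by (unfold upper in Hw; lra).
      assert (1 <= Re (far_barrier c3 d3 w)).
      { apply far_barrier_ge_1; auto.
        pose proof (Cmod_minus_le w (RtoC c3)) as A; rewrite Cmod_R in A; lra. }
      assert (0 <= Re (near_barrier c1 d1 w)) by (apply near_barrier_pos; auto).
      assert (0 <= Re (near_barrier c2 d2 w)) by (apply near_barrier_pos; auto).
      assert (M <= M * (Re (near_barrier c1 d1 w) + Re (near_barrier c2 d2 w) + Re (far_barrier c3 d3 w))).
      { rewrite <- (Rmult_1_r M) at 1; apply Rmult_le_compat_l; lra. }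
      specialize (HbM w Hw); lra. }
  rewrite Rg in G.
  assert (Hz' : 0 <= Im z) by (unfold upper in Hz; lra).
  pose proof (near_barrier_le c1 d1 z Hd1 Hz' Hz1).
  pose proof (near_barrier_le c2 d2 z Hd2 Hz' Hz2).
  pose proof (far_barrier_le c3 d3 z Hd3 Hz').
  assert (M * (Re (near_barrier c1 d1 z) + Re (near_barrier c2 d2 z) + Re (far_barrier c3 d3 z))
    <= M * (2 * (d1 / Cmod (z - RtoC c1)) + 2 * (d2 / Cmod (z - RtoC c2)) + 2 * (Cmod (z - RtoC c3) / d3))).
  { apply Rmult_le_compat_l; lra. }
  lra.
Qed.

(** The majorant is applied to [f] and to [- f]. At a real point either the boundary hypothesis
    gives [eta], or one of the three ratios is at least 1 and the right side exceeds [M]. *)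
Lemma harmonic_bound (f : C -> C) (c1 c2 c3 d1 d2 d3 k eta M : R) :
  0 < d1 -> 0 < d2 -> 0 < d3 -> 1 / 2 <= M -> 0 <= eta ->
  ccontinuous f -> (forall z, upper z -> cderivable f z) ->
  (forall z, closed_upper z -> Rabs (Re (f z) - k) <= M) ->
  (forall x : R, Rabs (Re (f (RtoC x)) - k) <= eta \/ Rabs (x - c1) < d1 \/ Rabs (x - c2) < d2 \/ d3 < Rabs (x - c3)) ->
  forall z, closed_upper z -> z <> RtoC c1 -> z <> RtoC c2 ->
  Rabs (Re (f z) - k) <= eta + 2 * M * (d1 / Cmod (z - RtoC c1) + d2 / Cmod (z - RtoC c2) + Cmod (z - RtoC c3) / d3).
Proof.
  intros Hd1 Hd2 Hd3 HM Heta Cf Df HbM Hb z Hz Hz1 Hz2.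
  assert (P1 : 0 < Cmod (z - RtoC c1)).
  { apply Cmod_gt_0; intros E; apply Hz1; replace z with (z - RtoC c1 + RtoC c1)%C by ring; rewrite E; ring. }
  assert (P2 : 0 < Cmod (z - RtoC c2)).
  { apply Cmod_gt_0; intros E; apply Hz2; replace z with (z - RtoC c2 + RtoC c2)%C by ring; rewrite E; ring. }
  assert (T1 : 0 < d1 / Cmod (z - RtoC c1)) by (apply Rdiv_lt_0_compat; assumption).
  assert (T2 : 0 < d2 / Cmod (z - RtoC c2)) by (apply Rdiv_lt_0_compat; assumption).
  assert (T3 : 0 <= Cmod (z - RtoC c3) / d3).
  { apply Rmult_le_pos; [apply Cmod_ge_0|left; apply Rinv_0_lt_compat; exact Hd3]. }
  destruct (Rle_lt_or_eq_dec 0 (Im z) Hz) as [Hu|Hr].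
  - apply Rabs_le; split.
    + pose (g := fun z => (RtoC (-1) * f z)%C).
      assert (Rg : forall z, Re (g z) = - Re (f z)) by (intros; unfold g, Re; simpl; ring).
      assert (G := harmonic_majorant g c1 c2 c3 d1 d2 d3 (- k) eta M Hd1 Hd2 Hd3 ltac:(lra) Heta).
      enough (Re (g z) - - k <= eta + 2 * M * (d1 / Cmod (z - RtoC c1) + d2 / Cmod (z - RtoC c2) + Cmod (z - RtoC c3) / d3))
        by (rewrite Rg in H; lra).
      apply G; auto.
      * intros w; apply continuous_Cmult; [apply continuous_const|apply Cf].
      * intros w Hw; apply cderivable_scal; auto.
      * intros w Hw; rewrite Rg; specialize (HbM w ltac:(unfold closed_upper, upper in *; lra)).
        apply Rabs_le_between in HbM; lra.
      * intros x; rewrite Rg; destruct (Hb x) as [H|H]; [left; apply Rabs_le_between in H; lra|auto].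
    + apply harmonic_majorant; auto; try lra.
      * intros w Hw; specialize (HbM w ltac:(unfold closed_upper, upper in *; lra)).
        apply Rabs_le_between in HbM; lra.
      * intros x; destruct (Hb x) as [H|H]; [left; apply Rabs_le_between in H; lra|auto].
  - assert (E : z = RtoC (Re z)) by (apply injective_projections; [reflexivity|simpl; symmetry; exact Hr]).
    assert (S : forall c : R, Cmod (z - RtoC c) = Rabs (Re z - c)).
    { intros c; rewrite E at 1; rewrite <- RtoC_minus, Cmod_R; reflexivity. }
    specialize (HbM z Hz).
    destruct (Hb (Re z)) as [H|[H|[H|H]]].
    + rewrite <- E in H; eapply Rle_trans; [exact H|].
      assert (0 <= 2 * M * (d1 / Cmod (z - RtoC c1) + d2 / Cmod (z - RtoC c2) + Cmod (z - RtoC c3) / d3)) by (apply Rmult_le_pos; lra).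
      lra.
    + rewrite <- S in H.
      assert (1 <= d1 / Cmod (z - RtoC c1)).
      { apply (Rmult_le_reg_r (Cmod (z - RtoC c1))); [exact P1|]; unfold Rdiv; rewrite Rmult_assoc, Rinv_l; lra. }
      nra.
    + rewrite <- S in H.
      assert (1 <= d2 / Cmod (z - RtoC c2)).
      { apply (Rmult_le_reg_r (Cmod (z - RtoC c2))); [exact P2|]; unfold Rdiv; rewrite Rmult_assoc, Rinv_l; lra. }
      nra.
    + rewrite <- S in H.
      assert (1 <= Cmod (z - RtoC c3) / d3).
      { apply (Rmult_le_reg_r d3); [exact Hd3|]; unfold Rdiv; rewrite Rmult_assoc, Rinv_l; lra. }
      nra.
Qed.

(** * Convex quadrilaterals *)

Lemma index_cases (i j : index) : j = i \/ j = next i \/ j = next (next i) \/ j = next (next (next i)).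
Proof. destruct i, j; auto. Qed.

Lemma next_neq (i : index) : next i <> i.
Proof. destruct i; discriminate. Qed.

Definition lerp (p q : C) (s : R) : C := (p + RtoC s * (q - p))%C.

Lemma orient_lerp (p q a b : C) (s : R) :
  orient p q (lerp a b s) = (1 - s) * orient p q a + s * orient p q b.
Proof. unfold orient, lerp, Re, Im; simpl; ring. Qed.

Lemma orient_self_l (p q : C) : orient p q p = 0.
Proof. unfold orient; ring. Qed.

Lemma orient_self_r (p q : C) : orient p q q = 0.
Proof. unfold orient; ring. Qed.

Lemma continuous_orient (p q z : C) : continuous (fun z => orient p q z) z.
Proof.
  unfold orient.
  apply (continuous_Rminus (fun z : C => (Re q - Re p) * (Im z - Im p)) (fun z : C => (Im q - Im p) * (Re z - Re p)));
  apply continuous_Rmult; try apply continuous_const.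
  - apply (continuous_Rminus Im (fun _ => Im p)); [apply continuous_Im|apply continuous_const].
  - apply (continuous_Rminus Re (fun _ => Re p)); [apply continuous_Re|apply continuous_const].
Qed.

Lemma orient_0_lerp (p q z : C) : p <> q -> orient p q z = 0 -> exists s, z = lerp p q s.
Proof.
  intros N E; destruct p as [a b], q as [c d], z as [u v].
  unfold orient, Re, Im in E; simpl in E.
  assert (P : 0 < (c - a) ^ 2 + (d - b) ^ 2).
  { pose proof (pow2_ge_0 (c - a)); pose proof (pow2_ge_0 (d - b)).
    destruct (Req_dec (c - a) 0) as [H1|H1].
    - assert (d - b <> 0) by (intros H2; apply N; f_equal; lra).
      pose proof (pow2_gt_0 _ H2); lra.
    - pose proof (pow2_gt_0 _ H1); lra. }
  set (t := (c - a) * (u - a) + (d - b) * (v - b)). set (n := (c - a) ^ 2 + (d - b) ^ 2) in *.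
  assert (E1 : (d - b) * ((c - a) * (v - b) - (d - b) * (u - a)) = 0) by (rewrite E; ring).
  assert (E2 : (c - a) * ((c - a) * (v - b) - (d - b) * (u - a)) = 0) by (rewrite E; ring).
  assert (Hu : (u - a) * n = (c - a) * t) by (unfold n, t; lra).
  assert (Hv : (v - b) * n = (d - b) * t) by (unfold n, t; lra).
  exists (t / n).
  unfold lerp; apply injective_projections; simpl; apply (Rmult_eq_reg_r n); try lra.
  - replace ((a + (t / n * (c + - a) - 0 * (d + - b))) * n) with (a * n + (c - a) * t) by (field; lra); lra.
  - replace ((b + (t / n * (d + - b) + 0 * (c + - a))) * n) with (b * n + (d - b) * t) by (field; lra); lra.
Qed.

Section Quadrilateral.
Variable x : index -> C.
Hypothesis Hx : convex_ccw_quadrilateral x.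

Definition side (i : index) (z : C) : R := orient (x i) (x (next i)) z.
Definition inside (z : C) : Prop := forall i, 0 < side i z.
Definition weakly_inside (z : C) : Prop := forall i, 0 <= side i z.

Lemma side_vertex (i j : index) : j <> i -> j <> next i -> 0 < side i (x j).
Proof. intros; apply Hx; auto. Qed.

Lemma side_start (i : index) : side i (x i) = 0.
Proof. apply orient_self_l. Qed.

Lemma side_end (i : index) : side i (x (next i)) = 0.
Proof. apply orient_self_r. Qed.

Lemma side_vertex_ge (i j : index) : 0 <= side i (x j).
Proof.
  destruct (index_cases i j) as [->|[->|[->| ->]]].
  - rewrite side_start; lra.
  - rewrite side_end; lra.
  - left; apply side_vertex; destruct i; discriminate.
  - left; apply side_vertex; destruct i; discriminate.
Qed.

Lemma vertex_neq (i : index) : x i <> x (next i).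
Proof.
  intros E. assert (H : 0 < side i (x (next (next i)))) by (apply side_vertex; destruct i; discriminate).
  unfold side in H; rewrite E in H; unfold orient in H; lra.
Qed.

Lemma side_lerp (i : index) (p q : C) (s : R) : side i (lerp p q s) = (1 - s) * side i p + s * side i q.
Proof. apply orient_lerp. Qed.

(** Each [side] is affine, which gives one direction. For the other, the diagonal from [x i1] to
    [x i3] splits the quadrilateral; the sign of [orient (x i1) (x i3) z] tells which triangle
    contains [z], and the weights are its barycentric coordinates there. *)
Lemma quadrilateral_iff (z : C) : quadrilateral x z <-> weakly_inside z.
Proof.
  split.
  - intros [t [Ht [Hs ->]]] i.
    replace (side i (t i1 * x i1 + t i2 * x i2 + t i3 * x i3 + t i4 * x i4)%C)
      with (t i1 * side i (x i1) + t i2 * side i (x i2) + t i3 * side i (x i3) + t i4 * side i (x i4)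
        + (1 - (t i1 + t i2 + t i3 + t i4)) * side i (RtoC 0))
      by (unfold side, orient, Re, Im; simpl; ring).
    rewrite Hs, Rminus_diag, Rmult_0_l, Rplus_0_r.
    repeat apply Rplus_le_le_0_compat; apply Rmult_le_pos; auto; apply side_vertex_ge.
  - intros H.
    assert (D1 : 0 < orient (x i1) (x i2) (x i3)) by (apply (side_vertex i1 i3); discriminate).
    assert (D2 : 0 < orient (x i3) (x i4) (x i1)) by (apply (side_vertex i3 i1); discriminate).
    pose proof (H i1) as H1; pose proof (H i2) as H2; pose proof (H i3) as H3; pose proof (H i4) as H4.
    unfold side in *; simpl in *.
    destruct (Rle_dec (orient (x i1) (x i3) z) 0) as [L|L].
    + set (D := orient (x i1) (x i2) (x i3)) in *.
      exists (fun i => match i with i1 => orient (x i2) (x i3) z / D | i2 => - orient (x i1) (x i3) z / D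
        | i3 => orient (x i1) (x i2) z / D | i4 => 0 end).
      split; [|split].
      * intros i; destruct i; try (apply Rmult_le_pos; [lra|left; apply Rinv_0_lt_compat; lra]); lra.
      * assert (E : orient (x i2) (x i3) z - orient (x i1) (x i3) z + orient (x i1) (x i2) z = D) by (unfold D, orient; ring).
        rewrite <- E in D1; field_simplify; [|lra]. rewrite <- E; field; lra.
      * apply injective_projections; simpl; apply (Rmult_eq_reg_r D); try lra;
          field_simplify; try lra; unfold D, orient, Re, Im; ring.
    + set (D := orient (x i3) (x i4) (x i1)) in *.
      exists (fun i => match i with i1 => orient (x i3) (x i4) z / D | i4 => orient (x i1) (x i3) z / D
        | i3 => orient (x i4) (x i1) z / D | i2 => 0 end).
      split; [|split].
      * intros i; destruct i; try (apply Rmult_le_pos; [lra|left; apply Rinv_0_lt_compat; lra]); lra.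
      * assert (E : orient (x i3) (x i4) z + orient (x i1) (x i3) z + orient (x i4) (x i1) z = D) by (unfold D, orient; ring).
        rewrite <- E in D2; field_simplify; [|lra]. rewrite <- E; field; lra.
      * apply injective_projections; simpl; apply (Rmult_eq_reg_r D); try lra;
          field_simplify; try lra; unfold D, orient, Re, Im; ring.
Qed.

Lemma interior_quadrilateral_iff (z : C) : interior_of (quadrilateral x) z <-> inside z.
Proof.
  split.
  - intros H i; apply locally_C_Cmod in H; destruct H as [d [Hd H]].
    assert (W : weakly_inside z).
    { apply quadrilateral_iff, H; replace (z - z)%C with (RtoC 0) by ring; rewrite Cmod_0; exact Hd. }
    destruct (Rle_lt_or_eq_dec _ _ (W i)) as [|E]; [assumption|exfalso].
    set (n := (x (next i) - x i)%C).
    assert (Hn : n <> RtoC 0).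
    { intros E'; apply (vertex_neq i). replace (x (next i)) with (n + x i)%C by (unfold n; ring); rewrite E'; ring. }
    apply Cmod_gt_0 in Hn.
    set (s := d / 2 / Cmod n).
    assert (Hs : 0 < s) by (repeat apply Rdiv_lt_0_compat; lra).
    (* [Ci * n] is the inner normal of the edge, so a point on the edge line is pushed outside by
       this translation, while the size of [s] keeps it in the given neighbourhood. *)
    assert (W' : weakly_inside (z - RtoC s * (Ci * n))%C).
    { apply quadrilateral_iff, H.
      replace (z - RtoC s * (Ci * n) - z)%C with (- (RtoC s * (Ci * n)))%C by ring.
      rewrite Cmod_opp, !Cmod_mult, Cmod_Ci, Cmod_R, Rabs_pos_eq by lra.
      replace (s * (1 * Cmod n)) with (d / 2) by (unfold s; field; lra); lra. }
    specialize (W' i).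
    assert (K : side i (z - RtoC s * (Ci * n))%C = side i z - s * Cmod n ^ 2).
    { rewrite Cmod2_alt; unfold side, orient, n, Re, Im; simpl; ring. }
    rewrite K, <- E in W'.
    assert (0 < Cmod n ^ 2) by (apply pow_lt; lra). nra.
  - intros H.
    assert (L : forall i, locally z (fun y => 0 < side i y)).
    { intros i; destruct (proj1 (continuous_CR_eps (fun y => side i y) z) (continuous_orient _ _ _) (side i z) (H i)) as [d [Hd H']].
      apply locally_C_Cmod; exists d; split; [exact Hd|]; intros z' Hz'.
      specialize (H' z' Hz'); apply Rabs_lt_between in H'; lra. }
    unfold interior_of.
    generalize (filter_and _ _ (L i1) (filter_and _ _ (L i2) (filter_and _ _ (L i3) (L i4)))).
    apply filter_imp; intros y (A1 & A2 & A3 & A4).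
    apply quadrilateral_iff; intros i; destruct i; left; assumption.
Qed.

Lemma inside_lerp (p q : C) (s : R) : 0 <= s <= 1 -> inside p -> inside q -> inside (lerp p q s).
Proof.
  intros Hs Hp Hq i; rewrite side_lerp.
  specialize (Hp i); specialize (Hq i). nra.
Qed.

Lemma weakly_inside_vertex (i : index) : weakly_inside (x i) /\ ~ inside (x i).
Proof.
  split; [intros j; apply side_vertex_ge|].
  intros H; specialize (H i); rewrite side_start in H; lra.
Qed.

(** The parameter along the line of edge [i] is bounded below and above by the two adjacent sides,
    each of which is positive at the end of the edge that it does not contain. *)
Lemma on_side (i : index) (z : C) : weakly_inside z -> side i z = 0 ->
  exists s, 0 <= s <= 1 /\ z = lerp (x i) (x (next i)) s.
Proof.
  intros W E; destruct (orient_0_lerp _ _ _ (vertex_neq i) E) as [s ->].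
  exists s; split; [|reflexivity].
  pose proof (W (next i)) as W1. pose proof (W (next (next (next i)))) as W2.
  rewrite side_lerp in W1, W2.
  rewrite side_start in W1.
  replace (side (next (next (next i))) (x i)) with 0 in W2
    by (destruct i; simpl; symmetry; apply side_end).
  assert (0 < side (next i) (x i)) by (apply side_vertex; destruct i; discriminate).
  assert (0 < side (next (next (next i))) (x (next i))) by (apply side_vertex; destruct i; discriminate).
  split; nra.
Qed.

Lemma side_open_edge (i j : index) (s : R) : 0 < s < 1 -> j <> i -> 0 < side j (lerp (x i) (x (next i)) s).
Proof.
  intros Hs N; rewrite side_lerp.
  pose proof (side_vertex_ge j i); pose proof (side_vertex_ge j (next i)).
  assert (0 < side j (x i) \/ 0 < side j (x (next i))).
  { destruct (index_cases i j) as [->|[->|[->| ->]]]; [congruence| | |].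
    - left; apply side_vertex; destruct i; discriminate.
    - left; apply side_vertex; destruct i; discriminate.
    - right; apply side_vertex; destruct i; discriminate. }
  destruct H1; nra.
Qed.

Lemma boundary_open_edge (z : C) : weakly_inside z -> ~ inside z -> (forall i, z <> x i) ->
  exists k s, 0 < s < 1 /\ z = lerp (x k) (x (next k)) s.
Proof.
  intros W NI NV.
  assert (E : exists k, side k z = 0).
  { apply NNPP; intros N; apply NI; intros i.
    destruct (Rle_lt_or_eq_dec _ _ (W i)) as [|E]; [assumption|exfalso; apply N; exists i; auto]. }
  destruct E as [k E]; destruct (on_side k z W E) as [s [Hs ->]].
  exists k, s; split; [|reflexivity].
  split; apply Rnot_le_lt; intros L.
  - assert (s = 0) by lra; subst s; apply (NV k); unfold lerp; ring.
  - assert (s = 1) by lra; subst s; apply (NV (next k)); unfold lerp; ring.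
Qed.

(** Convexity: before [p] the line is on the wrong side of edge [k], strictly between [p] and [q] it
    is in the interior, and beyond [q] it violates the side that vanishes at [q]. *)
Lemma chord_meets_boundary (k : index) (s : R) (q z : C) :
  0 < s < 1 -> let p := lerp (x k) (x (next k)) s in
  weakly_inside q -> ~ inside q -> 0 < side k q ->
  weakly_inside z -> ~ inside z -> orient p q z = 0 -> z = p \/ z = q.
Proof.
  intros Hs p Wq Nq Hq Wz Nz E.
  assert (Sp : side k p = 0) by (unfold p; rewrite side_lerp, side_start, side_end; ring).
  assert (Op : forall j, j <> k -> 0 < side j p) by (intros; apply side_open_edge; auto).
  assert (N : p <> q) by (intros H; rewrite <- H, Sp in Hq; lra).
  destruct (orient_0_lerp p q z N E) as [u ->].
  destruct (Rlt_dec u 0) as [L|L].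
  { specialize (Wz k); rewrite side_lerp, Sp in Wz; nra. }
  destruct (Req_dec u 0) as [->|U0]; [left; unfold lerp; ring|].
  destruct (Req_dec u 1) as [->|U1]; [right; unfold lerp; ring|].
  exfalso; destruct (Rlt_dec u 1) as [L1|L1].
  - apply Nz; intros j; rewrite side_lerp; specialize (Wq j).
    destruct (classic (j = k)) as [->|Nj]; [rewrite Sp; nra|specialize (Op j Nj); nra].
  - assert (Ej : exists j, side j q = 0).
    { apply NNPP; intros H; apply Nq; intros i.
      destruct (Rle_lt_or_eq_dec _ _ (Wq i)) as [|E']; [assumption|exfalso; apply H; exists i; auto]. }
    destruct Ej as [j Ej].
    assert (Nj : j <> k) by (intros ->; lra).
    specialize (Wz j); rewrite side_lerp, Ej in Wz; specialize (Op j Nj); nra.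
Qed.

(** Since [p] divides the edge in the ratio of [s] to [1 - s], the two signed areas are [s] and
    [- (1 - s)] times [side k q]. *)
Lemma chord_separates (k : index) (s : R) (q : C) :
  0 < s < 1 -> let p := lerp (x k) (x (next k)) s in 0 < side k q ->
  0 < orient p q (x k) /\ orient p q (x (next k)) < 0.
Proof.
  intros Hs p Hq.
  assert (E1 : orient p q (x k) = s * side k q) by (unfold p, lerp, side, orient, Re, Im; simpl; ring).
  assert (E2 : orient p q (x (next k)) = - ((1 - s) * side k q)) by (unfold p, lerp, side, orient, Re, Im; simpl; ring).
  rewrite E1, E2; split; nra.
Qed.

End Quadrilateral.

(** * Boundary correspondence *)

(** The open arc of the real line mapped to the edge from [x i] to [x (next i)]. *)
Definition arc (z4 : R) (i : index) (t : R) : Prop :=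
  match i with i1 => 1 < t | i2 => t < 0 | i3 => 0 < t < z4 | i4 => z4 < t < 1 end.

(** The properties of the Schwarz-Christoffel map on which the estimates rest. Continuity is
    required on all of [C], as in [goursat], whereas holomorphy, injectivity and surjectivity
    concern the open half plane. Nothing is said yet about where the real arcs go. *)
Record disc_chart (x : index -> C) (z4 : R) (g : C -> C) : Prop := {
  dc_continuous : ccontinuous g;
  dc_derivable : forall z, upper z -> cderivable g z;
  dc_inside : forall z, upper z -> inside x (g z);
  dc_inj : forall z z', upper z -> upper z' -> g z = g z' -> z = z';
  dc_surj : forall v, inside x v -> exists z, upper z /\ g z = v;
  dc_infty : forall e, 0 < e -> exists M, forall z, M < Cmod z -> Cmod (g z - x i2) < e;
  dc_one : g (RtoC 1) = x i1;
  dc_zero : g (RtoC 0) = x i3;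
  dc_z4 : g (RtoC z4) = x i4;
  dc_range : 0 < z4 < 1 }.

(** Reflecting the lower half plane onto the upper one makes [w] continuous on all of C. *)
Definition fold_upper (w : C -> C) (z : C) : C := w (Re z, Rabs (Im z)).

Lemma fold_upper_eq (w : C -> C) (z : C) : closed_upper z -> fold_upper w z = w z.
Proof.
  intros H; unfold fold_upper; rewrite Rabs_pos_eq by exact H; destruct z; reflexivity.
Qed.

Lemma disc_chart_of_schwarz_christoffel (x : index -> C) (w : C -> C) (z4 : R) :
  convex_ccw_quadrilateral x -> schwarz_christoffel x w -> 0 < z4 < 1 -> w (RtoC z4) = x i4 ->
  disc_chart x z4 (fold_upper w).
Proof.
  intros Hx [[D [V [I S]]] [Cw [W1 [Wi W0]]]] Hz W4.
  assert (CU : forall z, closed_upper (Re z, Rabs (Im z))) by (intros; apply Rabs_pos).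
  assert (UC : forall z, upper z -> closed_upper z) by (intros z H; left; exact H).
  assert (RC : forall t : R, closed_upper (RtoC t)) by (intros t; right; reflexivity).
  constructor; auto.
  - intros z.
    apply (filterlim_comp _ _ _ (fun z : C => (Re z, Rabs (Im z))) w (locally z)
       (within closed_upper (locally (Re z, Rabs (Im z))))).
    + intros P HP; unfold within in HP.
      assert (K : continuous (U := C_UniformSpace) (fun z : C => (Re z, Rabs (Im z))) z).
      { apply (continuous_pair (fun z : C => Re z) (fun z : C => Rabs (Im z))); [apply continuous_Re|].
        apply (continuous_comp Im Rabs); [apply continuous_Im|apply continuous_Rabs]. }
      specialize (K _ HP); unfold filtermap in *.
      revert K; apply filter_imp; intros y Hy; apply Hy, CU.
    + apply Cw, CU.
  - intros z Hz'; apply (cderivable_ext_loc w _ z (Im z) Hz').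
    + intros z' Hd; symmetry; apply fold_upper_eq; left.
      pose proof (im_le_Cmod (z' - z)) as A.
      assert (B : Rabs (Im z' - Im z) < Im z).
      { eapply Rle_lt_trans; [|exact Hd]; eapply Rle_trans; [|exact A]; right; f_equal; unfold Im; simpl; ring. }
      apply Rabs_lt_between in B; lra.
    + apply ex_derive_cderivable, D, Hz'.
  - intros z Hz'; rewrite fold_upper_eq by auto.
    apply interior_quadrilateral_iff; auto.
  - intros z z' Hz1 Hz2; rewrite !fold_upper_eq by auto; auto.
  - intros v Hv; destruct (S v) as [z [Hz1 Hz2]]; [apply interior_quadrilateral_iff; auto|].
    exists z; rewrite fold_upper_eq by auto; auto.
  - intros e He.
    destruct (Wi (fun y => Cmod (y - x i2) < e)) as [M HM].
    { apply locally_C_Cmod; exists e; auto. }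
    exists M; intros z Hz'; unfold fold_upper; apply HM; [|apply CU].
    replace (Cmod (Re z, Rabs (Im z))) with (Cmod z); [exact Hz'|].
    unfold Cmod; f_equal; destruct z as [a b]; simpl; unfold Rabs; destruct Rcase_abs; ring.
  - rewrite fold_upper_eq; auto.
  - rewrite fold_upper_eq; auto.
  - rewrite fold_upper_eq; auto.
Qed.

Section Boundary.
Variables (x : index -> C) (z4 : R) (g : C -> C).
Hypothesis Hx : convex_ccw_quadrilateral x.
Hypothesis Hg : disc_chart x z4 g.

Let gC := dc_continuous _ _ _ Hg.

(** From the mean value property of [1 / (g - g z)]. *)
Lemma inverse_continuous (c : C) (r : R) : upper c -> 0 < r ->
  exists m, 0 < m /\ forall z, upper z -> Cmod (g z - g c) < m -> Cmod (z - c) < r.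
Proof.
  intros Hc Hr; pose proof PI_RGT_0 as HPI.
  (* The closed disc of radius [r'] about [c] then lies in the open half plane and inside the disc
     of radius [r]. *)
  set (r' := Rmin (r / 2) (Im c / 2)).
  assert (Hr' : 0 < r') by (unfold upper in Hc; apply Rmin_pos; lra).
  assert (Hr1 : r' <= r / 2) by apply Rmin_l.
  assert (Hr2 : r' <= Im c / 2) by apply Rmin_r.
  assert (Up : forall z, Cmod (z - c) <= r' -> upper z).
  { intros z Hz; pose proof (im_le_Cmod (z - c)) as A; unfold upper in *.
    assert (B : Rabs (Im z - Im c) <= Im c / 2).
    { eapply Rle_trans; [|apply Hr2]; eapply Rle_trans; [|exact Hz]; eapply Rle_trans; [|exact A].
      right; f_equal; unfold Im; simpl; ring. }
    apply Rabs_le_between in B; lra. }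
  assert (Circ : forall t, Cmod (c + Cexp (ln r', t) - c) = r') by (intros; rewrite Cmod_circle, exp_ln; auto).
  assert (Cc : forall h : C -> R, (forall z, continuous (U := R_UniformSpace) h z) ->
     forall t, continuous (fun t => h (c + Cexp (ln r', t))%C) t).
  { intros h Hh t; apply (continuous_comp (U := R_UniformSpace) (V := C_UniformSpace) (W := R_UniformSpace)
       (fun t => (c + Cexp (ln r', t))%C) h); [|apply Hh].
    apply continuous_Cplus; [apply continuous_const|apply (continuous_line_v Cexp); exact ccontinuous_Cexp]. }
  destruct (continuity_ab_min (fun t => Cmod (g (c + Cexp (ln r', t))%C - g c)) 0 (2 * PI)) as [t0 [Hmin _]]; [lra| |].
  { intros t _; apply continuity_pt_filterlim.
    apply (Cc (fun z => Cmod (g z - g c))).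
    intros z; apply continuous_Cmod_comp.
    apply (continuous_Cplus g (fun _ => (- g c)%C)); [apply gC|apply continuous_const]. }
  set (m0 := Cmod (g (c + Cexp (ln r', t0))%C - g c)) in *.
  assert (Hm0 : 0 < m0).
  { apply Cmod_gt_0; intros E.
    assert (E' : (c + Cexp (ln r', t0))%C = c).
    { apply (dc_inj _ _ _ Hg); [apply Up; rewrite Circ; lra|exact Hc|].
      replace (g (c + Cexp (ln r', t0))%C) with (g (c + Cexp (ln r', t0))%C - g c + g c)%C by ring.
      rewrite E; ring. }
    specialize (Circ t0); rewrite E' in Circ.
    replace (c - c)%C with (RtoC 0) in Circ by ring; rewrite Cmod_0 in Circ; lra. }
  exists (m0 / 3); split; [lra|]; intros z Hz Hd.
  apply Rnot_le_lt; intros Hfar.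
  assert (Far : forall t, 0 <= t <= 2 * PI -> 2 * m0 / 3 <= Cmod (g (c + Cexp (ln r', t))%C - g z)).
  { intros t Ht; specialize (Hmin t Ht).
    pose proof (Cmod_minus_le (g (c + Cexp (ln r', t))%C - g c) (g z - g c)) as A.
    replace (g (c + Cexp (ln r', t))%C - g c - (g z - g c))%C with (g (c + Cexp (ln r', t))%C - g z)%C in A by ring.
    lra. }
  assert (Surf : forall z', Cmod (z' - c) <= r' -> (g z' - g z)%C <> RtoC 0).
  { intros z' Hz' E.
    assert (z' = z).
    { apply (dc_inj _ _ _ Hg); [apply Up; lra|exact Hz|].
      replace (g z') with (g z' - g z + g z)%C by ring; rewrite E; ring. }
    subst z'; lra. }
  (* For [z] outside the disc injectivity makes [F] holomorphic on it. It equals 1 at [c], but its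
     modulus on the circle is at most [m0 / 3] divided by [2 * m0 / 3], which is 1/2. *)
  pose (F := fun z' => ((g c - g z) * / (g z' - g z))%C).
  assert (DF : forall z', upper z' -> (g z' - g z)%C <> RtoC 0 -> cderivable F z').
  { intros z' Hz' N; apply cderivable_scal.
    apply (cderivable_comp Cinv (fun z' => (g z' - g z)%C)); [|apply cderivable_inv; exact N].
    apply cderivable_minus_const, (dc_derivable _ _ _ Hg), Hz'. }
  assert (MV := mean_value F c r' Hr').
  lapply MV; [clear MV; intros MV|intros z' Hz'; apply cderivable_continuous, DF; auto].
  lapply MV; [clear MV; intros MV|intros z' Hz'; apply DF; [apply Up; lra|apply Surf; lra]].
  assert (Fc : F c = RtoC 1).
  { unfold F; field; apply Surf; replace (c - c)%C with (RtoC 0) by ring; rewrite Cmod_0; lra. }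
  rewrite Fc in MV; change (Re (RtoC 1)) with 1 in MV; rewrite Rmult_1_r in MV.
  assert (CF : forall t, continuous (fun t => Re (F (c + Cexp (ln r', t))%C)) t).
  { intros t; apply (continuous_comp (U := R_UniformSpace) (V := C_UniformSpace) (W := R_UniformSpace)
       (fun t => (c + Cexp (ln r', t))%C) (fun z => Re (F z))).
    - apply continuous_Cplus; [apply continuous_const|apply (continuous_line_v Cexp); exact ccontinuous_Cexp].
    - apply continuous_Re_comp, cderivable_continuous, DF; [apply Up|apply Surf]; rewrite Circ; lra. }
  assert (Le : RInt (fun t => Re (F (c + Cexp (ln r', t))%C)) 0 (2 * PI) <= RInt (fun _ => 1 / 2) 0 (2 * PI)).
  { apply RInt_le; [lra|apply ex_RInt_cont; exact CF|apply (ex_RInt_const (V := R_NormedModule))|].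
    intros t Ht; eapply Rle_trans; [apply Rle_abs|]; eapply Rle_trans; [apply re_le_Cmod|].
    unfold F; rewrite Cmod_mult, Cmod_inv by (apply Surf; rewrite Circ; lra).
    specialize (Far t ltac:(lra)); rewrite Cmod_minus_sym.
    apply (Rmult_le_reg_r (Cmod (g (c + Cexp (ln r', t))%C - g z))); [lra|].
    rewrite Rmult_assoc, Rinv_l by lra; lra. }
  rewrite MV, (RInt_const (V := R_CompleteNormedModule)) in Le.
  change (scal (2 * PI - 0) (1 / 2)) with ((2 * PI - 0) * (1 / 2)) in Le.
  lra.
Qed.

(** Otherwise the value would also be [g c] for some [c] of the open half plane. Points just above
    [t] then have images near [g c], and continuity of the inverse puts these points near [c],
    although their imaginary parts are at most half that of [c]. *)
Lemma real_not_inside (t : R) : ~ inside x (g (RtoC t)).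
Proof.
  intros H; destruct (dc_surj _ _ _ Hg _ H) as [c [Hc Ec]].
  assert (Hc2 : 0 < Im c / 2) by (unfold upper in Hc; lra).
  destruct (inverse_continuous c _ Hc Hc2) as [m [Hm Hinv]].
  destruct (proj1 (continuous_C_eps g (RtoC t)) (gC _) m Hm) as [d [Hd Hcont]].
  set (s := Rmin (d / 2) (Im c / 2)).
  assert (Hs : 0 < s) by (apply Rmin_pos; lra).
  assert (Hs1 : s <= d / 2) by apply Rmin_l.
  assert (Hs2 : s <= Im c / 2) by apply Rmin_r.
  assert (Hz : Cmod ((t, s) - RtoC t) < d).
  { replace ((t, s) - RtoC t)%C with (RtoC s * Ci)%C by (apply injective_projections; simpl; ring).
    rewrite Cmod_mult, Cmod_Ci, Cmod_R, Rabs_pos_eq; lra. }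
  specialize (Hcont _ Hz); rewrite <- Ec in Hcont.
  specialize (Hinv (t, s) Hs Hcont).
  pose proof (im_le_Cmod ((t, s) - c)) as A.
  assert (Rabs (s - Im c) < Im c / 2).
  { eapply Rle_lt_trans; [|exact Hinv]; eapply Rle_trans; [|exact A]; right; f_equal; unfold Im; simpl; ring. }
  apply Rabs_lt_between in H0; lra.
Qed.

Lemma real_approach (t : R) (e : R) (rho : C -> R) :
  0 < e -> continuous (U := R_UniformSpace) rho (RtoC t) -> 0 < rho (RtoC t) ->
  exists z, upper z /\ Cmod (g z - g (RtoC t)) < e /\ 0 < rho z.
Proof.
  intros He Cr Hr.
  destruct (proj1 (continuous_C_eps g (RtoC t)) (gC _) e He) as [d [Hd H]].
  destruct (proj1 (continuous_CR_eps rho (RtoC t)) Cr _ Hr) as [d' [Hd' H']].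
  set (s := Rmin (d / 2) (d' / 2)).
  assert (Hs : 0 < s) by (apply Rmin_pos; lra).
  assert (Hs1 : s <= d / 2) by apply Rmin_l.
  assert (Hs2 : s <= d' / 2) by apply Rmin_r.
  assert (Hz : Cmod ((t, s) - RtoC t) = s).
  { replace ((t, s) - RtoC t)%C with (RtoC s * Ci)%C by (apply injective_projections; simpl; ring).
    rewrite Cmod_mult, Cmod_Ci, Cmod_R, Rabs_pos_eq; lra. }
  exists (t, s); split; [exact Hs|split; [apply H; lra|]].
  specialize (H' (t, s) ltac:(lra)); apply Rabs_lt_between in H'; lra.
Qed.

Lemma real_weakly_inside (t : R) : weakly_inside x (g (RtoC t)).
Proof.
  intros i; apply Rnot_lt_le; intros L.
  destruct (real_approach t 1 (fun z => - side x i (g z)) Rlt_0_1) as [z [Hz [_ H]]].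
  - apply (continuous_opp (V := R_NormedModule) (fun z => side x i (g z))).
    apply (continuous_comp g (side x i)); [apply gC|apply continuous_orient].
  - lra.
  - pose proof (dc_inside _ _ _ Hg z Hz i); lra.
Qed.

(** If the level set of [rho] is mapped away from [P], points mapped near [P] lie on
    one side only: the quadrilateral is convex, so the segment between their
    images pulls back to a path along which [rho] cannot change sign. *)
Lemma crosscut (rho : C -> R) (P : C) (eta : R) (z z' : C) :
  (forall z, continuous (U := R_UniformSpace) rho z) ->
  (forall z, upper z -> rho z = 0 -> eta <= Cmod (g z - P)) ->
  upper z -> upper z' -> Cmod (g z - P) < eta -> Cmod (g z' - P) < eta ->
  rho z < 0 -> 0 < rho z' -> False.
Proof.
  intros Cr Hl Hz Hz' Nz Nz' Rz Rz'.
  (* The path is extended constantly outside [[0, 1]], because the intermediate value theorem is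
     used in its form for functions continuous on the whole line. *)
  pose (cl := fun t : R => Rmax 0 (Rmin t 1)).
  assert (Hcl : forall t, 0 <= cl t <= 1).
  { intros t; unfold cl, Rmax, Rmin; repeat destruct Rle_dec; lra. }
  assert (Ccl : forall t s, Rabs (cl s - cl t) <= Rabs (s - t)).
  { intros t s; unfold cl, Rmax, Rmin, Rabs; repeat destruct Rle_dec; repeat destruct Rcase_abs; lra. }
  assert (Hex : forall t, exists y, upper y /\ g y = lerp (g z) (g z') (cl t)).
  { intros t; apply (dc_surj _ _ _ Hg), inside_lerp; auto; apply (dc_inside _ _ _ Hg); auto. }
  pose (h := fun t => proj1_sig (constructive_indefinite_description _ (Hex t))).
  assert (Hh : forall t, upper (h t) /\ g (h t) = lerp (g z) (g z') (cl t)).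
  { intros t; exact (proj2_sig (constructive_indefinite_description _ (Hex t))). }
  assert (Ch : continuity (fun t => rho (h t))).
  { intros t; apply continuity_pt_filterlim.
    intros Q [e HQ].
    destruct (Hh t) as [U1 E1].
    destruct (proj1 (continuous_CR_eps rho (h t)) (Cr _) e (cond_pos e)) as [d [Hd H]].
    destruct (inverse_continuous (h t) d U1 Hd) as [m [Hm Hinv]].
    set (K := Cmod (g z' - g z) + 1).
    assert (HK : 0 < K) by (unfold K; pose proof (Cmod_ge_0 (g z' - g z)); lra).
    assert (Hmk : 0 < m / K) by (apply Rdiv_lt_0_compat; assumption).
    exists (mkposreal _ Hmk); intros s Hs; apply HQ.
    apply H, Hinv; [apply Hh|].
    rewrite E1, (proj2 (Hh s)); unfold lerp.
    replace (g z + RtoC (cl s) * (g z' - g z) - (g z + RtoC (cl t) * (g z' - g z)))%C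
      with (RtoC (cl s - cl t) * (g z' - g z))%C by (rewrite RtoC_minus; ring).
    rewrite Cmod_mult, Cmod_R.
    assert (B : Rabs (cl s - cl t) < m / K) by (eapply Rle_lt_trans; [apply Ccl|exact Hs]).
    apply Rle_lt_trans with (Rabs (cl s - cl t) * K).
    - apply Rmult_le_compat_l; [apply Rabs_pos|unfold K; lra].
    - apply (Rmult_lt_compat_r K) in B; [|exact HK].
      unfold Rdiv in B; rewrite Rmult_assoc, Rinv_l in B by lra; lra. }
  assert (H0 : h 0 = z).
  { apply (dc_inj _ _ _ Hg); [apply Hh|exact Hz|]; rewrite (proj2 (Hh 0)).
    unfold cl; rewrite Rmin_left, Rmax_left by lra; unfold lerp; ring. }
  assert (H1 : h 1 = z').
  { apply (dc_inj _ _ _ Hg); [apply Hh|exact Hz'|]; rewrite (proj2 (Hh 1)).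
    unfold cl; rewrite Rmin_left, Rmax_right by lra; unfold lerp; ring. }
  destruct (IVT (fun t => rho (h t)) 0 1 Ch Rlt_0_1) as [t [Ht Et]]; [rewrite H0; exact Rz|rewrite H1; exact Rz'|].
  specialize (Hl (h t) (proj1 (Hh t)) Et); rewrite (proj2 (Hh t)) in Hl.
  assert (C1 : cl t = t) by (unfold cl; rewrite Rmin_left, Rmax_right; lra).
  rewrite C1 in Hl; unfold lerp in Hl.
  (* Discs are convex: a point of the segment between two points closer than [eta] to [P] is itself
     closer than [eta] to [P]. *)
  replace (g z + RtoC t * (g z' - g z) - P)%C with (RtoC (1 - t) * (g z - P) + RtoC t * (g z' - P))%C in Hl
    by (rewrite RtoC_minus; ring).
  pose proof (Cmod_triangle (RtoC (1 - t) * (g z - P)) (RtoC t * (g z' - P))) as T.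
  rewrite !Cmod_mult, !Cmod_R, !Rabs_pos_eq in T by lra.
  assert (0 <= (1 - t) * (eta - Cmod (g z - P))) by (apply Rmult_le_pos; lra).
  assert (0 <= t * (eta - Cmod (g z' - P))) by (apply Rmult_le_pos; lra).
  destruct (Rlt_dec t 1).
  - assert (0 < (1 - t) * (eta - Cmod (g z - P))) by (apply Rmult_lt_0_compat; lra). lra.
  - assert (0 < t * (eta - Cmod (g z' - P))) by (apply Rmult_lt_0_compat; lra). lra.
Qed.

(** Thales' equation of the circle with diameter [[a, b]]: zero on the circle, negative inside. *)
Definition circle_level (a b : R) (z : C) : R := (Re z - a) * (Re z - b) + Im z * Im z.

Lemma continuous_circle_level (a b : R) (z : C) : continuous (U := R_UniformSpace) (circle_level a b) z.
Proof.
  apply (continuous_Rplus (fun z : C => (Re z - a) * (Re z - b)) (fun z : C => Im z * Im z)).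
  - apply (continuous_Rmult (fun z : C => Re z - a) (fun z : C => Re z - b)).
    + apply (continuous_Rminus Re (fun _ => a)); [apply continuous_Re|apply continuous_const].
    + apply (continuous_Rminus Re (fun _ => b)); [apply continuous_Re|apply continuous_const].
  - apply (continuous_Rmult Im Im); apply continuous_Im.
Qed.

Lemma continuous_dist_path (P : C) (ga : R -> C) (t : R) :
  continuous (U := C_UniformSpace) ga t -> continuity_pt (fun t => Cmod (g (ga t) - P)) t.
Proof.
  intros H; apply continuity_pt_filterlim.
  apply (continuous_Cmod_comp (fun t => (g (ga t) - P)%C)).
  apply (continuous_Cplus (fun t => g (ga t)) (fun _ => (- P)%C)); [|apply continuous_const].
  apply (continuous_comp (U := R_UniformSpace) (V := C_UniformSpace) (W := C_UniformSpace) ga g); [exact H|apply gC].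
Qed.

(** The closed half circle is compact. Its open part is mapped to the interior, where [P] is not,
    and its two ends are excluded by hypothesis, so the distance to [P] has a positive minimum. *)
Lemma circle_away (a b : R) (P : C) : a < b -> ~ inside x P -> P <> g (RtoC a) -> P <> g (RtoC b) ->
  exists eta, 0 < eta /\ forall z, upper z -> circle_level a b z = 0 -> eta <= Cmod (g z - P).
Proof.
  intros Hab NP Na Nb.
  pose (ga := fun t => (t, sqrt ((t - a) * (b - t)))).
  destruct (continuity_ab_min (fun t => Cmod (g (ga t) - P)) a b) as [t0 [Hmin Ht0]]; [lra| |].
  { intros t _; apply continuous_dist_path.
    apply (continuous_pair (fun t => t) (fun t => sqrt ((t - a) * (b - t)))); [apply continuous_id|].
    apply (continuous_comp (fun t => (t - a) * (b - t)) sqrt); [|apply continuous_sqrt].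
    apply (ex_derive_continuous (fun t => (t - a) * (b - t))); auto_derive; auto. }
  exists (Cmod (g (ga t0) - P)); split.
  - apply Cmod_gt_0; intros E.
    assert (E' : g (ga t0) = P) by (replace (g (ga t0)) with (g (ga t0) - P + P)%C by ring; rewrite E; ring).
    destruct (Req_dec t0 a) as [Ea|Ea].
    { apply Na; rewrite <- E', Ea; unfold ga; f_equal. rewrite Rminus_diag, Rmult_0_l, sqrt_0; reflexivity. }
    destruct (Req_dec t0 b) as [Eb|Eb].
    { apply Nb; rewrite <- E', Eb; unfold ga; f_equal. rewrite Rminus_diag, Rmult_0_r, sqrt_0; reflexivity. }
    apply NP; rewrite <- E'; apply (dc_inside _ _ _ Hg).
    unfold upper, ga; simpl; apply sqrt_lt_R0; apply Rmult_lt_0_compat; lra.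
  - intros [s t] Hz Hl; unfold circle_level, upper, Re, Im in *; simpl in *.
    assert (Htt : 0 < t * t) by (apply Rmult_lt_0_compat; lra).
    assert (Hs : a <= s <= b).
    { split; apply Rnot_lt_le; intros F.
      - assert (0 < (a - s) * (b - s)) by (apply Rmult_lt_0_compat; lra); lra.
      - assert (0 < (s - a) * (s - b)) by (apply Rmult_lt_0_compat; lra); lra. }
    replace (s, t) with (ga s); [apply Hmin; exact Hs|].
    unfold ga; f_equal; replace ((s - a) * (b - s)) with (t * t) by lra.
    apply sqrt_square; lra.
Qed.

(** The same for a crosscut with one end at infinity, where the map tends to [x i2]: beyond modulus
    [M] the distance is at least half of that from [P] to [x i2]. *)
Lemma ray_away (a : R) (P : C) : ~ inside x P -> P <> g (RtoC a) -> P <> x i2 ->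
  exists eta, 0 < eta /\ forall z, upper z -> Re z = a -> eta <= Cmod (g z - P).
Proof.
  intros NP Na Ni.
  assert (Hp : 0 < Cmod (P - x i2)).
  { apply Cmod_gt_0; intros E; apply Ni; replace P with (P - x i2 + x i2)%C by ring; rewrite E; ring. }
  destruct (dc_infty _ _ _ Hg (Cmod (P - x i2) / 2)) as [M HM]; [lra|].
  destruct (continuity_ab_min (fun t => Cmod (g (a, t) - P)) 0 (Rabs M)) as [t0 [Hmin Ht0]]; [apply Rabs_pos| |].
  { intros t _; apply (continuous_dist_path P (fun t => (a, t))).
    apply (continuous_pair (fun _ => a) (fun t => t)); [apply continuous_const|apply continuous_id]. }
  assert (Hm : 0 < Cmod (g (a, t0) - P)).
  { apply Cmod_gt_0; intros E.
    assert (E' : g (a, t0) = P) by (replace (g (a, t0)) with (g (a, t0) - P + P)%C by ring; rewrite E; ring).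
    destruct (Req_dec t0 0) as [E0|E0]; [apply Na; rewrite <- E', E0; reflexivity|].
    apply NP; rewrite <- E'; apply (dc_inside _ _ _ Hg); unfold upper; simpl; lra. }
  exists (Rmin (Cmod (g (a, t0) - P)) (Cmod (P - x i2) / 2)); split; [apply Rmin_pos; lra|].
  intros [s t] Hz Es; unfold upper, Re, Im in *; simpl in *; subst s.
  destruct (Rle_dec t (Rabs M)) as [L|L].
  - eapply Rle_trans; [apply Rmin_l|apply Hmin; lra].
  - eapply Rle_trans; [apply Rmin_r|].
    assert (H : M < Cmod (a, t)).
    { pose proof (im_le_Cmod (a, t)) as A; unfold Im in A; simpl in A.
      pose proof (Rle_abs M); pose proof (Rle_abs t); lra. }
    specialize (HM _ H).
    pose proof (Cmod_minus_le (P - x i2) (g (a, t) - x i2)) as A.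
    replace (P - x i2 - (g (a, t) - x i2))%C with (P - g (a, t))%C in A by ring.
    rewrite (Cmod_minus_sym P (g (a, t))) in A; lra.
Qed.

(** The crosscut joining the two ends of arc [i], which is a vertical ray when one end is infinity.
    The sign is chosen so that the level is negative on arc [i] and positive on the other arcs. *)
Definition arc_level (i : index) (z : C) : R :=
  match i with i1 => 1 - Re z | i2 => Re z | i3 => circle_level 0 z4 z | i4 => circle_level z4 1 z end.

Lemma continuous_arc_level (i : index) (z : C) : continuous (U := R_UniformSpace) (arc_level i) z.
Proof.
  destruct i; simpl; try apply continuous_circle_level.
  - apply (continuous_Rminus (fun _ => 1) Re); [apply continuous_const|apply continuous_Re].
  - apply continuous_Re.
Qed.

Lemma arc_level_inner (i : index) (t : R) : arc z4 i t -> arc_level i (RtoC t) < 0.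
Proof.
  pose proof (dc_range _ _ _ Hg).
  destruct i; unfold arc_level, circle_level, Re, Im; simpl; intros; try lra; nra.
Qed.

Lemma arc_level_outer (i j : index) (t : R) : arc z4 j t -> j <> i -> 0 < arc_level i (RtoC t).
Proof.
  pose proof (dc_range _ _ _ Hg).
  destruct i, j; unfold arc_level, circle_level, Re, Im; simpl; intros A N; try congruence; try lra; nra.
Qed.

Lemma arc_away (i : index) (P : C) : ~ inside x P -> P <> x i -> P <> x (next i) ->
  exists eta, 0 < eta /\ forall z, upper z -> arc_level i z = 0 -> eta <= Cmod (g z - P).
Proof.
  pose proof (dc_range _ _ _ Hg) as Hr; pose proof (dc_one _ _ _ Hg) as E1; pose proof (dc_zero _ _ _ Hg) as E0;
  pose proof (dc_z4 _ _ _ Hg) as E4.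
  intros NP N1 N2; destruct i; simpl in *.
  - destruct (ray_away 1 P NP) as [e [He H]]; [rewrite E1; exact N1|exact N2|].
    exists e; split; [exact He|]; intros z Hz L; apply H; [exact Hz|lra].
  - destruct (ray_away 0 P NP) as [e [He H]]; [rewrite E0; exact N2|exact N1|].
    exists e; split; [exact He|]; intros z Hz L; apply H; [exact Hz|lra].
  - apply circle_away; [lra|exact NP|rewrite E0; exact N1|rewrite E4; exact N2].
  - apply circle_away; [lra|exact NP|rewrite E4; exact N1|rewrite E1; exact N2].
Qed.

(** [t] is approached from the negative side of the crosscut; a point on the positive side with an
    image close to [g t] would contradict [crosscut]. *)
Lemma arc_separated (i : index) (t : R) : arc z4 i t ->
  g (RtoC t) <> x i -> g (RtoC t) <> x (next i) ->
  exists eta, 0 < eta /\ forall z, upper z -> 0 < arc_level i z -> eta <= Cmod (g z - g (RtoC t)).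
Proof.
  intros Ht N1 N2.
  destruct (arc_away i (g (RtoC t)) (real_not_inside t) N1 N2) as [eta [He H]].
  exists eta; split; [exact He|]; intros z Hz Hl; apply Rnot_lt_le; intros L.
  destruct (real_approach t eta (fun z => - arc_level i z) He) as [z' [Hz' [D' L']]].
  - apply (continuous_opp (V := R_NormedModule) (arc_level i)), continuous_arc_level.
  - pose proof (arc_level_inner i t Ht); lra.
  - apply (crosscut (arc_level i) (g (RtoC t)) eta z' z); auto; [apply continuous_arc_level|lra].
Qed.

Lemma arc_separated_real (i : index) (t s : R) : arc z4 i t ->
  g (RtoC t) <> x i -> g (RtoC t) <> x (next i) -> 0 < arc_level i (RtoC s) -> g (RtoC s) <> g (RtoC t).
Proof.
  intros Ht N1 N2 L E.
  destruct (arc_separated i t Ht N1 N2) as [eta [He H]].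
  destruct (real_approach s eta (arc_level i) He) as [z [Hz [D L']]]; [apply continuous_arc_level|exact L|].
  specialize (H z Hz L'); rewrite E in D; lra.
Qed.

Lemma arc_avoids_arcs (i k : index) (t s : R) : arc z4 i t -> arc z4 k s -> k <> i ->
  g (RtoC t) <> x i -> g (RtoC t) <> x (next i) -> g (RtoC s) <> g (RtoC t).
Proof.
  intros Ht Hs N N1 N2; apply (arc_separated_real i); auto; apply (arc_level_outer i k); auto.
Qed.

(** Three vertices are values at the real points 1, 0 and [z4], on which [arc_level i] is positive
    unless they are ends of arc [i]. The vertex [x i2] is the limit at infinity, so for the two
    bounded arcs a point far up the imaginary axis takes the place of a real one. *)
Lemma arc_avoids_vertices (i j : index) (t : R) : arc z4 i t ->
  g (RtoC t) <> x i -> g (RtoC t) <> x (next i) -> g (RtoC t) <> x j.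
Proof.
  pose proof (dc_range _ _ _ Hg) as Hr; pose proof (dc_one _ _ _ Hg) as E1; pose proof (dc_zero _ _ _ Hg) as E0;
  pose proof (dc_z4 _ _ _ Hg) as E4.
  intros Ht N1 N2.
  assert (Inf : i = i3 \/ i = i4 -> g (RtoC t) <> x i2).
  { intros Hi E; destruct (arc_separated i t Ht N1 N2) as [eta [He H]].
    destruct (dc_infty _ _ _ Hg eta He) as [M HM].
    specialize (HM (0, Rabs M + 2)).
    assert (L : 0 < arc_level i (0, Rabs M + 2)).
    { pose proof (Rabs_pos M).
      destruct Hi as [-> | ->]; unfold arc_level, circle_level, Re, Im; simpl; nra. }
    specialize (H (0, Rabs M + 2) ltac:(unfold upper; simpl; pose proof (Rabs_pos M); lra) L).
    rewrite E in H.
    assert (M < Cmod (0, Rabs M + 2)).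
    { pose proof (im_le_Cmod (0, Rabs M + 2)) as A; unfold Im in A; simpl in A.
      pose proof (Rle_abs M); pose proof (Rle_abs (Rabs M + 2)); lra. }
    specialize (HM H0); lra. }
  assert (Fin : forall s, 0 < arc_level i (RtoC s) -> g (RtoC t) <> g (RtoC s)).
  { intros s L E; apply (arc_separated_real i t s); auto. }
  destruct i, j; simpl in N1, N2; auto;
    rewrite <- ?E1, <- ?E0, <- ?E4; apply Fin; unfold arc_level, circle_level, Re, Im; simpl; nra.
Qed.

Lemma arc_interval (i : index) (s t u : R) : arc z4 i s -> arc z4 i u -> s <= t <= u -> arc z4 i t.
Proof. destruct i; simpl; lra. Qed.

(** With [t] increasing, arc [i] runs from the preimage of [x i] to that of [x (next i)]; for arc
    [i1] the terminal point is infinity. *)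
Lemma arc_end (i : index) (L : C -> R) (t0 : R) :
  (forall z, continuous (U := R_UniformSpace) L z) -> 0 < L (x (next i)) -> arc z4 i t0 ->
  exists t1, t0 < t1 /\ arc z4 i t1 /\ 0 < L (g (RtoC t1)).
Proof.
  pose proof (dc_range _ _ _ Hg) as Hr; pose proof (dc_one _ _ _ Hg) as E1; pose proof (dc_zero _ _ _ Hg) as E0;
  pose proof (dc_z4 _ _ _ Hg) as E4.
  intros CL HL Ht.
  assert (Fin : forall b, g (RtoC b) = x (next i) -> t0 < b -> exists t1, t0 < t1 < b /\ 0 < L (g (RtoC t1))).
  { intros b Eb Hb; rewrite <- Eb in HL.
    assert (CLg : continuous (U := R_UniformSpace) (fun z => L (g z)) (RtoC b)).
    { apply (continuous_comp (U := C_UniformSpace) (V := C_UniformSpace) (W := R_UniformSpace) g L); [apply gC|apply CL]. }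
    destruct (proj1 (continuous_CR_eps _ _) CLg _ HL) as [d [Hd H]].
    exists (Rmax (b - d / 2) ((t0 + b) / 2)).
    assert (M : t0 < Rmax (b - d / 2) ((t0 + b) / 2) < b /\ b - Rmax (b - d / 2) ((t0 + b) / 2) < d).
    { unfold Rmax; destruct Rle_dec; lra. }
    split; [lra|].
    specialize (H (RtoC (Rmax (b - d / 2) ((t0 + b) / 2)))).
    rewrite <- RtoC_minus, Cmod_R, Rabs_left in H by lra.
    specialize (H ltac:(lra)); apply Rabs_lt_between in H; lra. }
  destruct i; simpl in *.
  - destruct (proj1 (continuous_CR_eps L (x i2)) (CL _) _ HL) as [d [Hd H]].
    destruct (dc_infty _ _ _ Hg d Hd) as [M HM].
    pose proof (Rabs_pos M); pose proof (Rle_abs M).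
    assert (HM' : M < Cmod (RtoC (t0 + Rabs M + 1))) by (rewrite Cmod_R, Rabs_pos_eq; lra).
    specialize (H _ (HM _ HM')); apply Rabs_lt_between in H.
    exists (t0 + Rabs M + 1); repeat split; lra.
  - destruct (Fin 0 E0 ltac:(lra)) as [t1 [T1 T2]]; exists t1; repeat split; auto; lra.
  - destruct (Fin z4 E4 ltac:(lra)) as [t1 [T1 T2]]; exists t1; repeat split; auto; lra.
  - destruct (Fin 1 E1 ltac:(lra)) as [t1 [T1 T2]]; exists t1; repeat split; auto; lra.
Qed.

Lemma arc_begin (i : index) (L : C -> R) :
  (forall z, continuous (U := R_UniformSpace) L z) -> L (x i) < 0 ->
  exists t1, arc z4 i t1 /\ L (g (RtoC t1)) < 0.
Proof.
  pose proof (dc_range _ _ _ Hg) as Hr; pose proof (dc_one _ _ _ Hg) as E1; pose proof (dc_zero _ _ _ Hg) as E0;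
  pose proof (dc_z4 _ _ _ Hg) as E4.
  intros CL HL.
  assert (Fin : forall b c, g (RtoC b) = x i -> b < c -> exists t1, b < t1 < c /\ L (g (RtoC t1)) < 0).
  { intros b c Eb Hb; rewrite <- Eb in HL.
    assert (CLg : continuous (U := R_UniformSpace) (fun z => L (g z)) (RtoC b)).
    { apply (continuous_comp (U := C_UniformSpace) (V := C_UniformSpace) (W := R_UniformSpace) g L); [apply gC|apply CL]. }
    destruct (proj1 (continuous_CR_eps _ _) CLg (- L (g (RtoC b)))) as [d [Hd H]]; [lra|].
    exists (Rmin (b + d / 2) ((b + c) / 2)).
    assert (M : b < Rmin (b + d / 2) ((b + c) / 2) < c /\ Rmin (b + d / 2) ((b + c) / 2) - b < d).
    { unfold Rmin; destruct Rle_dec; lra. }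
    split; [lra|].
    specialize (H (RtoC (Rmin (b + d / 2) ((b + c) / 2)))).
    rewrite <- RtoC_minus, Cmod_R, Rabs_pos_eq in H by lra.
    specialize (H ltac:(lra)); apply Rabs_lt_between in H; lra. }
  destruct i; simpl in *.
  - destruct (Fin 1 2 E1 ltac:(lra)) as [t1 [T1 T2]]; exists t1; split; [lra|exact T2].
  - destruct (proj1 (continuous_CR_eps L (x i2)) (CL _) (- L (x i2))) as [d [Hd H]]; [lra|].
    destruct (dc_infty _ _ _ Hg d Hd) as [M HM].
    pose proof (Rabs_pos M); pose proof (Rle_abs M).
    assert (HM' : M < Cmod (RtoC (- Rabs M - 1))) by (rewrite Cmod_R, Rabs_left; lra).
    specialize (H _ (HM _ HM')); apply Rabs_lt_between in H.
    exists (- Rabs M - 1); split; lra.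
  - destruct (Fin 0 z4 E0 ltac:(lra)) as [t1 [T1 T2]]; exists t1; split; [lra|exact T2].
  - destruct (Fin z4 1 E4 ltac:(lra)) as [t1 [T1 T2]]; exists t1; split; [lra|exact T2].
Qed.

Lemma continuity_along_reals (L : C -> R) :
  (forall z, continuous (U := R_UniformSpace) L z) -> continuity (fun t => L (g (RtoC t))).
Proof.
  intros CL t; apply continuity_pt_filterlim.
  apply (continuous_comp (U := R_UniformSpace) (V := C_UniformSpace) (W := R_UniformSpace) (fun t => g (RtoC t)) L); [|apply CL].
  apply (continuous_line_h g); exact gC.
Qed.

Lemma arc_crosses_from (i : index) (L : C -> R) (t0 : R) :
  (forall z, continuous (U := R_UniformSpace) L z) -> arc z4 i t0 ->
  L (g (RtoC t0)) < 0 -> 0 < L (x (next i)) ->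
  exists t, t0 < t /\ arc z4 i t /\ L (g (RtoC t)) = 0.
Proof.
  intros CL Ht H0 H1.
  destruct (arc_end i L t0 CL H1 Ht) as [t1 [T1 [A1 P1]]].
  destruct (IVT (fun t => L (g (RtoC t))) t0 t1 (continuity_along_reals L CL) T1 H0 P1) as [t [Ht' E]].
  exists t; repeat split; auto.
  - destruct (Req_dec t t0) as [->|]; lra.
  - apply (arc_interval i t0 t t1); auto.
Qed.

Lemma arc_crosses (i : index) (L : C -> R) :
  (forall z, continuous (U := R_UniformSpace) L z) -> L (x i) * L (x (next i)) < 0 ->
  exists t, arc z4 i t /\ L (g (RtoC t)) = 0.
Proof.
  intros CL H.
  assert (K : forall L', (forall z, continuous (U := R_UniformSpace) L' z) -> L' (x i) < 0 -> 0 < L' (x (next i)) ->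
    exists t, arc z4 i t /\ L' (g (RtoC t)) = 0).
  { intros L' C' A B. destruct (arc_begin i L' C' A) as [t0 [T0 T1]].
    destruct (arc_crosses_from i L' t0 C' T0 T1 B) as [t [_ [T2 T3]]]; exists t; auto. }
  destruct (Rlt_dec (L (x i)) 0) as [N|N].
  - apply K; auto; nra.
  - destruct (K (fun z => - L z)) as [t [T E]].
    + intros z; apply (continuous_opp (V := R_NormedModule) L), CL.
    + destruct (Req_dec (L (x i)) 0) as [E|E]; [rewrite E in H; lra|lra].
    + destruct (Rlt_dec (L (x (next i))) 0); [lra|nra].
    + exists t; split; [exact T|lra].
Qed.

(** The chord from the avoided point to [q] separates the two ends of arc [k], so the image of the
    arc crosses its line. Boundary points on this line are only the avoided point and [q]. *)
Lemma arc_goes_round (k : index) (s : R) (q : C) :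
  0 < s < 1 -> weakly_inside x q -> ~ inside x q -> 0 < side x k q ->
  (forall t, arc z4 k t -> g (RtoC t) <> lerp (x k) (x (next k)) s) ->
  exists t, arc z4 k t /\ g (RtoC t) = q.
Proof.
  intros Hs Wq Nq Sq Av.
  destruct (arc_crosses k (orient (lerp (x k) (x (next k)) s) q)) as [t [T E]].
  - intros z; apply continuous_orient.
  - destruct (chord_separates x k s q Hs Sq); nra.
  - exists t; split; [exact T|].
    destruct (chord_meets_boundary x Hx k s q (g (RtoC t)) Hs Wq Nq Sq (real_weakly_inside t) (real_not_inside t) E) as [H|H]; auto.
    exfalso; exact (Av t T H).
Qed.

(** Suppose that the value lies on another open edge [k]. Arcs do not share such values, so arc [k]
    avoids this point of its own edge and must go round through the midpoint [q] of edge [i]. Then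
    arc [i] in turn avoids [q], and has to go round through the vertex [x (next (next i))], which is
    impossible. *)
Lemma arc_on_side (i : index) (t : R) : arc z4 i t -> side x i (g (RtoC t)) = 0.
Proof.
  intros Ht; apply NNPP; intros N.
  assert (N1 : g (RtoC t) <> x i) by (intros E; apply N; rewrite E; apply side_start).
  assert (N2 : g (RtoC t) <> x (next i)) by (intros E; apply N; rewrite E; apply side_end).
  destruct (boundary_open_edge x Hx (g (RtoC t)) (real_weakly_inside t) (real_not_inside t)) as [k [s [Hs Es]]].
  { intros j; apply (arc_avoids_vertices i j t Ht N1 N2). }
  assert (Nk : k <> i).
  { intros ->; apply N; rewrite Es, side_lerp, side_start, side_end; ring. }
  set (q := lerp (x i) (x (next i)) (1 / 2)).
  assert (Si : side x i q = 0) by (unfold q; rewrite side_lerp, side_start, side_end; ring).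
  assert (So : forall j, j <> i -> 0 < side x j q) by (intros; apply side_open_edge; auto; lra).
  assert (Wq : weakly_inside x q).
  { intros j; destruct (classic (j = i)) as [->|Nj]; [rewrite Si; lra|left; auto]. }
  assert (Nq : ~ inside x q) by (intros H; specialize (H i); lra).
  destruct (arc_goes_round k s q Hs Wq Nq (So k Nk)) as [t' [Ht' Et']].
  { intros u Hu; rewrite <- Es; apply (arc_avoids_arcs i k t u); auto. }
  assert (Nq1 : g (RtoC t') <> x k).
  { rewrite Et'; intros E; pose proof (So k Nk) as S; rewrite E, side_start in S; lra. }
  assert (Nq2 : g (RtoC t') <> x (next k)).
  { rewrite Et'; intros E; pose proof (So k Nk) as S; rewrite E, side_end in S; lra. }
  destruct (arc_goes_round i (1 / 2) (x (next (next i)))) as [u [Hu Eu]]; try lra.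
  - apply weakly_inside_vertex; exact Hx.
  - apply weakly_inside_vertex; exact Hx.
  - apply side_vertex; [exact Hx|destruct i; discriminate|destruct i; discriminate].
  - intros u Hu; fold q; rewrite <- Et'; apply (arc_avoids_arcs k i t' u); auto.
  - refine (arc_avoids_vertices i (next (next i)) u Hu _ _ Eu); rewrite Eu;
      intros E; pose proof (side_vertex x Hx i (next (next i))) as S;
      rewrite E, ?side_start, ?side_end in S;
      (lapply S; [clear S; intros S|destruct i; discriminate]); (lapply S; [lra|destruct i; discriminate]).
Qed.

Lemma arc_lerp (i : index) (t : R) : arc z4 i t ->
  exists s, 0 <= s <= 1 /\ g (RtoC t) = lerp (x i) (x (next i)) s.
Proof.
  intros Ht; apply on_side; [exact Hx|apply real_weakly_inside|apply arc_on_side; exact Ht].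
Qed.

Lemma Re_lerp (p q : C) (s : R) : Re (lerp p q s) = Re p + s * (Re q - Re p).
Proof. unfold lerp, Re; simpl; ring. Qed.

Lemma arc_eq_of_Re (i : index) (s t : R) : arc z4 i s -> arc z4 i t -> Re (x i) <> Re (x (next i)) ->
  Re (g (RtoC s)) = Re (g (RtoC t)) -> g (RtoC s) = g (RtoC t).
Proof.
  intros Hs Ht N E.
  destruct (arc_lerp i s Hs) as [u [Hu Eu]]; destruct (arc_lerp i t Ht) as [v [Hv Ev]].
  rewrite Eu, Ev in *; rewrite !Re_lerp in E; f_equal.
  assert ((u - v) * (Re (x (next i)) - Re (x i)) = 0) by lra.
  apply Rmult_integral in H; destruct H; lra.
Qed.

(** If the abscissa turned back between [s] and [t], the middle abscissa would be taken at some [s']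
    between them and again at some [t'] beyond [t]. On one edge equal abscissae mean equal points,
    but the half circle over [[s, t]] separates [s'] from [t'], against [crosscut]. *)
Lemma arc_monotone (i : index) (s t : R) : arc z4 i s -> arc z4 i t -> s < t ->
  Re (x i) <> Re (x (next i)) ->
  0 <= (Re (x (next i)) - Re (x i)) * (Re (g (RtoC t)) - Re (g (RtoC s))).
Proof.
  intros Hs Ht Hst N; apply Rnot_lt_le; intros Hneg.
  set (d := Re (x (next i)) - Re (x i)) in *.
  (* The zero of [L] is the middle abscissa; the factor [d] makes [L] increase towards [x (next i)]
     whichever way the edge points. *)
  pose (L := fun z => d * (Re z - (Re (g (RtoC s)) + Re (g (RtoC t))) / 2)).
  assert (CL : forall z, continuous (U := R_UniformSpace) L z).
  { intros z; apply (continuous_Rmult (fun _ => d) (fun z : C => Re z - (Re (g (RtoC s)) + Re (g (RtoC t))) / 2)); [apply continuous_const|].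
    apply (continuous_Rminus Re (fun _ => (Re (g (RtoC s)) + Re (g (RtoC t))) / 2)); [apply continuous_Re|apply continuous_const]. }
  assert (Ls : 0 < L (g (RtoC s))) by (unfold L; nra).
  assert (Lt : L (g (RtoC t)) < 0) by (unfold L; nra).
  assert (Le : 0 < L (x (next i))).
  { destruct (arc_lerp i s Hs) as [u [Hu Eu]].
    assert (K : L (g (RtoC s)) = L (x (next i)) - (1 - u) * (d * d)).
    { unfold L; rewrite Eu at 1; rewrite Re_lerp; fold d; unfold d; ring. }
    assert (0 <= d * d) by nra. nra. }
  destruct (arc_crosses_from i L t CL Ht Lt Le) as [t' [T1 [T2 T3]]].
  destruct (IVT (fun r => - L (g (RtoC r))) s t) as [s' [S1 S2]]; [|exact Hst|lra|lra|].
  { apply (continuity_along_reals (fun z => - L z)).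
    intros z; apply (continuous_opp (V := R_NormedModule) L), CL. }
  assert (S3 : s < s' < t).
  { destruct (Req_dec s' s) as [->|]; [lra|]; destruct (Req_dec s' t) as [->|]; lra. }
  assert (E : g (RtoC s') = g (RtoC t')).
  { apply (arc_eq_of_Re i); auto.
    - apply (arc_interval i s s' t); auto; lra.
    - assert (Hd : d <> 0) by (unfold d; lra).
      assert (S4 : L (g (RtoC s')) = 0) by lra.
      unfold L in T3, S4; apply Rmult_integral in T3; apply Rmult_integral in S4; lra. }
  destruct (circle_away s t (g (RtoC s')) Hst (real_not_inside s')) as [eta [He H]].
  { intros E'; assert (L (g (RtoC s')) = 0) by lra. rewrite E' in H; lra. }
  { intros E'; assert (L (g (RtoC s')) = 0) by lra. rewrite E' in H; lra. }
  destruct (real_approach s' eta (fun z => - circle_level s t z) He) as [z [Hz [Dz Lz]]].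
  { apply (continuous_opp (V := R_NormedModule) (circle_level s t)), continuous_circle_level. }
  { unfold circle_level, Re, Im; simpl; nra. }
  destruct (real_approach t' eta (circle_level s t) He) as [z' [Hz' [Dz' Lz']]].
  { apply continuous_circle_level. }
  { unfold circle_level, Re, Im; simpl; nra. }
  rewrite <- E in Dz'.
  apply (crosscut (circle_level s t) (g (RtoC s')) eta z z'); auto; [apply continuous_circle_level|lra].
Qed.

End Boundary.

(** * Averages over cross-sections of a strip *)

(** Duhamel's formula with an error that is bounded, not merely integrable. *)
Lemma linear_tracking (Y : R -> R) (k E s t : R) :
  (forall r, continuous Y r) -> k <> 0 -> s <= t ->
  (forall r, s <= r <= t -> Rabs (Y r - Y s - k * RInt Y s r) <= E) ->
  Rabs (Y t - Y s * exp (k * (t - s))) <= 2 * E * (1 + exp (k * (t - s))).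
Proof.
  intros CY Hk Hst H.
  assert (HE : 0 <= E) by (eapply Rle_trans; [apply Rabs_pos|apply (H s); lra]).
  pose (Z := fun r => RInt Y s r).
  assert (DZ : forall r, is_derive Z r (Y r)).
  { intros r; apply (is_derive_RInt Y Z s r); [|apply CY].
    apply filter_forall; intros r'; apply (RInt_correct (V := R_CompleteNormedModule)), ex_RInt_cont, CY. }
  pose (e := fun r => exp (- k * (r - s))).
  assert (He : forall r, 0 < e r) by (intros; apply exp_pos).
  (* The integrating factor is applied to the primitive [Z], so the derivative of [h] is [e] times
     the error that the hypothesis bounds. [G] has derivative [- E * e], hence the increment of [h]
     is dominated by the decrement of [G]. *)
  pose (h := fun r => e r * (Z r + Y s / k)).
  pose (G := fun r => E * e r / k).
  assert (De : forall r, is_derive e r (- k * e r)).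
  { intros r; unfold e; auto_derive; [auto|unfold Rminus; ring]. }
  assert (Dh : forall r, is_derive h r (e r * (Y r - Y s - k * Z r))).
  { intros r; unfold h.
    evar_last.
    - apply (is_derive_mult (K := R_AbsRing) e (fun r => Z r + Y s / k)); [apply De| |apply Rmult_comm].
      apply (is_derive_plus (K := R_AbsRing) Z (fun _ => Y s / k)); [apply DZ|apply (is_derive_const (K := R_AbsRing))].
    - unfold plus, mult, zero; simpl; field; exact Hk. }
  assert (DG : forall r, is_derive G r (- E * e r)).
  { intros r; unfold G.
    apply (is_derive_ext (fun r => (E / k) * e r)); [intros; simpl; field; exact Hk|].
    evar_last; [apply (is_derive_scal e), De|]. field; exact Hk. }
  assert (B : Rabs (h t - h s) <= G s - G t).
  { destruct (Req_dec s t) as [<-|Nst]; [rewrite !Rminus_diag, Rabs_R0; lra|].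
    assert (Bd : forall r, s <= r <= t -> - E * e r <= e r * (Y r - Y s - k * Z r) <= E * e r).
    { intros r Hr; specialize (H r Hr); apply Rabs_le_between in H; fold (Z r) in H.
      specialize (He r); split; nra. }
    apply Rabs_le; split.
    - destruct (MVT_gen (fun r => h r - G r) s t (fun r => e r * (Y r - Y s - k * Z r) - (- E * e r))) as [r [Hr Er]].
      + intros r _; apply (is_derive_minus (K := R_AbsRing) h G); [apply Dh|apply DG].
      + intros r _; apply continuity_pt_filterlim.
        apply (ex_derive_continuous (fun r => h r - G r)); eexists; apply (is_derive_minus (K := R_AbsRing) h G); [apply Dh|apply DG].
      + rewrite Rmin_left, Rmax_right in Hr by lra; specialize (Bd r Hr).
        assert (0 <= (e r * (Y r - Y s - k * Z r) - - E * e r) * (t - s)) by (apply Rmult_le_pos; lra). lra.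
    - destruct (MVT_gen (fun r => h r + G r) s t (fun r => e r * (Y r - Y s - k * Z r) + (- E * e r))) as [r [Hr Er]].
      + intros r _; apply (is_derive_plus (K := R_AbsRing) h G); [apply Dh|apply DG].
      + intros r _; apply continuity_pt_filterlim.
        apply (ex_derive_continuous (fun r => h r + G r)); eexists; apply (is_derive_plus (K := R_AbsRing) h G); [apply Dh|apply DG].
      + rewrite Rmin_left, Rmax_right in Hr by lra; specialize (Bd r Hr).
        assert (0 <= - (e r * (Y r - Y s - k * Z r) + - E * e r) * (t - s)) by (apply Rmult_le_pos; lra). lra. }
  set (x := exp (k * (t - s))).
  assert (Hx : 0 < x) by apply exp_pos.
  assert (Ex : e t * x = 1).
  { unfold e, x; rewrite <- exp_plus; replace (- k * (t - s) + k * (t - s)) with 0 by ring; apply exp_0. }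
  assert (Es : e s = 1) by (unfold e; rewrite Rminus_diag, Rmult_0_r; apply exp_0).
  assert (Zs : Z s = 0) by (unfold Z; apply (RInt_point (V := R_CompleteNormedModule))).
  assert (B2 : Rabs (k * Z t + Y s - Y s * x) <= E * (1 + x)).
  { replace (k * Z t + Y s - Y s * x) with ((k * x) * (h t - h s)).
    - rewrite Rabs_mult.
      apply Rle_trans with (Rabs (k * x) * (G s - G t)); [apply Rmult_le_compat_l; [apply Rabs_pos|exact B]|].
      replace (G s - G t) with (E * (1 - e t) / k) by (unfold G; rewrite Es; field; exact Hk).
      rewrite Rabs_mult, (Rabs_pos_eq x) by lra.
      assert (Q : Rabs k * x * (E * (1 - e t) / k) = (Rabs k / k) * (E * (x - 1))).
      { transitivity (Rabs k / k * (E * (x - e t * x))); [field; exact Hk|rewrite Ex; reflexivity]. }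
      rewrite Q.
      assert (Sg : Rabs k / k = 1 \/ Rabs k / k = -1).
      { unfold Rabs; destruct Rcase_abs; [right|left]; field; exact Hk. }
      destruct Sg as [-> | ->]; nra.
    - unfold h; rewrite Es, Zs. transitivity (k * (e t * x) * Z t + (e t * x) * Y s - Y s * x); [field; exact Hk|rewrite Ex; ring]. }
  specialize (H t ltac:(lra)); fold (Z t) in H.
  apply Rabs_le_between in H; apply Rabs_le_between in B2; apply Rabs_le.
  assert (0 <= E * x) by (apply Rmult_le_pos; lra). lra.
Qed.

Lemma RInt_Rext (f g : R -> R) (a b : R) :
  (forall t, Rmin a b < t < Rmax a b -> f t = g t) -> RInt f a b = RInt g a b.
Proof. apply (RInt_ext (V := R_CompleteNormedModule)). Qed.

Section Strip.
Variables (W : C -> C) (B : R).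
Hypothesis CW : ccontinuous W.
Hypothesis DW : forall z, 0 < Im z < 1 -> cderivable W z.
Hypothesis HB : forall z, Rabs (Im (W z)) <= B.

Definition section_mean (t : R) : R := RInt (fun s => Re (W (t, s))) 0 1.
Let U := section_mean.
Let D (t : R) : R := Im (W (t, 1)) - Im (W (t, 0)).

Lemma strip_B_pos : 0 <= B.
Proof. eapply Rle_trans; [apply Rabs_pos|apply (HB 0)]. Qed.

Lemma cont_D (t : R) : continuous D t.
Proof. apply continuous_Rminus; apply (cont_Im_h W CW). Qed.

(** The imaginary part of Cauchy's theorem on [[t1, t2] x [0, 1]]. *)
Lemma mean_increment_lt (t1 t2 : R) : t1 < t2 -> U t2 - U t1 = RInt D t1 t2.
Proof.
  intros H.
  assert (Z := goursat_Im W t1 t2 0 1 CW H Rlt_0_1 (fun x y _ Hy => DW (x, y) Hy)).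
  unfold D; rewrite RInt_Rminus by (apply cont_Im_h; exact CW).
  unfold U, section_mean; lra.
Qed.

Lemma is_derive_mean (t : R) : is_derive U t (D t).
Proof.
  apply (is_derive_ext (fun r => U (t - 1) + RInt D (t - 1) r)).
  - intros r; destruct (Rtotal_order (t - 1) r) as [L|[<-|L]].
    + rewrite <- mean_increment_lt by exact L; simpl; ring.
    + rewrite (RInt_point (V := R_CompleteNormedModule)); unfold zero; simpl; ring.
    + rewrite <- (opp_RInt_swap (V := R_CompleteNormedModule)) by (apply ex_RInt_cont, cont_D).
      rewrite <- mean_increment_lt by exact L; unfold opp; simpl; ring.
  - evar_last.
    + apply (is_derive_plus (K := R_AbsRing) (fun _ => U (t - 1)) (fun r => RInt D (t - 1) r)); [apply (is_derive_const (K := R_AbsRing))|].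
      apply (is_derive_RInt D (fun r => RInt D (t - 1) r) (t - 1) t); [|apply cont_D].
      apply filter_forall; intros r'; apply (RInt_correct (V := R_CompleteNormedModule)), ex_RInt_cont, cont_D.
    + unfold plus, zero; simpl; ring.
Qed.

Lemma cont_mean (t : R) : continuous U t.
Proof. apply (ex_derive_continuous U); eexists; apply is_derive_mean. Qed.

Lemma mean_lipschitz (s t : R) : Rabs (U t - U s) <= 2 * B * Rabs (t - s).
Proof.
  assert (K : forall s t, s < t -> Rabs (U t - U s) <= 2 * B * Rabs (t - s)).
  { intros a b H; rewrite mean_increment_lt by exact H.
    rewrite (Rabs_pos_eq (b - a)), Rmult_comm by lra.
    apply abs_RInt_le_const; [lra|apply ex_RInt_cont, cont_D|].
    intros r _; unfold D; pose proof (HB (r, 1)) as H1; pose proof (HB (r, 0)) as H0.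
    apply Rabs_le_between in H1; apply Rabs_le_between in H0; apply Rabs_le; lra. }
  destruct (Rtotal_order s t) as [H|[->|H]].
  - auto.
  - rewrite !Rminus_diag, Rabs_R0; lra.
  - rewrite Rabs_minus_sym, (Rabs_minus_sym t s); auto.
Qed.

Lemma section_Im_bound (t : R) : Rabs (RInt (fun y => Im (W (t, y))) 0 1) <= B.
Proof.
  replace B with ((1 - 0) * B) by ring.
  apply abs_RInt_le_const; [lra|apply ex_RInt_cont; intros; apply (cont_Im_v W CW)|intros; apply HB].
Qed.

(** The real part of Cauchy's theorem: the two edge integrals differ by the integrals of [Im W] over
    the two cross-sections, each at most [B]. *)
Lemma edge_integrals_close (t1 t2 : R) : t1 < t2 ->
  Rabs (RInt (fun t => Re (W (t, 1))) t1 t2 - RInt (fun t => Re (W (t, 0))) t1 t2) <= 2 * B.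
Proof.
  intros H.
  assert (Z := goursat W t1 t2 0 1 CW H Rlt_0_1 (fun x y _ Hy => DW (x, y) Hy)).
  unfold flux in Z.
  pose proof (section_Im_bound t1) as B1; pose proof (section_Im_bound t2) as B2.
  apply Rabs_le_between in B1; apply Rabs_le_between in B2; apply Rabs_le; lra.
Qed.

(** Cauchy's theorem for [z W z] plays the role of Fubini. *)
Lemma edge_integral_mean (t1 t2 : R) : t1 < t2 ->
  Rabs (RInt (fun t => Re (W (t, 1))) t1 t2 - RInt U t1 t2) <= 2 * B.
Proof.
  intros H.
  pose (V := fun z => (z * W z)%C).
  assert (CV : ccontinuous V) by (intros z; apply (continuous_Cmult (fun z => z) W); [apply continuous_id|apply CW]).
  assert (Z := goursat_Im V t1 t2 0 1 CV H Rlt_0_1).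
  lapply Z; [clear Z; intros Z|].
  2:{ intros x y _ Hy; apply (cderivable_mult (fun z => z) W); [apply cderivable_id|apply DW; exact Hy]. }
  (* The height [b] multiplies [Re W], so the lower edge contributes nothing of it and the integral
     over the upper edge is isolated. *)
  assert (EI : forall a b, Im (V (a, b)) = a * Im (W (a, b)) + b * Re (W (a, b))) by (intros; unfold V, Re, Im; simpl; ring).
  assert (ER : forall a b, Re (V (a, b)) = a * Re (W (a, b)) - b * Im (W (a, b))) by (intros; unfold V, Re, Im; simpl; ring).
  assert (Cid : forall r : R, continuous (fun t : R => t) r) by (intros; apply continuous_id).
  assert (C0 : forall r, continuous (fun t => t * Im (W (t, 0))) r) by (intros; apply continuous_Rmult; [apply Cid|apply (cont_Im_h W CW)]).
  assert (C1 : forall r, continuous (fun t => t * Im (W (t, 1))) r) by (intros; apply continuous_Rmult; [apply Cid|apply (cont_Im_h W CW)]).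
  assert (Cs : forall a r, continuous (fun s => s * Im (W (a, s))) r) by (intros; apply continuous_Rmult; [apply Cid|apply (cont_Im_v W CW)]).
  rewrite (RInt_Rext (fun t => Im (V (t, 0))) (fun t => t * Im (W (t, 0)))) in Z by (intros; rewrite EI; ring).
  rewrite (RInt_Rext (fun t => Im (V (t, 1))) (fun t => t * Im (W (t, 1)) + Re (W (t, 1)))) in Z by (intros; rewrite EI; ring).
  rewrite (RInt_Rext (fun y => Re (V (t2, y))) (fun y => t2 * Re (W (t2, y)) - y * Im (W (t2, y)))) in Z by (intros; rewrite ER; ring).
  rewrite (RInt_Rext (fun y => Re (V (t1, y))) (fun y => t1 * Re (W (t1, y)) - y * Im (W (t1, y)))) in Z by (intros; rewrite ER; ring).
  rewrite RInt_Rplus in Z by (try exact C1; apply cont_Re_h; exact CW).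
  assert (Cr : forall a r, continuous (fun y => a * Re (W (a, y))) r).
  { intros; apply continuous_Rmult; [apply continuous_const|apply (cont_Re_v W CW)]. }
  rewrite !RInt_Rminus in Z by (try apply Cs; apply Cr).
  rewrite !RInt_Rscal in Z by (intros; apply (cont_Re_v W CW)).
  fold (section_mean t1) (section_mean t2) in Z; fold U in Z.
  (* Integration by parts for [t * U t]. It brings in the integral of [U], and its other terms
     cancel against those of Cauchy's theorem up to two integrals bounded by [B]. *)
  assert (P : RInt (fun t => U t + t * D t) t1 t2 = t2 * U t2 - t1 * U t1).
  { apply is_RInt_unique, (is_RInt_derive (fun t => t * U t)).
    - intros r _. evar_last.
      + apply (is_derive_mult (K := R_AbsRing) (fun t => t) U); [apply (is_derive_id (K := R_AbsRing))|apply is_derive_mean|apply Rmult_comm].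
      + unfold plus, mult, one; simpl; ring.
    - intros r _; apply continuous_Rplus; [apply cont_mean|].
      apply (continuous_Rmult (fun t => t) D); [apply Cid|apply cont_D]. }
  assert (CD : forall r, continuous (fun t => t * D t) r).
  { intros r; apply (continuous_Rmult (fun t => t) D); [apply Cid|apply cont_D]. }
  rewrite (RInt_Rplus U (fun t => t * D t) t1 t2 cont_mean CD) in P.
  assert (Q : RInt (fun t => t * D t) t1 t2 = RInt (fun t => t * Im (W (t, 1))) t1 t2 - RInt (fun t => t * Im (W (t, 0))) t1 t2).
  { rewrite <- RInt_Rminus by assumption; apply RInt_Rext; intros; unfold D; simpl; ring. }
  assert (Bs : forall a, Rabs (RInt (fun s => s * Im (W (a, s))) 0 1) <= B).
  { intros a; replace B with ((1 - 0) * B) by ring.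
    apply abs_RInt_le_const; [lra|apply ex_RInt_cont, Cs|].
    intros s Hs; rewrite Rabs_mult, (Rabs_pos_eq s) by lra.
    pose proof (HB (a, s)); pose proof (Rabs_pos (Im (W (a, s)))); nra. }
  pose proof (Bs t1) as B1; pose proof (Bs t2) as B2.
  apply Rabs_le_between in B1; apply Rabs_le_between in B2; apply Rabs_le. lra.
Qed.

(** On the edges [Im W] is an affine function of [Re W], so the increment of [U] involves the
    integrals of [Re W] along the edges. Replacing them by the integral of [U] costs [2 * B] on the
    upper edge and [4 * B] on the lower one; this is the error fed to [linear_tracking]. *)
Lemma strip_tracking (a1 b1 a0 b0 p s t : R) :
  s <= t -> a1 - a0 <> 0 -> (a1 - a0) * p + (b1 - b0) = 0 ->
  (forall r, s < r < t -> Im (W (r, 1)) = a1 * Re (W (r, 1)) + b1) ->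
  (forall r, s < r < t -> Im (W (r, 0)) = a0 * Re (W (r, 0)) + b0) ->
  Rabs ((U t - p) - (U s - p) * exp ((a1 - a0) * (t - s))) <=
    2 * ((2 * Rabs a1 + 4 * Rabs a0) * B) * (1 + exp ((a1 - a0) * (t - s))).
Proof.
  intros Hst Hk Hp E1 E0.
  apply (linear_tracking (fun r => U r - p) (a1 - a0)); auto.
  { intros r; apply (continuous_Rminus U (fun _ => p)); [apply cont_mean|apply continuous_const]. }
  intros r Hr.
  pose proof strip_B_pos as BP.
  assert (CC : forall q : R, continuous (fun _ : R => p) q) by (intros; apply continuous_const).
  rewrite RInt_Rminus, (RInt_const (V := R_CompleteNormedModule)) by (try apply cont_mean; auto).
  change (scal (r - s) p) with ((r - s) * p).
  pose proof (Rabs_pos a1); pose proof (Rabs_pos a0).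
  destruct (Req_dec s r) as [<-|N].
  { rewrite (RInt_point (V := R_CompleteNormedModule)).
    apply Rle_trans with (Rabs 0); [right; f_equal; unfold zero; simpl; ring|].
    rewrite Rabs_R0; apply Rmult_le_pos; lra. }
  assert (L : s < r) by lra.
  pose proof (mean_increment_lt s r L) as M.
  unfold D in M; rewrite RInt_Rminus in M by (intros; apply (cont_Im_h W CW)).
  assert (F : forall (a b y : R), (forall q, s < q < t -> Im (W (q, y)) = a * Re (W (q, y)) + b) ->
    RInt (fun q => Im (W (q, y))) s r = a * RInt (fun q => Re (W (q, y))) s r + (r - s) * b).
  { intros a b y E.
    rewrite (RInt_Rext _ (fun q => a * Re (W (q, y)) + b)).
    - rewrite RInt_Rplus, RInt_Rscal, (RInt_const (V := R_CompleteNormedModule)); [reflexivity| | |];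
        intros; try apply (cont_Re_h W CW); try apply continuous_const.
      apply continuous_Rmult; [apply continuous_const|apply (cont_Re_h W CW)].
    - intros q Hq; apply E; rewrite Rmin_left, Rmax_right in Hq by lra; lra. }
  rewrite (F a1 b1 1 E1), (F a0 b0 0 E0) in M.
  pose proof (edge_integral_mean s r L) as I1; pose proof (edge_integrals_close s r L) as I2.
  set (J1 := RInt (fun q => Re (W (q, 1))) s r) in *.
  set (J0 := RInt (fun q => Re (W (q, 0))) s r) in *.
  set (J := RInt U s r) in *.
  replace (U r - p - (U s - p) - (a1 - a0) * (J - (r - s) * p)) with (a1 * (J1 - J) - a0 * ((J1 - J) - (J1 - J0)) + (r - s) * ((a1 - a0) * p + (b1 - b0))) by lra.
  rewrite Hp, Rmult_0_r, Rplus_0_r.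
  eapply Rle_trans; [apply Rabs_triang|]; rewrite Rabs_Ropp, !Rabs_mult.
  assert (I3 : Rabs (J1 - J - (J1 - J0)) <= 4 * B).
  { eapply Rle_trans; [apply Rabs_triang|]; rewrite Rabs_Ropp; lra. }
  apply (Rmult_le_compat_l _ _ _ (Rabs_pos a1)) in I1.
  apply (Rmult_le_compat_l _ _ _ (Rabs_pos a0)) in I3. lra.
Qed.

(** Comparison of a boundary value with the section mean, through its average over a
    window on which it is extremal. *)
Lemma edge_value_le_mean (y t s1 h : R) : y = 0 \/ y = 1 -> 0 < h -> t - h <= s1 <= t ->
  (forall s, s1 <= s <= s1 + h -> Re (W (t, y)) <= Re (W (s, y))) ->
  Re (W (t, y)) <= U t + B * (4 / h + 2 * h).
Proof.
  intros Hy Hh Hs1 H.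
  pose proof strip_B_pos as BP.
  assert (I1 := edge_integral_mean s1 (s1 + h) ltac:(lra)).
  assert (I2 := edge_integrals_close s1 (s1 + h) ltac:(lra)).
  assert (I : RInt (fun s => Re (W (s, y))) s1 (s1 + h) <= RInt U s1 (s1 + h) + 4 * B).
  { apply Rabs_le_between in I1; apply Rabs_le_between in I2; destruct Hy as [-> | ->]; lra. }
  assert (L : RInt (fun _ => Re (W (t, y))) s1 (s1 + h) <= RInt (fun s => Re (W (s, y))) s1 (s1 + h)).
  { apply RInt_le; [lra|apply (ex_RInt_const (V := R_NormedModule))|apply ex_RInt_cont; intros; apply (cont_Re_h W CW)|].
    intros s Hs; apply H; lra. }
  (* The mean drifts by at most [2 * B * h] over the window. Together with the [4 * B] from the edge
     integrals, division by [h] gives the factor [4 / h + 2 * h]. *)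
  assert (M : RInt U s1 (s1 + h) <= RInt (fun _ => U t + 2 * B * h) s1 (s1 + h)).
  { apply RInt_le; [lra|apply ex_RInt_cont, cont_mean|apply (ex_RInt_const (V := R_NormedModule))|].
    intros s Hs; pose proof (mean_lipschitz t s) as K; apply Rabs_le_between in K.
    assert (Rabs (s - t) <= h) by (apply Rabs_le; lra). nra. }
  rewrite (RInt_const (V := R_CompleteNormedModule)) in L, M.
  change (scal (s1 + h - s1) (Re (W (t, y)))) with ((s1 + h - s1) * Re (W (t, y))) in L.
  change (scal (s1 + h - s1) (U t + 2 * B * h)) with ((s1 + h - s1) * (U t + 2 * B * h)) in M.
  apply (Rmult_le_reg_l h); [exact Hh|].
  replace (h * (U t + B * (4 / h + 2 * h))) with (h * (U t + 2 * B * h) + 4 * B) by (field; lra).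
  replace (s1 + h - s1) with h in * by ring. lra.
Qed.

Lemma mean_le_edge_value (y t s1 h : R) : y = 0 \/ y = 1 -> 0 < h -> t - h <= s1 <= t ->
  (forall s, s1 <= s <= s1 + h -> Re (W (s, y)) <= Re (W (t, y))) ->
  U t - B * (4 / h + 2 * h) <= Re (W (t, y)).
Proof.
  intros Hy Hh Hs1 H.
  pose proof strip_B_pos as BP.
  assert (I1 := edge_integral_mean s1 (s1 + h) ltac:(lra)).
  assert (I2 := edge_integrals_close s1 (s1 + h) ltac:(lra)).
  assert (I : RInt U s1 (s1 + h) - 4 * B <= RInt (fun s => Re (W (s, y))) s1 (s1 + h)).
  { apply Rabs_le_between in I1; apply Rabs_le_between in I2; destruct Hy as [-> | ->]; lra. }
  assert (L : RInt (fun s => Re (W (s, y))) s1 (s1 + h) <= RInt (fun _ => Re (W (t, y))) s1 (s1 + h)).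
  { apply RInt_le; [lra|apply ex_RInt_cont; intros; apply (cont_Re_h W CW)|apply (ex_RInt_const (V := R_NormedModule))|].
    intros s Hs; apply H; lra. }
  assert (M : RInt (fun _ => U t - 2 * B * h) s1 (s1 + h) <= RInt U s1 (s1 + h)).
  { apply RInt_le; [lra|apply (ex_RInt_const (V := R_NormedModule))|apply ex_RInt_cont, cont_mean|].
    intros s Hs; pose proof (mean_lipschitz t s) as K; apply Rabs_le_between in K.
    assert (Rabs (s - t) <= h) by (apply Rabs_le; lra). nra. }
  rewrite (RInt_const (V := R_CompleteNormedModule)) in L, M.
  change (scal (s1 + h - s1) (Re (W (t, y)))) with ((s1 + h - s1) * Re (W (t, y))) in L.
  change (scal (s1 + h - s1) (U t - 2 * B * h)) with ((s1 + h - s1) * (U t - 2 * B * h)) in M.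
  apply (Rmult_le_reg_l h); [exact Hh|].
  replace (h * (U t - B * (4 / h + 2 * h))) with (h * (U t - 2 * B * h) - 4 * B) by (field; lra).
  replace (s1 + h - s1) with h in * by ring. lra.
Qed.

End Strip.

(** * Strip coordinates at the marked points *)

(** The abscissa, in the strip coordinate [c + exp (PI z)], of the half circle of radius [r]. *)
Definition lg (r : R) : R := ln r / PI.

Lemma exp_lg (r : R) : 0 < r -> exp (PI * lg r) = r.
Proof.
  intros H; unfold lg; pose proof PI_RGT_0.
  replace (PI * (ln r / PI)) with (ln r) by (field; lra); apply exp_ln; exact H.
Qed.

Lemma lg_exp (t : R) : lg (exp (PI * t)) = t.
Proof. unfold lg; rewrite ln_exp; field; pose proof PI_RGT_0; lra. Qed.

Lemma lg_1 : lg 1 = 0.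
Proof. unfold lg; rewrite ln_1; unfold Rdiv; ring. Qed.

Lemma lg_mult (r s : R) : 0 < r -> 0 < s -> lg (r * s) = lg r + lg s.
Proof. intros; unfold lg; rewrite ln_mult by assumption; field; pose proof PI_RGT_0; lra. Qed.

Lemma lg_inv (r : R) : 0 < r -> lg (/ r) = - lg r.
Proof. intros; unfold lg; rewrite ln_Rinv by assumption; field; pose proof PI_RGT_0; lra. Qed.

Lemma lg_div (r s : R) : 0 < r -> 0 < s -> lg (r / s) = lg r - lg s.
Proof. intros; unfold Rdiv; rewrite lg_mult, lg_inv by (auto; apply Rinv_0_lt_compat; auto); ring. Qed.

Lemma lg_lt (r s : R) : 0 < r -> r < s -> lg r < lg s.
Proof.
  intros; unfold lg; pose proof PI_RGT_0.
  apply Rmult_lt_compat_r; [apply Rinv_0_lt_compat; lra|apply ln_increasing; assumption].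
Qed.

Lemma lg_le (r s : R) : 0 < r -> r <= s -> lg r <= lg s.
Proof. intros H [L| ->]; [left; apply lg_lt; assumption|lra]. Qed.

Lemma exp_PI_lt (t s : R) : t < s -> exp (PI * t) < exp (PI * s).
Proof. intros; apply exp_increasing, Rmult_lt_compat_l; [apply PI_RGT_0|assumption]. Qed.

Lemma exp_PI_le (t s : R) : t <= s -> exp (PI * t) <= exp (PI * s).
Proof. intros [H| ->]; [left; apply exp_PI_lt; exact H|lra]. Qed.

Lemma exp_le (s t : R) : s <= t -> exp s <= exp t.
Proof. intros [H| ->]; [left; apply exp_increasing, H|lra]. Qed.

Section StripMonotone.
Variables (W : C -> C) (B : R).
Hypothesis CW : ccontinuous W.
Hypothesis DW : forall z, 0 < Im z < 1 -> cderivable W z.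
Hypothesis HB : forall z, Rabs (Im (W z)) <= B.

(** The value at [t] is the least one on the window to one side of [t] and the greatest on the
    other; the sign of [k] says which side is which. *)
Lemma monotone_edge_value (y t h k : R) : y = 0 \/ y = 1 -> 0 < h -> k <> 0 ->
  (forall s s', t - h <= s -> s < s' -> s' <= t + h -> 0 <= k * (Re (W (s', y)) - Re (W (s, y)))) ->
  Rabs (Re (W (t, y)) - section_mean W t) <= B * (4 / h + 2 * h).
Proof.
  intros Hy Hh Hk M.
  assert (M' : forall s s', t - h <= s -> s <= s' -> s' <= t + h -> 0 <= k * (Re (W (s', y)) - Re (W (s, y)))).
  { intros s s' H1 [H2| ->] H3; [auto|rewrite Rminus_diag; lra]. }
  destruct (Rlt_dec 0 k) as [P|P].
  - assert (R1 : Re (W (t, y)) <= section_mean W t + B * (4 / h + 2 * h)).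
    { apply (edge_value_le_mean W B CW DW HB y t t h Hy Hh); [lra|].
      intros s Hs; specialize (M' t s); nra. }
    assert (R2 : section_mean W t - B * (4 / h + 2 * h) <= Re (W (t, y))).
    { apply (mean_le_edge_value W B CW DW HB y t (t - h) h Hy Hh); [lra|].
      intros s Hs; specialize (M' s t); nra. }
    apply Rabs_le; lra.
  - assert (R1 : Re (W (t, y)) <= section_mean W t + B * (4 / h + 2 * h)).
    { apply (edge_value_le_mean W B CW DW HB y t (t - h) h Hy Hh); [lra|].
      intros s Hs; specialize (M' s t); nra. }
    assert (R2 : section_mean W t - B * (4 / h + 2 * h) <= Re (W (t, y))).
    { apply (mean_le_edge_value W B CW DW HB y t t h Hy Hh); [lra|].
      intros s Hs; specialize (M' t s); nra. }
    apply Rabs_le; lra.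
Qed.

Lemma section_mean_close (t v d : R) :
  (forall s, 0 <= s <= 1 -> Rabs (Re (W (t, s)) - v) <= d) -> Rabs (section_mean W t - v) <= d.
Proof.
  intros H; unfold section_mean.
  pose proof (RInt_diff_le (fun s => Re (W (t, s))) (fun _ => v) 0 1 d Rle_0_1
    (fun s => cont_Re_v W CW s t) (fun s => continuous_const v s) H) as K.
  rewrite (RInt_const (V := R_CompleteNormedModule)) in K.
  change (scal (1 - 0) v) with ((1 - 0) * v) in K.
  rewrite Rminus_0_r, !Rmult_1_l in K; exact K.
Qed.
End StripMonotone.

(** Thickness of the window used to compare boundary values with section means:
    the radii vary by a factor 5/4. *)
Definition window : R := lg (5 / 4).
(** The factor of [B] in [monotone_edge_value] for [h = window]. *)
Definition window_const : R := 4 / window + 2 * window.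

Lemma window_pos : 0 < window.
Proof. unfold window; rewrite <- lg_1; apply lg_lt; lra. Qed.

Lemma window_const_pos : 0 < window_const.
Proof.
  pose proof window_pos; unfold window_const.
  assert (0 < 4 / window) by (apply Rdiv_lt_0_compat; lra); lra.
Qed.

Section Charts.
Variables (a b p : index -> R) (eps : R) (x : index -> C) (z4 : R) (g : C -> C) (B : R).
Hypothesis Heps : 0 < eps.
Hypothesis Hxl : forall i, x i = (p i, eps * (a i * p i + b i)).
Hypothesis Hxr : forall i, x i = (p i, eps * (a (next i) * p i + b (next i))).
Hypothesis Hx : convex_ccw_quadrilateral x.
Hypothesis Hg : disc_chart x z4 g.
Hypothesis HB : forall z, Rabs (Im (g z)) <= B.

Let gC := dc_continuous _ _ _ Hg.

(** The strip of height 1 is mapped onto the half plane, its lower edge to the ray to the right of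
    [c] and its upper edge to the ray to the left. The same form serves all marked points, and with
    [c = 0] also infinity and the neck. *)
Definition chart (c : R) (z : C) : C := g (RtoC c + Cexp (RtoC PI * z))%C.
(** The mean of [Re g] with respect to the angle over the half circle about [c] of radius
    [exp (PI * t)]. *)
Definition U (c t : R) : R := section_mean (chart c) t.

Lemma p_neq (i : index) : p i <> p (next i).
Proof.
  intros E; apply (vertex_neq x Hx i); rewrite (Hxr i), (Hxl (next i)), E; reflexivity.
Qed.

(** The edge from [x i] to [x (next i)] lies on the Lagrangian of index [next i], whence the shift
    of the index in all slopes below. *)
Lemma arc_line (i : index) (t : R) : arc z4 i t ->
  Im (g (RtoC t)) = eps * a (next i) * Re (g (RtoC t)) + eps * b (next i).
Proof.
  intros Ht; destruct (arc_lerp x z4 g Hx Hg i t Ht) as [s [_ ->]].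
  rewrite (Hxr i), (Hxl (next i)); unfold lerp, Re, Im; simpl; ring.
Qed.

Lemma arc_between (i : index) (t : R) : arc z4 i t ->
  exists s, 0 <= s <= 1 /\ Re (g (RtoC t)) = p i + s * (p (next i) - p i).
Proof.
  intros Ht; destruct (arc_lerp x z4 g Hx Hg i t Ht) as [s [Hs ->]].
  exists s; split; [exact Hs|]; rewrite Re_lerp, (Hxl i), (Hxl (next i)); reflexivity.
Qed.

Lemma chart_right (c t : R) : chart c (t, 0) = g (RtoC (c + exp (PI * t))).
Proof.
  unfold chart; f_equal; apply injective_projections; unfold Cexp, Re, Im; simpl;
    replace (PI * t - 0 * 0) with (PI * t) by ring; replace (PI * 0 + 0 * t) with 0 by ring.
  - rewrite cos_0; ring.
  - rewrite sin_0; ring.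
Qed.

Lemma chart_left (c t : R) : chart c (t, 1) = g (RtoC (c - exp (PI * t))).
Proof.
  unfold chart; f_equal; apply injective_projections; unfold Cexp, Re, Im; simpl;
    replace (PI * t - 0 * 1) with (PI * t) by ring; replace (PI * 1 + 0 * t) with PI by ring.
  - rewrite cos_PI; ring.
  - rewrite sin_PI; ring.
Qed.

Lemma ccontinuous_chart (c : R) : ccontinuous (chart c).
Proof.
  apply (ccontinuous_comp g (fun z => (RtoC c + Cexp (RtoC PI * z))%C)); [|exact gC].
  intros z; apply continuous_Cplus; [apply continuous_const|].
  apply (ccontinuous_comp Cexp (fun z => (RtoC PI * z)%C)); [|exact ccontinuous_Cexp].
  intros y; apply (continuous_Cmult (fun _ => RtoC PI) (fun z => z)); [apply continuous_const|apply continuous_id].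
Qed.

Lemma cderivable_chart (c : R) (z : C) : 0 < Im z < 1 -> cderivable (chart c) z.
Proof.
  intros Hz; apply (cderivable_comp g (fun z => (RtoC c + Cexp (RtoC PI * z))%C)).
  - apply cderivable_plus; [apply cderivable_const|].
    apply (cderivable_comp Cexp (fun z => (RtoC PI * z)%C)); [|apply cderivable_Cexp].
    apply cderivable_scal, cderivable_id.
  - apply (dc_derivable _ _ _ Hg); unfold upper, Cexp, Im, Re in *; simpl.
    rewrite Rplus_0_l; apply Rmult_lt_0_compat; [apply exp_pos|].
    pose proof PI_RGT_0; apply sin_gt_0; rewrite Rmult_0_l, Rplus_0_r; nra.
Qed.

Lemma chart_bound (c : R) (z : C) : Rabs (Im (chart c z)) <= B.
Proof. apply HB. Qed.

Lemma B_pos : 0 <= B.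
Proof. eapply Rle_trans; [apply Rabs_pos|apply (HB 0)]. Qed.

Lemma U_lipschitz (c s t : R) : Rabs (U c t - U c s) <= 2 * B * Rabs (t - s).
Proof. apply mean_lipschitz; [apply ccontinuous_chart|apply cderivable_chart|apply chart_bound]. Qed.

(** The radii between [4 / 5 * r] and [5 / 4 * r] are those of the window about [lg r]. As long as
    they stay in one arc, [arc_monotone] provides the monotonicity needed in
    [monotone_edge_value]. *)
Lemma value_right (c r : R) (i : index) : 0 < r ->
  (forall r', 4 / 5 * r <= r' <= 5 / 4 * r -> arc z4 i (c + r')) ->
  Rabs (Re (g (RtoC (c + r))) - U c (lg r)) <= B * window_const.
Proof.
  intros Hr Ha.
  rewrite <- (exp_lg r Hr) at 1; rewrite <- chart_right.
  apply (monotone_edge_value (chart c) B (ccontinuous_chart c) (cderivable_chart c) (chart_bound c)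
    0 (lg r) window (p (next i) - p i)); [auto|apply window_pos| |].
  { pose proof (p_neq i); lra. }
  assert (W1 : forall s, lg r - window <= s <= lg r + window -> 4 / 5 * r <= exp (PI * s) <= 5 / 4 * r).
  { intros s Hs; unfold window in Hs; split.
    - rewrite <- (exp_lg (4 / 5 * r)) by lra; apply exp_PI_le.
      rewrite lg_mult by lra. replace (4 / 5) with (/ (5 / 4)) by field. rewrite lg_inv by lra; lra.
    - rewrite <- (exp_lg (5 / 4 * r)) by lra; apply exp_PI_le; rewrite lg_mult by lra; lra. }
  intros s s' H1 H2 H3; rewrite !chart_right.
  pose proof (arc_monotone x z4 g Hx Hg i (c + exp (PI * s)) (c + exp (PI * s'))) as M.
  rewrite (Hxl i), (Hxl (next i)) in M; unfold Re in M at 1 2 3 4; simpl in M.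
  apply M.
  - apply Ha, W1; lra.
  - apply Ha, W1; lra.
  - apply Rplus_lt_compat_l, exp_PI_lt, H2.
  - apply p_neq.
Qed.

Lemma value_left (c r : R) (i : index) : 0 < r ->
  (forall r', 4 / 5 * r <= r' <= 5 / 4 * r -> arc z4 i (c - r')) ->
  Rabs (Re (g (RtoC (c - r))) - U c (lg r)) <= B * window_const.
Proof.
  intros Hr Ha.
  rewrite <- (exp_lg r Hr) at 1; rewrite <- chart_left.
  apply (monotone_edge_value (chart c) B (ccontinuous_chart c) (cderivable_chart c) (chart_bound c)
    1 (lg r) window (- (p (next i) - p i))); [auto|apply window_pos| |].
  { pose proof (p_neq i); lra. }
  assert (W1 : forall s, lg r - window <= s <= lg r + window -> 4 / 5 * r <= exp (PI * s) <= 5 / 4 * r).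
  { intros s Hs; unfold window in Hs; split.
    - rewrite <- (exp_lg (4 / 5 * r)) by lra; apply exp_PI_le.
      rewrite lg_mult by lra. replace (4 / 5) with (/ (5 / 4)) by field. rewrite lg_inv by lra; lra.
    - rewrite <- (exp_lg (5 / 4 * r)) by lra; apply exp_PI_le; rewrite lg_mult by lra; lra. }
  intros s s' H1 H2 H3; rewrite !chart_left.
  pose proof (arc_monotone x z4 g Hx Hg i (c - exp (PI * s')) (c - exp (PI * s))) as M.
  rewrite (Hxl i), (Hxl (next i)) in M; unfold Re in M at 1 2 3 4; simpl in M.
  lapply M; [clear M; intros M|apply Ha, W1; lra].
  lapply M; [clear M; intros M|apply Ha, W1; lra].
  lapply M; [clear M; intros M|pose proof (exp_PI_lt s s' H2); lra].
  lapply M; [clear M; intros M|apply p_neq]. lra.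
Qed.

(** Seen from [c], arc [i] is the lower edge of the strip and arc [j] the upper one, so
    [strip_tracking] runs with the slopes of index [next i] and [next j]. *)
Lemma chart_tracking (c s t P : R) (i j : index) :
  s <= t -> a (next j) <> a (next i) ->
  (a (next j) - a (next i)) * P + (b (next j) - b (next i)) = 0 ->
  (forall r, s < r < t -> arc z4 i (c + exp (PI * r)) /\ arc z4 j (c - exp (PI * r))) ->
  let k := eps * (a (next j) - a (next i)) in
  let E := 2 * ((2 * Rabs (a (next j)) + 4 * Rabs (a (next i))) * (eps * B)) in
  Rabs ((U c t - P) - (U c s - P) * exp (k * (t - s))) <= E * (1 + exp (k * (t - s))).
Proof.
  intros Hst Ha HP Harc k E.
  pose proof (strip_tracking (chart c) B (ccontinuous_chart c) (cderivable_chart c) (chart_bound c)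
    (eps * a (next j)) (eps * b (next j)) (eps * a (next i)) (eps * b (next i)) P s t Hst) as T.
  replace (eps * a (next j) - eps * a (next i)) with k in T by (unfold k; ring).
  lapply T; [clear T; intros T|unfold k; apply Rmult_integral_contrapositive; split; lra].
  lapply T; [clear T; intros T|].
  2:{ transitivity (eps * ((a (next j) - a (next i)) * P + (b (next j) - b (next i)))); [unfold k; ring|rewrite HP; ring]. }
  lapply T; [clear T; intros T|].
  2:{ intros r Hr; rewrite chart_left; apply arc_line, Harc, Hr. }
  lapply T; [clear T; intros T|].
  2:{ intros r Hr; rewrite chart_right; apply arc_line, Harc, Hr. }
  rewrite !Rabs_mult, (Rabs_pos_eq eps) in T by lra.
  unfold U; eapply Rle_trans; [exact T|]; right; unfold E; ring.
Qed.

(** The arcs 1 and 3 are mapped to opposite edges; a thick half annulus joining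
    them would bring these edges close together. *)
Lemma modulus_bound (gap k : R) : 0 < gap -> (k = 1 \/ k = -1) ->
  (forall s t, arc z4 i1 s -> arc z4 i3 t -> gap <= k * (Re (g (RtoC s)) - Re (g (RtoC t)))) ->
  z4 * gap <= 2 * B * PI.
Proof.
  intros Hgap Hk Hsep.
  pose proof (dc_range _ _ _ Hg) as Hz. pose proof PI_RGT_0 as HPI.
  (* Half circles about 1 with radius between [1 - z4] and 1 end on arc [i1] to the right and on arc
     [i3] to the left. *)
  set (t1 := lg (1 - z4)).
  assert (Ht1 : t1 < 0) by (unfold t1; rewrite <- lg_1; apply lg_lt; lra).
  pose proof (edge_integrals_close (chart 1) B (ccontinuous_chart 1) (cderivable_chart 1) (chart_bound 1) t1 0 Ht1) as I.
  assert (CR : forall y r, continuous (fun t => Re (chart 1 (t, y))) r) by (intros; apply cont_Re_h, ccontinuous_chart).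
  rewrite <- RInt_Rminus in I by apply CR.
  assert (L : RInt (fun _ => gap) t1 0 <= RInt (fun t => - k * (Re (chart 1 (t, 1)) - Re (chart 1 (t, 0)))) t1 0).
  { apply RInt_le; [lra|apply (ex_RInt_const (V := R_NormedModule))| |].
    - apply ex_RInt_cont; intros r; apply (continuous_Rmult (fun _ => - k) (fun t => Re (chart 1 (t, 1)) - Re (chart 1 (t, 0)))); [apply continuous_const|].
      apply continuous_Rminus; apply CR.
    - intros t Ht; rewrite chart_left, chart_right.
      assert (E1 : 1 - z4 < exp (PI * t)) by (rewrite <- (exp_lg (1 - z4)) by lra; apply exp_PI_lt; apply Ht).
      assert (E2 : exp (PI * t) < 1) by (rewrite <- exp_0, <- (Rmult_0_r PI); apply exp_PI_lt; apply Ht).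
      assert (S := Hsep (1 + exp (PI * t)) (1 - exp (PI * t))); simpl in S.
      specialize (S ltac:(lra) ltac:(lra)); lra. }
  rewrite (RInt_const (V := R_CompleteNormedModule)) in L.
  change (scal (0 - t1) gap) with ((0 - t1) * gap) in L.
  rewrite RInt_Rscal in L by (intros; apply continuous_Rminus; apply CR).
  set (J := RInt (fun x0 : R => Re (chart 1 (x0, 1)) - Re (chart 1 (x0, 0))) t1 0) in *.
  assert (L2 : (0 - t1) * gap <= 2 * B).
  { apply Rabs_le_between in I; destruct Hk as [-> | ->]; lra. }
  assert (L3 : z4 <= - t1 * PI).
  { unfold t1, lg. replace (- (ln (1 - z4) / PI) * PI) with (- ln (1 - z4)) by (field; lra).
    assert (ln (1 - z4) <= - z4); [|lra].
    rewrite <- (ln_exp (- z4)).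
    left; apply ln_increasing; [lra|]. pose proof (exp_ineq1 (- z4) ltac:(lra)); lra. }
  assert (L4 : z4 * gap <= - t1 * PI * gap) by (apply Rmult_le_compat_r; lra).
  assert (L5 : (0 - t1) * gap * PI <= 2 * B * PI) by (apply Rmult_le_compat_r; lra).
  lra.
Qed.

Lemma value_neg (r : R) : 0 < r -> Rabs (Re (g (RtoC (- r))) - U 0 (lg r)) <= B * window_const.
Proof.
  intros Hr; replace (- r) with (0 - r) by ring.
  apply (value_left 0 r i2 Hr); simpl; intros; lra.
Qed.

(** Here and below the margins 4/5 and 5/4 keep the whole window of radii within a single arc. *)
Lemma value_arc1 (r : R) : 5 / 4 < r -> Rabs (Re (g (RtoC r)) - U 0 (lg r)) <= B * window_const.
Proof.
  intros Hr; replace r with (0 + r) at 1 by ring.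
  apply (value_right 0 r i1); simpl; intros; lra.
Qed.

Lemma value_arc4 (r : R) : 5 / 4 * z4 < r < 4 / 5 -> Rabs (Re (g (RtoC r)) - U 0 (lg r)) <= B * window_const.
Proof.
  intros Hr; pose proof (dc_range _ _ _ Hg); replace r with (0 + r) at 1 by ring.
  apply (value_right 0 r i4); simpl; intros; lra.
Qed.

Lemma value_arc3 (r : R) : 0 < r < 4 / 5 * z4 -> Rabs (Re (g (RtoC r)) - U 0 (lg r)) <= B * window_const.
Proof.
  intros Hr; pose proof (dc_range _ _ _ Hg); replace r with (0 + r) at 1 by ring.
  apply (value_right 0 r i3); simpl; intros; lra.
Qed.

Lemma value_right_1 (r : R) : 0 < r -> Rabs (Re (g (RtoC (1 + r))) - U 1 (lg r)) <= B * window_const.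
Proof. intros Hr; apply (value_right 1 r i1 Hr); simpl; intros; lra. Qed.

Lemma value_left_1 (r : R) : 0 < r < 4 / 5 * (1 - z4) -> Rabs (Re (g (RtoC (1 - r))) - U 1 (lg r)) <= B * window_const.
Proof. intros Hr; apply (value_left 1 r i4); simpl; intros; lra. Qed.

Lemma value_right_z4 (r : R) : 0 < r < 4 / 5 * (1 - z4) -> Rabs (Re (g (RtoC (z4 + r))) - U z4 (lg r)) <= B * window_const.
Proof. intros Hr; apply (value_right z4 r i4); simpl; intros; lra. Qed.

Lemma value_left_z4 (r : R) : 0 < r < 4 / 5 * z4 -> Rabs (Re (g (RtoC (z4 - r))) - U z4 (lg r)) <= B * window_const.
Proof. intros Hr; apply (value_left z4 r i3); simpl; intros; lra. Qed.

Lemma Rabs_lg_le (r d : R) : 0 < d -> d <= r <= / d -> Rabs (lg r) <= - lg d.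
Proof.
  intros Hd [H1 H2]; apply Rabs_le; split.
  - rewrite Ropp_involutive; apply lg_le; lra.
  - rewrite <- lg_inv by exact Hd; apply lg_le; lra.
Qed.

(** The boundary point 1/2 has distance 1/2 from both 0 and 1, so its value is close to both
    means. *)
Lemma hub_1_link : z4 <= 1 / 4 -> Rabs (U 1 (lg (1 / 2)) - U 0 (lg (1 / 2))) <= 2 * B * window_const.
Proof.
  intros Hz; pose proof (dc_range _ _ _ Hg).
  pose proof (value_left_1 (1 / 2) ltac:(lra)) as V1; pose proof (value_arc4 (1 / 2) ltac:(lra)) as V2.
  replace (1 - 1 / 2) with (1 / 2) in V1 by field.
  apply Rabs_le_between in V1; apply Rabs_le_between in V2; apply Rabs_le; lra.
Qed.

(** The linking point is [3 / 2 * z4], at distance [1 / 2 * z4] from [z4]. *)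
Lemma hub_z4_link : z4 <= 1 / 4 -> Rabs (U z4 (lg (1 / 2 * z4)) - U 0 (lg (3 / 2 * z4))) <= 2 * B * window_const.
Proof.
  intros Hz; pose proof (dc_range _ _ _ Hg).
  pose proof (value_right_z4 (1 / 2 * z4) ltac:(lra)) as V1; pose proof (value_arc4 (3 / 2 * z4) ltac:(lra)) as V2.
  replace (z4 + 1 / 2 * z4) with (3 / 2 * z4) in V1 by field.
  apply Rabs_le_between in V1; apply Rabs_le_between in V2; apply Rabs_le; lra.
Qed.

(** Away from 1 the half circle about 0 through [y] gives the value directly. Between 4/5 and 5/4
    its window would contain the marked point 1, so half circles about 1 are used and the link leads
    back to 0. The constant counts three window comparisons and two drifts of [U] over a length of
    at most [- lg d]. *)
Lemma hub_1 (d y : R) : z4 <= 1 / 4 -> 0 < d <= 1 / 2 -> 5 / 4 * z4 < d ->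
  d <= Rabs y <= / d -> d <= Rabs (y - 1) ->
  Rabs (Re (g (RtoC y)) - U 0 0) <= B * (3 * window_const - 4 * lg d).
Proof.
  intros Hz Hd Hzd Hy Hy1.
  pose proof (dc_range _ _ _ Hg) as Hr. pose proof window_const_pos as WP. pose proof B_pos as BP.
  assert (Ld : 0 <= - lg d) by (rewrite <- lg_inv by lra; rewrite <- lg_1; apply lg_le; [lra|]; rewrite <- Rinv_1; apply Rinv_le_contravar; lra).
  assert (Fa : forall r, d <= r <= / d -> Rabs (Re (g (RtoC y)) - U 0 (lg r)) <= B * window_const ->
    Rabs (Re (g (RtoC y)) - U 0 0) <= B * (3 * window_const - 4 * lg d)).
  { intros r Hr' H.
    pose proof (U_lipschitz 0 0 (lg r)) as L; rewrite Rminus_0_r in L.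
    pose proof (Rabs_lg_le r d ltac:(lra) Hr') as L2.
    assert (2 * B * Rabs (lg r) <= 2 * B * - lg d) by (apply Rmult_le_compat_l; lra).
    assert (0 <= B * window_const) by (apply Rmult_le_pos; lra).
    assert (0 <= B * - lg d) by (apply Rmult_le_pos; lra).
    apply Rabs_le_between in H; apply Rabs_le_between in L; apply Rabs_le; lra. }
  destruct (Rlt_dec y 0) as [N|N].
  { rewrite Rabs_left in Hy by exact N; apply (Fa (- y) Hy).
    rewrite <- (Ropp_involutive y) at 1; apply value_neg; lra. }
  rewrite Rabs_pos_eq in Hy by lra.
  destruct (Rlt_dec (5 / 4) y) as [N1|N1]; [apply (Fa y Hy), value_arc1, N1|].
  destruct (Rlt_dec y (4 / 5)) as [N2|N2]; [apply (Fa y Hy), value_arc4; lra|].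
  assert (R1 : Rabs (y - 1) <= 1 / 4) by (apply Rabs_le; lra).
  assert (V : Rabs (Re (g (RtoC y)) - U 1 (lg (Rabs (y - 1)))) <= B * window_const).
  { destruct (Rle_dec 1 y) as [G|G].
    - rewrite (Rabs_pos_eq (y - 1)) in * by lra.
      replace y with (1 + (y - 1)) at 1 by ring; apply value_right_1; lra.
    - rewrite (Rabs_left (y - 1)) in * by lra.
      replace y with (1 - - (y - 1)) at 1 by ring; apply value_left_1; lra. }
  pose proof (hub_1_link Hz) as Lk.
  pose proof (U_lipschitz 1 (lg (1 / 2)) (lg (Rabs (y - 1)))) as L1.
  pose proof (U_lipschitz 0 0 (lg (1 / 2))) as L2; rewrite Rminus_0_r in L2.
  assert (G1 : lg (Rabs (y - 1)) <= lg (1 / 2)) by (apply lg_le; lra).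
  assert (G2 : lg d <= lg (Rabs (y - 1))) by (apply lg_le; lra).
  assert (G3 : lg (1 / 2) <= 0) by (rewrite <- lg_1; apply lg_le; lra).
  assert (A1 : 2 * B * Rabs (lg (Rabs (y - 1)) - lg (1 / 2)) <= 2 * B * - lg d).
  { apply Rmult_le_compat_l; [lra|]; apply Rabs_le; lra. }
  assert (A2 : 2 * B * Rabs (lg (1 / 2)) <= 2 * B * - lg d).
  { apply Rmult_le_compat_l; [lra|]; apply Rabs_le; lra. }
  apply Rabs_le_between in V; apply Rabs_le_between in Lk; apply Rabs_le_between in L1; apply Rabs_le_between in L2.
  apply Rabs_le; lra.
Qed.

(** The same at scale [z4], with the marked point [z4] in place of 1; [z4 / d < 4 / 5] keeps the
    range away from the marked point 1. *)
Lemma hub_z4 (d y : R) : z4 <= 1 / 4 -> 0 < d <= 1 / 2 -> z4 / d < 4 / 5 ->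
  d * z4 <= Rabs y <= z4 / d -> d * z4 <= Rabs (y - z4) ->
  Rabs (Re (g (RtoC y)) - U 0 (lg z4)) <= B * (3 * window_const - 4 * lg d).
Proof.
  intros Hz Hd Hzd Hy Hy1.
  pose proof (dc_range _ _ _ Hg) as Hr. pose proof window_const_pos as WP. pose proof B_pos as BP.
  assert (Ld : lg (3 / 2) <= - lg d).
  { rewrite <- lg_inv by lra; apply lg_le; [lra|].
    apply Rle_trans with (/ (1 / 2)); [lra|]; apply Rinv_le_contravar; lra. }
  assert (Ld0 : 0 <= lg (3 / 2)) by (rewrite <- lg_1; apply lg_le; lra).
  assert (Hdz : 0 < d * z4) by (apply Rmult_lt_0_compat; lra).
  assert (Fa : forall r, d * z4 <= r <= z4 / d -> Rabs (Re (g (RtoC y)) - U 0 (lg r)) <= B * window_const ->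
    Rabs (Re (g (RtoC y)) - U 0 (lg z4)) <= B * (3 * window_const - 4 * lg d)).
  { intros r Hr' H.
    pose proof (U_lipschitz 0 (lg z4) (lg r)) as L.
    assert (L2 : Rabs (lg r - lg z4) <= - lg d).
    { rewrite <- lg_div by lra; apply Rabs_lg_le; [lra|]; split.
      - apply (Rmult_le_reg_r z4); [lra|]; unfold Rdiv; rewrite Rmult_assoc, Rinv_l; lra.
      - apply (Rmult_le_reg_r z4); [lra|]; unfold Rdiv in *; rewrite Rmult_assoc, Rinv_l; lra. }
    assert (2 * B * Rabs (lg r - lg z4) <= 2 * B * - lg d) by (apply Rmult_le_compat_l; lra).
    assert (0 <= B * window_const) by (apply Rmult_le_pos; lra).
    assert (0 <= B * - lg d) by (apply Rmult_le_pos; lra).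
    apply Rabs_le_between in H; apply Rabs_le_between in L; apply Rabs_le; lra. }
  destruct (Rlt_dec y 0) as [N|N].
  { rewrite Rabs_left in Hy by exact N; apply (Fa (- y) Hy).
    rewrite <- (Ropp_involutive y) at 1; apply value_neg; lra. }
  rewrite Rabs_pos_eq in Hy by lra.
  destruct (Rlt_dec (5 / 4 * z4) y) as [N1|N1]; [apply (Fa y Hy), value_arc4; lra|].
  destruct (Rlt_dec y (4 / 5 * z4)) as [N2|N2]; [apply (Fa y Hy), value_arc3; lra|].
  assert (R1 : Rabs (y - z4) <= 1 / 4 * z4) by (apply Rabs_le; lra).
  assert (V : Rabs (Re (g (RtoC y)) - U z4 (lg (Rabs (y - z4)))) <= B * window_const).
  { destruct (Rle_dec z4 y) as [G|G].
    - rewrite (Rabs_pos_eq (y - z4)) in * by lra.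
      replace y with (z4 + (y - z4)) at 1 by ring; apply value_right_z4; lra.
    - rewrite (Rabs_left (y - z4)) in * by lra.
      replace y with (z4 - - (y - z4)) at 1 by ring; apply value_left_z4; lra. }
  pose proof (hub_z4_link Hz) as Lk.
  pose proof (U_lipschitz z4 (lg (1 / 2 * z4)) (lg (Rabs (y - z4)))) as L1.
  pose proof (U_lipschitz 0 (lg z4) (lg (3 / 2 * z4))) as L2.
  assert (G1 : lg (Rabs (y - z4)) <= lg (1 / 2 * z4)) by (apply lg_le; lra).
  assert (G2 : lg (d * z4) <= lg (Rabs (y - z4))) by (apply lg_le; lra).
  assert (G3 : lg (1 / 2 * z4) <= lg z4) by (apply lg_le; lra).
  rewrite (lg_mult d z4) in G2 by lra.
  assert (G4 : lg (3 / 2 * z4) = lg (3 / 2) + lg z4) by (apply lg_mult; lra).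
  assert (A1 : 2 * B * Rabs (lg (Rabs (y - z4)) - lg (1 / 2 * z4)) <= 2 * B * - lg d).
  { apply Rmult_le_compat_l; [lra|]; apply Rabs_le; lra. }
  assert (A2 : 2 * B * Rabs (lg (3 / 2 * z4) - lg z4) <= 2 * B * - lg d).
  { apply Rmult_le_compat_l; [lra|]; apply Rabs_le; lra. }
  apply Rabs_le_between in V; apply Rabs_le_between in Lk; apply Rabs_le_between in L1; apply Rabs_le_between in L2.
  apply Rabs_le; lra.
Qed.
End Charts.

(** * From boundary values to interior values by barriers *)

Section Interior.
Variable (g : C -> C).
Hypothesis gC : ccontinuous g.
Hypothesis gD : forall z, upper z -> cderivable g z.

(** [harmonic_bound] with both small discs at [c]: on the half circle of radius [r] each of the
    three ratios equals [1 / K]. *)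
Lemma annulus_estimate (c r K k eta M : R) (z : C) :
  0 < r -> 1 <= K -> 0 <= eta -> 1 / 2 <= M ->
  (forall z, closed_upper z -> Rabs (Re (g z) - k) <= M) ->
  (forall y, r / K <= Rabs (y - c) <= r * K -> Rabs (Re (g (RtoC y)) - k) <= eta) ->
  closed_upper z -> Cmod (z - RtoC c) = r ->
  Rabs (Re (g z) - k) <= eta + 6 * M / K.
Proof.
  intros Hr HK He HM Hb Hbd Hz Hzr.
  assert (P1 : 0 < r / K) by (apply Rdiv_lt_0_compat; lra).
  assert (P2 : 0 < r * K) by (apply Rmult_lt_0_compat; lra).
  assert (N : z <> RtoC c).
  { intros E; rewrite E in Hzr; replace (RtoC c - RtoC c)%C with (RtoC 0) in Hzr by ring; rewrite Cmod_0 in Hzr; lra. }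
  pose proof (harmonic_bound g c c c (r / K) (r / K) (r * K) k eta M P1 P1 P2 HM He gC gD Hb) as H.
  lapply H; [clear H; intros H|].
  2:{ intros y. destruct (Rlt_dec (Rabs (y - c)) (r / K)); [auto|].
      destruct (Rlt_dec (r * K) (Rabs (y - c))); [auto|]. left; apply Hbd; lra. }
  specialize (H z Hz N N); rewrite Hzr in H.
  replace (eta + 6 * M / K) with (eta + 2 * M * (r / K / r + r / K / r + r / (r * K))) by (field; lra).
  exact H.
Qed.

(** [s] is the scale of the hub, and 0, [s] and infinity are its marked points. Boundary values are
    known down to the finer scale [d'], so that each ratio is at most [d' / d] in the region of
    scale [d]. *)
Lemma hub_estimate (s d d' k eta M : R) (z : C) :
  0 < s -> 0 < d -> 0 < d' -> 0 <= eta -> 1 / 2 <= M ->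
  (forall z, closed_upper z -> Rabs (Re (g z) - k) <= M) ->
  (forall y, d' * s <= Rabs y <= s / d' -> d' * s <= Rabs (y - s) -> Rabs (Re (g (RtoC y)) - k) <= eta) ->
  closed_upper z -> d * s <= Cmod z <= s / d -> d * s <= Cmod (z - RtoC s) ->
  Rabs (Re (g z) - k) <= eta + 6 * M * (d' / d).
Proof.
  intros Hs Hd Hd' He HM Hb Hbd Hz H1 H2.
  assert (P1 : 0 < d' * s) by (apply Rmult_lt_0_compat; lra).
  assert (P2 : 0 < s / d') by (apply Rdiv_lt_0_compat; lra).
  assert (P3 : 0 < d * s) by (apply Rmult_lt_0_compat; lra).
  assert (N0 : z <> RtoC 0) by (apply Cmod_gt_0; lra).
  assert (Ns : z <> RtoC s).
  { intros E; rewrite E in H2; replace (RtoC s - RtoC s)%C with (RtoC 0) in H2 by ring; rewrite Cmod_0 in H2; lra. }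
  pose proof (harmonic_bound g 0 s 0 (d' * s) (d' * s) (s / d') k eta M P1 P1 P2 HM He gC gD Hb) as H.
  lapply H; [clear H; intros H|].
  2:{ intros y; rewrite Rminus_0_r. destruct (Rlt_dec (Rabs y) (d' * s)); [auto|].
      destruct (Rlt_dec (Rabs (y - s)) (d' * s)); [auto|].
      destruct (Rlt_dec (s / d') (Rabs y)); [auto|]. left; apply Hbd; lra. }
  specialize (H z Hz N0 Ns).
  replace (z - RtoC 0)%C with z in H by ring.
  eapply Rle_trans; [exact H|]; apply Rplus_le_compat_l.
  replace (6 * M * (d' / d)) with (2 * M * (d' / d + d' / d + d' / d)) by ring.
  apply Rmult_le_compat_l; [lra|].
  assert (Q : forall q, d * s <= q -> d' * s / q <= d' / d).
  { intros q Hq; apply Rle_trans with (d' * s / (d * s)); [|right; field; lra].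
    unfold Rdiv; apply Rmult_le_compat_l; [lra|]; apply Rinv_le_contravar; lra. }
  apply Rplus_le_compat; [apply Rplus_le_compat; apply Q; lra|].
  apply Rle_trans with (s / d / (s / d')); [|right; field; lra].
  unfold Rdiv at 1 3; apply Rmult_le_compat_r; [left; apply Rinv_0_lt_compat; exact P2|lra].
Qed.
End Interior.

(** The solution of [I' = - m (I - P)] with [I 0 = H]. *)
Definition flow (m P H t : R) : R := P + (H - P) * exp (- m * t).

Lemma one_minus_exp_le (t : R) : 1 - exp (- t) <= t.
Proof.
  destruct (Req_dec t 0) as [->|N]; [rewrite Ropp_0, exp_0; lra|].
  pose proof (exp_ineq1 (- t) ltac:(lra)); lra.
Qed.

(** The exponentials are bounded by a free constant [S], which is 1 on the ends but may be larger on
    the neck, where the flow can expand. The time with the larger exponential serves as base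
    point. *)
Lemma flow_lipschitz (m P H s t S : R) : 0 <= S ->
  exp (- m * s) <= S -> exp (- m * t) <= S ->
  Rabs (flow m P H s - flow m P H t) <= Rabs (H - P) * (S * Rabs m) * Rabs (s - t).
Proof.
  intros HS.
  assert (K : forall s t, exp (- m * s) <= exp (- m * t) -> exp (- m * t) <= S ->
    Rabs (flow m P H s - flow m P H t) <= Rabs (H - P) * (S * Rabs m) * Rabs (s - t)).
  { intros u v L1 L2; unfold flow.
    replace (P + (H - P) * exp (- m * u) - (P + (H - P) * exp (- m * v))) with ((H - P) * (exp (- m * u) - exp (- m * v))) by ring.
    rewrite Rabs_mult, Rmult_assoc; apply Rmult_le_compat_l; [apply Rabs_pos|].
    rewrite Rabs_left1 by lra.
    assert (E : exp (- m * u) = exp (- m * v) * exp (- (m * (u - v)))) by (rewrite <- exp_plus; f_equal; ring).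
    rewrite E.
    pose proof (one_minus_exp_le (m * (u - v))) as Q; pose proof (exp_pos (- m * v)) as Pv.
    replace (- (exp (- m * v) * exp (- (m * (u - v))) - exp (- m * v))) with (exp (- m * v) * (1 - exp (- (m * (u - v))))) by ring.
    apply Rle_trans with (exp (- m * v) * Rabs (m * (u - v))).
    - apply Rmult_le_compat_l; [lra|]; pose proof (Rle_abs (m * (u - v))); lra.
    - rewrite Rabs_mult, Rmult_assoc; apply Rmult_le_compat_r; [|exact L2].
      apply Rmult_le_pos; apply Rabs_pos. }
  intros L1 L2; destruct (Rle_dec (exp (- m * s)) (exp (- m * t))) as [L|L].
  - apply K; assumption.
  - rewrite Rabs_minus_sym, (Rabs_minus_sym s t); apply K; lra.
Qed.

(** Three errors add up: the tracking error, the wrong starting value [u0] instead of [H], and the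
    wrong starting time [t0] instead of 0. *)
Lemma flow_from_base (m P H u u0 t t0 E S : R) : 0 <= S ->
  Rabs ((u - P) - (u0 - P) * exp (- m * (t - t0))) <= E ->
  exp (- m * t) <= S -> exp (- m * (t - t0)) <= S ->
  Rabs (u - flow m P H t) <= E + S * Rabs (u0 - H) + Rabs (H - P) * (S * Rabs m) * Rabs t0.
Proof.
  intros HS HE L1 L2.
  pose proof (flow_lipschitz m P H (t - t0) t S HS L2 L1) as F.
  replace (t - t0 - t) with (- t0) in F by ring; rewrite Rabs_Ropp in F.
  assert (Q : Rabs ((u0 - H) * exp (- m * (t - t0))) <= S * Rabs (u0 - H)).
  { rewrite Rabs_mult, (Rabs_pos_eq (exp _)) by (left; apply exp_pos).
    rewrite Rmult_comm; apply Rmult_le_compat_r; [apply Rabs_pos|exact L2]. }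
  replace (u - flow m P H t) with
    ((u - P - (u0 - P) * exp (- m * (t - t0))) + (u0 - H) * exp (- m * (t - t0)) + (flow m P H (t - t0) - flow m P H t))
    by (unfold flow; ring).
  eapply Rle_trans; [apply Rabs_triang|]; apply Rplus_le_compat; [|exact F].
  eapply Rle_trans; [apply Rabs_triang|]; apply Rplus_le_compat; [exact HE|exact Q].
Qed.

(** * Tracking along ends, and pinning at vertices of index zero *)

Section Ends.
Variables (a b p : index -> R) (eps : R) (x : index -> C) (z4 : R) (g : C -> C) (B : R).
Hypothesis Heps : 0 < eps.
Hypothesis Hxl : forall i, x i = (p i, eps * (a i * p i + b i)).
Hypothesis Hxr : forall i, x i = (p i, eps * (a (next i) * p i + b (next i))).
Hypothesis Hx : convex_ccw_quadrilateral x.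
Hypothesis Hg : disc_chart x z4 g.
Hypothesis HB : forall z, Rabs (Im (g z)) <= B.
Variable A : R.
Hypothesis HA : forall i, Rabs (a i) <= A.

Notation U := (U g).
(** [12 = 2 * (2 + 4)], from the constants in [chart_tracking] with both slopes bounded by [A]. With
    [B] of order [eps] this is of order [eps ^ 2]. *)
Definition track_err : R := 12 * A * (eps * B).

Lemma track_err_pos : 0 <= track_err.
Proof.
  unfold track_err; pose proof (B_pos g B HB).
  assert (0 <= A) by (eapply Rle_trans; [apply Rabs_pos|apply (HA i1)]).
  assert (0 <= eps * B) by (apply Rmult_le_pos; lra). nra.
Qed.

Lemma tracking (c s t P k : R) (i j : index) :
  s <= t -> a (next j) <> a (next i) ->
  (a (next j) - a (next i)) * P + (b (next j) - b (next i)) = 0 ->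
  (forall r, s < r < t -> arc z4 i (c + exp (PI * r)) /\ arc z4 j (c - exp (PI * r))) ->
  k = eps * (a (next j) - a (next i)) ->
  Rabs ((U c t - P) - (U c s - P) * exp (k * (t - s))) <= track_err * (1 + exp (k * (t - s))).
Proof.
  intros Hst N HP Harc ->.
  eapply Rle_trans; [apply (chart_tracking a b p eps x z4 g B Heps Hxl Hxr Hx Hg HB c s t P i j); auto|].
  pose proof (exp_pos (eps * (a (next j) - a (next i)) * (t - s))).
  apply Rmult_le_compat_r; [lra|].
  unfold track_err; pose proof (B_pos g B HB).
  pose proof (HA (next i)); pose proof (HA (next j)).
  assert (0 <= eps * B) by (apply Rmult_le_pos; lra).
  replace (12 * A * (eps * B)) with (2 * ((2 * A + 4 * A) * (eps * B))) by ring.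
  apply Rmult_le_compat_l; [lra|]; apply Rmult_le_compat_r; lra.
Qed.

(** The forward estimate multiplied by the inverse exponential; it contracts where forward tracking
    expands. *)
Lemma tracking_backward (c s t P k : R) (i j : index) :
  s <= t -> a (next j) <> a (next i) ->
  (a (next j) - a (next i)) * P + (b (next j) - b (next i)) = 0 ->
  (forall r, s < r < t -> arc z4 i (c + exp (PI * r)) /\ arc z4 j (c - exp (PI * r))) ->
  k = eps * (a (next j) - a (next i)) ->
  Rabs ((U c s - P) - (U c t - P) * exp (- k * (t - s))) <= track_err * (1 + exp (- k * (t - s))).
Proof.
  intros Hst N HP Harc Hk.
  pose proof (tracking c s t P k i j Hst N HP Harc Hk) as T.
  assert (E : exp (k * (t - s)) * exp (- k * (t - s)) = 1).
  { rewrite <- exp_plus; replace (k * (t - s) + - k * (t - s)) with 0 by ring; apply exp_0. }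
  pose proof (exp_pos (- k * (t - s))) as Pm.
  replace (U c s - P - (U c t - P) * exp (- k * (t - s)))
    with (- exp (- k * (t - s)) * (U c t - P - (U c s - P) * exp (k * (t - s)))).
  - rewrite Rabs_mult, Rabs_Ropp, Rabs_pos_eq by lra.
    apply (Rmult_le_compat_l (exp (- k * (t - s)))) in T; [|lra].
    eapply Rle_trans; [exact T|]; right.
    transitivity (track_err * (exp (- k * (t - s)) + exp (k * (t - s)) * exp (- k * (t - s)))); [ring|].
    rewrite E; ring.
  - transitivity ((U c s - P) * (exp (k * (t - s)) * exp (- k * (t - s))) - (U c t - P) * exp (- k * (t - s))); [ring|].
    rewrite E; ring.
Qed.

Lemma U_limit_center (c : R) (e T : R) : 0 < e -> exists s, s <= T /\ Rabs (U c s - Re (g (RtoC c))) <= e.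
Proof.
  intros He.
  destruct (proj1 (continuous_C_eps g (RtoC c)) (dc_continuous _ _ _ Hg _) e He) as [d [Hd H]].
  exists (Rmin T (lg (d / 2))); split; [apply Rmin_l|].
  apply (section_mean_close _ (ccontinuous_chart x z4 g Hg c)).
  intros s _; left.
  assert (M : Cmod (RtoC c + Cexp (RtoC PI * (Rmin T (lg (d / 2)), s)) - RtoC c) < d).
  { replace (RtoC c + Cexp (RtoC PI * (Rmin T (lg (d / 2)), s)) - RtoC c)%C with (Cexp (RtoC PI * (Rmin T (lg (d / 2)), s))) by ring.
    rewrite Cmod_Cexp; unfold Re; simpl. rewrite Rmult_0_l, Rminus_0_r.
    apply Rle_lt_trans with (exp (PI * lg (d / 2))); [apply exp_PI_le, Rmin_r|rewrite exp_lg; lra]. }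
  eapply Rle_lt_trans; [|apply (H _ M)]. eapply Rle_trans; [|apply re_le_Cmod].
  right; f_equal; unfold chart, Re; simpl; ring.
Qed.

Lemma U_limit_infty (e T : R) : 0 < e -> exists s, T <= s /\ Rabs (U 0 s - Re (x i2)) <= e.
Proof.
  intros He.
  destruct (dc_infty _ _ _ Hg e He) as [M HM].
  exists (Rmax T (lg (Rabs M + 1))); split; [apply Rmax_l|].
  apply (section_mean_close _ (ccontinuous_chart x z4 g Hg 0)).
  intros s _; left.
  assert (L : M < Cmod (RtoC 0 + Cexp (RtoC PI * (Rmax T (lg (Rabs M + 1)), s)))).
  { replace (RtoC 0 + Cexp (RtoC PI * (Rmax T (lg (Rabs M + 1)), s)))%C with (Cexp (RtoC PI * (Rmax T (lg (Rabs M + 1)), s))) by ring.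
    rewrite Cmod_Cexp; unfold Re; simpl. rewrite Rmult_0_l, Rminus_0_r.
    pose proof (Rle_abs M); pose proof (Rabs_pos M).
    apply Rlt_le_trans with (exp (PI * lg (Rabs M + 1))); [rewrite exp_lg; lra|apply exp_PI_le, Rmax_r]. }
  eapply Rle_lt_trans; [|apply (HM _ L)]. eapply Rle_trans; [|apply re_le_Cmod].
  right; f_equal; unfold chart, Re; simpl; ring.
Qed.

(** Tracking can be started at arbitrarily small radii, where [U] is as close to [P] as desired.
    Since [k < 0], the initial deviation is not amplified and only the tracking error is left. *)
Lemma pinned_center (c T t P k : R) (i j : index) :
  t <= T -> a (next j) <> a (next i) ->
  (a (next j) - a (next i)) * P + (b (next j) - b (next i)) = 0 ->
  (forall r, r < T -> arc z4 i (c + exp (PI * r)) /\ arc z4 j (c - exp (PI * r))) ->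
  k = eps * (a (next j) - a (next i)) -> k < 0 -> Re (g (RtoC c)) = P ->
  Rabs (U c t - P) <= 2 * track_err.
Proof.
  intros Ht N HP Harc Hk Kn Hc.
  apply le_epsilon; intros e He.
  destruct (U_limit_center c e t He) as [s [Hs Es]]; rewrite Hc in Es.
  pose proof (tracking c s t P k i j Hs N HP (fun r Hr => Harc r ltac:(lra)) Hk) as Tr.
  assert (X : exp (k * (t - s)) <= 1) by (rewrite <- exp_0; apply exp_le; nra).
  pose proof (exp_pos (k * (t - s))) as X0; pose proof track_err_pos as TE.
  assert (Q : Rabs ((U c s - P) * exp (k * (t - s))) <= e).
  { rewrite Rabs_mult, (Rabs_pos_eq (exp _)) by lra. pose proof (Rabs_pos (U c s - P)); nra. }
  assert (track_err * (1 + exp (k * (t - s))) <= 2 * track_err) by nra.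
  apply Rabs_le_between in Tr; apply Rabs_le_between in Q; apply Rabs_le; lra.
Qed.

(** The same at infinity: tracking starts at large radii and runs backward, so the contracting sign
    is [0 < k]. *)
Lemma pinned_infty (T s P k : R) (i j : index) :
  T <= s -> a (next j) <> a (next i) ->
  (a (next j) - a (next i)) * P + (b (next j) - b (next i)) = 0 ->
  (forall r, T < r -> arc z4 i (0 + exp (PI * r)) /\ arc z4 j (0 - exp (PI * r))) ->
  k = eps * (a (next j) - a (next i)) -> 0 < k -> Re (x i2) = P ->
  Rabs (U 0 s - P) <= 2 * track_err.
Proof.
  intros Ht N HP Harc Hk Kn Hc.
  apply le_epsilon; intros e He.
  destruct (U_limit_infty e s He) as [t [Hs Es]]; rewrite Hc in Es.
  pose proof (tracking_backward 0 s t P k i j Hs N HP (fun r Hr => Harc r ltac:(lra)) Hk) as Tr.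
  assert (X : exp (- k * (t - s)) <= 1) by (rewrite <- exp_0; apply exp_le; nra).
  pose proof (exp_pos (- k * (t - s))) as X0; pose proof track_err_pos as TE.
  assert (Q : Rabs ((U 0 t - P) * exp (- k * (t - s))) <= e).
  { rewrite Rabs_mult, (Rabs_pos_eq (exp _)) by lra. pose proof (Rabs_pos (U 0 t - P)); nra. }
  assert (track_err * (1 + exp (- k * (t - s))) <= 2 * track_err) by nra.
  apply Rabs_le_between in Tr; apply Rabs_le_between in Q; apply Rabs_le; lra.
Qed.

End Ends.

(** * Gradient flow of quadratic functions *)

Lemma is_derive_within_eps (D : R -> Prop) (u : R -> R) (t l : R) :
  is_derive_within D u t l -> forall e, 0 < e -> exists d, 0 < d /\
  forall y, D y -> Rabs (y - t) < d -> Rabs (u y - u t - (y - t) * l) <= e * Rabs (y - t).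
Proof.
  intros [_ H] e He.
  assert (F : is_filter_lim (within D (locally t)) t).
  { intros P HP; unfold within; revert HP; apply filter_imp; auto. }
  destruct (H t F (mkposreal e He)) as [d Hd].
  exists d; split; [apply cond_pos|]; intros y Dy Hy; exact (Hd y Hy Dy).
Qed.

(** The product of [u - q] with the integrating factor [exp (m * r)] has derivative zero. *)
Lemma linear_flow_unique (D : R -> Prop) (u : R -> R) (m q s t : R) :
  s <= t -> (forall r, s <= r <= t -> D r) ->
  (forall r, D r -> is_derive_within D u r (- (m * (u r - q)))) ->
  u t - q = (u s - q) * exp (- m * (t - s)).
Proof.
  intros Hst HD Hu.
  destruct (Req_dec s t) as [<-|N]; [rewrite Rminus_diag, Rmult_0_r, exp_0; ring|].
  (* At an end of [D] the derivative is only one-sided. Freezing [u] outside [[s, t]] gives a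
     function continuous on the whole line and differentiable in the open interval, as the mean
     value theorem demands. *)
  pose (cl := fun r => Rmax s (Rmin r t)).
  assert (Icl : forall r, s <= cl r <= t) by (intros r; unfold cl, Rmax, Rmin; repeat destruct Rle_dec; lra).
  assert (Ecl : forall r, s <= r <= t -> cl r = r) by (intros r Hr; unfold cl, Rmax, Rmin; repeat destruct Rle_dec; lra).
  assert (Lcl : forall r r', Rabs (cl r - cl r') <= Rabs (r - r')).
  { intros r r'; unfold cl, Rmax, Rmin, Rabs; repeat destruct Rle_dec; repeat destruct Rcase_abs; lra. }
  pose (v := fun r => u (cl r)).
  assert (Cv : forall r, continuous v r).
  { intros r P [e HP].
    destruct (is_derive_within_eps D u (cl r) _ (Hu _ (HD _ (Icl r))) 1 Rlt_0_1) as [d [Hd H]].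
    set (l := - (m * (u (cl r) - q))) in *.
    assert (Hl : 0 < Rabs l + 1) by (pose proof (Rabs_pos l); lra).
    assert (Hd2 : 0 < Rmin d (e / (Rabs l + 1))) by (apply Rmin_pos; [exact Hd|apply Rdiv_lt_0_compat; [apply cond_pos|exact Hl]]).
    exists (mkposreal _ Hd2); intros y Hy; apply HP.
    assert (Hy' : Rabs (y - r) < Rmin d (e / (Rabs l + 1))) by exact Hy.
    pose proof (Rmin_l d (e / (Rabs l + 1))); pose proof (Rmin_r d (e / (Rabs l + 1))).
    pose proof (Lcl y r) as L.
    specialize (H (cl y) (HD _ (Icl y)) ltac:(lra)).
    change (Rabs (u (cl y) - u (cl r)) < e).
    replace (u (cl y) - u (cl r)) with ((u (cl y) - u (cl r) - (cl y - cl r) * l) + (cl y - cl r) * l) by ring.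
    eapply Rle_lt_trans; [apply Rabs_triang|]; rewrite Rabs_mult.
    apply Rle_lt_trans with (Rabs (cl y - cl r) * (Rabs l + 1)); [lra|].
    apply Rlt_le_trans with (e / (Rabs l + 1) * (Rabs l + 1)); [apply Rmult_lt_compat_r; lra|right; field; lra]. }
  assert (Dv : forall r, s < r < t -> is_derive v r (- (m * (v r - q)))).
  { intros r Hr; split; [apply is_linear_scal_l|].
    intros y Hy; apply (is_filter_lim_locally_unique (V := R_NormedModule)) in Hy; subst y.
    intros e.
    destruct (is_derive_within_eps D u r _ (Hu _ (HD r ltac:(lra))) e (cond_pos e)) as [d [Hd H]].
    assert (Hd2 : 0 < Rmin d (Rmin (r - s) (t - r))) by (repeat apply Rmin_pos; lra).
    exists (mkposreal _ Hd2); intros y Hy.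
    assert (Hy' : Rabs (y - r) < Rmin d (Rmin (r - s) (t - r))) by exact Hy.
    assert (M : Rmin d (Rmin (r - s) (t - r)) <= d /\ Rmin d (Rmin (r - s) (t - r)) <= r - s /\ Rmin d (Rmin (r - s) (t - r)) <= t - r).
    { unfold Rmin; repeat destruct Rle_dec; lra. }
    assert (Hyi : s <= y <= t) by (apply Rabs_lt_between in Hy'; lra).
    unfold v; rewrite (Ecl y Hyi), (Ecl r) by lra.
    apply H; [apply HD; exact Hyi|lra]. }
  pose (h := fun r => (v r - q) * exp (m * r)).
  destruct (MVT_gen h s t (fun _ => 0)) as [r [_ Er]].
  - intros r Hr; rewrite Rmin_left, Rmax_right in Hr by lra.
    unfold h; evar_last.
    + apply (is_derive_mult (K := R_AbsRing) (fun r => v r - q) (fun r => exp (m * r))); [|apply (is_derive_comp (K := R_AbsRing) (V := R_NormedModule) exp (fun r => m * r)); [apply is_derive_exp|]|apply Rmult_comm].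
      * apply (is_derive_minus (K := R_AbsRing) v (fun _ => q)); [apply Dv, Hr|apply (is_derive_const (K := R_AbsRing))].
      * apply (is_derive_scal (fun r => r)), (is_derive_id (K := R_AbsRing)).
    + unfold plus, mult, minus, zero, scal, opp, one, plus; simpl; unfold mult; simpl; ring.
  - intros r _; apply continuity_pt_filterlim.
    apply (continuous_Rmult (fun r => v r - q) (fun r => exp (m * r))).
    + apply (continuous_Rminus v (fun _ => q)); [apply Cv|apply continuous_const].
    + apply (ex_derive_continuous (fun r => exp (m * r))); auto_derive; auto.
  - unfold h, v in Er; rewrite (Ecl s), (Ecl t) in Er by lra.
    assert (E1 : (u t - q) * exp (m * t) = (u s - q) * exp (m * s)) by lra.
    assert (E2 : exp (- m * (t - s)) = exp (m * s) * exp (- (m * t))) by (rewrite <- exp_plus; f_equal; ring).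
    assert (E3 : exp (m * t) * exp (- (m * t)) = 1) by (rewrite <- exp_plus, Rplus_opp_r; apply exp_0).
    rewrite E2, <- Rmult_assoc, <- E1, Rmult_assoc, E3; ring.
Qed.

(** * Positions of the vertices of the quadrilateral and admissible gradient lines *)

Section Geometry.
Variables (a b p : index -> R) (x : index -> C).
Hypothesis Hxl : forall i, x i = (p i, a i * p i + b i).
Hypothesis Hxr : forall i, x i = (p i, a (next i) * p i + b (next i)).
Hypothesis Hx : convex_ccw_quadrilateral x.

Lemma vertex_line (i : index) : a i * p i + b i = a (next i) * p i + b (next i).
Proof. pose proof (Hxl i) as E; rewrite (Hxr i) in E; injection E; auto. Qed.

(** Vertices of index 0 are the ones at which the quadrilateral is locally monotone. *)
Lemma slope_sign (i : index) :
  0 < (p (next i) - p i) * (p (next (next i)) - p (next i)) * (a (next (next i)) - a (next i)).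
Proof.
  assert (H : 0 < orient (x i) (x (next i)) (x (next (next i)))) by (apply Hx; destruct i; discriminate).
  rewrite (Hxr i), (Hxl (next i)), (Hxl (next (next i))) in H.
  pose proof (vertex_line (next i)) as V.
  unfold orient, Re, Im in H; simpl in H.
  replace ((p (next i) - p i) * (p (next (next i)) - p (next i)) * (a (next (next i)) - a (next i)))
    with ((p (next i) - p i) * (a (next (next i)) * p (next (next i)) + b (next (next i)) - (a (next i) * p i + b (next i))) -
      (a (next i) * p (next i) + b (next i) - (a (next i) * p i + b (next i))) * (p (next (next i)) - p i)); [exact H|].
  replace (b (next (next i))) with (a (next i) * p (next i) + b (next i) - a (next (next i)) * p (next i)) by lra.
  ring.
Qed.

(** The diagonals cross, so an average of [p i1] and [p i3] equals an average of [p i2] and [p i4],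
    the weights being areas of the triangles that omit one vertex. When both diagonals point the
    same way, the initial points 1 and 2 must therefore lie on one side of both 3 and 4. *)
Lemma vertices_separated : (p i3 - p i1) * (p i4 - p i2) > 0 ->
  exists k, (k = 1 \/ k = -1) /\ forall i j, (i = i1 \/ i = i2) -> (j = i3 \/ j = i4) -> 0 < k * (p i - p j).
Proof.
  intros Hp.
  assert (H1 : 0 < orient (x i2) (x i3) (x i4)) by (apply (Hx i2 i4); discriminate).
  assert (H2 : 0 < orient (x i3) (x i4) (x i1)) by (apply (Hx i3 i1); discriminate).
  assert (H3 : 0 < orient (x i4) (x i1) (x i2)) by (apply (Hx i4 i2); discriminate).
  assert (H4 : 0 < orient (x i1) (x i2) (x i3)) by (apply (Hx i1 i3); discriminate).
  set (A1 := orient (x i2) (x i3) (x i4)) in *. set (A2 := orient (x i3) (x i4) (x i1)) in *.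
  set (A3 := orient (x i4) (x i1) (x i2)) in *. set (A4 := orient (x i1) (x i2) (x i3)) in *.
  assert (E1 : A1 * p i1 + A3 * p i3 = A2 * p i2 + A4 * p i4).
  { unfold A1, A2, A3, A4; rewrite !Hxl; unfold orient, Re, Im; simpl; ring. }
  assert (E2 : A1 + A3 = A2 + A4) by (unfold A1, A2, A3, A4, orient; ring).
  assert (K : forall y, A1 * (p i1 - y) + A3 * (p i3 - y) = A2 * (p i2 - y) + A4 * (p i4 - y)).
  { intros y; replace (A1 * (p i1 - y) + A3 * (p i3 - y)) with (A1 * p i1 + A3 * p i3 - (A1 + A3) * y) by ring.
    rewrite E1, E2; ring. }
  pose proof (K (p i1)) as K1; pose proof (K (p i2)) as K2; pose proof (K (p i3)) as K3; pose proof (K (p i4)) as K4.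
  rewrite Rminus_diag in K1, K2, K3, K4.
  assert (Pos : forall u v, 0 < u -> 0 <= v -> 0 <= u * v) by (intros; apply Rmult_le_pos; lra).
  assert (SPos : forall u v, 0 < u -> 0 < v -> 0 < u * v) by (intros; apply Rmult_lt_0_compat; lra).
  destruct (Rlt_dec (p i1) (p i3)) as [L|L].
  - assert (L2 : p i2 < p i4) by (apply (Rmult_lt_reg_l (p i3 - p i1)); lra).
    assert (L3 : p i2 < p i3).
    { apply Rnot_le_lt; intros F.
      pose proof (SPos A1 (p i3 - p i1) H1 ltac:(lra)); pose proof (Pos A2 (p i2 - p i3) H2 ltac:(lra)); pose proof (SPos A4 (p i4 - p i3) H4 ltac:(lra)). lra. }
    assert (L4 : p i1 < p i4).
    { apply Rnot_le_lt; intros F.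
      pose proof (Pos A1 (p i1 - p i4) H1 ltac:(lra)); pose proof (SPos A3 (p i3 - p i4) H3 ltac:(lra)); pose proof (SPos A2 (p i4 - p i2) H2 ltac:(lra)). lra. }
    exists (-1); split; [auto|]; intros i j [-> | ->] [-> | ->]; lra.
  - assert (L1 : p i3 < p i1) by (destruct (Req_dec (p i1) (p i3)) as [E|E]; [rewrite E in Hp; lra|lra]).
    assert (L2 : p i4 < p i2) by (apply (Rmult_lt_reg_l (p i1 - p i3)); lra).
    assert (L3 : p i3 < p i2).
    { apply Rnot_le_lt; intros F.
      pose proof (SPos A1 (p i1 - p i3) H1 ltac:(lra)); pose proof (Pos A2 (p i3 - p i2) H2 ltac:(lra)); pose proof (SPos A4 (p i3 - p i4) H4 ltac:(lra)). lra. }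
    assert (L4 : p i4 < p i1).
    { apply Rnot_le_lt; intros F.
      pose proof (Pos A1 (p i4 - p i1) H1 ltac:(lra)); pose proof (SPos A3 (p i4 - p i3) H3 ltac:(lra)); pose proof (SPos A2 (p i2 - p i4) H2 ltac:(lra)). lra. }
    exists 1; split; [auto|]; intros i j [-> | ->] [-> | ->]; lra.
Qed.

(** The flow of [f4 - f2] cannot run from the group {p2, p3} to the group {p4, p1}. *)
Lemma no_transverse_edge (k l : R) : (k = 1 \/ k = -1) ->
  (forall i j, (i = i1 \/ i = i2) -> (j = i3 \/ j = i4) -> 0 < k * (p i - p j)) ->
  0 < l -> a i4 <> a i2 ->
  let q := - (b i4 - b i2) / (a i4 - a i2) in
  (0 < a i2 - a i1 -> 0 < a i4 - a i3 -> p i1 - q = (p i3 - q) * exp (- (a i4 - a i2) * l) -> False) /\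
  (0 < a i3 - a i2 -> 0 < a i1 - a i4 -> p i4 - q = (p i2 - q) * exp (- (a i4 - a i2) * l) -> False).
Proof.
  intros Hk Hs Hl N q.
  set (c := a i4 - a i2) in *.
  assert (Hc : c <> 0) by (unfold c; lra).
  assert (Hq : forall y, c * y + (b i4 - b i2) = c * (y - q)) by (intros; unfold q; field; exact Hc).
  (* A flow line in positive time never moves against its velocity [- c * (y - q)]. *)
  assert (Dir : forall y z, z - q = (y - q) * exp (- c * l) -> c * (y - q) * (z - y) <= 0).
  { intros y z E; replace (z - y) with ((z - q) - (y - q)) by ring; rewrite E.
    replace (c * (y - q) * ((y - q) * exp (- c * l) - (y - q))) with (- ((y - q) * (y - q) * (c * (1 - exp (- c * l))))) by ring.
    assert (S1 : 0 <= (y - q) * (y - q)) by apply Rle_0_sqr.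
    assert (S2 : 0 <= c * (1 - exp (- c * l))).
    { destruct (Rlt_dec 0 c) as [P|P].
      - pose proof (Rmult_lt_0_compat _ _ P Hl).
        assert (exp (- c * l) <= 1) by (rewrite <- exp_0; apply exp_le; lra). apply Rmult_le_pos; lra.
      - assert (0 <= - c * l) by (apply Rmult_le_pos; lra).
        assert (1 <= exp (- c * l)) by (rewrite <- exp_0 at 1; apply exp_le; lra).
        replace (c * (1 - exp (- c * l))) with (- c * (exp (- c * l) - 1)) by ring. apply Rmult_le_pos; lra. }
    pose proof (Rmult_le_pos _ _ S1 S2); lra. }
  assert (O1 : 0 < orient (x i1) (x i2) (x i3)) by (apply (Hx i1 i3); discriminate).
  assert (O2 : 0 < orient (x i3) (x i4) (x i2)) by (apply (Hx i3 i2); discriminate).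
  rewrite (Hxr i1), (Hxl i2), (Hxr i3) in O1; rewrite (Hxr i3), (Hxl i4), (Hxl i2) in O2.
  unfold orient, Re, Im in O1, O2; simpl in O1, O2.
  (* [x i1] and [x i2] lie on the second line and [x i3] on the fourth, so this orientation is the
     width of the edge times the gap between these two lines at [p i3], that is, the gradient of
     [f4 - f2] there. *)
  assert (O1' : 0 < (p i2 - p i1) * (c * (p i3 - q))) by (rewrite <- Hq; unfold c; lra).
  assert (O2' : (p i4 - p i3) * (c * (p i2 - q)) < 0) by (rewrite <- Hq; unfold c; lra).
  pose proof (Hs i1 i3 ltac:(auto) ltac:(auto)) as S13; pose proof (Hs i1 i4 ltac:(auto) ltac:(auto)) as S14.
  pose proof (Hs i2 i3 ltac:(auto) ltac:(auto)) as S23; pose proof (Hs i2 i4 ltac:(auto) ltac:(auto)) as S24.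
  pose proof (slope_sign i4) as G1; pose proof (slope_sign i3) as G4; simpl in G1, G4.
  split.
  - intros M1 _ E; specialize (Dir _ _ E).
    assert (G1' : 0 < (p i1 - p i4) * (p i2 - p i1)) by (apply (Rmult_lt_reg_r (a i2 - a i1)); [exact M1|lra]).
    assert (T : 0 < (p i1 - p i3) * (p i2 - p i1)).
    { destruct Hk as [-> | ->].
      - apply Rmult_lt_0_compat; [lra|]; apply (Rmult_lt_reg_l (p i1 - p i4)); lra.
      - replace ((p i1 - p i3) * (p i2 - p i1)) with ((p i3 - p i1) * (p i1 - p i2)) by ring.
        apply Rmult_lt_0_compat; [lra|]; apply (Rmult_lt_reg_l (p i4 - p i1)); lra. }
    pose proof (Rmult_lt_0_compat _ _ O1' T) as T1.
    assert (T2 : 0 <= (p i2 - p i1) * (p i2 - p i1) * - (c * (p i3 - q) * (p i1 - p i3))).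
    { apply Rmult_le_pos; [apply Rle_0_sqr|lra]. }
    lra.
  - intros _ M4 E; specialize (Dir _ _ E).
    assert (G4' : 0 < (p i4 - p i3) * (p i1 - p i4)) by (apply (Rmult_lt_reg_r (a i1 - a i4)); [exact M4|lra]).
    assert (T : 0 < (p i4 - p i3) * (p i2 - p i4)).
    { destruct Hk as [-> | ->].
      - apply Rmult_lt_0_compat; [|lra]; apply (Rmult_lt_reg_r (p i1 - p i4)); lra.
      - replace ((p i4 - p i3) * (p i2 - p i4)) with ((p i3 - p i4) * (p i4 - p i2)) by ring.
        apply Rmult_lt_0_compat; [|lra]; apply (Rmult_lt_reg_r (p i4 - p i1)); lra. }
    assert (O2'' : 0 < - ((p i4 - p i3) * (c * (p i2 - q)))) by lra.
    pose proof (Rmult_lt_0_compat _ _ O2'' T) as T1.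
    assert (T2 : 0 <= (p i4 - p i3) * (p i4 - p i3) * - (c * (p i2 - q) * (p i4 - p i2))).
    { apply Rmult_le_pos; [apply Rle_0_sqr|lra]. }
    lra.
Qed.
End Geometry.

(** * Asymptotics of the Schwarz-Christoffel maps *)

Definition small (P : R -> Prop) : Prop := exists e0, 0 < e0 /\ forall eps, 0 < eps < e0 -> P eps.

Lemma small_and (P Q : R -> Prop) : small P -> small Q -> small (fun e => P e /\ Q e).
Proof.
  intros [e1 [H1 K1]] [e2 [H2 K2]]; exists (Rmin e1 e2); split; [apply Rmin_pos; assumption|].
  intros e He; pose proof (Rmin_l e1 e2); pose proof (Rmin_r e1 e2); split; [apply K1|apply K2]; lra.
Qed.

Lemma small_imp (P Q : R -> Prop) : (forall e, 0 < e -> P e -> Q e) -> small P -> small Q.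
Proof. intros H [e1 [H1 K1]]; exists e1; split; [exact H1|]; intros e He; apply H; [lra|apply K1, He]. Qed.

Lemma small_linear (c eta : R) : 0 < eta -> small (fun e => c * e <= eta).
Proof.
  intros He; exists (eta / (Rabs c + 1)); pose proof (Rabs_pos c); pose proof (Rle_abs c).
  split; [apply Rdiv_lt_0_compat; lra|]; intros e [E1 E2].
  apply (Rmult_lt_compat_r (Rabs c + 1)) in E2; [|lra].
  unfold Rdiv in E2; rewrite Rmult_assoc, Rinv_l, Rmult_1_r in E2 by lra. nra.
Qed.

Lemma small_lt (e0 : R) : 0 < e0 -> small (fun e => e < e0).
Proof. intros H; exists e0; split; [exact H|]; intros e He; lra. Qed.

(** [K] brings the barrier cost [6 * M / K] below a quarter of the tolerance; [/ (2 * K)] is the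
    normalised radius at which the description by the hub takes over. *)
Lemma thick_annulus (M eta : R) : 0 < M -> 0 < eta ->
  exists K, 1 <= K /\ 6 * M / K <= eta / 4 /\ 0 < / (2 * K) <= 1 / 2.
Proof.
  intros HM He; exists (Rmax 1 (24 * M / eta)).
  pose proof (Rmax_l 1 (24 * M / eta)) as HK; pose proof (Rmax_r 1 (24 * M / eta)) as Q.
  set (K := Rmax _ _) in *; split; [exact HK|split; [|split; [apply Rinv_0_lt_compat; lra|]]].
  - apply (Rle_div_l (6 * M) (eta / 4) K); [lra|].
    apply (Rmult_le_compat_l (eta / 4)) in Q; [|lra].
    replace (eta / 4 * (24 * M / eta)) with (6 * M) in Q by (field; lra). exact Q.
  - replace (1 / 2) with (/ 2) by field; apply Rinv_le_contravar; lra.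
Qed.

(** Gluing along an end, in terms of a normalised radius [rho] which is small near the
    vertex and of order 1 near the hub: [flow] describes the map up to [rho = 1 / (2 K)],
    and for larger [rho] both sides are close to the hub value [H]. *)
Lemma end_gluing (rho : R -> C -> R) (g : R -> C -> C) (m P H Lam M D : R) :
  0 <= Lam -> 0 <= D -> 0 < M ->
  (forall s t, s <= 0 -> t <= 0 -> Rabs (flow m P H s - flow m P H t) <= Lam * Rabs (s - t)) ->
  (forall K, 1 <= K -> small (fun eps => forall z, closed_upper z -> 0 < rho eps z <= / (2 * K) ->
     Rabs (Re (g eps z) - flow m P H (eps * lg (rho eps z))) <= D * eps + Lam * eps * lg K + 6 * M / K)) ->
  (forall d eta, 0 < d <= 1 / 2 -> 0 < eta -> small (fun eps => forall z, closed_upper z -> d <= rho eps z <= 1 / 2 ->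
     Rabs (Re (g eps z) - H) <= eta)) ->
  forall delta eta, 0 < delta <= 1 / 2 -> 0 < eta -> small (fun eps => forall z, closed_upper z -> 0 < rho eps z <= delta ->
     Rabs (Re (g eps z) - flow m P H (eps * (lg (rho eps z) - lg delta))) <= eta).
Proof.
  intros HL HD HM Lip Near Hub delta eta Hd He.
  destruct (thick_annulus M eta HM He) as (K & HK1 & HK2 & HK3).
  assert (Ldl : lg delta <= 0) by (rewrite <- lg_1; apply lg_le; lra).
  assert (F0 : flow m P H 0 = H) by (unfold flow; rewrite Rmult_0_r, exp_0; ring).
  generalize (small_and _ _ (Near K HK1) (small_and _ _ (Hub (/ (2 * K)) (eta / 2) HK3 ltac:(lra))
    (small_and _ _ (small_linear D (eta / 4) ltac:(lra)) (small_and _ _ (small_linear (Lam * lg K) (eta / 4) ltac:(lra))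
      (small_and _ _ (small_linear (Lam * - lg delta) (eta / 4) ltac:(lra)) (small_linear (Lam * lg (2 * K)) (eta / 4) ltac:(lra))))))).
  apply small_imp; intros eps Heps (N & Hb & E1 & E2 & E3 & E4) z Hz Hr.
  assert (Lr : lg (rho eps z) <= lg delta) by (apply lg_le; lra).
  pose proof (Lip (eps * lg (rho eps z)) (eps * (lg (rho eps z) - lg delta)) ltac:(nra) ltac:(nra)) as L.
  replace (eps * lg (rho eps z) - eps * (lg (rho eps z) - lg delta)) with (- (eps * - lg delta)) in L by ring.
  rewrite Rabs_Ropp, (Rabs_pos_eq (eps * - lg delta)) in L by (apply Rmult_le_pos; lra).
  destruct (Rle_dec (rho eps z) (/ (2 * K))) as [Q|Q].
  - specialize (N z Hz ltac:(lra)).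
    apply Rabs_le_between in N; apply Rabs_le_between in L; apply Rabs_le; lra.
  - specialize (Hb z Hz ltac:(lra)).
    pose proof (Lip 0 (eps * (lg (rho eps z) - lg delta)) ltac:(lra) ltac:(nra)) as L2; rewrite F0 in L2.
    assert (G : - lg (2 * K) <= lg (rho eps z)) by (rewrite <- lg_inv by lra; apply lg_le; lra).
    rewrite (Rabs_pos_eq (0 - eps * (lg (rho eps z) - lg delta))) in L2 by nra.
    assert (Lam * (0 - eps * (lg (rho eps z) - lg delta)) <= Lam * (eps * lg (2 * K))).
    { apply Rmult_le_compat_l; [exact HL|]. nra. }
    apply Rabs_le_between in Hb; apply Rabs_le_between in L2; apply Rabs_le; lra.
Qed.

Lemma flow_lipschitz_neg (m P H s t : R) : m < 0 \/ H = P -> s <= 0 -> t <= 0 ->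
  Rabs (flow m P H s - flow m P H t) <= Rabs (H - P) * Rabs m * Rabs (s - t).
Proof.
  intros Hm Hs Ht; destruct Hm as [Hm|Hm].
  - replace (Rabs (H - P) * Rabs m) with (Rabs (H - P) * (1 * Rabs m)) by ring.
    apply flow_lipschitz; [lra| |]; rewrite <- exp_0; apply exp_le; nra.
  - unfold flow; rewrite Hm, Rminus_diag, Rabs_R0, !Rmult_0_l, Rminus_diag, Rabs_R0; lra.
Qed.

Lemma flow_bounded_neg (m P H t : R) : m < 0 \/ H = P -> t <= 0 -> Rabs (flow m P H t) <= Rabs P + Rabs (H - P).
Proof.
  intros Hm Ht; unfold flow; eapply Rle_trans; [apply Rabs_triang|]; apply Rplus_le_compat_l.
  destruct Hm as [Hm|Hm].
  - rewrite Rabs_mult, (Rabs_pos_eq (exp _)) by (left; apply exp_pos).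
    rewrite <- (Rmult_1_r (Rabs (H - P))) at 2; apply Rmult_le_compat_l; [apply Rabs_pos|].
    rewrite <- exp_0; apply exp_le; nra.
  - rewrite Hm, Rminus_diag, Rmult_0_l; lra.
Qed.

(** [V] is a section mean along an end, normalised so that the hub is at abscissa 0. *)
Lemma end_profile (V : R -> R) (m P H eps E D t0 t : R) :
  0 < eps -> t <= t0 -> t0 <= 0 -> 0 <= E -> 0 <= D ->
  (0 < m /\ H = P /\ Rabs (V t - P) <= E) \/
  (m < 0 /\ Rabs ((V t - P) - (V t0 - P) * exp (- m * (eps * t - eps * t0))) <= E) ->
  Rabs (V t0 - H) <= D ->
  Rabs (V t - flow m P H (eps * t)) <= E + D + Rabs (H - P) * Rabs m * (eps * - t0).
Proof.
  intros He Ht Ht0 HE HD [[Hm [-> HV]]|[Hm HV]] HD0.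
  - unfold flow; rewrite Rminus_diag, Rabs_R0, !Rmult_0_l, Rplus_0_r; lra.
  - pose proof (flow_from_base m P H (V t) (V t0) (eps * t) (eps * t0) E 1 ltac:(lra) HV) as F.
    lapply F; [clear F; intros F|rewrite <- exp_0; apply exp_le].
    2:{ assert (0 <= - m * (eps * - t)) by (apply Rmult_le_pos; [lra|apply Rmult_le_pos; lra]). lra. }
    lapply F; [clear F; intros F|rewrite <- exp_0; apply exp_le].
    2:{ assert (0 <= - m * (eps * (t0 - t))) by (apply Rmult_le_pos; [lra|apply Rmult_le_pos; lra]). lra. }
    rewrite !Rmult_1_l in F.
    replace (Rabs (eps * t0)) with (eps * - t0) in F by (rewrite Rabs_mult, (Rabs_pos_eq eps), Rabs_left1; lra).
    lra.
Qed.

(** In [annulus_estimate] the reference value is a constant. The profile [F] is frozen at [lg r],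
    and its variation over the annulus is the term [Lm * lg K]. *)
Lemma near_profile (g : C -> C) (c r K D0 Lm M : R) (F : R -> R) (z : C) :
  ccontinuous g -> (forall z, upper z -> cderivable g z) ->
  0 < r -> 1 <= K -> 0 <= D0 -> 0 <= Lm -> 1 / 2 <= M ->
  (forall z, closed_upper z -> Rabs (Re (g z) - F (lg r)) <= M) ->
  (forall t, lg r - lg K <= t <= lg r + lg K -> Rabs (F t - F (lg r)) <= Lm * Rabs (t - lg r)) ->
  (forall y, r / K <= Rabs (y - c) <= r * K -> Rabs (Re (g (RtoC y)) - F (lg (Rabs (y - c)))) <= D0) ->
  closed_upper z -> Cmod (z - RtoC c) = r ->
  Rabs (Re (g z) - F (lg r)) <= D0 + Lm * lg K + 6 * M / K.
Proof.
  intros gC gD Hr HK HD HL HM Hb HF Hbd Hz Hzr.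
  assert (LK : 0 <= lg K) by (rewrite <- lg_1; apply lg_le; lra).
  apply (annulus_estimate g gC gD c r K (F (lg r)) (D0 + Lm * lg K) M z); auto.
  { assert (0 <= Lm * lg K) by (apply Rmult_le_pos; lra); lra. }
  intros y Hy; specialize (Hbd y Hy).
  assert (P1 : 0 < r / K) by (apply Rdiv_lt_0_compat; lra).
  assert (L1 : lg r - lg K <= lg (Rabs (y - c))) by (rewrite <- lg_div by lra; apply lg_le; lra).
  assert (L2 : lg (Rabs (y - c)) <= lg r + lg K) by (rewrite <- lg_mult by lra; apply lg_le; lra).
  specialize (HF (lg (Rabs (y - c))) ltac:(lra)).
  assert (Q : Lm * Rabs (lg (Rabs (y - c)) - lg r) <= Lm * lg K).
  { apply Rmult_le_compat_l; [exact HL|]; apply Rabs_le; lra. }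
  apply Rabs_le_between in Hbd; apply Rabs_le_between in HF; apply Rabs_le; lra.
Qed.

(** * Uniform estimates for the family: hubs, ends and neck *)

Section Family.
Variables (a b p : index -> R) (x : R -> index -> C) (z4 : R -> R) (G : R -> C -> C) (C0 M0 A : R).
Hypothesis Hxl : forall eps, 0 < eps -> forall i, x eps i = (p i, eps * (a i * p i + b i)).
Hypothesis Hxr : forall eps, 0 < eps -> forall i, x eps i = (p i, eps * (a (next i) * p i + b (next i))).
Hypothesis Hx : forall eps, 0 < eps -> convex_ccw_quadrilateral (x eps).
Hypothesis Hg : forall eps, 0 < eps -> disc_chart (x eps) (z4 eps) (G eps).
Hypothesis HB : forall eps, 0 < eps -> forall z, Rabs (Im (G eps z)) <= eps * C0.
Hypothesis HM : forall eps, 0 < eps -> forall z, closed_upper z -> Rabs (Re (G eps z)) <= M0.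
Hypothesis HA : forall i, Rabs (a i) <= A.
Hypothesis Hpl : forall i, (a (next i) - a i) * p i + (b (next i) - b i) = 0.
Variables (kap : R).
Hypothesis Hkap : kap = 1 \/ kap = -1.
Hypothesis Hsep : forall i j, (i = i1 \/ i = i2) -> (j = i3 \/ j = i4) -> 0 < kap * (p i - p j).
Variables (H H' : R).
Hypothesis HH : (H = p i1 /\ a i1 < a i2) \/ (H = p i2 /\ a i2 < a i3).
Hypothesis HH' : (H' = p i3 /\ a i3 < a i4) \/ (H' = p i4 /\ a i4 < a i1).
Hypothesis Ha : forall i, a (next i) <> a i.
Hypothesis Hsel : forall i, (i = i1 \/ i = i2) -> a i < a (next i) -> H = p i.
Hypothesis Hsel' : forall i, (i = i3 \/ i = i4) -> a i < a (next i) -> H' = p i.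

Notation edge_lemma L h := (L a b p _ _ _ _ _ (Hxl _ h) (Hxr _ h) (Hx _ h) (Hg _ h) (HB _ h)).
Notation track_lemma L h := (L a b p _ _ _ _ _ h (Hxl _ h) (Hxr _ h) (Hx _ h) (Hg _ h) (HB _ h) A HA).

Let WC := window_const.
Notation U eps := (U (G eps)).
Notation err eps := (track_err eps (eps * C0) A).

Lemma C0_pos : 0 <= C0.
Proof.
  pose proof (HB 1 Rlt_0_1 0) as K; pose proof (Rabs_pos (Im (G 1 0))); lra.
Qed.

Lemma M0_pos : 0 <= M0.
Proof.
  eapply Rle_trans; [apply Rabs_pos|apply (HM 1 Rlt_0_1 0)]. right; reflexivity.
Qed.

Lemma A_pos : 0 <= A.
Proof. eapply Rle_trans; [apply Rabs_pos|apply (HA i1)]. Qed.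

(** Twice the tracking constant; for [eps < 1] the quadratic error is bounded by this multiple of
    [eps]. *)
Definition err_const : R := 24 * A * C0.

Lemma err_const_pos : 0 <= err_const.
Proof. unfold err_const; pose proof A_pos; pose proof C0_pos; assert (0 <= A * C0) by (apply Rmult_le_pos; lra); lra. Qed.

Lemma err_le (eps : R) : 0 < eps < 1 -> 2 * err eps <= err_const * eps.
Proof.
  intros He; unfold track_err, err_const; pose proof A_pos; pose proof C0_pos.
  assert (0 <= A * C0) by (apply Rmult_le_pos; lra).
  replace (2 * (12 * A * (eps * (eps * C0)))) with (24 * (A * C0) * eps * eps) by ring.
  replace (24 * A * C0 * eps) with (24 * (A * C0) * eps * 1) by ring.
  apply Rmult_le_compat_l; [apply Rmult_le_pos; lra|lra].
Qed.

(** Points of edges 1 and 3 are averages of the vertices 1, 2 and 3, 4 respectively, so the gap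
    between the two groups persists for all pairs of points and [modulus_bound] applies. *)
Lemma small_z4 (eta : R) : 0 < eta -> small (fun eps => z4 eps <= eta).
Proof.
  intros He.
  set (gap := Rmin (Rmin (kap * (p i1 - p i3)) (kap * (p i1 - p i4))) (Rmin (kap * (p i2 - p i3)) (kap * (p i2 - p i4)))).
  assert (Hgap : 0 < gap) by (unfold gap; repeat apply Rmin_pos; apply Hsep; auto).
  assert (Gl : gap <= kap * (p i1 - p i3) /\ gap <= kap * (p i1 - p i4) /\ gap <= kap * (p i2 - p i3) /\ gap <= kap * (p i2 - p i4)).
  { unfold gap, Rmin; repeat destruct Rle_dec; lra. }
  generalize (small_linear (2 * C0 * PI / gap) eta He); apply small_imp; intros eps Heps L.
  assert (Q : z4 eps * gap <= 2 * (eps * C0) * PI).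
  { apply (modulus_bound (x eps) (z4 eps) (G eps) (eps * C0) (Hg eps Heps) (HB eps Heps) gap kap Hgap Hkap).
    intros s t Hs Ht.
    destruct (arc_between a b p eps (x eps) (z4 eps) (G eps) (Hxl eps Heps) (Hx eps Heps) (Hg eps Heps) i1 s Hs) as [u [Hu ->]].
    destruct (arc_between a b p eps (x eps) (z4 eps) (G eps) (Hxl eps Heps) (Hx eps Heps) (Hg eps Heps) i3 t Ht) as [v [Hv ->]].
    simpl.
    replace (kap * (p i1 + u * (p i2 - p i1) - (p i3 + v * (p i4 - p i3)))) with
      ((1 - u) * ((1 - v) * (kap * (p i1 - p i3)) + v * (kap * (p i1 - p i4))) + u * ((1 - v) * (kap * (p i2 - p i3)) + v * (kap * (p i2 - p i4)))) by ring.
    assert (T1 : gap <= (1 - v) * (kap * (p i1 - p i3)) + v * (kap * (p i1 - p i4))) by nra.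
    assert (T2 : gap <= (1 - v) * (kap * (p i2 - p i3)) + v * (kap * (p i2 - p i4))) by nra.
    nra. }
  apply Rle_trans with (2 * C0 * PI / gap * eps); [|exact L].
  apply (Rmult_le_reg_r gap); [exact Hgap|].
  replace (2 * C0 * PI / gap * eps * gap) with (2 * (eps * C0) * PI) by (field; lra). exact Q.
Qed.

Lemma small_setup (eta : R) : 0 < eta -> small (fun eps => eps < 1 /\ z4 eps <= 1 / 10 /\ z4 eps <= eta).
Proof.
  intros He; apply small_and; [apply small_lt; lra|apply small_and; apply small_z4; lra].
Qed.

(** The five strips are half circles about 1, large ones about 0 (for infinity), small ones about 0,
    small ones about [z4], and those about 0 with radius between [z4] and 1 for the neck. In each,
    the first arc is the lower edge and the second the upper edge. *)
Lemma arcs_1 (eps : R) (r : R) : 0 < eps -> r < lg (1 - z4 eps) ->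
  arc (z4 eps) i1 (1 + exp (PI * r)) /\ arc (z4 eps) i4 (1 - exp (PI * r)).
Proof.
  intros He Hr; pose proof (dc_range _ _ _ (Hg eps He)); pose proof (exp_pos (PI * r)).
  apply exp_PI_lt in Hr; rewrite exp_lg in Hr by lra; simpl; lra.
Qed.

Lemma arcs_2 (eps : R) (r : R) : 0 < r ->
  arc (z4 eps) i1 (0 + exp (PI * r)) /\ arc (z4 eps) i2 (0 - exp (PI * r)).
Proof.
  intros Hr; rewrite <- lg_1 in Hr; apply exp_PI_lt in Hr; rewrite exp_lg in Hr by lra; simpl; lra.
Qed.

Lemma arcs_3 (eps : R) (r : R) : 0 < eps -> r < lg (z4 eps) ->
  arc (z4 eps) i3 (0 + exp (PI * r)) /\ arc (z4 eps) i2 (0 - exp (PI * r)).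
Proof.
  intros He Hr; pose proof (dc_range _ _ _ (Hg eps He)); pose proof (exp_pos (PI * r)).
  apply exp_PI_lt in Hr; rewrite exp_lg in Hr by lra; simpl; lra.
Qed.

Lemma arcs_4 (eps : R) (r : R) : 0 < eps -> z4 eps <= 1 / 10 -> r < lg (z4 eps) ->
  arc (z4 eps) i4 (z4 eps + exp (PI * r)) /\ arc (z4 eps) i3 (z4 eps - exp (PI * r)).
Proof.
  intros He Hz Hr; pose proof (dc_range _ _ _ (Hg eps He)); pose proof (exp_pos (PI * r)).
  apply exp_PI_lt in Hr; rewrite exp_lg in Hr by lra; simpl; lra.
Qed.

Lemma arcs_int (eps : R) (r : R) : 0 < eps -> lg (z4 eps) < r < 0 ->
  arc (z4 eps) i4 (0 + exp (PI * r)) /\ arc (z4 eps) i2 (0 - exp (PI * r)).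
Proof.
  intros He [H1 H2]; pose proof (dc_range _ _ _ (Hg eps He)); pose proof (exp_pos (PI * r)).
  apply exp_PI_lt in H1; rewrite exp_lg in H1 by lra.
  rewrite <- lg_1 in H2; apply exp_PI_lt in H2; rewrite exp_lg in H2 by lra; simpl; lra.
Qed.

Lemma pinned_1 (eps t : R) : 0 < eps < 1 -> t <= lg (1 - z4 eps) -> a i1 < a i2 ->
  Rabs (U eps 1 t - p i1) <= err_const * eps.
Proof.
  intros He Ht Hm; eapply Rle_trans; [|apply err_le; exact He].
  pose proof (proj1 He) as He'.
  apply (track_lemma pinned_center He' 1 (lg (1 - z4 eps)) t (p i1) (eps * (a i1 - a i2)) i1 i4); simpl; auto; try lra.
  - pose proof (Hpl i1); simpl in *; lra.
  - intros r Hr; apply arcs_1; auto.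
  - nra.
  - rewrite (dc_one _ _ _ (Hg eps He')), (Hxl eps He'); reflexivity.
Qed.

Lemma pinned_2 (eps t : R) : 0 < eps < 1 -> 0 <= t -> a i2 < a i3 ->
  Rabs (U eps 0 t - p i2) <= err_const * eps.
Proof.
  intros He Ht Hm; eapply Rle_trans; [|apply err_le; exact He].
  pose proof (proj1 He) as He'.
  apply (track_lemma pinned_infty He' 0 t (p i2) (eps * (a i3 - a i2)) i1 i2); simpl; auto; try lra.
  - pose proof (Hpl i2); simpl in *; lra.
  - intros r Hr; exact (arcs_2 eps r Hr).
  - nra.
  - rewrite (Hxl eps He'); reflexivity.
Qed.

Lemma pinned_3 (eps t : R) : 0 < eps < 1 -> t <= lg (z4 eps) -> a i3 < a i4 ->
  Rabs (U eps 0 t - p i3) <= err_const * eps.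
Proof.
  intros He Ht Hm; eapply Rle_trans; [|apply err_le; exact He].
  pose proof (proj1 He) as He'.
  apply (track_lemma pinned_center He' 0 (lg (z4 eps)) t (p i3) (eps * (a i3 - a i4)) i3 i2); simpl; auto; try lra.
  - pose proof (Hpl i3); simpl in *; lra.
  - intros r Hr; apply arcs_3; auto.
  - nra.
  - rewrite (dc_zero _ _ _ (Hg eps He')), (Hxl eps He'); reflexivity.
Qed.

Lemma pinned_4 (eps t : R) : 0 < eps < 1 -> z4 eps <= 1 / 10 -> t <= lg (z4 eps) -> a i4 < a i1 ->
  Rabs (U eps (z4 eps) t - p i4) <= err_const * eps.
Proof.
  intros He Hz Ht Hm; eapply Rle_trans; [|apply err_le; exact He].
  pose proof (proj1 He) as He'.
  apply (track_lemma pinned_center He' (z4 eps) (lg (z4 eps)) t (p i4) (eps * (a i4 - a i1)) i4 i3); simpl; auto; try lra.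
  - pose proof (Hpl i4); simpl in *; lra.
  - intros r Hr; apply arcs_4; auto.
  - nra.
  - rewrite (dc_z4 _ _ _ (Hg eps He')), (Hxl eps He'); reflexivity.
Qed.

(** The pinning error, one link between two charts, and the drift of [U] over a length of at most
    [lg 2]. *)
Definition hub_const : R := err_const + C0 * (2 * WC + 2 * lg 2).

Lemma lg2_pos : 0 < lg 2.
Proof. rewrite <- lg_1; apply lg_lt; lra. Qed.

Lemma lg_half : lg (1 / 2) = - lg 2.
Proof. rewrite lg_div, lg_1 by lra; ring. Qed.

Lemma hub_const_pos : 0 <= hub_const.
Proof.
  unfold hub_const; pose proof err_const_pos; pose proof C0_pos; pose proof lg2_pos; pose proof window_const_pos.
  assert (0 <= C0 * (2 * WC + 2 * lg 2)) by (apply Rmult_le_pos; unfold WC; lra). lra.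
Qed.

(** Only the mean in the chart of the vertex of index zero is pinned directly; the link transfers
    its value to the other chart of the hub, whose vertex has index one. *)
Lemma near_hub_values (eps : R) : 0 < eps < 1 -> z4 eps <= 1 / 10 ->
  Rabs (U eps 0 0 - H) <= hub_const * eps /\ Rabs (U eps 1 (lg (1 / 2)) - H) <= hub_const * eps.
Proof.
  intros He Hz; pose proof (proj1 He) as He'.
  pose proof (edge_lemma hub_1_link He' ltac:(lra)) as L1.
  pose proof (U_lipschitz _ _ _ _ (Hg eps He') (HB eps He') 0 0 (lg (1 / 2))) as L2.
  rewrite Rminus_0_r, lg_half, Rabs_Ropp, (Rabs_pos_eq (lg 2)) in L2 by (pose proof lg2_pos; lra).
  fold WC in L1; rewrite lg_half in *.
  assert (E : hub_const * eps = err_const * eps + (2 * (eps * C0) * WC + 2 * (eps * C0) * lg 2)) by (unfold hub_const; ring).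
  pose proof (dc_range _ _ _ (Hg eps He')).
  pose proof err_const_pos; pose proof C0_pos; pose proof lg2_pos; pose proof window_const_pos as WCp; fold WC in WCp.
  assert (0 <= 2 * (eps * C0) * WC) by (apply Rmult_le_pos; [apply Rmult_le_pos; [lra|apply Rmult_le_pos; lra]|lra]).
  assert (0 <= 2 * (eps * C0) * lg 2) by (apply Rmult_le_pos; [apply Rmult_le_pos; [lra|apply Rmult_le_pos; lra]|lra]).
  apply Rabs_le_between in L1; apply Rabs_le_between in L2.
  destruct HH as [[-> Hm]|[-> Hm]].
  - pose proof (pinned_1 eps (- lg 2) He) as P.
    lapply P; [clear P; intros P|rewrite <- lg_half; apply lg_le; lra].
    specialize (P Hm); apply Rabs_le_between in P; split; apply Rabs_le; lra.
  - pose proof (pinned_2 eps 0 He ltac:(lra) Hm) as P.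
    apply Rabs_le_between in P; split; apply Rabs_le; lra.
Qed.

Lemma far_hub_values (eps : R) : 0 < eps < 1 -> z4 eps <= 1 / 10 ->
  Rabs (U eps 0 (lg (z4 eps)) - H') <= hub_const * eps /\
  Rabs (U eps (z4 eps) (lg (1 / 2 * z4 eps)) - H') <= hub_const * eps.
Proof.
  intros He Hz; pose proof (proj1 He) as He'.
  pose proof (dc_range _ _ _ (Hg eps He')) as Hr.
  pose proof (edge_lemma hub_z4_link He' ltac:(lra)) as L1.
  pose proof (U_lipschitz _ _ _ _ (Hg eps He') (HB eps He') 0 (lg (z4 eps)) (lg (3 / 2 * z4 eps))) as L2.
  assert (Q : Rabs (lg (3 / 2 * z4 eps) - lg (z4 eps)) <= lg 2).
  { rewrite lg_mult by lra. replace (lg (3 / 2) + lg (z4 eps) - lg (z4 eps)) with (lg (3 / 2)) by ring.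
    rewrite Rabs_pos_eq; [apply lg_le; lra|rewrite <- lg_1; apply lg_le; lra]. }
  fold WC in L1.
  assert (E : hub_const * eps = err_const * eps + (2 * (eps * C0) * WC + 2 * (eps * C0) * lg 2)) by (unfold hub_const; ring).
  pose proof err_const_pos; pose proof C0_pos; pose proof lg2_pos; pose proof window_const_pos as WCp; fold WC in WCp.
  assert (0 <= 2 * (eps * C0) * WC) by (apply Rmult_le_pos; [apply Rmult_le_pos; [lra|apply Rmult_le_pos; lra]|lra]).
  assert (BP : 0 <= 2 * (eps * C0)) by (apply Rmult_le_pos; [lra|apply Rmult_le_pos; lra]).
  apply (Rmult_le_compat_l _ _ _ BP) in Q.
  assert (0 <= 2 * (eps * C0) * lg 2) by (apply Rmult_le_pos; [apply Rmult_le_pos; [lra|apply Rmult_le_pos; lra]|lra]).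
  apply Rabs_le_between in L1; apply Rabs_le_between in L2.
  destruct HH' as [[-> Hm]|[-> Hm]].
  - pose proof (pinned_3 eps (lg (z4 eps)) He ltac:(lra) Hm) as P.
    apply Rabs_le_between in P; split; apply Rabs_le; lra.
  - pose proof (pinned_4 eps (lg (1 / 2 * z4 eps)) He Hz) as P.
    lapply P; [clear P; intros P|apply lg_le; lra].
    specialize (P Hm); apply Rabs_le_between in P; split; apply Rabs_le; lra.
Qed.

Lemma Re_minus_bound (eps k K : R) (z : C) : 0 < eps -> closed_upper z -> Rabs k <= K -> Rabs (Re (G eps z) - k) <= M0 + K + 1.
Proof.
  intros He Hz Hk; pose proof (HM eps He z Hz) as B1.
  apply Rabs_le_between in B1; apply Rabs_le_between in Hk; apply Rabs_le; lra.
Qed.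

Lemma fine_scale (d eta M : R) : 0 < d <= 1 / 2 -> 0 < eta -> 0 < M ->
  exists d', 0 < d' <= d /\ 6 * M * (d' / d) <= eta / 2.
Proof.
  intros Hd He HM'.
  exists (d * Rmin 1 (eta / (12 * M))).
  assert (P : 0 < Rmin 1 (eta / (12 * M))) by (apply Rmin_pos; [lra|apply Rdiv_lt_0_compat; lra]).
  pose proof (Rmin_l 1 (eta / (12 * M))); pose proof (Rmin_r 1 (eta / (12 * M))) as Q.
  split; [split; [apply Rmult_lt_0_compat; lra|]|].
  - rewrite <- (Rmult_1_r d) at 2; apply Rmult_le_compat_l; lra.
  - replace (d * Rmin 1 (eta / (12 * M)) / d) with (Rmin 1 (eta / (12 * M))) by (field; lra).
    apply (Rmult_le_compat_l (6 * M)) in Q; [|lra].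
    replace (6 * M * (eta / (12 * M))) with (eta / 2) in Q by (field; lra). exact Q.
Qed.

(** The boundary estimate is made at a finer scale [d'], chosen before [eps], so that the cost
    [6 * M * (d' / d)] of the uncontrolled neighbourhoods of the marked points is at most half the
    tolerance. *)
Lemma near_hub (d eta : R) : 0 < d <= 1 / 2 -> 0 < eta ->
  small (fun eps => forall z, closed_upper z -> d <= Cmod z <= / d -> d <= Cmod (z - 1) ->
    Rabs (Re (G eps z) - H) <= eta).
Proof.
  intros Hd He; pose proof M0_pos as HM0; pose proof (Rabs_pos H).
  set (M := M0 + Rabs H + 1).
  destruct (fine_scale d eta M Hd He ltac:(unfold M; lra)) as [d' [Hd' Hs]].
  generalize (small_and _ _ (small_setup (d' / 2) ltac:(lra)) (small_and _ _ (small_linear hub_const (eta / 4) ltac:(lra))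
    (small_linear (C0 * (3 * WC - 4 * lg d')) (eta / 4) ltac:(lra)))).
  apply small_imp; intros eps Heps ((E1 & E2 & E3) & E4 & E5) z Hz Hz1 Hz2.
  apply Rle_trans with (eta / 2 + 6 * M * (d' / d)); [|lra].
  apply (hub_estimate (G eps) (dc_continuous _ _ _ (Hg eps Heps)) (dc_derivable _ _ _ (Hg eps Heps)) 1 d d' H (eta / 2) M z);
    auto; try lra.
  - unfold M; lra.
  - intros z' Hz'; apply Re_minus_bound; auto; lra.
  - intros y Hy1 Hy2; rewrite !Rmult_1_r in *; unfold Rdiv in Hy1; rewrite Rmult_1_l in Hy1.
    pose proof (edge_lemma hub_1 Heps d' y ltac:(lra) ltac:(lra) ltac:(lra) Hy1 Hy2) as B1; fold WC in B1.
    pose proof (proj1 (near_hub_values eps ltac:(lra) E2)) as B2.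
    apply Rabs_le_between in B1; apply Rabs_le_between in B2; apply Rabs_le; lra.
Qed.

Lemma far_hub (d eta : R) : 0 < d <= 1 / 2 -> 0 < eta ->
  small (fun eps => forall z, closed_upper z -> d * z4 eps <= Cmod z <= z4 eps / d -> d * z4 eps <= Cmod (z - RtoC (z4 eps)) ->
    Rabs (Re (G eps z) - H') <= eta).
Proof.
  intros Hd He; pose proof M0_pos as HM0; pose proof (Rabs_pos H').
  set (M := M0 + Rabs H' + 1).
  destruct (fine_scale d eta M Hd He ltac:(unfold M; lra)) as [d' [Hd' Hs]].
  generalize (small_and _ _ (small_setup (d' / 2) ltac:(lra)) (small_and _ _ (small_linear hub_const (eta / 4) ltac:(lra))
    (small_linear (C0 * (3 * WC - 4 * lg d')) (eta / 4) ltac:(lra)))).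
  apply small_imp; intros eps Heps ((E1 & E2 & E3) & E4 & E5) z Hz Hz1 Hz2.
  pose proof (dc_range _ _ _ (Hg eps Heps)) as Hr.
  apply Rle_trans with (eta / 2 + 6 * M * (d' / d)); [|lra].
  apply (hub_estimate (G eps) (dc_continuous _ _ _ (Hg eps Heps)) (dc_derivable _ _ _ (Hg eps Heps)) (z4 eps) d d' H' (eta / 2) M z);
    auto; try lra.
  - unfold M; lra.
  - intros z' Hz'; apply Re_minus_bound; auto; lra.
  - intros y Hy1 Hy2.
    assert (Q : z4 eps / d' < 4 / 5).
    { apply Rle_lt_trans with (d' / 2 / d'); [apply Rmult_le_compat_r; [left; apply Rinv_0_lt_compat; lra|exact E3]|].
      replace (d' / 2 / d') with (1 / 2) by (field; lra); lra. }
    pose proof (edge_lemma hub_z4 Heps d' y ltac:(lra) ltac:(lra) Q Hy1 Hy2) as B1; fold WC in B1.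
    pose proof (proj1 (far_hub_values eps ltac:(lra) E2)) as B2.
    apply Rabs_le_between in B1; apply Rabs_le_between in B2; apply Rabs_le; lra.
Qed.

(** The second derivative of the difference of potentials at vertex [i]: negative exactly when the
    Morse index is one. *)
Definition slope_jump (i : index) : R := a (next i) - a i.

Definition profile_const (i : index) (h : R) : R :=
  err_const + hub_const + Rabs (h - p i) * Rabs (slope_jump i) * lg 2.

Lemma profile_const_pos (i : index) (h : R) : 0 <= profile_const i h.
Proof.
  unfold profile_const; pose proof err_const_pos; pose proof hub_const_pos; pose proof lg2_pos.
  assert (0 <= Rabs (h - p i) * Rabs (slope_jump i) * lg 2).
  { apply Rmult_le_pos; [apply Rmult_le_pos; apply Rabs_pos|lra]. }
  lra.
Qed.

Lemma slope_jump_neg (i : index) : ~ a i < a (next i) -> slope_jump i < 0.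
Proof. intros N; unfold slope_jump; pose proof (Ha i); lra. Qed.

Lemma err_factor_le (eps e : R) : 0 < eps < 1 -> e <= 0 -> err eps * (1 + exp e) <= err_const * eps.
Proof.
  intros He Hn; pose proof (err_le eps He).
  assert (0 <= err eps).
  { apply (track_err_pos a eps (G eps) (eps * C0)); auto; [lra|]; apply HB; lra. }
  assert (exp e <= 1) by (rewrite <- exp_0; apply exp_le; lra). nra.
Qed.

(** At index zero the flow is constant and [V] is pinned to it from the vertex. At index one
    tracking starts from the known hub value and runs towards the vertex, where the exponential is
    at most 1. Hence the error is uniform in [t]. *)
Lemma profile (V : R -> R) (i : index) (h eps t0 t : R) : 0 < eps < 1 -> t <= t0 -> - lg 2 <= t0 <= 0 ->
  (a i < a (next i) -> h = p i /\ Rabs (V t - p i) <= err_const * eps) ->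
  Rabs ((V t - p i) - (V t0 - p i) * exp (- slope_jump i * (eps * t - eps * t0))) <=
    err eps * (1 + exp (- slope_jump i * (eps * t - eps * t0))) ->
  Rabs (V t0 - h) <= hub_const * eps ->
  Rabs (V t - flow (slope_jump i) (p i) h (eps * t)) <= profile_const i h * eps.
Proof.
  intros He Ht Ht0 Pin Tr Hub; pose proof err_const_pos; pose proof hub_const_pos; pose proof lg2_pos.
  eapply Rle_trans; [apply (end_profile V (slope_jump i) (p i) h eps (err_const * eps) (hub_const * eps) t0 t); auto|].
  - lra.
  - lra.
  - apply Rmult_le_pos; lra.
  - apply Rmult_le_pos; lra.
  - destruct (Rlt_dec (a i) (a (next i))) as [P|P].
    + left; destruct (Pin P); repeat split; auto; unfold slope_jump; lra.
    + right; pose proof (slope_jump_neg i P) as N; split; [exact N|].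
      eapply Rle_trans; [exact Tr|apply err_factor_le; [exact He|]].
      assert (0 <= - slope_jump i * (eps * (t0 - t))) by (apply Rmult_le_pos; [|apply Rmult_le_pos]; lra). lra.
  - unfold profile_const.
    assert (Rabs (h - p i) * Rabs (slope_jump i) * (eps * - t0) <= Rabs (h - p i) * Rabs (slope_jump i) * (eps * lg 2)); [|lra].
    apply Rmult_le_compat_l; [apply Rmult_le_pos; apply Rabs_pos|apply Rmult_le_compat_l; lra].
Qed.

Lemma profile_1 (eps t : R) : 0 < eps < 1 -> z4 eps <= 1 / 10 -> t <= lg (1 / 2) ->
  Rabs (U eps 1 t - flow (slope_jump i1) (p i1) H (eps * t)) <= profile_const i1 H * eps.
Proof.
  intros He Hz Ht; pose proof (proj1 He) as He'; pose proof lg2_pos.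
  pose proof (dc_range _ _ _ (Hg eps He')) as Hr.
  assert (Hl : lg (1 / 2) <= lg (1 - z4 eps)) by (apply lg_le; lra).
  apply (profile (U eps 1) i1 H eps (lg (1 / 2)) t He Ht); [rewrite lg_half; lra| | |].
  - intros P; split; [apply (Hsel i1); auto|apply pinned_1; auto; lra].
  - replace (- slope_jump i1 * (eps * t - eps * lg (1 / 2))) with (- (eps * (a i1 - a i2)) * (lg (1 / 2) - t)) by (unfold slope_jump; simpl; ring).
    apply (track_lemma tracking_backward He' 1 t (lg (1 / 2)) (p i1) (eps * (a i1 - a i2)) i1 i4); simpl; auto.
    + pose proof (Ha i1); simpl in *; auto.
    + pose proof (Hpl i1); simpl in *; lra.
    + intros r Hr'; apply arcs_1; auto; lra.
  - exact (proj2 (near_hub_values eps He Hz)).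
Qed.

(** The end at infinity is read in the reversed abscissa, since the vertex is at large radii;
    backward tracking becomes forward tracking. *)
Lemma profile_2 (eps t : R) : 0 < eps < 1 -> z4 eps <= 1 / 10 -> 0 <= t ->
  Rabs (U eps 0 t - flow (slope_jump i2) (p i2) H (eps * - t)) <= profile_const i2 H * eps.
Proof.
  intros He Hz Ht; pose proof (proj1 He) as He'; pose proof lg2_pos.
  pose proof (profile (fun s => U eps 0 (- s)) i2 H eps 0 (- t) He ltac:(lra) ltac:(lra)) as E.
  cbv beta in E; rewrite Ropp_involutive, Ropp_0 in E; apply E.
  - intros P; split; [apply (Hsel i2); auto|apply pinned_2; auto].
  - replace (- slope_jump i2 * (eps * - t - eps * 0)) with ((eps * (a i3 - a i2)) * (t - 0)) by (unfold slope_jump; simpl; ring).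
    apply (track_lemma tracking He' 0 0 t (p i2) (eps * (a i3 - a i2)) i1 i2); simpl; auto.
    + pose proof (Ha i2); simpl in *; auto.
    + pose proof (Hpl i2); simpl in *; lra.
    + intros r Hr'; exact (arcs_2 eps r (proj1 Hr')).
  - exact (proj1 (near_hub_values eps He Hz)).
Qed.

Lemma profile_3 (eps t : R) : 0 < eps < 1 -> z4 eps <= 1 / 10 -> t <= 0 ->
  Rabs (U eps 0 (t + lg (z4 eps)) - flow (slope_jump i3) (p i3) H' (eps * t)) <= profile_const i3 H' * eps.
Proof.
  intros He Hz Ht; pose proof (proj1 He) as He'; pose proof lg2_pos.
  apply (profile (fun s => U eps 0 (s + lg (z4 eps))) i3 H' eps 0 t He Ht); [lra| | |].
  - intros P; split; [apply (Hsel' i3); auto|apply pinned_3; auto; lra].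
  - rewrite Rplus_0_l.
    replace (- slope_jump i3 * (eps * t - eps * 0)) with (- (eps * (a i3 - a i4)) * (lg (z4 eps) - (t + lg (z4 eps)))) by (unfold slope_jump; simpl; ring).
    apply (track_lemma tracking_backward He' 0 (t + lg (z4 eps)) (lg (z4 eps)) (p i3) (eps * (a i3 - a i4)) i3 i2); simpl; auto.
    + lra.
    + pose proof (Ha i3); simpl in *; auto.
    + pose proof (Hpl i3); simpl in *; lra.
    + intros r Hr'; apply arcs_3; auto; lra.
  - rewrite Rplus_0_l; exact (proj1 (far_hub_values eps He Hz)).
Qed.

(** The shift by [lg (z4 eps)] measures radii in units of [z4]. The base radius is [1 / 2 * z4], the
    one of the link to the chart at 0. *)
Lemma profile_4 (eps t : R) : 0 < eps < 1 -> z4 eps <= 1 / 10 -> t <= lg (1 / 2) ->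
  Rabs (U eps (z4 eps) (t + lg (z4 eps)) - flow (slope_jump i4) (p i4) H' (eps * t)) <= profile_const i4 H' * eps.
Proof.
  intros He Hz Ht; pose proof (proj1 He) as He'; pose proof lg2_pos.
  pose proof (dc_range _ _ _ (Hg eps He')) as Hr.
  assert (Eh : lg (1 / 2) + lg (z4 eps) = lg (1 / 2 * z4 eps)) by (rewrite lg_mult; lra).
  apply (profile (fun s => U eps (z4 eps) (s + lg (z4 eps))) i4 H' eps (lg (1 / 2)) t He Ht); rewrite lg_half in *; [lra| | |].
  - intros P; split; [apply (Hsel' i4); auto|apply pinned_4; auto; lra].
  - replace (- slope_jump i4 * (eps * t - eps * - lg 2)) with (- (eps * (a i4 - a i1)) * (- lg 2 + lg (z4 eps) - (t + lg (z4 eps)))) by (unfold slope_jump; simpl; ring).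
    apply (track_lemma tracking_backward He' (z4 eps) (t + lg (z4 eps)) (- lg 2 + lg (z4 eps)) (p i4) (eps * (a i4 - a i1)) i4 i3); simpl; auto.
    + lra.
    + pose proof (Ha i4); simpl in *; auto.
    + pose proof (Hpl i4); simpl in *; lra.
    + intros r Hr'; apply arcs_4; auto; lra.
  - rewrite Eh; exact (proj2 (far_hub_values eps He Hz)).
Qed.

Definition edge_const (i : index) (h : R) : R := C0 * WC + profile_const i h.

Lemma edge_const_pos (i : index) (h : R) : 0 <= edge_const i h.
Proof.
  unfold edge_const; pose proof (profile_const_pos i h); pose proof C0_pos; pose proof window_const_pos.
  assert (0 <= C0 * WC) by (apply Rmult_le_pos; unfold WC; lra). lra.
Qed.

Lemma edge_combine (eps v u f h : R) (i : index) :
  Rabs (v - u) <= eps * C0 * WC -> Rabs (u - f) <= profile_const i h * eps -> Rabs (v - f) <= edge_const i h * eps.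
Proof.
  intros H1 H2; unfold edge_const; apply Rabs_le_between in H1; apply Rabs_le_between in H2; apply Rabs_le; lra.
Qed.

Lemma edge_1 (eps y : R) : 0 < eps < 1 -> z4 eps <= 1 / 10 -> 0 < Rabs (y - 1) <= 1 / 2 ->
  Rabs (Re (G eps (RtoC y)) - flow (slope_jump i1) (p i1) H (eps * lg (Rabs (y - 1)))) <= edge_const i1 H * eps.
Proof.
  intros He Hz Hy; pose proof (proj1 He) as He'.
  eapply edge_combine; [|apply profile_1; auto; apply lg_le; lra].
  destruct (Rle_dec 1 y) as [L|L].
  - rewrite (Rabs_pos_eq (y - 1)) in * by lra.
    replace y with (1 + (y - 1)) at 1 by ring; apply (edge_lemma value_right_1 He'); lra.
  - rewrite (Rabs_left (y - 1)) in * by lra.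
    replace y with (1 - - (y - 1)) at 1 by ring; apply (edge_lemma value_left_1 He'); lra.
Qed.

Lemma edge_2 (eps y : R) : 0 < eps < 1 -> z4 eps <= 1 / 10 -> 2 <= Rabs y ->
  Rabs (Re (G eps (RtoC y)) - flow (slope_jump i2) (p i2) H (eps * - lg (Rabs y))) <= edge_const i2 H * eps.
Proof.
  intros He Hz Hy; pose proof (proj1 He) as He'.
  eapply edge_combine; [|apply profile_2; auto; rewrite <- lg_1; apply lg_le; lra].
  destruct (Rle_dec 0 y) as [L|L].
  - rewrite (Rabs_pos_eq y) in * by lra; apply (edge_lemma value_arc1 He'); lra.
  - rewrite (Rabs_left y) in * by lra.
    rewrite <- (Ropp_involutive y) at 1; apply (edge_lemma value_neg He'); lra.
Qed.

Lemma edge_3 (eps y : R) : 0 < eps < 1 -> z4 eps <= 1 / 10 -> 0 < Rabs y <= 1 / 2 * z4 eps ->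
  Rabs (Re (G eps (RtoC y)) - flow (slope_jump i3) (p i3) H' (eps * (lg (Rabs y) - lg (z4 eps)))) <= edge_const i3 H' * eps.
Proof.
  intros He Hz Hy; pose proof (proj1 He) as He'; pose proof (dc_range _ _ _ (Hg eps He')) as Hr.
  assert (L : lg (Rabs y) <= lg (z4 eps)) by (apply lg_le; lra).
  pose proof (profile_3 eps (lg (Rabs y) - lg (z4 eps)) He Hz ltac:(lra)) as P.
  replace (lg (Rabs y) - lg (z4 eps) + lg (z4 eps)) with (lg (Rabs y)) in P by ring.
  eapply edge_combine; [|exact P].
  destruct (Rle_dec 0 y) as [L'|L'].
  - rewrite (Rabs_pos_eq y) in * by lra; apply (edge_lemma value_arc3 He'); lra.
  - rewrite (Rabs_left y) in * by lra.
    rewrite <- (Ropp_involutive y) at 1; apply (edge_lemma value_neg He'); lra.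
Qed.

Lemma edge_4 (eps y : R) : 0 < eps < 1 -> z4 eps <= 1 / 10 -> 0 < Rabs (y - z4 eps) <= 1 / 2 * z4 eps ->
  Rabs (Re (G eps (RtoC y)) - flow (slope_jump i4) (p i4) H' (eps * (lg (Rabs (y - z4 eps)) - lg (z4 eps)))) <= edge_const i4 H' * eps.
Proof.
  intros He Hz Hy; pose proof (proj1 He) as He'; pose proof (dc_range _ _ _ (Hg eps He')) as Hr.
  assert (L : lg (Rabs (y - z4 eps)) <= lg (1 / 2) + lg (z4 eps)) by (rewrite <- lg_mult by lra; apply lg_le; lra).
  pose proof (profile_4 eps (lg (Rabs (y - z4 eps)) - lg (z4 eps)) He Hz ltac:(lra)) as P.
  replace (lg (Rabs (y - z4 eps)) - lg (z4 eps) + lg (z4 eps)) with (lg (Rabs (y - z4 eps))) in P by ring.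
  eapply edge_combine; [|exact P].
  destruct (Rle_dec (z4 eps) y) as [L'|L'].
  - rewrite (Rabs_pos_eq (y - z4 eps)) in * by lra.
    replace y with (z4 eps + (y - z4 eps)) at 1 by ring; apply (edge_lemma value_right_z4 He'); lra.
  - rewrite (Rabs_left (y - z4 eps)) in * by lra.
    replace y with (z4 eps - - (y - z4 eps)) at 1 by ring; apply (edge_lemma value_left_z4 He'); lra.
Qed.

(** Common part of the four ends; [sg] is the direction in which [lg] of the radius runs
    and [off] the normalisation of the radius. *)
Lemma end_near (i : index) (h : R) (sg : R) (cen off : R -> R) (rad : R -> R -> R -> Prop) :
  (sg = 1 \/ sg = -1) -> slope_jump i < 0 \/ h = p i ->
  (forall eps K r, 0 < eps -> 1 <= K -> rad eps K r -> 0 < r /\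
     (forall t, lg r - lg K <= t <= lg r + lg K -> sg * (t - off eps) <= 0)) ->
  (forall eps K r y, 0 < eps < 1 -> z4 eps <= 1 / 10 -> 1 <= K -> rad eps K r -> r / K <= Rabs (y - cen eps) <= r * K ->
     Rabs (Re (G eps (RtoC y)) - flow (slope_jump i) (p i) h (eps * (sg * (lg (Rabs (y - cen eps)) - off eps)))) <= edge_const i h * eps) ->
  forall K, 1 <= K -> small (fun eps => forall z, closed_upper z -> rad eps K (Cmod (z - RtoC (cen eps))) ->
    Rabs (Re (G eps z) - flow (slope_jump i) (p i) h (eps * (sg * (lg (Cmod (z - RtoC (cen eps))) - off eps)))) <=
    edge_const i h * eps + Rabs (h - p i) * Rabs (slope_jump i) * eps * lg K + 6 * (M0 + (Rabs (p i) + Rabs (h - p i)) + 1) / K).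
Proof.
  intros Hsg Hsl Hrad Hedge K HK.
  generalize (small_setup 1 Rlt_0_1); apply small_imp; intros eps Heps (E1 & E2 & _) z Hz Hr.
  set (r := Cmod (z - RtoC (cen eps))) in *.
  destruct (Hrad eps K r Heps HK Hr) as [Hr0 Ht].
  assert (LK : 0 <= lg K) by (rewrite <- lg_1; apply lg_le; lra).
  assert (Lam : 0 <= Rabs (h - p i) * Rabs (slope_jump i)) by (apply Rmult_le_pos; apply Rabs_pos).
  pose proof (edge_const_pos i h) as EC; pose proof M0_pos; pose proof (Rabs_pos (p i)); pose proof (Rabs_pos (h - p i)).
  assert (Sg : forall t, lg r - lg K <= t <= lg r + lg K -> eps * (sg * (t - off eps)) <= 0).
  { intros t Ht'; specialize (Ht t Ht').
    assert (0 <= eps * - (sg * (t - off eps))) by (apply Rmult_le_pos; lra). lra. }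
  apply (near_profile (G eps) (cen eps) r K (edge_const i h * eps) (Rabs (h - p i) * Rabs (slope_jump i) * eps)
    (M0 + (Rabs (p i) + Rabs (h - p i)) + 1) (fun t => flow (slope_jump i) (p i) h (eps * (sg * (t - off eps)))) z); auto.
  - apply (dc_continuous _ _ _ (Hg eps Heps)).
  - apply (dc_derivable _ _ _ (Hg eps Heps)).
  - apply Rmult_le_pos; lra.
  - apply Rmult_le_pos; lra.
  - lra.
  - intros z' Hz'; apply Re_minus_bound; auto.
    apply flow_bounded_neg; [exact Hsl|apply Sg; lra].
  - intros t Ht'. eapply Rle_trans; [apply flow_lipschitz_neg; [exact Hsl|apply Sg; lra|apply Sg; lra]|].
    replace (eps * (sg * (t - off eps)) - eps * (sg * (lg r - off eps))) with ((eps * sg) * (t - lg r)) by ring.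
    rewrite Rabs_mult, Rabs_mult, (Rabs_pos_eq eps) by lra.
    assert (Rabs sg = 1) as -> by (destruct Hsg as [-> | ->]; [apply Rabs_R1|rewrite Rabs_left; lra]).
    right; ring.
  - intros y Hy; apply (Hedge eps K r); auto.
Qed.

Lemma sel_1 (i : index) : i = i1 \/ i = i2 -> slope_jump i < 0 \/ H = p i.
Proof.
  intros Hi; destruct (Rlt_dec (a i) (a (next i))) as [L|L]; [right; apply Hsel; auto|left; apply slope_jump_neg; exact L].
Qed.

Lemma sel_2 (i : index) : i = i3 \/ i = i4 -> slope_jump i < 0 \/ H' = p i.
Proof.
  intros Hi; destruct (Rlt_dec (a i) (a (next i))) as [L|L]; [right; apply Hsel'; auto|left; apply slope_jump_neg; exact L].
Qed.

Definition end_bound (i : index) (h : R) : R := M0 + (Rabs (p i) + Rabs (h - p i)) + 1.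

Lemma end_bound_pos (i : index) (h : R) : 0 < end_bound i h.
Proof. unfold end_bound; pose proof M0_pos; pose proof (Rabs_pos (p i)); pose proof (Rabs_pos (h - p i)); lra. Qed.

Lemma end_glue (i : index) (h : R) (rho : R -> C -> R) : slope_jump i < 0 \/ h = p i ->
  (forall K, 1 <= K -> small (fun eps => forall z, closed_upper z -> 0 < rho eps z <= / (2 * K) ->
     Rabs (Re (G eps z) - flow (slope_jump i) (p i) h (eps * lg (rho eps z))) <=
     edge_const i h * eps + Rabs (h - p i) * Rabs (slope_jump i) * eps * lg K + 6 * end_bound i h / K)) ->
  (forall d eta, 0 < d <= 1 / 2 -> 0 < eta -> small (fun eps => forall z, closed_upper z -> d <= rho eps z <= 1 / 2 ->
     Rabs (Re (G eps z) - h) <= eta)) ->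
  forall delta eta, 0 < delta <= 1 / 2 -> 0 < eta -> small (fun eps => forall z, closed_upper z -> 0 < rho eps z <= delta ->
     Rabs (Re (G eps z) - flow (slope_jump i) (p i) h (eps * (lg (rho eps z) - lg delta))) <= eta).
Proof.
  intros Hsl; apply end_gluing.
  - apply Rmult_le_pos; apply Rabs_pos.
  - apply edge_const_pos.
  - apply end_bound_pos.
  - intros s t Hs Ht; apply flow_lipschitz_neg; auto.
Qed.

Lemma Cmod_sub_bounds (z : C) (c : R) : 0 <= c -> c - Cmod (z - RtoC c) <= Cmod z <= c + Cmod (z - RtoC c).
Proof.
  intros Hc.
  pose proof (Cmod_minus_le (RtoC c) (RtoC c - z)) as A1.
  replace (RtoC c - (RtoC c - z))%C with z in A1 by ring.
  rewrite (Cmod_minus_sym (RtoC c) z), Cmod_R, Rabs_pos_eq in A1 by lra.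
  pose proof (Cmod_triangle (z - RtoC c) (RtoC c)) as A2.
  replace (z - RtoC c + RtoC c)%C with z in A2 by ring.
  rewrite Cmod_R, Rabs_pos_eq in A2 by lra. lra.
Qed.

Lemma inv_le_of (K r : R) : 1 <= K -> 0 < r -> r <= / (2 * K) -> r * K <= 1 / 2.
Proof.
  intros HK Hr L; apply (Rmult_le_compat_r K) in L; [|lra].
  replace (/ (2 * K) * K) with (1 / 2) in L by (field; lra); exact L.
Qed.

Lemma end_1 (delta eta : R) : 0 < delta <= 1 / 2 -> 0 < eta ->
  small (fun eps => forall z, closed_upper z -> 0 < Cmod (z - 1) <= delta ->
    Rabs (Re (G eps z) - flow (slope_jump i1) (p i1) H (eps * (lg (Cmod (z - 1)) - lg delta))) <= eta).
Proof.
  apply (end_glue i1 H (fun _ z => Cmod (z - 1))); [apply sel_1; auto| |].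
  - intros K HK.
    pose proof (end_near i1 H 1 (fun _ => 1) (fun _ => 0) (fun _ K r => 0 < r <= / (2 * K)) ltac:(auto) (sel_1 i1 ltac:(auto))) as E.
    lapply E; [clear E; intros E|].
    2:{ intros eps K' r He HK' Hr; split; [lra|]; intros t Ht.
        pose proof (inv_le_of K' r HK' (proj1 Hr) (proj2 Hr)) as L.
        assert (lg r + lg K' <= 0) by (rewrite <- lg_mult, <- lg_1 by lra; apply lg_le; [apply Rmult_lt_0_compat; lra|lra]). lra. }
    lapply E; [clear E; intros E|].
    2:{ intros eps K' r y He Hz HK' Hr Hy.
        pose proof (inv_le_of K' r HK' (proj1 Hr) (proj2 Hr)) as L.
        assert (0 < r / K') by (apply Rdiv_lt_0_compat; lra).
        rewrite Rmult_1_l, Rminus_0_r; apply edge_1; auto; lra. }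
    generalize (E K HK); apply small_imp; intros eps _ N z Hz Hr; specialize (N z Hz Hr).
    rewrite Rmult_1_l, Rminus_0_r in N; exact N.
  - intros d eta' Hd He; generalize (near_hub d eta' Hd He); apply small_imp; intros eps _ N z Hz Hr.
    pose proof (Cmod_sub_bounds z 1 ltac:(lra)).
    apply N; auto; [|lra]. split; [lra|].
    apply Rle_trans with (/ (1 / 2)); [lra|apply Rinv_le_contravar; lra].
Qed.

(** At infinity the normalised radius is the inverse modulus, so the direction [sg] in [end_near] is
    -1. *)
Lemma end_2 (delta eta : R) : 0 < delta <= 1 / 2 -> 0 < eta ->
  small (fun eps => forall z, closed_upper z -> 0 < / Cmod z <= delta ->
    Rabs (Re (G eps z) - flow (slope_jump i2) (p i2) H (eps * (lg (/ Cmod z) - lg delta))) <= eta).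
Proof.
  assert (Pz : forall z, 0 < / Cmod z -> 0 < Cmod z).
  { intros z Hz; destruct (Rle_lt_or_eq_dec _ _ (Cmod_ge_0 z)) as [|E]; [assumption|rewrite <- E, Rinv_0 in Hz; lra]. }
  apply (end_glue i2 H (fun _ z => / Cmod z)); [apply sel_1; auto| |].
  - intros K HK.
    pose proof (end_near i2 H (-1) (fun _ => 0) (fun _ => 0) (fun _ K r => 2 * K <= r) ltac:(auto) (sel_1 i2 ltac:(auto))) as E.
    assert (Q : forall K' r, 1 <= K' -> 2 * K' <= r -> 2 <= r / K').
    { intros K' r HK' Hr; apply (Rmult_le_reg_r K'); [lra|]; unfold Rdiv; rewrite Rmult_assoc, Rinv_l; lra. }
    lapply E; [clear E; intros E|].
    2:{ intros eps K' r He HK' Hr; split; [lra|]; intros t Ht.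
        specialize (Q K' r HK' Hr).
        assert (0 <= lg r - lg K') by (rewrite <- lg_div, <- lg_1 by lra; apply lg_le; lra). lra. }
    lapply E; [clear E; intros E|].
    2:{ intros eps K' r y He Hz HK' Hr Hy.
        specialize (Q K' r HK' Hr). rewrite !Rminus_0_r in *.
        replace (-1 * lg (Rabs y)) with (- lg (Rabs y)) by ring. apply edge_2; auto; lra. }
    generalize (E K HK); apply small_imp; intros eps _ N z Hz Hr.
    pose proof (Pz z (proj1 Hr)) as Pz'.
    specialize (N z Hz); replace (z - RtoC 0)%C with z in N by ring.
    lapply N; [clear N; intros N|].
    2:{ rewrite <- (Rinv_inv (Cmod z)), <- (Rinv_inv (2 * K)); apply Rinv_le_contravar; lra. }
    rewrite Rminus_0_r in N; rewrite lg_inv by exact Pz'.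
    replace (-1 * lg (Cmod z)) with (- lg (Cmod z)) in N by ring. exact N.
  - intros d eta' Hd He; generalize (near_hub d eta' Hd He); apply small_imp; intros eps _ N z Hz Hr.
    assert (Pz' : 0 < Cmod z) by (apply Pz; lra).
    assert (L1 : 2 <= Cmod z).
    { rewrite <- (Rinv_inv (Cmod z)). apply Rle_trans with (/ (1 / 2)); [lra|apply Rinv_le_contravar; lra]. }
    assert (L2 : Cmod z <= / d) by (rewrite <- (Rinv_inv (Cmod z)); apply Rinv_le_contravar; lra).
    pose proof (Cmod_sub_bounds z 1 ltac:(lra)).
    apply N; auto; lra.
Qed.

Lemma far_radius_pos (eps r : R) : 0 < eps -> 0 < r / z4 eps -> 0 < r.
Proof.
  intros He L; pose proof (dc_range _ _ _ (Hg eps He)).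
  replace r with (r / z4 eps * z4 eps) by (field; lra); apply Rmult_lt_0_compat; lra.
Qed.

Lemma far_radius (eps K r : R) : 0 < eps -> 1 <= K -> 0 < r / z4 eps <= / (2 * K) -> 0 < r /\ r * K <= 1 / 2 * z4 eps.
Proof.
  intros He HK Hr; pose proof (dc_range _ _ _ (Hg eps He)).
  pose proof (inv_le_of K (r / z4 eps) HK (proj1 Hr) (proj2 Hr)) as L.
  split; [apply (far_radius_pos eps); [auto|apply Hr]|].
  apply (Rle_div_l (r * K) (1 / 2) (z4 eps)); [lra|].
  replace (r * K / z4 eps) with (r / z4 eps * K) by (field; lra); exact L.
Qed.

(** Radii are divided by [z4], the scale of the far hub; this is the offset [lg (z4 eps)] in
    [end_near]. *)
Lemma end_3 (delta eta : R) : 0 < delta <= 1 / 2 -> 0 < eta ->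
  small (fun eps => forall z, closed_upper z -> 0 < Cmod z / z4 eps <= delta ->
    Rabs (Re (G eps z) - flow (slope_jump i3) (p i3) H' (eps * (lg (Cmod z / z4 eps) - lg delta))) <= eta).
Proof.
  apply (end_glue i3 H' (fun eps z => Cmod z / z4 eps)); [apply sel_2; auto| |].
  - intros K HK.
    pose proof (end_near i3 H' 1 (fun _ => 0) (fun eps => lg (z4 eps)) (fun eps K r => 0 < r / z4 eps <= / (2 * K)) ltac:(auto) (sel_2 i3 ltac:(auto))) as E.
    lapply E; [clear E; intros E|].
    2:{ intros eps K' r He HK' Hr; destruct (far_radius eps K' r He HK' Hr) as [Q1 Q2]; pose proof (dc_range _ _ _ (Hg eps He)).
        split; [lra|]; intros t Ht.
        assert (lg r + lg K' <= lg (z4 eps)) by (rewrite <- lg_mult by lra; apply lg_le; [apply Rmult_lt_0_compat; lra|lra]). lra. }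
    lapply E; [clear E; intros E|].
    2:{ intros eps K' r y He Hz HK' Hr Hy; pose proof (dc_range _ _ _ (Hg eps (proj1 He))).
        destruct (far_radius eps K' r (proj1 He) HK' Hr) as [Q1 Q2].
        assert (0 < r / K') by (apply Rdiv_lt_0_compat; lra).
        rewrite Rmult_1_l; rewrite !Rminus_0_r in *; apply edge_3; auto; lra. }
    generalize (E K HK); apply small_imp; intros eps He N z Hz Hr; pose proof (dc_range _ _ _ (Hg eps He)).
    specialize (N z Hz); replace (z - RtoC 0)%C with z in N by ring. specialize (N Hr).
    pose proof (far_radius_pos eps _ He (proj1 Hr)) as Cz.
    rewrite Rmult_1_l in N; rewrite lg_div by lra; exact N.
  - intros d eta' Hd He; generalize (far_hub d eta' Hd He); apply small_imp; intros eps He' N z Hz Hr.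
    pose proof (dc_range _ _ _ (Hg eps He')).
    pose proof (proj1 (Rle_div_l _ _ (z4 eps) ltac:(lra)) (proj2 Hr)) as L1; pose proof (proj2 (Rle_div_r _ _ (z4 eps) ltac:(lra)) (proj1 Hr)) as L2.
    pose proof (Cmod_sub_bounds z (z4 eps) ltac:(lra)).
    assert (z4 eps / (1 / 2) <= z4 eps / d) by (apply Rmult_le_compat_l; [lra|apply Rinv_le_contravar; lra]).
    assert (d * z4 eps <= 1 / 2 * z4 eps) by (apply Rmult_le_compat_r; lra).
    apply N; auto; lra.
Qed.

Lemma end_4 (delta eta : R) : 0 < delta <= 1 / 2 -> 0 < eta ->
  small (fun eps => forall z, closed_upper z -> 0 < Cmod (z - RtoC (z4 eps)) / z4 eps <= delta ->
    Rabs (Re (G eps z) - flow (slope_jump i4) (p i4) H' (eps * (lg (Cmod (z - RtoC (z4 eps)) / z4 eps) - lg delta))) <= eta).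
Proof.
  apply (end_glue i4 H' (fun eps z => Cmod (z - RtoC (z4 eps)) / z4 eps)); [apply sel_2; auto| |].
  - intros K HK.
    pose proof (end_near i4 H' 1 z4 (fun eps => lg (z4 eps)) (fun eps K r => 0 < r / z4 eps <= / (2 * K)) ltac:(auto) (sel_2 i4 ltac:(auto))) as E.
    lapply E; [clear E; intros E|].
    2:{ intros eps K' r He HK' Hr; destruct (far_radius eps K' r He HK' Hr) as [Q1 Q2]; pose proof (dc_range _ _ _ (Hg eps He)).
        split; [lra|]; intros t Ht.
        assert (lg r + lg K' <= lg (z4 eps)) by (rewrite <- lg_mult by lra; apply lg_le; [apply Rmult_lt_0_compat; lra|lra]). lra. }
    lapply E; [clear E; intros E|].
    2:{ intros eps K' r y He Hz HK' Hr Hy; pose proof (dc_range _ _ _ (Hg eps (proj1 He))).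
        destruct (far_radius eps K' r (proj1 He) HK' Hr) as [Q1 Q2].
        assert (0 < r / K') by (apply Rdiv_lt_0_compat; lra).
        rewrite Rmult_1_l; apply edge_4; auto; lra. }
    generalize (E K HK); apply small_imp; intros eps He N z Hz Hr; pose proof (dc_range _ _ _ (Hg eps He)).
    specialize (N z Hz Hr).
    pose proof (far_radius_pos eps _ He (proj1 Hr)) as Cz.
    rewrite Rmult_1_l in N; rewrite lg_div by lra; exact N.
  - intros d eta' Hd He; generalize (far_hub d eta' Hd He); apply small_imp; intros eps He' N z Hz Hr.
    pose proof (dc_range _ _ _ (Hg eps He')).
    pose proof (proj1 (Rle_div_l _ _ (z4 eps) ltac:(lra)) (proj2 Hr)) as L1; pose proof (proj2 (Rle_div_r _ _ (z4 eps) ltac:(lra)) (proj1 Hr)) as L2.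
    pose proof (Cmod_sub_bounds z (z4 eps) ltac:(lra)).
    assert (z4 eps / (1 / 2) <= z4 eps / d) by (apply Rmult_le_compat_l; [lra|apply Rinv_le_contravar; lra]).
    assert (d * z4 eps <= 1 / 2 * z4 eps) by (apply Rmult_le_compat_r; lra).
    apply N; auto; lra.
Qed.

(** * The neck and the internal edge of the gradient tree *)

Section InternalEdge.
Variable q : R.
Let kq := a i3 - a i1.
Hypothesis Hkq : kq <> 0.
Hypothesis Hq : kq * q + (b i3 - b i1) = 0.
Hypothesis HqH : H <> q.

(** The rescaled length of the internal edge stays bounded, since the flow line leads
    from [H], at positive distance from the rest point [q], to the bounded value [H']. *)
Lemma internal_growth : exists S, 1 <= S /\
  small (fun eps => forall t, lg (z4 eps) <= t <= 0 -> exp (- kq * (eps * - t)) <= S).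
Proof.
  destruct (Rlt_dec 0 kq) as [P|P].
  - exists 1; split; [lra|]; exists 1; split; [lra|]; intros eps He t Ht.
    rewrite <- exp_0; apply exp_le.
    assert (0 <= kq * (eps * - t)) by (apply Rmult_le_pos; [lra|apply Rmult_le_pos; lra]). lra.
  - assert (N : kq < 0) by lra.
    assert (Hd : 0 < Rabs (H - q)) by (apply Rabs_pos_lt; lra).
    set (c := 2 * (Rabs (H' - q) + 1) / Rabs (H - q)).
    exists (Rmax 1 c); split; [apply Rmax_l|].
    generalize (small_and _ _ (small_setup 1 Rlt_0_1) (small_and _ _ (small_linear hub_const 1 ltac:(lra))
      (small_linear (hub_const + err_const) (Rabs (H - q) / 2) ltac:(lra)))).
    apply small_imp; intros eps Heps ((E1 & E2 & _) & E3 & E4) t Ht.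
    pose proof (dc_range _ _ _ (Hg eps Heps)) as Hr.
    assert (Lz : lg (z4 eps) <= 0) by (rewrite <- lg_1; apply lg_le; lra).
    set (X := exp (eps * kq * (0 - lg (z4 eps)))).
    assert (HX : 0 < X) by apply exp_pos.
    assert (Kn : eps * kq * (0 - lg (z4 eps)) <= 0).
    { assert (0 <= eps * - kq * (0 - lg (z4 eps))) by (apply Rmult_le_pos; [apply Rmult_le_pos|]; lra). lra. }
    (* Forward tracking from the far hub contracts, as [kq < 0]. If the factor [X] were very small,
       the mean at the near hub would be close to [q], but it is close to [H]; this bounds [X] from
       below. *)
    assert (T : Rabs ((U eps 0 0 - q) - (U eps 0 (lg (z4 eps)) - q) * X) <= err_const * eps).
    { eapply Rle_trans; [apply (track_lemma tracking Heps 0 (lg (z4 eps)) 0 q (eps * kq) i4 i2); simpl; auto|].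
      - unfold kq in Hkq; lra.
      - intros r Hr'; apply arcs_int; auto.
      - apply err_factor_le; [lra|exact Kn]. }
    pose proof (proj1 (near_hub_values eps ltac:(lra) E2)) as V0.
    pose proof (proj1 (far_hub_values eps ltac:(lra) E2)) as V1.
    assert (B1 : Rabs ((U eps 0 (lg (z4 eps)) - q) * X) <= (Rabs (H' - q) + 1) * X).
    { rewrite Rabs_mult, (Rabs_pos_eq X) by lra; apply Rmult_le_compat_r; [lra|].
      replace (U eps 0 (lg (z4 eps)) - q) with ((U eps 0 (lg (z4 eps)) - H') + (H' - q)) by ring.
      eapply Rle_trans; [apply Rabs_triang|]; lra. }
    assert (B2 : Rabs (H - q) <= hub_const * eps + err_const * eps + (Rabs (H' - q) + 1) * X).
    { replace (H - q) with (- (U eps 0 0 - H) + ((U eps 0 0 - q) - (U eps 0 (lg (z4 eps)) - q) * X) + (U eps 0 (lg (z4 eps)) - q) * X) by ring.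
      eapply Rle_trans; [apply Rabs_triang|]; apply Rplus_le_compat; [|exact B1].
      eapply Rle_trans; [apply Rabs_triang|]; rewrite Rabs_Ropp; lra. }
    eapply Rle_trans; [|apply Rmax_r].
    apply Rle_trans with (/ X).
    + unfold X; rewrite <- exp_Ropp; apply exp_le.
      assert (0 <= eps * - kq * (t - lg (z4 eps))) by (apply Rmult_le_pos; [apply Rmult_le_pos|]; lra). lra.
    + apply (Rmult_le_reg_r X); [exact HX|]; rewrite Rinv_l by lra; unfold c.
      apply (Rmult_le_reg_r (Rabs (H - q))); [exact Hd|].
      replace (2 * (Rabs (H' - q) + 1) / Rabs (H - q) * X * Rabs (H - q)) with (2 * ((Rabs (H' - q) + 1) * X)) by (field; lra).
      lra.
Qed.

(** Tracking starts at the near hub, where the flow line starts; the growth factor [S] multiplies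
    both the tracking error and the error of the hub value. *)
Lemma internal_profile (S eps t : R) : 1 <= S -> 0 < eps < 1 -> z4 eps <= 1 / 10 -> lg (z4 eps) <= t <= 0 ->
  exp (- kq * (eps * - t)) <= S ->
  Rabs (U eps 0 t - flow kq q H (eps * - t)) <= (err_const * (1 + S) + S * hub_const) * eps.
Proof.
  intros HS He Hz Ht Hexp; pose proof (proj1 He) as He'.
  pose proof err_const_pos; pose proof hub_const_pos.
  assert (T : Rabs ((U eps 0 t - q) - (U eps 0 0 - q) * exp (- kq * (eps * - t - 0))) <= err_const * (1 + S) * eps).
  { replace (- kq * (eps * - t - 0)) with (- (eps * kq) * (0 - t)) by ring.
    replace (- kq * (eps * - t)) with (- (eps * kq) * (0 - t)) in Hexp by ring.
    eapply Rle_trans; [apply (track_lemma tracking_backward He' 0 t 0 q (eps * kq) i4 i2); simpl; auto|].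
    - lra.
    - unfold kq in Hkq; lra.
    - intros r Hr; apply arcs_int; auto; lra.
    - pose proof (err_le eps He).
      assert (0 <= err eps) by (apply (track_err_pos a eps (G eps) (eps * C0)); auto).
      apply Rle_trans with (err_const * eps * (1 + S)); [|right; ring].
      apply Rmult_le_compat; try lra. pose proof (exp_pos (- (eps * kq) * (0 - t))); lra. }
  pose proof (flow_from_base kq q H (U eps 0 t) (U eps 0 0) (eps * - t) 0 _ S ltac:(lra) T Hexp) as F.
  rewrite Rabs_R0, Rmult_0_r, Rplus_0_r, Rminus_0_r in F.
  specialize (F Hexp).
  pose proof (proj1 (near_hub_values eps He Hz)) as V.
  apply (Rmult_le_compat_l S) in V; [|lra]. lra.
Qed.

(** Three zones of radii. Within bounded ratio of 1 or of [z4] the hub estimates hold and the flow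
    is almost constant; between them an annulus of ratio [K] fits into the neck and [near_profile]
    applies. *)
Lemma internal (delta eta : R) : 0 < delta <= 1 / 2 -> 0 < eta ->
  small (fun eps => forall z, closed_upper z -> z4 eps / delta <= Cmod z <= delta ->
    Rabs (Re (G eps z) - flow kq q H (eps * - lg (Cmod z))) <= eta).
Proof.
  intros Hd He.
  destruct internal_growth as [S [HS Gr]].
  set (D := err_const * (1 + S) + S * hub_const).
  set (Lam := Rabs (H - q) * (S * Rabs kq)).
  set (M := M0 + (Rabs q + Rabs (H - q) * S) + 1).
  pose proof M0_pos; pose proof (Rabs_pos q); pose proof (Rabs_pos (H - q)) as Hpq; pose proof C0_pos;
    pose proof err_const_pos; pose proof hub_const_pos; pose proof window_const_pos as WCp; fold WC in WCp.
  assert (HS' : 0 <= Rabs (H - q) * S) by (apply Rmult_le_pos; lra).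
  assert (HD : 0 <= D) by (unfold D; apply Rplus_le_le_0_compat; apply Rmult_le_pos; lra).
  assert (HL : 0 <= Lam) by (unfold Lam; apply Rmult_le_pos; [lra|apply Rmult_le_pos; [lra|apply Rabs_pos]]).
  assert (HMp : 1 <= M) by (unfold M; lra).
  destruct (thick_annulus M eta ltac:(lra) He) as (K & HK1 & HK2 & HK3).
  assert (F0 : flow kq q H 0 = H) by (unfold flow; rewrite Rmult_0_r, exp_0; ring).
  assert (LK2 : 0 <= lg (2 * K)) by (rewrite <- lg_1; apply lg_le; lra).
  generalize (small_and _ _ Gr (small_and _ _ (small_setup 1 Rlt_0_1)
    (small_and _ _ (near_hub (/ (2 * K)) (eta / 4) HK3 ltac:(lra)) (small_and _ _ (far_hub (/ (2 * K)) (eta / 4) HK3 ltac:(lra))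
    (small_and _ _ (small_linear (C0 * WC + D + hub_const) (eta / 4) ltac:(lra))
    (small_and _ _ (small_linear (Lam * lg K) (eta / 4) ltac:(lra)) (small_linear (Lam * lg (2 * K)) (eta / 4) ltac:(lra)))))))).
  apply small_imp; intros eps Heps (Eg & (E1 & E2 & _) & En & Ef & E3 & E4 & E5) z Hz Hr.
  pose proof (dc_range _ _ _ (Hg eps Heps)) as Hzr.
  set (r := Cmod z) in *.
  assert (Hr2 : 2 * z4 eps <= r).
  { apply Rle_trans with (z4 eps / delta); [|lra].
    rewrite Rmult_comm; apply Rmult_le_compat_l; [lra|].
    rewrite <- (Rinv_inv 2); apply Rinv_le_contravar; lra. }
  assert (Lip : forall s t, lg (z4 eps) <= s <= 0 -> lg (z4 eps) <= t <= 0 ->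
    Rabs (flow kq q H (eps * - s) - flow kq q H (eps * - t)) <= Lam * eps * Rabs (s - t)).
  { intros s t Hs Ht; eapply Rle_trans; [apply (flow_lipschitz kq q H _ _ S); [lra|apply Eg; lra|apply Eg; lra]|].
    replace (eps * - s - eps * - t) with (eps * - (s - t)) by ring.
    rewrite Rabs_mult, Rabs_Ropp, (Rabs_pos_eq eps) by lra; fold Lam; right; ring. }
  assert (Lr : lg (z4 eps) <= lg r <= 0) by (split; [apply lg_le; lra|rewrite <- lg_1; apply lg_le; lra]).
  destruct (Rle_dec (/ (2 * K)) r) as [Q1|Q1].
  { pose proof (Cmod_sub_bounds z 1 ltac:(lra)) as Cb; fold r in Cb.
    assert (Bd : Rabs (Re (G eps z) - H) <= eta / 4).
    { apply En; [exact Hz| |lra]; split; [exact Q1|]. rewrite Rinv_inv; fold r; lra. }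
    pose proof (Lip (lg r) 0 Lr ltac:(lra)) as L; rewrite Ropp_0, Rmult_0_r, F0, Rminus_0_r in L.
    assert (L2 : Rabs (lg r) <= lg (2 * K)).
    { rewrite Rabs_left1 by lra. rewrite <- lg_inv by lra; apply lg_le; [apply Rinv_0_lt_compat; lra|].
      rewrite <- (Rinv_inv (2 * K)); apply Rinv_le_contravar; lra. }
    apply (Rmult_le_compat_l (Lam * eps)) in L2; [|apply Rmult_le_pos; lra].
    apply Rabs_le_between in Bd; apply Rabs_le_between in L; apply Rabs_le; lra. }
  destruct (Rle_dec r (2 * K * z4 eps)) as [Q2|Q2].
  { pose proof (Cmod_sub_bounds z (z4 eps) ltac:(lra)) as Cb; fold r in Cb.
    assert (dz : / (2 * K) * z4 eps <= 1 / 2 * z4 eps) by (apply Rmult_le_compat_r; lra).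
    assert (Bd : Rabs (Re (G eps z) - H') <= eta / 4).
    { apply Ef; [exact Hz| |].
      - fold r; unfold Rdiv; rewrite Rinv_inv; lra.
      - pose proof (Cmod_minus_le z (RtoC (z4 eps))) as A1; rewrite Cmod_R, Rabs_pos_eq in A1 by lra; fold r in A1; lra. }
    pose proof (Lip (lg r) (lg (z4 eps)) Lr ltac:(lra)) as L.
    assert (L2 : Rabs (lg r - lg (z4 eps)) <= lg (2 * K)).
    { rewrite Rabs_pos_eq by lra. assert (lg r <= lg (2 * K) + lg (z4 eps)); [|lra].
      rewrite <- lg_mult by lra; apply lg_le; lra. }
    apply (Rmult_le_compat_l (Lam * eps)) in L2; [|apply Rmult_le_pos; lra].
    (* The mean at radius [z4] is close both to the flow, by tracking through the neck, and to [H'],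
       by the far hub; so the flow line arrives near [H']. *)
    pose proof (internal_profile S eps (lg (z4 eps)) HS ltac:(lra) E2 ltac:(lra) (Eg (lg (z4 eps)) ltac:(lra))) as P1; fold D in P1.
    pose proof (proj1 (far_hub_values eps ltac:(lra) E2)) as P2.
    assert (0 <= C0 * WC * eps) by (apply Rmult_le_pos; [apply Rmult_le_pos; lra|lra]).
    apply Rabs_le_between in Bd; apply Rabs_le_between in L; apply Rabs_le_between in P1; apply Rabs_le_between in P2;
      apply Rabs_le; lra. }
  assert (QK : r * K <= 1 / 2) by (apply inv_le_of; lra).
  assert (QK2 : 2 * z4 eps <= r / K).
  { apply (Rmult_le_reg_r K); [lra|]; unfold Rdiv; rewrite (Rmult_assoc r), Rinv_l; lra. }
  assert (Tr : forall t, lg r - lg K <= t <= lg r + lg K -> lg (z4 eps) <= t <= 0).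
  { intros t Ht; split.
    - apply Rle_trans with (lg r - lg K); [rewrite <- lg_div by lra; apply lg_le; lra|lra].
    - apply Rle_trans with (lg r + lg K); [lra|]. rewrite <- lg_mult, <- lg_1 by lra; apply lg_le; [apply Rmult_lt_0_compat; lra|lra]. }
  pose proof (near_profile (G eps) 0 r K ((C0 * WC + D) * eps) (Lam * eps) M (fun t => flow kq q H (eps * - t)) z
    (dc_continuous _ _ _ (Hg eps Heps)) (dc_derivable _ _ _ (Hg eps Heps)) ltac:(lra) HK1) as Nr.
  assert (Fin : Rabs (Re (G eps z) - flow kq q H (eps * - lg r)) <= (C0 * WC + D) * eps + Lam * eps * lg K + 6 * M / K).
  { apply Nr; auto.
    - apply Rmult_le_pos; [|lra]; apply Rplus_le_le_0_compat; [apply Rmult_le_pos; lra|exact HD].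
    - apply Rmult_le_pos; lra.
    - lra.
    - intros z' Hz'; apply Re_minus_bound; auto.
      unfold flow; eapply Rle_trans; [apply Rabs_triang|]; apply Rplus_le_compat_l.
      rewrite Rabs_mult, (Rabs_pos_eq (exp _)) by (left; apply exp_pos).
      apply Rmult_le_compat_l; [exact Hpq|apply Eg; lra].
    - intros y Hy; rewrite Rminus_0_r in *.
      assert (Ly : lg (z4 eps) <= lg (Rabs y) <= 0) by (split; [apply lg_le; lra|rewrite <- lg_1; apply lg_le; lra]).
      pose proof (internal_profile S eps (lg (Rabs y)) HS ltac:(lra) E2 Ly (Eg _ Ly)) as P1; fold D in P1.
      assert (P2 : Rabs (Re (G eps (RtoC y)) - U eps 0 (lg (Rabs y))) <= eps * C0 * WC).
      { destruct (Rle_dec 0 y) as [L|L].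
        - rewrite (Rabs_pos_eq y) in * by lra; apply (edge_lemma value_arc4 Heps); lra.
        - rewrite (Rabs_left y) in * by lra.
          rewrite <- (Ropp_involutive y) at 1; apply (edge_lemma value_neg Heps); lra. }
      apply Rabs_le_between in P1; apply Rabs_le_between in P2; apply Rabs_le; lra.
    - replace (z - RtoC 0)%C with z by ring; reflexivity. }
  assert (0 <= hub_const * eps) by (apply Rmult_le_pos; lra).
  lra.
Qed.
End InternalEdge.

End Family.

(** [Lub_Rbar] of the empty set is [m_infty], which is not close to 0; hence the hypothesis that the
    region is nonempty for small [eps]. *)
Lemma tends_to_0_sup {T : Type} (S : R -> T -> Prop) (h : R -> T -> R) :
  small (fun eps => exists s, S eps s) ->
  (forall eta, 0 < eta -> small (fun eps => forall s, S eps s -> 0 <= h eps s <= eta)) ->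
  tends_to_0 (fun eps => sup_on (S eps) (h eps)).
Proof.
  intros Hne Hs P [d Hd].
  assert (Hd2 : 0 < d / 2) by (pose proof (cond_pos d); lra).
  destruct (small_and _ _ Hne (Hs (d / 2) Hd2)) as [e0 [He0 K]].
  exists (mkposreal e0 He0); intros eps Heps Hpos.
  assert (Hlt : 0 < eps < e0).
  { split; [exact Hpos|].
    assert (A : Rabs (eps - 0) < e0) by exact Heps.
    rewrite Rminus_0_r in A; apply Rabs_lt_between in A; lra. }
  destruct (K eps Hlt) as [[s Ss] Hh].
  unfold sup_on.
  set (E := fun r => exists s0, S eps s0 /\ r = h eps s0).
  destruct (Lub_Rbar_correct E) as [Ub Lb].
  assert (U1 : Rbar_le (Lub_Rbar E) (Finite (d / 2))).
  { apply Lb; intros r [s' [Ss' ->]]; apply Hh, Ss'. }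
  assert (U2 : Rbar_le (Finite 0) (Lub_Rbar E)).
  { eapply Rbar_le_trans; [|apply Ub; exists s; split; [exact Ss|reflexivity]]. apply Hh, Ss. }
  destruct (Lub_Rbar E) as [y| |]; simpl in U1, U2; try contradiction.
  apply Hd. change (Rabs (y - 0) < d). rewrite Rminus_0_r, Rabs_pos_eq; pose proof (cond_pos d); lra.
Qed.

Lemma weakly_inside_bounds (x : index -> C) (p c : index -> R) (e : R) (z : C) :
  convex_ccw_quadrilateral x -> 0 < e -> (forall i, x i = (p i, e * c i)) -> weakly_inside x z ->
  Rabs (Re z) <= Rabs (p i1) + Rabs (p i2) + Rabs (p i3) + Rabs (p i4) /\
  Rabs (Im z) <= e * (Rabs (c i1) + Rabs (c i2) + Rabs (c i3) + Rabs (c i4)).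
Proof.
  intros Hx He E W; apply (quadrilateral_iff x Hx) in W; destruct W as [t [Ht [Hs ->]]].
  assert (T : forall i, 0 <= t i <= 1).
  { intros i; pose proof (Ht i1); pose proof (Ht i2); pose proof (Ht i3); pose proof (Ht i4); destruct i; lra. }
  assert (K : forall u : index -> R, Rabs (t i1 * u i1 + t i2 * u i2 + t i3 * u i3 + t i4 * u i4) <= Rabs (u i1) + Rabs (u i2) + Rabs (u i3) + Rabs (u i4)).
  { intros u.
    assert (K : forall i, Rabs (t i * u i) <= Rabs (u i)).
    { intros i; rewrite Rabs_mult, (Rabs_pos_eq (t i)) by apply T.
      rewrite <- (Rmult_1_l (Rabs (u i))) at 2; apply Rmult_le_compat_r; [apply Rabs_pos|apply T]. }
    pose proof (K i1); pose proof (K i2); pose proof (K i3); pose proof (K i4).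
    pose proof (Rabs_triang (t i1 * u i1 + t i2 * u i2 + t i3 * u i3) (t i4 * u i4)).
    pose proof (Rabs_triang (t i1 * u i1 + t i2 * u i2) (t i3 * u i3)).
    pose proof (Rabs_triang (t i1 * u i1) (t i2 * u i2)). lra. }
  rewrite !E; split.
  - eapply Rle_trans; [|apply (K p)]; right; f_equal; unfold Re; simpl; ring.
  - replace (Im _) with (e * (t i1 * c i1 + t i2 * c i2 + t i3 * c i3 + t i4 * c i4)) by (unfold Im; simpl; ring).
    rewrite Rabs_mult, (Rabs_pos_eq e) by lra; apply Rmult_le_compat_l; [lra|apply K].
Qed.

Lemma closed_upper_weakly_inside (x : index -> C) (z4 : R) (g : C -> C) (z : C) :
  disc_chart x z4 g -> closed_upper z -> weakly_inside x (g z).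
Proof.
  intros Hg Hz; destruct (Rle_lt_or_eq_dec _ _ Hz) as [Hu|Hr].
  - intros i; left; apply (dc_inside _ _ _ Hg z Hu).
  - replace z with (RtoC (Re z)) by (apply injective_projections; [reflexivity|simpl; exact Hr]).
    apply (real_weakly_inside x z4 g Hg).
Qed.

(** * Morse indices of the vertices at each hub *)

Section VertexIndices.
Variables (a b p : index -> R) (x : index -> C).
Hypothesis Hxl : forall i, x i = (p i, a i * p i + b i).
Hypothesis Hxr : forall i, x i = (p i, a (next i) * p i + b (next i)).
Hypothesis Hx : convex_ccw_quadrilateral x.
Variable kap : R.
Hypothesis Hkap : kap = 1 \/ kap = -1.
Hypothesis Hsep : forall i j, (i = i1 \/ i = i2) -> (j = i3 \/ j = i4) -> 0 < kap * (p i - p j).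

Lemma separated_product : 0 < (p i1 - p i4) * (p i2 - p i3).
Proof.
  pose proof (Hsep i1 i4 ltac:(auto) ltac:(auto)); pose proof (Hsep i2 i3 ltac:(auto) ltac:(auto)).
  destruct Hkap as [-> | ->]; nra.
Qed.

(** By [slope_sign], two vertices of index zero would make [p i4], [p i1], [p i2], [p i3] a monotone
    sequence, against [separated_product]. *)
Lemma one_index_zero_12 : a i1 < a i2 -> a i2 < a i3 -> False.
Proof.
  intros M1 M2; pose proof separated_product as S.
  pose proof (slope_sign a b p x Hxl Hxr Hx i4) as G1; pose proof (slope_sign a b p x Hxl Hxr Hx i1) as G2; simpl in G1, G2.
  assert (G1' : 0 < (p i1 - p i4) * (p i2 - p i1)) by (apply (Rmult_lt_reg_r (a i2 - a i1)); lra).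
  assert (G2' : 0 < (p i2 - p i1) * (p i3 - p i2)) by (apply (Rmult_lt_reg_r (a i3 - a i2)); lra).
  pose proof (Rmult_lt_0_compat _ _ G1' G2') as T.
  assert (T2 : 0 <= (p i2 - p i1) * (p i2 - p i1) * ((p i1 - p i4) * (p i2 - p i3))).
  { apply Rmult_le_pos; [apply Rle_0_sqr|lra]. }
  lra.
Qed.

Lemma one_index_zero_34 : a i3 < a i4 -> a i4 < a i1 -> False.
Proof.
  intros M1 M2; pose proof separated_product as S.
  pose proof (slope_sign a b p x Hxl Hxr Hx i2) as G1; pose proof (slope_sign a b p x Hxl Hxr Hx i3) as G2; simpl in G1, G2.
  assert (G1' : 0 < (p i3 - p i2) * (p i4 - p i3)) by (apply (Rmult_lt_reg_r (a i4 - a i3)); lra).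
  assert (G2' : 0 < (p i4 - p i3) * (p i1 - p i4)) by (apply (Rmult_lt_reg_r (a i1 - a i4)); lra).
  pose proof (Rmult_lt_0_compat _ _ G1' G2') as T.
  assert (T2 : 0 <= (p i4 - p i3) * (p i4 - p i3) * ((p i1 - p i4) * (p i2 - p i3))).
  { apply Rmult_le_pos; [apply Rle_0_sqr|lra]. }
  lra.
Qed.

(** Over [q] the first and third lines meet. If [p i1 = q], then [x i1] lies on the third line with
    [x i2] and [x i3]; if [p i2 = q], then [x i2] lies on the first line with [x i4] and [x i1].
    Neither is possible in a convex quadrilateral. *)
Lemma rest_point_neq (q : R) (i : index) : i = i1 \/ i = i2 -> (a i3 - a i1) * q + (b i3 - b i1) = 0 -> p i <> q.
Proof.
  intros Hi Hq E; subst q.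
  destruct Hi as [-> | ->].
  - assert (O : 0 < orient (x i2) (x i3) (x i1)) by (apply (Hx i2 i1); discriminate).
    rewrite (Hxr i2), (Hxl i3), (Hxl i1) in O; unfold orient, Re, Im in O; simpl in O.
    replace (b i1) with ((a i3 - a i1) * p i1 + b i3) in O by lra. ring_simplify in O; lra.
  - assert (O : 0 < orient (x i4) (x i1) (x i2)) by (apply (Hx i4 i2); discriminate).
    rewrite (Hxr i4), (Hxl i1), (Hxr i2) in O; unfold orient, Re, Im in O; simpl in O.
    replace (b i3) with (b i1 - (a i3 - a i1) * p i2) in O by lra. ring_simplify in O; lra.
Qed.
End VertexIndices.

(** * Shape of the gradient tree *)

Section Tree.
Variables (f : index -> R -> R) (a b p : index -> R) (T : tree).
Hypothesis Hder : forall i j y, Derive (fdiff f i j) y = (a j - a i) * y + (b j - b i).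
Hypothesis Hpl : forall i, (a (next i) - a i) * p i + (b (next i) - b i) = 0.
Hypothesis HT : gradient_tree f p T.

Lemma neg_gradient_flow_linear (i j : index) (q : R) (D : R -> Prop) (u : R -> R) :
  (a j - a i) * q + (b j - b i) = 0 -> neg_gradient_flow (fdiff f i j) D u ->
  forall r, D r -> is_derive_within D u r (- ((a j - a i) * (u r - q))).
Proof.
  intros Hq H r Hr; specialize (H r Hr); rewrite Hder in H.
  replace (- ((a j - a i) * (u r - q))) with (- ((a j - a i) * u r + (b j - b i))); [exact H|].
  replace (b j - b i) with (- ((a j - a i) * q)) by lra; ring.
Qed.

Lemma external_flow (i : index) (t : R) : t <= 0 ->
  ext T i t = flow (a (next i) - a i) (p i) (ext T i 0) t.
Proof.
  intros Ht; destruct HT as [He _]; destruct (He i) as [Hf _].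
  pose proof (linear_flow_unique (fun t => t <= 0) (ext T i) (a (next i) - a i) (p i) t 0 Ht ltac:(intros; lra)
    (neg_gradient_flow_linear i (next i) (p i) _ _ (Hpl i) Hf)) as E.
  unfold flow; rewrite E, Rmult_assoc, <- exp_plus.
  replace (- (a (next i) - a i) * (0 - t) + - (a (next i) - a i) * t) with 0 by ring.
  rewrite exp_0; ring.
Qed.

(** At a minimum every nonconstant solution moves away from [p i] in backward time, so the limit at
    [m_infty] forces the constant one. *)
Lemma external_constant (i : index) : a i < a (next i) -> ext T i 0 = p i.
Proof.
  intros Hm; destruct HT as [He _]; destruct (He i) as [_ Hl].
  destruct (Req_dec (ext T i 0) (p i)) as [|N]; [assumption|exfalso].
  assert (Hd : 0 < Rabs (ext T i 0 - p i)) by (apply Rabs_pos_lt; lra).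
  apply is_lim_spec in Hl; destruct (Hl (mkposreal _ Hd)) as [M HM].
  set (t := Rmin (M - 1) 0).
  assert (Ht : t <= 0) by apply Rmin_r.
  assert (HtM : t < M) by (apply Rle_lt_trans with (M - 1); [apply Rmin_l|lra]).
  specialize (HM t HtM); simpl in HM.
  rewrite external_flow in HM by exact Ht; unfold flow in HM.
  replace (p i + (ext T i 0 - p i) * exp (- (a (next i) - a i) * t) - p i) with ((ext T i 0 - p i) * exp (- (a (next i) - a i) * t)) in HM by ring.
  rewrite Rabs_mult, (Rabs_pos_eq (exp _)) in HM by (left; apply exp_pos).
  assert (1 <= exp (- (a (next i) - a i) * t)).
  { rewrite <- exp_0 at 1; apply exp_le.
    assert (0 <= (a (next i) - a i) * - t) by (apply Rmult_le_pos; lra). lra. }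
  nra.
Qed.

(** The external edges at the two vertices of index zero are constant. A single internal vertex
    would identify [p i0] with [p i0']. In the other type with an internal edge, these vertices are
    either at the same end of that edge, with the same contradiction, or at opposite ends, which
    [no_transverse_edge] excludes. *)
Lemma tree_is_12_34 (x : index -> C) (kap : R) (i0 i0' : index) :
  (forall i, x i = (p i, a i * p i + b i)) -> (forall i, x i = (p i, a (next i) * p i + b (next i))) ->
  convex_ccw_quadrilateral x -> a i4 <> a i2 -> (kap = 1 \/ kap = -1) ->
  (forall i j, (i = i1 \/ i = i2) -> (j = i3 \/ j = i4) -> 0 < kap * (p i - p j)) ->
  (i0 = i1 \/ i0 = i2) -> a i0 < a (next i0) -> (i0' = i3 \/ i0' = i4) -> a i0' < a (next i0') ->
  exists l u, int T = edge_12_34 l u /\ 0 < l /\ u 0 = p i0 /\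
    ext T i1 0 = p i0 /\ ext T i2 0 = p i0 /\ ext T i3 0 = p i0' /\ ext T i4 0 = p i0'.
Proof.
  intros Hxl Hxr Hx H42 Hk Hsep Hi Hm Hi' Hm'.
  pose proof (external_constant i0 Hm) as E; pose proof (external_constant i0' Hm') as E'.
  pose proof (Hsep i0 i0' Hi Hi') as S.
  assert (N : p i0 <> p i0') by (intros F; rewrite F, Rminus_diag in S; lra).
  destruct HT as [_ HI]; destruct (int T) as [|l u|l u].
  - exfalso; destruct HI as (A1 & A2 & A3); apply N; rewrite <- E, <- E'.
    destruct Hi as [-> | ->], Hi' as [-> | ->]; congruence.
  - destruct HI as (Hl & _ & [A1 A2] & [A3 A4]).
    exists l, u; split; [reflexivity|split; [exact Hl|]].
    destruct Hi as [-> | ->], Hi' as [-> | ->]; repeat split; congruence.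
  - exfalso; destruct HI as (Hl & Hf & [A1 A2] & [A3 A4]).
    set (q := - (b i4 - b i2) / (a i4 - a i2)).
    assert (Hq : (a i4 - a i2) * q + (b i4 - b i2) = 0) by (unfold q; field; lra).
    pose proof (linear_flow_unique _ u (a i4 - a i2) q 0 l ltac:(lra) (fun r Hr => Hr)
      (neg_gradient_flow_linear i2 i4 q _ _ Hq Hf)) as F.
    rewrite Rminus_0_r in F.
    destruct (no_transverse_edge a b p x Hxl Hxr Hx kap l Hk Hsep Hl H42) as [F1 F2]; fold q in F1, F2.
    destruct Hi as [-> | ->], Hi' as [-> | ->]; simpl in *.
    + apply F1; try lra. rewrite <- E, <- E', <- A4, <- A2; exact F.
    + apply N; congruence.
    + apply N; congruence.
    + apply F2; try lra. rewrite <- E, <- E', <- A3, <- A1; exact F.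
Qed.

Lemma extended_flow (i j : index) (q l : R) (u v : R -> R) (t : R) :
  (a j - a i) * q + (b j - b i) = 0 -> extends_flow (fdiff f i j) l u v -> 0 < l -> 0 <= t ->
  v t = flow (a j - a i) q (u 0) t.
Proof.
  intros Hq [Hf He] Hl Ht.
  pose proof (linear_flow_unique (fun _ => True) v (a j - a i) q 0 t Ht (fun r _ => I) (neg_gradient_flow_linear i j q _ _ Hq Hf)) as E.
  rewrite Rminus_0_r, (He 0) in E by lra.
  unfold flow; lra.
Qed.
End Tree.

(** * Regions and coordinates of the theorem, and its proof *)

Lemma Cmod_minus_R_le (w : C) (r : R) : Cmod (w - RtoC r) <= Rabs (Re w - r) + Rabs (Im w).
Proof.
  eapply Rle_trans; [apply Cmod_le_abs|]; apply Rplus_le_compat; right; f_equal; unfold Re, Im; simpl; ring.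
Qed.

Lemma Cexp_upper (t s : R) : 0 <= s <= 1 -> 0 <= Im (Cexp (t, PI * s)).
Proof.
  intros Hs; unfold Cexp, Im; simpl; pose proof PI_RGT_0.
  apply Rmult_le_pos; [left; apply exp_pos|]; apply sin_ge_0; [apply Rmult_le_pos; lra|].
  rewrite <- (Rmult_1_r PI) at 2; apply Rmult_le_compat_l; lra.
Qed.

Lemma strip_exponent (s : R * R) : (RtoC PI * strip_coord s)%C = (PI * fst s, PI * snd s).
Proof. destruct s; unfold strip_coord; apply injective_projections; simpl; ring. Qed.

Lemma Cexp_neg_upper (t s : R) : 0 <= s <= 1 -> Im (Cexp (- (t, PI * s))) <= 0.
Proof.
  intros Hs; pose proof (Cexp_upper (- t) s Hs) as H; unfold Cexp, Im, Re in *; simpl in *.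
  rewrite sin_neg; lra.
Qed.

(** All limits are real and the imaginary part is at most [eps * C0], so estimates of real parts
    imply convergence in modulus. *)
Lemma tends_to_0_of_Re {T : Type} (S : R -> T -> Prop) (w : R -> C -> C) (pt : R -> T -> C) (v : R -> T -> R) (C0 : R) :
  (forall eps, 0 < eps -> forall z, Rabs (Im (fold_upper (w eps) z)) <= eps * C0) ->
  small (fun eps => exists s, S eps s) ->
  (forall eps, 0 < eps -> forall s, S eps s -> closed_upper (pt eps s)) ->
  (forall eta, 0 < eta -> small (fun eps => forall s, S eps s -> Rabs (Re (fold_upper (w eps) (pt eps s)) - v eps s) <= eta)) ->
  tends_to_0 (fun eps => sup_on (S eps) (fun s => Cmod (w eps (pt eps s) - RtoC (v eps s)))).
Proof.
  intros HB Hne Hcl Hs.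
  apply (tends_to_0_sup S (fun eps s => Cmod (w eps (pt eps s) - RtoC (v eps s))) Hne).
  intros eta He.
  generalize (small_and _ _ (Hs (eta / 2) ltac:(lra)) (small_linear C0 (eta / 2) ltac:(lra))).
  apply small_imp; intros eps Heps [K1 K2] s Ss.
  split; [apply Cmod_ge_0|].
  specialize (K1 s Ss); pose proof (HB eps Heps (pt eps s)) as K3.
  rewrite (fold_upper_eq (w eps) (pt eps s) (Hcl eps Heps s Ss)) in K1, K3.
  eapply Rle_trans; [apply Cmod_minus_R_le|]. lra.
Qed.

Lemma Derive_n_2_fdiff (f : index -> R -> R) (a b : index -> R) (i j : index) (y : R) :
  (forall i j y, Derive (fdiff f i j) y = (a j - a i) * y + (b j - b i)) ->
  Derive_n (fdiff f i j) 2 y = a j - a i.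
Proof.
  intros H; simpl.
  rewrite (Derive_ext _ (fun y => (a j - a i) * y + (b j - b i))) by (intros; apply H).
  apply is_derive_unique; auto_derive; auto; ring.
Qed.

Lemma affine_slopes (f : index -> R -> R) : (forall i, affine_potential (f i)) ->
  exists a b : index -> R, (forall i y, Derive (f i) y = a i * y + b i) /\
    (forall i j y, Derive (fdiff f i j) y = (a j - a i) * y + (b j - b i)).
Proof.
  intros H.
  assert (K : exists a b c : index -> R, forall i y, f i y = / 2 * a i * y ^ 2 + b i * y + c i).
  { destruct (H i1) as (A1 & B1 & C1 & E1), (H i2) as (A2 & B2 & C2 & E2),
      (H i3) as (A3 & B3 & C3 & E3), (H i4) as (A4 & B4 & C4 & E4).
    exists (fun i => match i with i1 => A1 | i2 => A2 | i3 => A3 | i4 => A4 end),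
      (fun i => match i with i1 => B1 | i2 => B2 | i3 => B3 | i4 => B4 end),
      (fun i => match i with i1 => C1 | i2 => C2 | i3 => C3 | i4 => C4 end).
    intros [] y; auto. }
  destruct K as (a & b & c & E); exists a, b; split.
  - intros i y; rewrite (Derive_ext _ _ y (E i)).
    apply is_derive_unique; auto_derive; auto; field.
  - intros i j y; unfold fdiff.
    rewrite (Derive_ext _ (fun y => / 2 * a j * y ^ 2 + b j * y + c j - (/ 2 * a i * y ^ 2 + b i * y + c i))) by (intros t; rewrite !E; reflexivity).
    apply is_derive_unique; auto_derive; auto; field.
Qed.

(** The point 1/2 would otherwise lie in both half discs. *)
Lemma delta_le_half (delta : R) : disjoint (D_at 0 delta) (D_at 1 delta) -> delta <= 1 / 2.
Proof.
  intros H; apply Rnot_lt_le; intros L; apply (H (RtoC (1 / 2))); unfold D_at, closed_upper; simpl.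
  rewrite <- !RtoC_minus, !Cmod_R. rewrite Rabs_pos_eq, Rabs_left by lra. lra.
Qed.

Lemma D_out_bounds (delta : R) (z : C) : 0 < delta -> D_out delta z ->
  closed_upper z /\ delta <= Cmod z <= / delta /\ delta <= Cmod (z - 1).
Proof.
  intros Hd [Hz Hn]; split; [exact Hz|].
  assert (A0 : delta <= Cmod z).
  { apply Rnot_lt_le; intros L; apply Hn; left; split; [|exact Hz].
    replace (z - RtoC 0)%C with z by ring; exact L. }
  split; [split; [exact A0|]|].
  - apply Rnot_lt_le; intros L; apply Hn; right; right; split; [apply Cmod_gt_0; lra|]; split; [|exact Hz].
    rewrite <- (Rinv_inv delta); apply Rinv_lt_contravar; [|exact L].
    apply Rmult_lt_0_compat; [apply Rinv_0_lt_compat; lra|lra].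
  - apply Rnot_lt_le; intros L; apply Hn; right; left; split; [exact L|exact Hz].
Qed.

Lemma D_out_Ci (delta : R) : 0 < delta <= 1 / 2 -> D_out delta Ci.
Proof.
  intros Hd; split; [unfold closed_upper, Im; simpl; lra|].
  intros [[H _]|[[H _]|[_ [H _]]]].
  - replace (Ci - RtoC 0)%C with Ci in H by ring; rewrite Cmod_Ci in H; lra.
  - pose proof (im_le_Cmod (Ci - RtoC 1)) as K; unfold Im in K; simpl in K.
    replace (1 + -0) with 1 in K by ring; rewrite Rabs_R1 in K; lra.
  - rewrite Cmod_Ci, Rinv_1 in H; lra.
Qed.

Lemma Cexp_strip (s : R * R) : Cmod (Cexp (RtoC PI * strip_coord s)) = exp (PI * fst s).
Proof. rewrite strip_exponent, Cmod_Cexp; reflexivity. Qed.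

Lemma Cexp_strip_neg (s : R * R) : Cmod (Cexp (- (RtoC PI * strip_coord s))) = exp (- (PI * fst s)).
Proof. rewrite strip_exponent, Cmod_Cexp; reflexivity. Qed.

Lemma phi_ext_closed_upper (z4 delta : R) (i : index) (s : R * R) :
  0 < z4 -> 0 < delta -> Theta_ext s -> closed_upper (phi_ext z4 delta i s).
Proof.
  intros Hz Hd [_ Hs].
  pose proof (Cexp_upper (PI * fst s) (snd s) Hs) as P1; pose proof (Cexp_neg_upper (PI * fst s) (snd s) Hs) as P2.
  unfold closed_upper, phi_ext; rewrite !strip_exponent.
  set (e := Cexp (PI * fst s, PI * snd s)) in *; set (e' := Cexp (- (PI * fst s, PI * snd s))) in *.
  destruct i.
  - assert (E : Im (RtoC 1 + RtoC delta * e) = delta * Im e) by (unfold Im; simpl; ring).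
    rewrite E; apply Rmult_le_pos; lra.
  - rewrite <- RtoC_inv by lra.
    assert (E : Im (- (RtoC (/ delta) * e')) = / delta * - Im e') by (unfold Im; simpl; ring).
    rewrite E; apply Rmult_le_pos; [left; apply Rinv_0_lt_compat|]; lra.
  - assert (E : Im (RtoC z4 * (RtoC delta * e)) = z4 * (delta * Im e)) by (unfold Im; simpl; ring).
    rewrite E; apply Rmult_le_pos; [lra|apply Rmult_le_pos; lra].
  - assert (E : Im (RtoC z4 * (RtoC 1 + RtoC delta * e)) = z4 * (delta * Im e)) by (unfold Im; simpl; ring).
    rewrite E; apply Rmult_le_pos; [lra|apply Rmult_le_pos; lra].
Qed.

Lemma exp_strip_lt_1 (t : R) : t < 0 -> exp (PI * t) < 1.
Proof. intros H; rewrite <- exp_0, <- (Rmult_0_r PI); apply exp_PI_lt, H. Qed.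

Lemma phi_int_closed_upper (s : R * R) : 0 <= snd s <= 1 -> closed_upper (phi_int s).
Proof.
  intros Hs; unfold closed_upper, phi_int.
  replace (- (RtoC PI * RtoC (fst s)) + Ci * RtoC PI * (RtoC 1 - RtoC (snd s)))%C with (- (PI * fst s), PI * (1 - snd s))
    by (apply injective_projections; simpl; ring).
  apply Cexp_upper; lra.
Qed.

Lemma Cmod_phi_int (s : R * R) : Cmod (phi_int s) = exp (PI * - fst s).
Proof.
  unfold phi_int; rewrite Cmod_Cexp; f_equal; unfold Re; simpl; ring.
Qed.

Theorem theorem4p1 :
  forall (f : index -> R -> R) (x : R -> index -> C) (p : index -> R) (T : tree)
         (w : R -> C -> C) (z4 : R -> R) (delta p0 p0' : R),
  (forall i, affine_potential (f i)) ->
  (forall eps, 0 < eps -> forall i j, i <> j ->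
     exists! z, lagrangian f eps i z /\ lagrangian f eps j z) ->
  (forall eps, 0 < eps -> forall i,
     lagrangian f eps i (x eps i) /\ lagrangian f eps (next i) (x eps i)) ->
  (forall eps, 0 < eps -> convex_ccw_quadrilateral (x eps)) ->
  (forall i, unique (critical_point (fdiff f i (next i))) (p i)) ->
  gradient_tree f p T ->
  (forall eps, 0 < eps -> schwarz_christoffel (x eps) (w eps)) ->
  (forall eps, 0 < eps -> 0 < z4 eps < 1 /\ w eps (RtoC (z4 eps)) = x eps i4) ->
  0 < delta ->
  disjoint (D_at 0 delta) (D_at 1 delta) ->
  disjoint (D_at 0 delta) (D_infty delta) ->
  disjoint (D_at 1 delta) (D_infty delta) ->
  (exists i, (i = i1 \/ i = i2) /\
     morse_index (fdiff f i (next i)) (p i) = 0%nat /\ p0 = p i) ->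
  (exists i, (i = i3 \/ i = i4) /\
     morse_index (fdiff f i (next i)) (p i) = 0%nat /\ p0' = p i) ->
  (p i3 - p i1) * (p i4 - p i2) > 0 ->
  tends_to_0 (fun eps =>
    sup_on (D_out delta) (fun z => Cmod (w eps z - RtoC p0)))
  /\
  tends_to_0 (fun eps =>
    sup_on (D_out delta)
      (fun z => Cmod (w eps (psi_inv (z4 eps) z) - RtoC p0')))
  /\
  (forall i, tends_to_0 (fun eps =>
    sup_on Theta_ext
      (fun s => Cmod (w eps (phi_ext (z4 eps) delta i s)
                      - RtoC (ext T i (eps * fst s))))))
  /\
  (exists (l : R) (Iint : R -> R), int T = edge_12_34 l Iint /\
    forall J : R -> R, extends_flow (fdiff f i1 i3) l Iint J ->
    tends_to_0 (fun eps =>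
      sup_on (Theta_int (z4 eps) delta)
        (fun s => Cmod (w eps (phi_int s) - RtoC (J (eps * fst s)))))).
Proof.
  intros f x p T w z4 delta p0 p0' Haff Hone Hxx Hconv Hcrit HT Hsc Hz4 Hdel Hdis _ _ Hi0 Hi0' Hsgn.
  destruct (affine_slopes f Haff) as (a & b & Df & Dd).
  assert (Lag : forall eps i z, lagrangian f eps i z <-> Im z = eps * (a i * Re z + b i)).
  { intros eps i z; unfold lagrangian, graph; rewrite Df; tauto. }
  (* With equal slopes the lines for [eps = 1] would be parallel, and an intersection point could be
     translated along them, against uniqueness. *)
  assert (Ha : forall i j, i <> j -> a i <> a j).
  { intros i j N E; destruct (Hone 1 Rlt_0_1 i j N) as [z [[Z1 Z2] Uz]].
    assert (F : z = (Re z + 1, Im z + a i)).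
    { apply Uz; rewrite !Lag in *; unfold Re, Im in *; simpl; split; [lra|rewrite <- E in *; lra]. }
    apply (f_equal Re) in F; unfold Re in F; simpl in F; lra. }
  assert (Ha' : forall i, a (next i) <> a i) by (intros i; apply Ha, next_neq).
  assert (Hpl : forall i, (a (next i) - a i) * p i + (b (next i) - b i) = 0).
  { intros i; destruct (Hcrit i) as [Cr _]; unfold critical_point in Cr; rewrite Dd in Cr; exact Cr. }
  assert (Hxl : forall eps, 0 < eps -> forall i, x eps i = (p i, eps * (a i * p i + b i))).
  { intros eps He i; destruct (Hxx eps He i) as [X1 X2]; rewrite Lag in X1, X2.
    assert (R1 : Re (x eps i) = p i).
    { pose proof (Ha' i); pose proof (Hpl i).
      assert (E : a i * Re (x eps i) + b i = a (next i) * Re (x eps i) + b (next i)) by (apply (Rmult_eq_reg_l eps); lra).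
      apply (Rmult_eq_reg_l (a (next i) - a i)); lra. }
    rewrite R1 in X1; apply injective_projections; [exact R1|exact X1]. }
  assert (Hxr : forall eps, 0 < eps -> forall i, x eps i = (p i, eps * (a (next i) * p i + b (next i)))).
  { intros eps He i; rewrite (Hxl eps He i); f_equal; f_equal; pose proof (Hpl i); lra. }
  assert (Hx1l : forall i, x 1 i = (p i, a i * p i + b i)) by (intros; rewrite (Hxl 1 Rlt_0_1), Rmult_1_l; reflexivity).
  assert (Hx1r : forall i, x 1 i = (p i, a (next i) * p i + b (next i))) by (intros; rewrite (Hxr 1 Rlt_0_1), Rmult_1_l; reflexivity).
  pose proof (Hconv 1 Rlt_0_1) as Hc1.
  destruct (vertices_separated a b p (x 1) Hx1l Hc1 Hsgn) as (kap & Hkap & Hsep).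
  assert (Morse : forall i, morse_index (fdiff f i (next i)) (p i) = 0%nat -> a i < a (next i)).
  { intros i; unfold morse_index; rewrite (Derive_n_2_fdiff f a b) by exact Dd.
    destruct Rlt_dec; [discriminate|]; pose proof (Ha' i); intros; lra. }
  destruct Hi0 as (i0 & Hi0 & Mi0 & ->); destruct Hi0' as (i0' & Hi0' & Mi0' & ->).
  apply Morse in Mi0; apply Morse in Mi0'.
  assert (HH : (p i0 = p i1 /\ a i1 < a i2) \/ (p i0 = p i2 /\ a i2 < a i3)).
  { destruct Hi0 as [-> | ->]; auto. }
  assert (HH' : (p i0' = p i3 /\ a i3 < a i4) \/ (p i0' = p i4 /\ a i4 < a i1)).
  { destruct Hi0' as [-> | ->]; auto. }
  (* The given vertex of index zero is the only one of its pair, so the other end of the hub has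
     index one. *)
  assert (Hsel : forall i, (i = i1 \/ i = i2) -> a i < a (next i) -> p i0 = p i).
  { intros i Hi Mi; pose proof (one_index_zero_12 a b p (x 1) Hx1l Hx1r Hc1 kap Hkap Hsep).
    destruct Hi0 as [-> | ->], Hi as [-> | ->]; auto; exfalso; auto. }
  assert (Hsel' : forall i, (i = i3 \/ i = i4) -> a i < a (next i) -> p i0' = p i).
  { intros i Hi Mi; pose proof (one_index_zero_34 a b p (x 1) Hx1l Hx1r Hc1 kap Hkap Hsep).
    destruct Hi0' as [-> | ->], Hi as [-> | ->]; auto; exfalso; auto. }
  set (G := fun eps => fold_upper (w eps)).
  assert (Hg : forall eps, 0 < eps -> disc_chart (x eps) (z4 eps) (G eps)).
  { intros eps He; destruct (Hz4 eps He); apply disc_chart_of_schwarz_christoffel; auto. }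
  set (c := fun i => a i * p i + b i).
  set (C0 := Rabs (c i1) + Rabs (c i2) + Rabs (c i3) + Rabs (c i4)).
  set (M0 := Rabs (p i1) + Rabs (p i2) + Rabs (p i3) + Rabs (p i4)).
  set (A := Rabs (a i1) + Rabs (a i2) + Rabs (a i3) + Rabs (a i4)).
  assert (HA : forall i, Rabs (a i) <= A).
  { intros i; unfold A; pose proof (Rabs_pos (a i1)); pose proof (Rabs_pos (a i2)); pose proof (Rabs_pos (a i3)); pose proof (Rabs_pos (a i4)).
    destruct i; lra. }
  assert (HM : forall eps, 0 < eps -> forall z, closed_upper z -> Rabs (Re (G eps z)) <= M0).
  { intros eps He z Hz.
    apply (weakly_inside_bounds (x eps) p c eps (G eps z) (Hconv eps He) He (Hxl eps He)).
    apply (closed_upper_weakly_inside _ (z4 eps)); auto. }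
  assert (HB : forall eps, 0 < eps -> forall z, Rabs (Im (G eps z)) <= eps * C0).
  { intros eps He z.
    assert (E : G eps z = G eps (Re z, Rabs (Im z))).
    { unfold G, fold_upper; simpl; rewrite Rabs_Rabsolu; reflexivity. }
    rewrite E.
    apply (weakly_inside_bounds (x eps) p c eps _ (Hconv eps He) He (Hxl eps He)).
    apply (closed_upper_weakly_inside _ (z4 eps)); auto; apply Rabs_pos. }
  pose proof (delta_le_half delta Hdis) as Hdh.
  assert (Hd : 0 < delta <= 1 / 2) by lra.
  destruct (tree_is_12_34 f a b p T Dd Hpl HT (x 1) kap i0 i0' Hx1l Hx1r Hc1 ltac:(apply Ha; discriminate) Hkap Hsep Hi0 Mi0 Hi0' Mi0')
    as (l & Iint & HI & Hl & HI0 & X1 & X2 & X3 & X4).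
  assert (small_true : forall P : Prop, P -> small (fun _ => P)) by (intros P HP; exists 1; split; [lra|auto]).
  split; [|split; [|split]].
  - apply (tends_to_0_of_Re (fun _ => D_out delta) w (fun _ z => z) (fun _ _ => p i0) C0 HB).
    + apply small_true; exists Ci; apply D_out_Ci, Hd.
    + intros eps _ z Hz; apply (D_out_bounds delta z Hdel Hz).
    + intros eta He.
      generalize (near_hub a b p x z4 G C0 M0 A Hxl Hxr Hconv Hg HB HM HA Hpl kap Hkap Hsep (p i0) HH Hsel delta eta Hd He).
      apply small_imp; intros eps _ K z Hz; destruct (D_out_bounds delta z Hdel Hz) as (B1 & B2 & B3); apply K; auto.
  - apply (tends_to_0_of_Re (fun _ => D_out delta) w (fun eps z => psi_inv (z4 eps) z) (fun _ _ => p i0') C0 HB).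
    + apply small_true; exists Ci; apply D_out_Ci, Hd.
    + intros eps He z Hz; destruct (D_out_bounds delta z Hdel Hz) as (B1 & _); destruct (Hz4 eps He) as [Z _].
      unfold closed_upper, psi_inv in *.
        assert (E : Im (RtoC (z4 eps) * z) = z4 eps * Im z) by (unfold Im; simpl; ring); rewrite E.
      apply Rmult_le_pos; lra.
    + intros eta He.
      generalize (far_hub a b p x z4 G C0 M0 A Hxl Hxr Hconv Hg HB HM HA Hpl kap Hkap Hsep (p i0') HH' Hsel' delta eta Hd He).
      apply small_imp; intros eps Heps K z Hz; destruct (D_out_bounds delta z Hdel Hz) as (B1 & B2 & B3); destruct (Hz4 eps Heps) as [Z _].
      assert (E1 : Cmod (psi_inv (z4 eps) z) = z4 eps * Cmod z).
      { unfold psi_inv; rewrite Cmod_mult, Cmod_R, Rabs_pos_eq; lra. }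
      assert (E2 : Cmod (psi_inv (z4 eps) z - RtoC (z4 eps)) = z4 eps * Cmod (z - 1)).
      { unfold psi_inv; replace (RtoC (z4 eps) * z - RtoC (z4 eps))%C with (RtoC (z4 eps) * (z - 1))%C by ring.
        rewrite Cmod_mult, Cmod_R, Rabs_pos_eq; lra. }
      apply K; rewrite ?E1, ?E2.
      * unfold closed_upper, psi_inv in *.
        assert (E : Im (RtoC (z4 eps) * z) = z4 eps * Im z) by (unfold Im; simpl; ring); rewrite E.
        apply Rmult_le_pos; lra.
      * rewrite (Rmult_comm delta); split; [apply Rmult_le_compat_l; lra|].
        unfold Rdiv; apply Rmult_le_compat_l; lra.
      * rewrite (Rmult_comm delta); apply Rmult_le_compat_l; lra.
  - intros i.
    apply (tends_to_0_of_Re (fun _ => Theta_ext) w (fun eps s => phi_ext (z4 eps) delta i s) (fun eps s => ext T i (eps * fst s)) C0 HB).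
    + apply small_true; exists (-1, 0); unfold Theta_ext; simpl; lra.
    + intros eps He s Hs; destruct (Hz4 eps He); apply phi_ext_closed_upper; auto; lra.
    + intros eta He.
      assert (Rad : forall s, Theta_ext s -> 0 < delta * exp (PI * fst s) <= delta).
      { intros s [Hs _]; pose proof (exp_strip_lt_1 (fst s) Hs); pose proof (exp_pos (PI * fst s)).
        split; [apply Rmult_lt_0_compat; lra|nra]. }
      assert (Lg : forall t, lg (delta * exp (PI * t)) - lg delta = t).
      { intros t; rewrite lg_mult, lg_exp by (try apply exp_pos; lra); ring. }
      assert (Ext : forall eps s, 0 < eps -> Theta_ext s ->
        ext T i (eps * fst s) = flow (slope_jump a i) (p i) (ext T i 0) (eps * fst s)).
      { intros eps s Heps [Hs _]; apply (external_flow f a b p T Dd Hpl HT); nra. }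
      destruct i.
      * generalize (end_1 a b p x z4 G C0 M0 A Hxl Hxr Hconv Hg HB HM HA Hpl kap Hkap Hsep (p i0) HH Ha' Hsel delta eta Hd He).
        apply small_imp; intros eps Heps K s Hs; destruct (Hz4 eps Heps) as [Z _].
        rewrite (Ext eps s Heps Hs), X1.
        assert (E : Cmod (phi_ext (z4 eps) delta i1 s - 1) = delta * exp (PI * fst s)).
        { unfold phi_ext; replace (RtoC 1 + RtoC delta * Cexp (RtoC PI * strip_coord s) - 1)%C with (RtoC delta * Cexp (RtoC PI * strip_coord s))%C by ring.
          rewrite Cmod_mult, Cmod_R, Cexp_strip, Rabs_pos_eq; lra. }
        specialize (K (phi_ext (z4 eps) delta i1 s)); rewrite E, Lg in K.
        apply K; [apply phi_ext_closed_upper; auto; lra|apply Rad, Hs].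
      * generalize (end_2 a b p x z4 G C0 M0 A Hxl Hxr Hconv Hg HB HM HA Hpl kap Hkap Hsep (p i0) HH Ha' Hsel delta eta Hd He).
        apply small_imp; intros eps Heps K s Hs; destruct (Hz4 eps Heps) as [Z _].
        rewrite (Ext eps s Heps Hs), X2.
        assert (E : / Cmod (phi_ext (z4 eps) delta i2 s) = delta * exp (PI * fst s)).
        { unfold phi_ext; rewrite <- RtoC_inv by lra; rewrite Cmod_opp, Cmod_mult, Cmod_R, Cexp_strip_neg, Rabs_pos_eq by (left; apply Rinv_0_lt_compat; lra).
          rewrite exp_Ropp, Rinv_mult, !Rinv_inv; reflexivity. }
        specialize (K (phi_ext (z4 eps) delta i2 s)); rewrite E, Lg in K.
        apply K; [apply phi_ext_closed_upper; auto; lra|apply Rad, Hs].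
      * generalize (end_3 a b p x z4 G C0 M0 A Hxl Hxr Hconv Hg HB HM HA Hpl kap Hkap Hsep (p i0') HH' Ha' Hsel' delta eta Hd He).
        apply small_imp; intros eps Heps K s Hs; destruct (Hz4 eps Heps) as [Z _].
        rewrite (Ext eps s Heps Hs), X3.
        assert (E : Cmod (phi_ext (z4 eps) delta i3 s) / z4 eps = delta * exp (PI * fst s)).
        { unfold phi_ext; rewrite !Cmod_mult, !Cmod_R, Cexp_strip, !Rabs_pos_eq by lra; field; lra. }
        specialize (K (phi_ext (z4 eps) delta i3 s)); rewrite E, Lg in K.
        apply K; [apply phi_ext_closed_upper; auto; lra|apply Rad, Hs].
      * generalize (end_4 a b p x z4 G C0 M0 A Hxl Hxr Hconv Hg HB HM HA Hpl kap Hkap Hsep (p i0') HH' Ha' Hsel' delta eta Hd He).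
        apply small_imp; intros eps Heps K s Hs; destruct (Hz4 eps Heps) as [Z _].
        rewrite (Ext eps s Heps Hs), X4.
        assert (E : Cmod (phi_ext (z4 eps) delta i4 s - RtoC (z4 eps)) / z4 eps = delta * exp (PI * fst s)).
        { unfold phi_ext; replace (RtoC (z4 eps) * (RtoC 1 + RtoC delta * Cexp (RtoC PI * strip_coord s)) - RtoC (z4 eps))%C
            with (RtoC (z4 eps) * (RtoC delta * Cexp (RtoC PI * strip_coord s)))%C by ring.
          rewrite !Cmod_mult, !Cmod_R, Cexp_strip, !Rabs_pos_eq by lra; field; lra. }
        specialize (K (phi_ext (z4 eps) delta i4 s)); rewrite E, Lg in K.
        apply K; [apply phi_ext_closed_upper; auto; lra|apply Rad, Hs].
  - exists l, Iint; split; [exact HI|]; intros J HJ.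
    assert (Hk : a i3 - a i1 <> 0) by (pose proof (Ha i3 i1 ltac:(discriminate)); lra).
    set (q := - (b i3 - b i1) / (a i3 - a i1)).
    assert (Hq : (a i3 - a i1) * q + (b i3 - b i1) = 0) by (unfold q; field; exact Hk).
    pose proof (rest_point_neq a b p (x 1) Hx1l Hx1r Hc1 q i0 Hi0 Hq) as Hqn.
    pose proof PI_RGT_0 as HPI.
    assert (Fst : forall eps s, Theta_int (z4 eps) delta s -> - lg delta < fst s < - lg (z4 eps) + lg delta /\ 0 <= snd s <= 1).
    { intros eps s [[H1 H2] H3]; unfold lg, Rdiv; lra. }
    assert (Ldel : lg delta <= 0) by (rewrite <- lg_1; apply lg_le; lra).
    apply (tends_to_0_of_Re (fun eps => Theta_int (z4 eps) delta) w (fun _ s => phi_int s) (fun eps s => J (eps * fst s)) C0 HB).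
    (* The interval of [Theta_int] is nonempty once [z4] is strictly below [delta ^ 2]; it is
       symmetric about [- lg (z4 eps) / 2], which is the witness. *)
    + assert (Dsq : 0 < delta * delta / 2) by nra.
      generalize (small_z4 a b p x z4 G C0 Hxl Hconv Hg HB kap Hkap Hsep _ Dsq).
      apply small_imp; intros eps Heps L; destruct (Hz4 eps Heps) as [Z _].
      assert (L2 : lg (z4 eps) < lg delta + lg delta) by (rewrite <- lg_mult by lra; apply lg_lt; lra).
      exists ((- lg (z4 eps)) / 2, 0); unfold Theta_int; simpl; unfold lg, Rdiv in *; split; [|lra].
      split; nra.
    + intros eps _ s [_ Hs]; apply phi_int_closed_upper, Hs.
    + intros eta He.
      generalize (internal a b p x z4 G C0 M0 A Hxl Hxr Hconv Hg HB HM HA Hpl kap Hkap Hsep (p i0) (p i0') HH HH' Hsel Hsel' q Hk Hq Hqn delta eta Hd He).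
      apply small_imp; intros eps Heps K s Hs; destruct (Hz4 eps Heps) as [Z _].
      destruct (Fst eps s Hs) as [[F1 F2] F3].
      specialize (K (phi_int s) (phi_int_closed_upper s F3)).
      (* The logarithmic radius of [phi_int s] is [- fst s], so the flow of the neck is evaluated at
         time [eps * fst s]. *)
      rewrite Cmod_phi_int, lg_exp, Ropp_involutive in K.
      rewrite (extended_flow f a b Dd i1 i3 q l Iint J (eps * fst s) Hq HJ Hl), HI0 by (apply Rmult_le_pos; lra).
      apply K; split.
      * rewrite <- (exp_lg (z4 eps / delta)) by (apply Rdiv_lt_0_compat; lra).
        apply exp_PI_le; rewrite lg_div by lra; lra.
      * rewrite <- (exp_lg delta) by lra; apply exp_PI_le; lra.
Qed.
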